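(* Let $n\ge1$, let $\mathcal{Q}\subseteq H^2(\mathbb{B}^n)$ be a quotient module, and let $X\in\mathcal{B}_1(\mathcal{Q})$ be a nonzero module map that admits a lift. Let $\psi=X(P_{\mathcal{Q}}1)$. Then the functional $X_{\mathcal{Q}}:(\mathcal{M}_{\mathcal{Q}},\|\cdot\|_1)\to\mathbb{C}$, $X_{\mathcal{Q}}f=\int_{\mathbb{S}^n}\psi f\,d\sigma$, satisfies $$\|X_{\mathcal{Q}}\|=\inf\{\|\varphi\|_\infty:\varphi\in\mathcal{S}(\mathbb{B}^n)\text{ and }X=S_\varphi\}.$$ Moreover, there exists $\theta\in\mathcal{S}(\mathbb{B}^n)$ such that $X=S_\theta$ and $\|\theta\|_\infty=\|X_{\mathcal{Q}}\|$.
   Context: $\mathbb{B}^n$ is the open unit ball of $\mathbb{C}^n$, $\mathbb{S}^n=\partial\mathbb{B}^n$, $\sigma$ the normalized surface measure on $\mathbb{S}^n$. $H^\infty(\mathbb{B}^n)$: bounded analytic functions on $\mathbb{B}^n$ with sup norm $\|\cdot\|_\infty$; $\mathcal{S}(\mathbb{B}^n)$: its closed unit ball. $H^2(\mathbb{B}^n)$: the Hardy space of analytic $f$ on $\mathbb{B}^n$ with $\|f\|^2=\sup_{0<r<1}\int_{\mathbb{S}^n}|f(r\zeta)|^2d\sigma(\zeta)<\infty$. Via boundary values ($K$-limits, a.e. equal to radial limits), $H^2(\mathbb{B}^n)$ is identified unitarily with $H^2(\mathbb{S}^n)=\overline{\mathbb{C}[z_1,\dots,z_n]}^{L^2(\mathbb{S}^n)}$.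 For $\varphi\in H^\infty(\mathbb{B}^n)$, $T_\varphi f=\varphi f$ on $H^2(\mathbb{B}^n)$. A quotient module is a nonzero closed subspace $\mathcal{Q}\subseteq H^2(\mathbb{B}^n)$ with $T_{z_i}^*\mathcal{Q}\subseteq\mathcal{Q}$ for $i=1,\dots,n$; $P_{\mathcal{Q}}$ is the orthogonal projection onto $\mathcal{Q}$ and $S_\varphi=P_{\mathcal{Q}}T_\varphi|_{\mathcal{Q}}$. $\mathcal{B}_1(\mathcal{Q})$: bounded operators on $\mathcal{Q}$ of norm at most $1$. A bounded operator $X$ on $\mathcal{Q}$ is a module map if $XS_{z_i}=S_{z_i}X$ for all $i$; it admits a lift if $X=S_\varphi$ for some $\varphi\in\mathcal{S}(\mathbb{B}^n)$. For $S\subseteq L^2(\mathbb{S}^n)$, $S^{conj}=\{\overline f:f\in S\}$. $\mathcal{M}(\mathbb{S}^n)=L^2(\mathbb{S}^n)\ominus[H^2(\mathbb{S}^n)+H^2(\mathbb{S}^n)^{conj}]$; $H^2_0(\mathbb{S}^n)=H^2(\mathbb{S}^n)\ominus\{1\}$. $\mathcal{M}_{\mathcal{Q}}=\mathcal{Q}^{conj}\dot+[\mathcal{M}(\mathbb{S}^n)\dot+H^2_0(\mathbb{S}^n)]$ ($\dot+$ = algebraic direct sum), viewed as a subspace of $L^1(\mathbb{S}^n)$ with the $L^1$ norm $\|\cdot\|_1$. $\|X_{\mathcal{Q}}\|$ is the norm as a linear functional on $(\mathcal{M}_{\mathcal{Q}},\|\cdot\|_1)$. *)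

(* Defs.v *)
From HB Require Import structures.
From mathcomp Require Import all_boot all_order all_algebra.
From mathcomp Require Import all_classical all_reals all_analysis.
From mathcomp Require Import measurable_realfun.
From mathcomp Require Import complex.
From mathcomp Require mpoly.

Set Implicit Arguments.
Unset Strict Implicit.
Unset Printing Implicit Defensive.

Import Order.TTheory GRing.Theory Num.Theory numFieldNormedType.Exports.

Local Open Scope classical_set_scope.
Local Open Scope ring_scope.
Local Open Scope complex_scope.

(* With this instance, [differentiable f z] for f : 'rV[R[i]]_n -> R[i] is
   Frechet differentiability over the complex numbers. *)
HB.instance Definition _ (R : realType) := NormedModule.copy R[i] R[i]^o.

Definition reim (R : realType) (z : R[i]) :
    measurableTypeR R * measurableTypeR R := (complex.Re z, complex.Im z).

Definition row_tuple (T : Type) n (z : 'rV[T]_n) : n.-tuple T :=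
  [tuple z ord0 i | i < n].

(* The Borel sigma-algebras of C and of C^n = R^2n, transported along the
   (bijective) real coordinates. *)
HB.instance Definition _ (R : realType) :=
  Measurable.copy R[i] (g_sigma_algebra_preimageType (@reim R)).

HB.instance Definition _ (R : realType) n :=
  Measurable.copy 'rV[R[i]]_n
    (g_sigma_algebra_preimageType (@row_tuple R[i] n)).

Section measurability.
Context {R : realType} {d : measure_display} {T : measurableType d}.

Lemma measurable_fun_preimageP (d1 : measure_display) (T1 : pointedType)
    (T2 : measurableType d1) (g : T1 -> T2) (f : T -> T1) :
  measurable_fun [set: T] (f : T -> g_sigma_algebra_preimageType g) <->
  measurable_fun [set: T] (g \o f).
Proof.
split=> mf _ A mA.
  rewrite comp_preimage; apply: mf => //=.
  by exists A => //; rewrite setTI.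
case: mA => B mB <-; rewrite !setTI -comp_preimage -[X in measurable X]setTI.
exact: mf.
Qed.

Lemma measurable_fun_complexP (f : T -> R[i]) :
  measurable_fun [set: T] f <->
  measurable_fun [set: T] (fun x => complex.Re (f x)) /\
  measurable_fun [set: T] (fun x => complex.Im (f x)).
Proof.
apply: (iff_trans (measurable_fun_preimageP (@reim R) f)).
exact: (measurable_fun_pairP (@reim R \o f)).
Qed.

Lemma measurable_fun_rowP n (f : T -> 'rV[R[i]]_n) :
  measurable_fun [set: T] f <->
  forall i, measurable_fun [set: T] (fun x => f x ord0 i).
Proof.
apply: (iff_trans (measurable_fun_preimageP (@row_tuple R[i] n) f)).
apply: (iff_trans (measurable_fun_tnthP _)).
have tE i : (@tnth n R[i])^~ i \o (@row_tuple R[i] n \o f) =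
    fun x => f x ord0 i.
  by apply/funext => x /=; rewrite tnth_mktuple.
by split=> mf i; have := mf i; rewrite tE.
Qed.

End measurability.

Section lebesgue_complex.
Context {R : realType}.

Definition complex_of_pair
    (p : measurableTypeR R * measurableTypeR R) : R[i] := p.1 +i* p.2.

Lemma measurable_complex_of_pair : measurable_fun setT complex_of_pair.
Proof. apply/measurable_fun_complexP; split.
  exact: measurable_fst.
exact: measurable_snd. Qed.

Definition row_cons n (p : R[i] * 'rV[R[i]]_n) : 'rV[R[i]]_n.+1 :=
  \row_i if unlift ord0 i is Some j then p.2 ord0 j else p.1.

Lemma measurable_row_coord n (i : 'I_n) :
  measurable_fun setT (fun z : 'rV[R[i]]_n => z ord0 i).
Proof.
have /measurable_fun_rowP := @measurable_id _ 'rV[R[i]]_n setT.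
exact.
Qed.

Lemma measurable_row_cons n : measurable_fun setT (@row_cons n).
Proof.
apply/measurable_fun_rowP => i; under eq_fun do rewrite mxE.
case: unliftP => [j _|_]; last exact: measurable_fst.
exact: (measurableT_comp (measurable_row_coord j)).
Qed.

Lemma pushforward_sigma_finite d1 d2 (T1 : measurableType d1)
    (T2 : measurableType d2) (m : set T1 -> \bar R)
    (f : T1 -> T2) (g : T2 -> T1) : cancel f g -> measurable_fun setT g ->
  sigma_finite setT m -> sigma_finite setT (pushforward m f).
Proof.
move=> fK mg [F TF mF].
exists (fun k => g @^-1` F k).
  by rewrite -preimage_bigcup -TF preimage_setT.
move=> k; have [mFk Fk] := mF k; split.
  by rewrite -[X in measurable X]setTI; exact: mg.
rewrite /pushforward -comp_preimage.
suff -> : g \o f = id by [].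
by apply/funext.
Qed.

Lemma product_sigma_finite d1 d2 (T1 : measurableType d1)
    (T2 : measurableType d2) (m1 : {sigma_finite_measure set T1 -> \bar R})
    (m2 : {sigma_finite_measure set T2 -> \bar R}) :
  sigma_finite setT (m1 \x m2)%E.
Proof.
have /sigma_finiteP[F [TF ndF Foo]] := sigma_finiteT m1.
have /sigma_finiteP[G [TG ndG Goo]] := sigma_finiteT m2.
exists (fun n => F n `*` G n).
  rewrite -setXTT TF TG predeqE => -[x y]; split.
    move=> [/= [n _ Fnx] [k _ Gky]]; exists (maxn n k) => //; split.
    - by move: x Fnx; exact/subsetPset/ndF/leq_maxl.
    - by move: y Gky; exact/subsetPset/ndG/leq_maxr.
  by move=> [n _ []/= ? ?]; split; exists n.
move=> k; have [? ?] := Foo k; have [? ?] := Goo k.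
split; first exact: measurableX.
by rewrite product_measure1E// lte_mul_pinfty// ge0_fin_numE.
Qed.

Definition lebesgue_complex : set R[i] -> \bar R :=
  pushforward ((@lebesgue_measure R) \x (@lebesgue_measure R))%E
    complex_of_pair.

Let lebesgue_complex0 : lebesgue_complex set0 = 0%E.
Proof. by apply: measure0; exact: measurable_complex_of_pair. Qed.

Let lebesgue_complex_ge0 A : (0 <= lebesgue_complex A)%E.
Proof. by apply: measure_ge0; exact: measurable_complex_of_pair. Qed.

Let lebesgue_complex_sigma_additive : semi_sigma_additive lebesgue_complex.
Proof.
by apply: measure_semi_sigma_additive; exact: measurable_complex_of_pair.
Qed.

HB.instance Definition _ := isMeasure.Build _ _ _ lebesgue_complex
  lebesgue_complex0 lebesgue_complex_ge0 lebesgue_complex_sigma_additive.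

Lemma measurable_reim : measurable_fun setT (@reim R).
Proof.
by have /measurable_fun_preimageP := @measurable_id _ R[i] setT; apply.
Qed.

Let lebesgue_complex_sigma_finite : sigma_finite setT lebesgue_complex.
Proof.
apply: (pushforward_sigma_finite _ measurable_reim); first by case.
exact: product_sigma_finite.
Qed.

HB.instance Definition _ :=
  Measure_isSigmaFinite.Build _ _ _ lebesgue_complex
    lebesgue_complex_sigma_finite.

Definition row_uncons n (z : 'rV[R[i]]_n.+1) : R[i] * 'rV[R[i]]_n :=
  (z ord0 ord0, \row_i z ord0 (lift ord0 i)).

Lemma row_consK n : cancel (@row_cons n) (@row_uncons n).
Proof.
move=> [c z]; congr pair; first by rewrite mxE unlift_none.
by apply/rowP => j; rewrite !mxE liftK.
Qed.

Lemma measurable_row_uncons n : measurable_fun setT (@row_uncons n).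
Proof.
apply: measurable_fun_pair; first exact: measurable_row_coord.
apply/measurable_fun_rowP => j; under eq_fun do rewrite mxE.
exact: measurable_row_coord.
Qed.

End lebesgue_complex.

Section volume_step.
Context {R : realType} (n : nat).
Variable m : {sigma_finite_measure set 'rV[R[i]]_n -> \bar R}.

Definition volume_step : set 'rV[R[i]]_n.+1 -> \bar R :=
  pushforward (lebesgue_complex \x m)%E (@row_cons R n).

Let volume_step0 : volume_step set0 = 0%E.
Proof. by apply: measure0; exact: measurable_row_cons. Qed.

Let volume_step_ge0 A : (0 <= volume_step A)%E.
Proof. by apply: measure_ge0; exact: measurable_row_cons. Qed.

Let volume_step_sigma_additive : semi_sigma_additive volume_step.
Proof.
by apply: measure_semi_sigma_additive; exact: measurable_row_cons.
Qed.

HB.instance Definition _ := isMeasure.Build _ _ _ volume_step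
  volume_step0 volume_step_ge0 volume_step_sigma_additive.

Let volume_step_sigma_finite : sigma_finite setT volume_step.
Proof.
apply: (pushforward_sigma_finite (@row_consK R n)).
  exact: measurable_row_uncons.
exact: product_sigma_finite.
Qed.

HB.instance Definition _ :=
  Measure_isSigmaFinite.Build _ _ _ volume_step volume_step_sigma_finite.

End volume_step.

(* Lebesgue measure on C^n = R^2n. *)
Fixpoint volume (R : realType) (n : nat) :
    {sigma_finite_measure set 'rV[R[i]]_n -> \bar R} :=
  match n with
  | 0 => \d_(0 : 'rV[R[i]]_0)
  | k.+1 => volume_step (volume R k)
  end.

Section sphere.
Context (R : realType) (n : nat).

Definition enorm (z : 'rV[R[i]]_n) : R :=
  Num.sqrt (\sum_(i < n) Normc.normc (z ord0 i) ^+ 2).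

Definition unit_ball : set 'rV[R[i]]_n := [set z | enorm z < 1].

Definition radial_proj (z : 'rV[R[i]]_n) : 'rV[R[i]]_n := (enorm z)^-1%:C *: z.

Lemma normc_sqr (c : R[i]) :
  Normc.normc c ^+ 2 = complex.Re c ^+ 2 + complex.Im c ^+ 2.
Proof. by case: c => a b /=; rewrite sqr_sqrtr// addr_ge0// sqr_ge0. Qed.

Lemma measurable_row_Re (i : 'I_n) :
  measurable_fun setT (fun z : 'rV[R[i]]_n => complex.Re (z ord0 i)).
Proof.
by have /measurable_fun_complexP[] := @measurable_row_coord R n i.
Qed.

Lemma measurable_row_Im (i : 'I_n) :
  measurable_fun setT (fun z : 'rV[R[i]]_n => complex.Im (z ord0 i)).
Proof.
by have /measurable_fun_complexP[] := @measurable_row_coord R n i.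
Qed.

Lemma measurable_enorm : measurable_fun setT enorm.
Proof.
apply: measurableT_comp => //.
  exact: continuous_measurable_fun (@sqrt_continuous R).
apply: measurable_sum => i; under eq_fun do rewrite normc_sqr.
by apply: measurable_funD; apply: measurable_funX;
  [exact: measurable_row_Re|exact: measurable_row_Im].
Qed.

Lemma measurable_unit_ball : measurable unit_ball.
Proof.
have -> : unit_ball = enorm @^-1` `]-oo, 1[%classic.
  by apply/seteqP; split => z /=; rewrite in_itv.
by rewrite -[X in measurable X]setTI; exact: measurable_enorm.
Qed.

Lemma measurable_radial_proj : measurable_fun setT radial_proj.
Proof.
apply/measurable_fun_rowP => i.
have mV : measurable_fun setT (fun z : 'rV[R[i]]_n => (enorm z)^-1).
  under eq_fun do rewrite -powR_inv1 ?sqrtr_ge0//.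
  have := @measurableT_comp _ _ _ _ _ _ (@powR R ^~ (-1)) _ enorm.
  by apply; [exact: measurable_powR|exact: measurable_enorm].
apply/measurable_fun_complexP; split.
  rewrite [X in measurable_fun _ X](_ : _ =
    (fun z => (enorm z)^-1 * complex.Re (z ord0 i))).
    by apply: measurable_funM => //; exact: measurable_row_Re.
  by apply/funext => z; rewrite mxE; case: (z ord0 i) => a b /=;
    rewrite mul0r subr0.
rewrite [X in measurable_fun _ X](_ : _ =
  (fun z => (enorm z)^-1 * complex.Im (z ord0 i))).
  by apply: measurable_funM => //; exact: measurable_row_Im.
by apply/funext => z; rewrite mxE; case: (z ord0 i) => a b /=;
  rewrite mul0r addr0.
Qed.

(* A |-> vol {z in B : z / |z| in A}: the polar-coordinates description of the
   surface measure of the unit sphere, up to a constant factor; it is carried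
   by the sphere. *)
Definition cone_measure : set 'rV[R[i]]_n -> \bar R :=
  pushforward (mrestr (volume R n) measurable_unit_ball) radial_proj.

Let cone_measure0 : cone_measure set0 = 0%E.
Proof. by apply: measure0; exact: measurable_radial_proj. Qed.

Let cone_measure_ge0 A : (0 <= cone_measure A)%E.
Proof. by apply: measure_ge0; exact: measurable_radial_proj. Qed.

Let cone_measure_sigma_additive : semi_sigma_additive cone_measure.
Proof.
by apply: measure_semi_sigma_additive; exact: measurable_radial_proj.
Qed.

HB.instance Definition _ := isMeasure.Build _ _ _ cone_measure
  cone_measure0 cone_measure_ge0 cone_measure_sigma_additive.

(* The default value of [mnormalize] is irrelevant, since the volume of the
   unit ball is positive and finite. *)
Definition sphere_measure : set 'rV[R[i]]_n -> \bar R :=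
  mnormalize cone_measure \d_(0 : 'rV[R[i]]_n).

HB.instance Definition _ := Probability.on sphere_measure.

End sphere.

Arguments enorm {R n}.
Arguments unit_ball {R n}.
Arguments sphere_measure {R n}.

Section hardy.
Context {R : realType} {n : nat}.
Implicit Types (f g h phi psi : 'rV[R[i]]_n -> R[i]).
Implicit Types (F G : 'rV[R[i]]_n -> R[i]).
Implicit Types (A B Q : set ('rV[R[i]]_n -> R[i])).
Implicit Types (X : ('rV[R[i]]_n -> R[i]) -> ('rV[R[i]]_n -> R[i])).

Local Notation C := R[i].
Local Notation sigma := (@sphere_measure R n).

(* Functions on the ball are represented by their extension by zero to C^n, so
   that equality of functions on the ball is Leibniz equality. *)
Definition on_ball f : 'rV[C]_n -> C := patch (fun=> 0) unit_ball f.

Definition analytic f :=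
  (forall z, unit_ball z -> differentiable f z) /\
  (forall z, ~ unit_ball z -> f z = 0).

Definition supnorm f : R := sup [set Normc.normc (f z) | z in unit_ball].

Definition Hinfty : set ('rV[C]_n -> C) :=
  [set f | analytic f /\
    exists M : R, forall z, unit_ball z -> Normc.normc (f z) <= M].

Definition schur : set ('rV[C]_n -> C) :=
  [set f | Hinfty f /\ supnorm f <= 1].

Definition hardy_norm2 f : \bar R :=
  ereal_sup [set (\int[sigma]_z (Normc.normc (f (r%:C *: z)) ^+ 2)%:E)%E |
    r in [set r : R | 0 < r < 1]].

Definition H2 : set ('rV[C]_n -> C) :=
  [set f | analytic f /\ (hardy_norm2 f < +oo)%E].

(* Functions on the sphere are functions on C^n, regarded up to equality almost
   everywhere for the surface measure. *)
Definition complex_integral F : C :=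
  (\int[sigma]_z complex.Re (F z))%R +i* (\int[sigma]_z complex.Im (F z))%R.

Definition conj_fun F : 'rV[C]_n -> C := fun z => (F z)^*.

Definition L2norm2 F : \bar R := (\int[sigma]_z (Normc.normc (F z) ^+ 2)%:E)%E.

Definition L1norm F : \bar R := (\int[sigma]_z (Normc.normc (F z))%:E)%E.

Definition L2 : set ('rV[C]_n -> C) :=
  [set F | measurable_fun setT F /\ (L2norm2 F < +oo)%E].

Definition L2dot F G : C := complex_integral (F \* conj_fun G).

Definition conj_set A : set ('rV[C]_n -> C) := [set conj_fun F | F in A].

Definition add_set A B : set ('rV[C]_n -> C) :=
  [set F | exists G H, [/\ A G, B H & F = G \+ H]].

Definition L2orth A : set ('rV[C]_n -> C) :=
  [set F | L2 F /\ forall G, A G -> L2dot F G = 0].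

Definition poly_fun (p : mpoly.mpoly n C) : 'rV[C]_n -> C :=
  fun z => mpoly.meval (fun i => z ord0 i) p.

(* H^2(S^n), the closure of the polynomials in L^2(S^n). *)
Definition H2S : set ('rV[C]_n -> C) :=
  [set F | L2 F /\ forall e : R, 0 < e ->
    exists p, (L2norm2 (F \- poly_fun p)%R < e%:E)%E].

Definition H2S0 : set ('rV[C]_n -> C) :=
  [set F | H2S F /\ L2dot F (fun=> 1) = 0].

Definition mixed : set ('rV[C]_n -> C) := L2orth (add_set H2S (conj_set H2S)).

(* Radial limits, the boundary values realizing the unitary identification of
   H^2(B^n) with H^2(S^n). *)
Definition boundary_value f : 'rV[C]_n -> C :=
  fun z => lim (f (r%:C *: z) @[r --> (1 : R)^'-]).

Definition boundary_set A : set ('rV[C]_n -> C) :=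
  [set F | L2 F /\ exists2 f, A f & F = boundary_value f %[ae sigma]].

Definition H2dot f g : C := L2dot (boundary_value f) (boundary_value g).

Definition one_ball : 'rV[C]_n -> C := on_ball (fun=> 1).

Definition mult phi f : 'rV[C]_n -> C := phi \* f.

Definition coordinate (i : 'I_n) : 'rV[C]_n -> C := on_ball (fun z => z ord0 i).

Definition H2adj X f : 'rV[C]_n -> C :=
  xget 0 [set g | H2 g /\ forall h, H2 h -> H2dot (X h) f = H2dot h g].

Definition closed_subspace Q :=
  [/\ Q `<=` H2, Q 0, forall (a : C) f g, Q f -> Q g -> Q (a *: f + g) &
    forall (u : nat -> 'rV[C]_n -> C) f, (forall k, Q (u k)) -> H2 f ->
      hardy_norm2 (u k - f) @[k --> \oo] --> 0%E -> Q f].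

Definition quotient_module Q :=
  [/\ closed_subspace Q, exists2 f, Q f & f <> 0 &
    forall i f, Q f -> Q (H2adj (mult (coordinate i)) f)].

Definition orth_proj Q f : 'rV[C]_n -> C :=
  xget 0 [set g | Q g /\ forall q, Q q -> H2dot (f - g) q = 0].

Definition compression Q phi f : 'rV[C]_n -> C := orth_proj Q (mult phi f).

(* B_1(Q); an operator on Q is only considered through its values on Q. *)
Definition contraction_on Q X :=
  [/\ forall f, Q f -> Q (X f),
    forall (a : C) f g, Q f -> Q g -> X (a *: f + g) = a *: X f + X g &
    forall f, Q f -> (hardy_norm2 (X f) <= hardy_norm2 f)%E].

Definition module_map Q X :=
  forall i f, Q f ->
    X (compression Q (coordinate i) f) = compression Q (coordinate i) (X f).

Definition is_lift Q X phi := forall f, Q f -> X f = compression Q phi f.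

Definition admits_lift Q X := exists2 phi, schur phi & is_lift Q X phi.

Definition M_space Q : set ('rV[C]_n -> C) :=
  add_set (conj_set (boundary_set Q)) (add_set mixed H2S0).

Definition X_functional psi F : C := complex_integral (boundary_value psi \* F).

(* The norm of [X_functional psi] on M_Q equipped with the L^1 norm. *)
Definition X_norm Q psi : \bar R :=
  ereal_sup [set (Normc.normc (X_functional psi F))%:E |
    F in [set F | M_space Q F /\ (L1norm F <= 1)%E]].

End hardy.

(* Main.v *)
(* Integration against psi on M_Q does not distinguish psi from a lift phi:
   phi - psi is orthogonal to Q, and both annihilate M + H^2_0 because monomials
   are orthogonal on the sphere.  Hence |X_Q f| <= |phi|_oo |f|_1 for every lift.
   Conversely Hahn-Banach extends X_Q from M_Q to L^2 with the bound c |f|_1,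
   c = |X_Q|; by Riesz and a test function the extension is integration against
   some g with |g| <= c.  As g annihilates M + H^2_0, it lies in H^2(S), so it is
   the boundary function of some theta, and the powers of theta show that
   |theta| <= c on the ball.  Finally theta - phi is orthogonal to Q and so is its
   product with every function of H^2: the orthogonal complement of Q is invariant
   under bounded analytic multipliers, these being strong limits of polynomials.
   Hence S_theta = S_phi = X.

   The identification of H^2(B) with H^2(S) rests on three facts: analytic
   functions are locally uniform limits of polynomials (Goursat, then averages over
   the coordinate rotations); f_r converges in L^2 to a function in
   H^2(S); and the radial limits exist, by a maximal ergodic inequality for the
   rotation z -> e^{it} z applied to Poisson means. *)

Require Import Defs.
From HB Require Import structures.
From mathcomp Require Import all_boot all_order all_algebra.
From mathcomp Require Import all_classical all_reals all_analysis.
From mathcomp Require Import measurable_realfun.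
From mathcomp Require Import complex.
From mathcomp Require Import ring lra.
From mathcomp Require mpoly.
Set Implicit Arguments.
Unset Strict Implicit.
Unset Printing Implicit Defensive.
Import Order.TTheory GRing.Theory Num.Theory numFieldNormedType.Exports.
Local Open Scope classical_set_scope.
Local Open Scope ring_scope.
Local Open Scope complex_scope.

(** [boundary_value] is a [lim], arbitrary where the radial limit fails to exist. Computations use
    the relation [bval f F] instead: one sequence of polynomials tends to [F] in L^2 of the sphere
    and to [f] pointwise in the ball. It is stable under linear combinations and bounded products,
    and turns norms, inner products and evaluations into statements on polynomials, where
    orthogonality of monomials makes dilations explicit. Radial limits serve only to identify
    [boundary_value f] with [F] almost everywhere.

    The costly step is from analytic functions to polynomials, because nothing is known of the
    derivative beyond its existence. Multiplying a coordinate by e^w turns a change of radius into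
    the comparison of two vertical sides of a rectangle. What is kept of analyticity is a scaling
    law for Fourier coefficients, stable under taking further coefficients, so that coordinates are
    treated one by one.

    For radial limits, Poisson integrals are sampled at N-th roots of unity: the maximal inequality
    then concerns finite averages along one rotation, and N may depend on the polynomial since the
    constants do not depend on N. *)

Local Notation nc := Normc.normc.
Local Notation Re := complex.Re.
Local Notation Im := complex.Im.

(** * Complex moduli and semi-definite inner products *)

Section complex_facts.
Context {R : realType}.
Implicit Types (x y z : R[i]) (r s : R).

Lemma normE z : `|z| = (nc z)%:C.
Proof. by rewrite normc_def; case: z. Qed.

Lemma nc_ge0 z : 0 <= nc z.
Proof. by case: z => a b; exact: sqrtr_ge0. Qed.

Lemma nc0 : nc (0 : R[i]) = 0.
Proof. exact: Normc.normc0. Qed.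

Lemma nc1 : nc (1 : R[i]) = 1.
Proof. exact: Normc.normc1. Qed.

Lemma nc_eq0 z : (nc z == 0) = (z == 0).
Proof. by apply/eqP/eqP => [/Normc.eq0_normc|->] //; rewrite nc0. Qed.

Lemma nc_gt0 z : (0 < nc z) = (z != 0).
Proof. by rewrite lt_def nc_ge0 andbT nc_eq0. Qed.

Lemma ncB x y : nc (x - y) <= nc x + nc y.
Proof. by rewrite (le_trans (le_normcD _ _))// normcN. Qed.

Lemma ncBC x y : nc (x - y) = nc (y - x).
Proof. by rewrite -normcN opprB. Qed.

Lemma ncJ z : nc (conjc z) = nc z.
Proof. by case: z => a b /=; rewrite sqrrN. Qed.

Lemma ncR r : nc r%:C = `|r|.
Proof. by rewrite /= expr0n addr0 sqrtr_sqr. Qed.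

Lemma ncR_ge0 r : 0 <= r -> nc r%:C = r.
Proof. by move=> r0; rewrite ncR ger0_norm. Qed.

Lemma ncX z k : nc (z ^+ k) = nc z ^+ k.
Proof. by elim: k => [|k ih]; rewrite ?expr0 ?nc1// !exprS Normc.normcM ih. Qed.

Lemma nc_sum (I : Type) (s : seq I) (P : pred I) (F : I -> R[i]) :
  nc (\sum_(i <- s | P i) F i) <= \sum_(i <- s | P i) nc (F i).
Proof.
elim/big_ind2: _ => [|x a y b xa yb|//]; first by rewrite nc0.
by rewrite (le_trans (le_normcD _ _))// lerD.
Qed.

Lemma nc_prod (I : Type) (s : seq I) (P : pred I) (F : I -> R[i]) :
  nc (\prod_(i <- s | P i) F i) = \prod_(i <- s | P i) nc (F i).
Proof. exact: (big_morph _ (@Normc.normcM R) nc1). Qed.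

Lemma ReD x y : Re (x + y) = Re x + Re y.
Proof. by case: x; case: y. Qed.

Lemma ImD x y : Im (x + y) = Im x + Im y.
Proof. by case: x; case: y. Qed.

Lemma ReN x : Re (- x) = - Re x.
Proof. by case: x. Qed.

Lemma ImN x : Im (- x) = - Im x.
Proof. by case: x. Qed.

Lemma ReM x y : Re (x * y) = Re x * Re y - Im x * Im y.
Proof. by case: x; case: y. Qed.

Lemma ImM x y : Im (x * y) = Re x * Im y + Im x * Re y.
Proof. by case: x => a b; case: y. Qed.

Lemma ReMr r x : Re (r%:C * x) = r * Re x.
Proof. by rewrite ReM mul0r subr0. Qed.

Lemma ImMr r x : Im (r%:C * x) = r * Im x.
Proof. by rewrite ImM mul0r addr0. Qed.

Lemma ReJ x : Re (conjc x) = Re x.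
Proof. by case: x. Qed.

Lemma ImJ x : Im (conjc x) = - Im x.
Proof. by case: x. Qed.

Lemma complex_ext x y : Re x = Re y -> Im x = Im y -> x = y.
Proof. by case: x; case: y => a b c d /= -> ->. Qed.

Lemma normc_ge_absRe z : `|Re z| <= nc z.
Proof. by rewrite -lecR -normE normc_ge_Re. Qed.

Lemma normc_ge_absIm z : `|Im z| <= nc z.
Proof.
rewrite -sqrtr_sqr; case: z => a b /=.
by rewrite ler_wsqrtr// lerDr sqr_ge0.
Qed.

Lemma nc_le_ReIm z : nc z <= `|Re z| + `|Im z|.
Proof.
case: z => a b /=; rewrite -[leRHS]ger0_norm ?addr_ge0// -sqrtr_sqr.
rewrite ler_wsqrtr// sqrrD !real_normK ?num_real// -addrA lerD2l lerDr.
by rewrite mulrn_wge0// mulr_ge0.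
Qed.

Lemma mulcJ z : z * conjc z = (nc z ^+ 2)%:C.
Proof.
rewrite normc_sqr; apply: complex_ext; first by rewrite ReM ReJ ImJ /=; ring.
by rewrite ImM ReJ ImJ /=; ring.
Qed.

(** Rotating by [u] turns the modulus of an integral or of a functional into a real part, to which
    monotonicity applies. *)
Lemma nc_polar z : exists u, nc u = 1 /\ u * z = (nc z)%:C.
Proof.
have [->|z0] := eqVneq z 0; first by exists 1; rewrite nc1 nc0 mulr0.
have nz : nc z != 0 by rewrite nc_eq0.
exists ((nc z)^-1%:C * conjc z); split.
  by rewrite Normc.normcM ncJ ncR_ge0 ?mulVf// invr_ge0 nc_ge0.
by rewrite -mulrA (mulrC _ z) mulcJ -rmorphM expr2 mulrA mulVf// mul1r.
Qed.

Lemma conjcD x y : conjc (x + y) = conjc x + conjc y.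
Proof. exact: rmorphD. Qed.

Lemma conjcM x y : conjc (x * y) = conjc x * conjc y.
Proof. exact: rmorphM. Qed.

Lemma conjcB x y : conjc (x - y) = conjc x - conjc y.
Proof. exact: rmorphB. Qed.

Lemma cJK x : conjc (conjc x) = x.
Proof. by case: x => a b /=; rewrite opprK. Qed.

Lemma nc_nat k : nc (k%:R : R[i]) = k%:R.
Proof. by rewrite -(rmorph_nat (real_complex R)) ncR_ge0. Qed.

End complex_facts.

Section semi_hilbert.
Context {R : realType} {V : lmodType R[i]}.
Variables (D : set V) (dot : V -> V -> R[i]).

(** The elements are functions rather than classes modulo null sets, so the form is only
    semi-definite, and it is controlled only on a set [D]. The same record serves [L2] with [L2dot]
    and [H2] with [H2dot]. *)
Record semi_hilbert : Prop := SemiHilbert {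
  sh0 : D 0;
  shL : forall (a : R[i]) f g, D f -> D g -> D (a *: f + g);
  shdotL : forall (a : R[i]) f g h, D f -> D g -> D h ->
    dot (a *: f + g) h = a * dot f h + dot g h;
  shdotC : forall f g, D f -> D g -> dot g f = conjc (dot f g);
  shdot_ge0 : forall f, D f -> 0 <= dot f f }.

Definition hn f : R := Num.sqrt (Re (dot f f)).

Definition hn_cauchy (u : nat -> V) :=
  forall e : R, 0 < e -> exists N, forall k l, (N <= k)%N -> (N <= l)%N ->
    hn (u k - u l) <= e.

Definition hn_cvg (u : nat -> V) f :=
  forall e : R, 0 < e -> exists N, forall k, (N <= k)%N -> hn (u k - f) <= e.

Definition hn_complete (A : set V) := forall u, (forall k, A (u k)) ->
  hn_cauchy u -> exists2 f, A f & hn_cvg u f.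

Definition subspace (A : set V) :=
  A 0 /\ forall (a : R[i]) f g, A f -> A g -> A (a *: f + g).

Hypothesis H : semi_hilbert.

Lemma shZ a f : D f -> D (a *: f).
Proof. by move=> Df; rewrite -[_ *: _]addr0; apply: shL => //; exact: sh0. Qed.

Lemma shD f g : D f -> D g -> D (f + g).
Proof. by move=> Df Dg; rewrite -[f]scale1r; exact: shL. Qed.

Lemma shB f g : D f -> D g -> D (f - g).
Proof. by move=> Df Dg; rewrite -scaleN1r addrC; exact: shL. Qed.

Lemma shdot0l f : D f -> dot 0 f = 0.
Proof.
move=> Df; have := shdotL H 1 (sh0 H) (sh0 H) Df.
by rewrite scale1r addr0 mul1r -{1}[dot 0 f]addr0 => /addrI.
Qed.

Lemma shdotZl a f g : D f -> D g -> dot (a *: f) g = a * dot f g.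
Proof.
by move=> Df Dg; rewrite -[_ *: _]addr0 shdotL ?shdot0l ?addr0//; exact: sh0.
Qed.

Lemma shdotDl f g h : D f -> D g -> D h -> dot (f + g) h = dot f h + dot g h.
Proof. by move=> *; rewrite -{1}[f]scale1r shdotL// mul1r. Qed.

Lemma shdotBl f g h : D f -> D g -> D h -> dot (f - g) h = dot f h - dot g h.
Proof.
by move=> *; rewrite addrC -scaleN1r shdotL// mulN1r addrC.
Qed.

Lemma shdotZr a f g : D f -> D g -> dot f (a *: g) = conjc a * dot f g.
Proof.
move=> Df Dg; rewrite (shdotC H (shZ a Dg) Df) shdotZl// conjcM.
by rewrite -(shdotC H Dg Df).
Qed.

Lemma shdotDr f g h : D f -> D g -> D h -> dot f (g + h) = dot f g + dot f h.
Proof.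
move=> Df Dg Dh; rewrite (shdotC H (shD Dg Dh) Df) shdotDl// conjcD.
by rewrite -(shdotC H Dg Df) -(shdotC H Dh Df).
Qed.

Lemma shdotBr f g h : D f -> D g -> D h -> dot f (g - h) = dot f g - dot f h.
Proof.
move=> Df Dg Dh; rewrite (shdotC H (shB Dg Dh) Df) shdotBl// conjcB.
by rewrite -(shdotC H Dg Df) -(shdotC H Dh Df).
Qed.

Lemma hn_ge0 f : 0 <= hn f.
Proof. exact: sqrtr_ge0. Qed.

Lemma dotff f : D f -> dot f f = (hn f ^+ 2)%:C.
Proof.
move=> Df; have := shdot_ge0 H Df; rewrite /hn; case: (dot f f) => a b.
by rewrite lecE => /andP[/eqP/= -> a0]; rewrite sqr_sqrtr.
Qed.

Lemma hn_sqrE f : D f -> hn f ^+ 2 = Re (dot f f).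
Proof. by move=> Df; rewrite dotff. Qed.

Lemma hn_sqrB f g : D f -> D g ->
  hn (f - g) ^+ 2 = hn f ^+ 2 + hn g ^+ 2 - 2 * Re (dot f g).
Proof.
move=> Df Dg; have Dfg := shB Df Dg.
rewrite !hn_sqrE// shdotBl// !shdotBr// (shdotC H Df Dg).
by rewrite !(ReD, ReN) ReJ; ring.
Qed.

Lemma hn_sqrD f g : D f -> D g ->
  hn (f + g) ^+ 2 = hn f ^+ 2 + hn g ^+ 2 + 2 * Re (dot f g).
Proof.
move=> Df Dg; have Dfg := shD Df Dg.
rewrite !hn_sqrE// shdotDl// !shdotDr// (shdotC H Df Dg).
by rewrite !(ReD, ReN) ReJ; ring.
Qed.

Lemma hnZ a f : D f -> hn (a *: f) = nc a * hn f.
Proof.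
move=> Df; apply/eqP; rewrite -(@eqrXn2 _ 2)// ?mulr_ge0 ?hn_ge0 ?nc_ge0//.
rewrite hn_sqrE; last exact: shZ.
rewrite shdotZl//; last exact: shZ.
by rewrite shdotZr// mulrA mulcJ dotff// -rmorphM exprMn.
Qed.

Lemma hnN f : D f -> hn (- f) = hn f.
Proof. by move=> Df; rewrite -scaleN1r hnZ// normcN nc1 mul1r. Qed.

Lemma hnBC f g : D f -> D g -> hn (f - g) = hn (g - f).
Proof. by move=> Df Dg; rewrite -hnN ?opprB//; exact: shB. Qed.

Lemma hn0 : hn 0 = 0.
Proof. by rewrite /hn shdot0l ?sqrtr0//; exact: sh0. Qed.

(** Moving [f] along [g] by a real multiple of [dot f g] makes the cross term real. The
    Cauchy-Schwarz inequality and the orthogonality of a minimizer are two choices of [t]. *)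
Lemma sh_expand f g (t : R) : D f -> D g ->
  hn (f - (t%:C * dot f g) *: g) ^+ 2 =
  hn f ^+ 2 - 2 * t * nc (dot f g) ^+ 2
  + t ^+ 2 * nc (dot f g) ^+ 2 * hn g ^+ 2.
Proof.
move=> Df Dg; rewrite hn_sqrB//; last exact: shZ.
rewrite hnZ// Normc.normcM ncR shdotZr// conjcM conjc_real -mulrA.
rewrite -[X in Re X]mulrA (mulrC (conjc _)) mulcJ -rmorphM/=.
by rewrite !exprMn real_normK ?num_real//; ring.
Qed.

Lemma cauchy_schwarz f g : D f -> D g -> nc (dot f g) <= hn f * hn g.
Proof.
move=> Df Dg.
have E t := sh_expand t Df Dg.
have P t : 0 <= hn f ^+ 2 - 2 * t * nc (dot f g) ^+ 2
  + t ^+ 2 * nc (dot f g) ^+ 2 * hn g ^+ 2 by rewrite -E sqr_ge0.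
rewrite -(@ler_pXn2r _ 2)// ?nnegrE ?nc_ge0 ?mulr_ge0 ?hn_ge0// exprMn.
(* A nonzero [g] may have norm 0. In that case the quadratic in [t] is affine, and the value of [t]
   chosen below would make it equal to -1 if the coefficient did not vanish. *)
have := hn_ge0 g; rewrite le_eqVlt => /predU1P[g0|g0].
  rewrite -g0 expr0n mulr0 leNgt; apply/negP; move: P.
  set c := nc _ ^+ 2 => P c0.
  have := P ((hn f ^+ 2 + 1) / (2 * c)).
  rewrite -g0 expr0n mulr0 addr0.
  have -> : 2 * ((hn f ^+ 2 + 1) / (2 * c)) *
    c = hn f ^+ 2 + 1 by field; rewrite gt_eqF.
  by rewrite opprD addrA subrr sub0r oppr_ge0 ler10.
have := P (hn g ^- 2).
have -> : hn f ^+ 2 - 2 * (hn g ^- 2) * nc (dot f g) ^+ 2 +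
    (hn g ^- 2) ^+ 2 * nc (dot f g) ^+ 2 * hn g ^+ 2 =
  hn f ^+ 2 - nc (dot f g) ^+ 2 / hn g ^+ 2 by field; rewrite gt_eqF.
by rewrite subr_ge0 ler_pdivrMr// exprn_gt0.
Qed.

Lemma hnD f g : D f -> D g -> hn (f + g) <= hn f + hn g.
Proof.
move=> Df Dg.
rewrite -(@ler_pXn2r _ 2)// ?nnegrE ?addr_ge0 ?hn_ge0// hn_sqrD// sqrrD.
have := le_trans (ler_norm _) (le_trans (normc_ge_absRe _) (cauchy_schwarz Df Dg)).
lra.
Qed.

Lemma hn_tri h f g : D f -> D g -> D h -> hn (f - g) <= hn (f - h) + hn (h - g).
Proof.
move=> Df Dg Dh; rewrite (le_trans _ (hnD _ _)) ?subrKA//; exact: shB.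
Qed.

Lemma parallelogram f g : D f -> D g ->
  hn (f + g) ^+ 2 + hn (f - g) ^+ 2 = 2 * hn f ^+ 2 + 2 * hn g ^+ 2.
Proof. by move=> Df Dg; rewrite hn_sqrD// hn_sqrB//; ring. Qed.

Lemma minimal_orth f A g : subspace A -> A `<=` D -> D f -> A g ->
  (forall h, A h -> hn (f - g) <= hn (f - h)) ->
  forall h, A h -> dot (f - g) h = 0.
Proof.
move=> [A0 AL] AD Df Ag gmin h Ah.
have [Dg Dh] : D g /\ D h by split; exact: AD.
have Dfg := shB Df Dg.
apply/eqP; rewrite -nc_eq0 -sqrf_eq0 eq_le sqr_ge0 andbT.
set c := nc _ ^+ 2; have c0 : 0 <= c by exact: sqr_ge0.
(* With this [t] the product [t * hn h ^+ 2] is [1 - t], so the squared norm changes by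
   [- (t * c * (1 + t))], which is negative unless [c] is 0. *)
pose t := (hn h ^+ 2 + 1)^-1.
have b0 : 0 < hn h ^+ 2 + 1 by rewrite ltr_wpDl// sqr_ge0.
have t0 : 0 < t by rewrite invr_gt0.
have := gmin ((t%:C * dot (f - g) h) *: h + g) (AL _ _ _ Ah Ag).
rewrite opprD (addrC (- _)) addrA -(@ler_pXn2r _ 2)// ?nnegrE ?hn_ge0//.
rewrite sh_expand// -/c -addrA lerDl.
have -> : - (2 * t * c) + t ^+ 2 * c * hn h ^+ 2 =
   - (t * c * (1 + t)) .
  by rewrite /t; field; rewrite gt_eqF.
by rewrite oppr_ge0 -mulrA pmulr_rle0// pmulr_lle0// addr_gt0.
Qed.

Lemma projection A f : subspace A -> A `<=` D -> hn_complete A -> D f ->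
  exists2 g, A g & forall h, A h -> dot (f - g) h = 0.
Proof.
move=> sA AD cA Df.
have [A0 AL] := sA.
pose S := [set hn (f - h) | h in A].
pose d := inf S.
have S0 : S !=set0 by exists (hn (f - 0)); exists 0.
have Slb : has_lbound S by exists 0 => _ [h _ <-]; exact: hn_ge0.
have dle h : A h -> d <= hn (f - h) by move=> Ah; apply: ge_inf => //; exists h.
have d0 : 0 <= d by apply: lb_le_inf => // _ [h _ <-]; exact: hn_ge0.
have /choice[u uP] k : exists g, A g /\ hn (f - g) < d + k.+1%:R^-1.
  have [_ [g Ag <-] gk] := @inf_adherent _ S k.+1%:R^-1 ltac:(by rewrite invr_gt0) (conj S0 Slb).
  by exists g.
have Au k : A (u k) by have [] := uP k.
have Du k : D (u k) by exact: AD.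
(* The midpoint of two near-minimizers lies in [A], hence at distance at least [d] from [f]; the
   parallelogram law then bounds their distance. The final 0 in the midpoint fits the closure
   property of [subspace]. *)
have par k l (e : R) : 0 <= e -> hn (f - u k) <= d + e -> hn (f - u l) <= d + e ->
    hn (u k - u l) ^+ 2 <= 4 * e * (2 * d + e).
  move=> e0 ke le.
  have := parallelogram (shB Df (Du k)) (shB Df (Du l)).
  have -> : f - u k - (f - u l) = u l - u k by rewrite opprB addrC addrA subrK.
  have -> : f - u k + (f - u l) = 2 *: (f - (2^-1 *: u k + (2^-1 *: u l + 0))).
    rewrite addr0 -scalerDr scalerBr scalerA mulfV ?scale1r ?pnatr_eq0//.
    by rewrite scaler_nat mulr2n opprD addrACA.
  set m := 2^-1 *: _ + _.
  have Am : A m by apply: (AL) => //; exact: AL.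
  have Dfm : D (f - m) by apply: shB => //; exact: AD.
  rewrite hnZ// nc_nat exprMn hnBC// => E.
  have dm : d ^+ 2 <= hn (f - m) ^+ 2 by rewrite ler_pXn2r ?nnegrE ?hn_ge0 ?dle.
  have {}ke : hn (f - u k) ^+ 2 <= (d + e) ^+ 2.
    by rewrite ler_pXn2r ?nnegrE ?hn_ge0 ?addr_ge0.
  have {}le : hn (f - u l) ^+ 2 <= (d + e) ^+ 2.
    by rewrite ler_pXn2r ?nnegrE ?hn_ge0 ?addr_ge0.
  by nra.
have uc : hn_cauchy u.
  move=> e e0.
  pose e' := Num.min 1 (e ^+ 2 / (4 * (2 * d + 1))).
  have q0 : 0 < 4 * (2 * d + 1) by rewrite mulr_gt0// ltr_wpDl// mulr_ge0.
  have e'0 : 0 < e' by rewrite lt_min ltr01 divr_gt0// exprn_gt0.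
  have [N NP] : exists N : nat, N.+1%:R^-1 < e'.
    have [N _ NP] := near_infty_natSinv_lt (PosNum e'0).
    by exists N; apply: NP => /=.
  exists N => k l Nk Nl.
  have Q j : (N <= j)%N -> hn (f - u j) <= d + e'.
    move=> Nj; have [_ /ltW/le_trans->//] := uP j.
    rewrite lerD2l (le_trans _ (ltW NP))// lef_pV2 ?posrE// ler_nat ltnS//.
  have := par _ _ _ (ltW e'0) (Q _ Nk) (Q _ Nl) => h.
  rewrite -(@ler_pXn2r _ 2)// ?nnegrE ?hn_ge0 ?(ltW e0)// (le_trans h)//.
  have e1 : e' <= 1 by rewrite ge_min lexx.
  have e2 : e' * (4 * (2 * d + 1)) <= e ^+ 2.
    by rewrite -ler_pdivlMr// ge_min lexx orbT.
  rewrite (le_trans _ e2)//; have := e'0; nra.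
have [g Ag ug] := cA _ Au uc; exists g => //.
apply: (minimal_orth sA AD Df Ag) => h Ah.
rewrite (le_trans _ (dle _ Ah))//; apply/ler_addgt0Pr => e e0.
have e20 : 0 < e / 2 by rewrite divr_gt0.
have [N NP] := ug _ e20.
have [M _ MP] := near_infty_natSinv_lt (PosNum e20).
pose k := maxn N M.
rewrite (le_trans (hn_tri Df (AD _ Ag) (Du k)))//.
rewrite (splitr e) addrA lerD//; last by rewrite NP// leq_maxl.
have [_ /ltW/le_trans->//] := uP k; rewrite lerD2l ltW// (MP k)//=.
by rewrite leq_maxr.
Qed.

Lemma riesz (l : V -> R[i]) (c : R) : hn_complete D ->
  (forall a f g, D f -> D g -> l (a *: f + g) = a * l f + l g) ->
  (forall f, D f -> nc (l f) <= c * hn f) ->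
  exists2 g, D g & forall f, D f -> l f = dot f g.
Proof.
move=> cD lL lb.
have D0 := sh0 H.
have lB f g : D f -> D g -> l (f - g) = l f - l g.
  by move=> Df Dg; rewrite addrC -scaleN1r lL// mulN1r addrC.
have l0 : l 0 = 0 by have := lB _ _ D0 D0; rewrite !subrr.
have [l00|/existsNP[x /not_implyP[Dx lx]]] := pselect (forall f, D f -> l f = 0).
  by exists 0 => // f Df; rewrite l00// (shdotC H _ Df)// shdot0l// conjc0.
pose A := [set f | D f /\ l f = 0].
have sA : subspace A.
  split=> // a f g [Df lf] [Dg lg]; split; first exact: shL.
  by rewrite lL// lf lg mulr0 addr0.
have AD : A `<=` D by move=> f [].
(* A negative [c] forces [l] to vanish. *)
have c0 : 0 <= c \/ forall f, D f -> l f = 0.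
  have [?|c0] := leP 0 c; [by left|right=> f Df].
  apply/eqP; rewrite -nc_eq0 eq_le nc_ge0 andbT (le_trans (lb _ Df))//.
  by rewrite nmulr_rle0 ?hn_ge0.
have cA : hn_complete A.
  move=> u Au uc.
  have [f Df uf] := cD u (fun k => AD _ (Au k)) uc.
  exists f => //; split=> //; apply/eqP; rewrite -nc_eq0 eq_le nc_ge0 andbT.
  case: c0 => [c0|->//]; last by rewrite nc0.
  apply/ler_addgt0Pr => e e0; rewrite add0r.
  have e1 : 0 < e / (c + 1) by rewrite divr_gt0// ltr_wpDl.
  have [N NP] := uf _ e1; have [DN lN] := Au N.
  have := lb _ (shB DN Df); rewrite lB// lN sub0r normcN => /le_trans->//.
  rewrite (le_trans (ler_wpM2l c0 (NP N (leqnn _))))//.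
  rewrite mulrCA ger_pMr// ler_pdivrMr ?mul1r ?lerDl// ltr_wpDl//.
have [a [Da la] xa] := projection sA AD cA Dx.
pose y := x - a.
have Dy : D y by exact: shB.
have ly : l y = l x by rewrite lB// la subr0.
have ly0 : l y != 0 by rewrite ly; exact/eqP.
(* Semi-definiteness alone does not give this: [y] has positive norm because [l y] is nonzero and
   bounded by a multiple of that norm. *)
have yy : dot y y != 0.
  apply: contra_neq ly0 => yy.
  apply/eqP; rewrite -nc_eq0 eq_le nc_ge0 andbT (le_trans (lb _ Dy))//.
  by rewrite /hn yy /= sqrtr0 mulr0.
exists (conjc (l y / dot y y) *: y); first exact: shZ.
move=> f Df.
have Af : A (f - (l f / l y) *: y).
  split; first by apply: shB => //; exact: shZ.
  rewrite lB//; last exact: shZ.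
  by rewrite -[_ *: y]addr0 lL// l0 addr0 mulfVK// subrr.
have := xa _ Af; rewrite -/y => /eqP.
rewrite shdotBr//; last exact: shZ.
rewrite shdotZr// subr_eq0 => /eqP yf.
rewrite (shdotZr _ Df Dy) cJK (shdotC H Dy Df) yf (conjcM (conjc _)) cJK -(shdotC H Dy Dy).
by field; rewrite ly0 yy.
Qed.

End semi_hilbert.

(** * Hahn-Banach theorem *)

Section hahn_banach.
Context {R : realType} {V : lmodType R[i]}.
Variables (D : set V) (p : V -> R).
Hypothesis sD : subspace D.
Hypothesis pD : forall f g, D f -> D g -> p (f + g) <= p f + p g.
Hypothesis pZ : forall (a : R[i]) f, D f -> p (a *: f) = nc a * p f.

(** Partial real-linear functionals dominated by [p], encoded by their graphs: extension becomes
    inclusion, and the union of a chain is again such a graph. *)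
Let real_graph (G : set (V * R)) := [/\ G (0, 0),
  forall (t : R) u v, G u -> G v ->
    G (t%:C *: u.1 + v.1, t * u.2 + v.2) &
  forall u, G u -> D u.1 /\ u.2 <= p u.1].

Let real_graph_fun G f x y : real_graph G -> G (f, x) -> G (f, y) -> x = y.
Proof.
move=> [G0 GL Gp] Gx Gy.
have p0 : p 0 = 0.
  by rewrite -(scale0r (0 : V)) pZ ?nc0 ?mul0r//; exact: sD.1.
have le u v : G (f, u) -> G (f, v) -> v <= u.
  move=> Gu Gv; have := Gp _ (GL (-1) _ _ Gu Gv) => /= -[_].
  by rewrite rmorphN1 scaleN1r addNr p0 mulN1r addrC subr_le0.
by apply/eqP; rewrite eq_le !le.
Qed.

Lemma hahn_banach_real (G0 : set (V * R)) : real_graph G0 ->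
  exists G, [/\ real_graph G, G0 `<=` G & forall f, D f -> exists x, G (f, x)].
Proof.
move=> gG0.
have DL := sD.2.
pose P := [set G | G = set0 \/ (real_graph G /\ G0 `<=` G)].
have [F FP Ft|A [PA Amax]] := @Zorn_bigcup _ P.
  have [[X0 [FX0 /eqP/set0P[w0 X0w]]]|nX] := pselect (exists X, F X /\ X <> set0); last first.
    left; apply/seteqP; split => // x [X FX Xx]; apply: nX; exists X; split => //.
    by move=> X0; rewrite X0 in Xx.
  right.
  have gX X x : F X -> X x -> real_graph X /\ G0 `<=` X.
    by move=> FX Xx; case: (FP _ FX) => // X00; rewrite X00 in Xx.
  have [[G00 _ _] GX0] := gX _ _ FX0 X0w.
  split; last by move=> x /GX0 X0x; exists X0.
  split; first by exists X0.
  - move=> t u v [X FX Xu] [Y FY Yv].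
    have [[_ XL _] _] := gX _ _ FX Xu.
    have [[_ YL _] _] := gX _ _ FY Yv.
    have [XY|YX] := Ft _ _ FX FY.
      by exists Y => //; apply: YL => //; exact: XY.
    by exists X => //; apply: XL => //; exact: YX.
  - by move=> u [X FX Xu]; have [[_ _ Xp] _] := gX _ _ FX Xu; exact: Xp.
have [gA GA] : real_graph A /\ G0 `<=` A.
  case: PA => // A0; exfalso; apply: (Amax G0); last by right; split.
  rewrite A0; split => // /(_ (0, 0)); apply; by case: gG0.
exists A; split => // f Df; apply: contrapT => nf.
have [A0 AL Ap] := gA.
have sepa u v : A u -> A v -> u.2 - p (u.1 - f) <= p (v.1 + f) - v.2.
  move=> Au Av; rewrite lerBlDr addrAC lerBrDl.
  have := Ap _ (AL 1 _ _ Au Av); rewrite /= rmorph1 scale1r mul1r addrC => -[_].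
  rewrite [v.2 + _]addrC => /le_trans->//.
  have [[Du _] [Dv _]] := (Ap _ Au, Ap _ Av).
  rewrite (le_trans _ (pD _ _))//.
  - by rewrite addrA addrAC subrK addrC.
  - by rewrite addrC -scaleN1r; exact: DL.
  - by rewrite -[_.1]scale1r; exact: DL.
(* Every number between the two sides of [sepa] is an admissible value at [f]; the supremum of the
   left-hand sides is one. *)
pose S := [set u.2 - p (u.1 - f) | u in A].
have S0 : S !=set0 by exists (0 - p (0 - f)); exists (0, 0).
have ubS v : A v -> ubound S (p (v.1 + f) - v.2).
  by move=> Av _ [u Au <-]; exact: sepa.
pose c := sup S.
have c1 u : A u -> u.2 - p (u.1 - f) <= c.
  move=> Au; apply: ub_le_sup; last by exists u.
  by exists (p (0 + f) - 0); exact: (ubS (0, 0)).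
have c2 v : A v -> c <= p (v.1 + f) - v.2.
  by move=> Av; apply: ge_sup => //; exact: ubS.
pose B := [set w | exists u (t : R), A u /\ w = (t%:C *: f + u.1, t * c + u.2)].
have AB : A `<=` B.
  by move=> [u1 u2] Au; exists (u1, u2), 0; rewrite /= scale0r mul0r !add0r.
have Bf : B (f, c) by exists (0, 0), 1; rewrite /= scale1r mul1r !addr0.
apply: (Amax B).
  by split => // BA; apply: nf; exists c; exact: BA.
right; split; last by move=> x /GA /AB.
split; first exact: AB.
- move=> t _ _ [u [s [Au ->]]] [v [r [Av ->]]].
  exists (t%:C *: u.1 + v.1, t * u.2 + v.2), (t * s + r); split; first exact: AL.
  congr (_, _) => /=; last by ring.
  by rewrite scalerDr scalerA addrACA rmorphD rmorphM scalerDl.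
- move=> _ [u [t [Au ->]]] /=.
  have [Du pu] := Ap _ Au.
  split; first exact: DL.
  have Auinv s : A (s%:C *: u.1, s * u.2).
    by have := AL s _ _ Au A0; rewrite /= !addr0.
  have [t0|t0|->] := ltgtP t 0.
  + have Nt0 : 0 < - t by rewrite oppr_gt0.
    have := c1 _ (Auinv (- t)^-1) => /=.
    have -> : t%:C *: f + u.1 = (- t)%:C *: ((- t)^-1%:C *: u.1 - f).
      rewrite scalerBr scalerA -rmorphM mulfV ?gt_eqF// scale1r addrC rmorphN.
      by rewrite scaleNr opprK.
    rewrite pZ; last first.
      by rewrite addrC -scaleN1r; apply: DL => //; have [+ _] := Ap _ (Auinv (- t)^-1); exact.
    rewrite ncR_ge0 ?(ltW Nt0)// -(ler_pM2l Nt0) mulrBr mulrA mulfV ?gt_eqF// mul1r.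
    by lra.
  + have := c2 _ (Auinv t^-1) => /=.
    have -> : t%:C *: f + u.1 = t%:C *: (t^-1%:C *: u.1 + f).
      by rewrite scalerDr scalerA -rmorphM mulfV ?gt_eqF// scale1r addrC.
    rewrite pZ; last exact: DL.
    rewrite ncR_ge0 ?(ltW t0)// -(ler_pM2l t0) mulrBr mulrA mulfV ?gt_eqF// mul1r.
    by lra.
  + by rewrite scale0r mul0r !add0r.
Qed.

(** The real part is extended and the complex functional is rebuilt from it. The bound on the
    modulus returns by rotating [L f] onto the positive axis, since [p] is invariant under
    unimodular scalars. *)
Lemma hahn_banach (M : set V) (l : V -> R[i]) : subspace M -> M `<=` D ->
  (forall a f g, M f -> M g -> l (a *: f + g) = a * l f + l g) ->
  (forall f, M f -> nc (l f) <= p f) ->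
  exists L : V -> R[i],
    [/\ forall a f g, D f -> D g -> L (a *: f + g) = a * L f + L g,
        forall f, D f -> nc (L f) <= p f & forall f, M f -> L f = l f].
Proof.
move=> [M0 ML] MD lL lp.
have [D0 DL] := sD.
have l0 : l 0 = 0.
  by have := lL 1 _ _ M0 M0; rewrite scale1r addr0 mul1r -{1}[l 0]addr0 => /addrI.
have lZ a f : M f -> l (a *: f) = a * l f.
  by move=> Mf; rewrite -[_ *: _]addr0 lL// l0 addr0.
pose G0 := [set u : V * R | M u.1 /\ u.2 = Re (l u.1)].
have [|G [gG G0G totG]] := @hahn_banach_real G0.
  split; first by split; rewrite //= l0.
  - move=> t u v [Mu ->] [Mv ->]; split => /=; first exact: ML.
    by rewrite lL// ReD ReMr.
  - move=> u [Mu ->]; split; first exact: MD.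
    exact: (le_trans (ler_norm _) (le_trans (normc_ge_absRe _) (lp _ Mu))).
have [_ GL Gp] := gG.
have /choice[U UP] f : exists x, D f -> G (f, x).
  by have [/totG[x Gx]|nD] := pselect (D f); [exists x|exists 0].
have UE f x : D f -> G (f, x) -> U f = x.
  by move=> Df Gx; apply: (real_graph_fun gG (UP _ Df) Gx).
have UL (t : R) f g : D f -> D g -> U (t%:C *: f + g) = t * U f + U g.
  by move=> Df Dg; apply: UE; [exact: DL|exact: (GL t _ _ (UP _ Df) (UP _ Dg))].
have Up f : D f -> U f <= p f by move=> Df; have [_] := Gp _ (UP _ Df).
have U0 : U 0 = 0.
  by have := UL 1 _ _ D0 D0; rewrite scale1r addr0 mul1r -{1}[U 0]addr0 => /addrI.
have DZ a f : D f -> D (a *: f) by move=> Df; rewrite -[_ *: _]addr0; exact: DL.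
have UZ (t : R) f : D f -> U (t%:C *: f) = t * U f.
  by move=> Df; rewrite -[_ *: _]addr0 UL// U0 addr0.
have UD f g : D f -> D g -> U (f + g) = U f + U g.
  by move=> Df Dg; rewrite -[f]scale1r (UL 1)// mul1r scale1r.
pose L f := U f +i* (- U ('i%C *: f)).
have LC a f : D f -> L (a *: f) = a * L f.
  move=> Df; have Dif := DZ 'i _ Df.
  have UC b : U (b *: f) = Re b * U f + Im b * U ('i%C *: f).
    have <- : U ((Re b)%:C *: f + (Im b)%:C *: ('i%C *: f)) = Re b * U f + Im b * U ('i%C *: f).
      by rewrite UL ?UZ//; exact: DZ.
    by congr U; rewrite scalerA -scalerDl {1}[b]complexE (mulrC _ 'i%C).
  rewrite /L scalerA (UC a) (UC ('i%C * a)).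
  by case: a => a b /=; congr Complex; ring.
have LD f g : D f -> D g -> L (f + g) = L f + L g.
  move=> Df Dg; rewrite /L scalerDr !UD//; [|exact: DZ..].
  by rewrite opprD.
exists L; split.
- by move=> a f g Df Dg; rewrite LD ?LC//; exact: DZ.
- move=> f Df; have [u [u1 uE]] := nc_polar (L f).
  have := LC u f Df; rewrite uE => /(congr1 (@complex.Re R))/= <-.
  by rewrite (le_trans (Up _ _)) ?pZ ?u1 ?mul1r//; exact: DZ.
- move=> f Mf; have Df := MD _ Mf.
  have Mif : M ('i%C *: f) by rewrite -[_ *: _]addr0; exact: ML.
  have -> : L f = Re (l f) +i* (- Re (l ('i%C *: f))).
    have g1 : G (f, Re (l f)) by apply: G0G; split.
    have g2 : G ('i%C *: f, Re (l ('i%C *: f))) by apply: G0G; split.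
    by rewrite /L (UE _ _ Df g1) (UE _ _ (DZ _ _ Df) g2).
  by rewrite lZ//; case: (l f) => a b /=; congr Complex; ring.
Qed.

End hahn_banach.

(** * Lebesgue spaces of the sphere *)

Section sphere_integral.
Context {R : realType} {n : nat}.
Local Notation C := R[i].
Local Notation T := 'rV[R[i]]_n.
Local Notation sigma := (@sphere_measure R n).
Implicit Types (F G : T -> C) (a : C).

Definition mfun F := measurable_fun [set: T] F.

Lemma mfunP F : mfun F <-> measurable_fun [set: T] (fun z => Re (F z)) /\
  measurable_fun [set: T] (fun z => Im (F z)).
Proof. exact: measurable_fun_complexP. Qed.

Lemma mfun_Re F : mfun F -> measurable_fun [set: T] (fun z => Re (F z)).
Proof. by case/mfunP. Qed.

Lemma mfun_Im F : mfun F -> measurable_fun [set: T] (fun z => Im (F z)).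
Proof. by case/mfunP. Qed.

Lemma mfun_cst a : mfun (fun=> a).
Proof. exact: measurable_cst. Qed.

Lemma mfunD F G : mfun F -> mfun G -> mfun (F \+ G).
Proof.
move=> /mfunP[F1 F2] /mfunP[G1 G2]; apply/mfunP; split.
  by under eq_fun do rewrite /= ReD; exact: measurable_funD.
by under eq_fun do rewrite /= ImD; exact: measurable_funD.
Qed.

Lemma mfunM F G : mfun F -> mfun G -> mfun (F \* G).
Proof.
move=> /mfunP[F1 F2] /mfunP[G1 G2]; apply/mfunP; split.
  by under eq_fun do rewrite /= ReM; apply: measurable_funB; exact: measurable_funM.
by under eq_fun do rewrite /= ImM; apply: measurable_funD; exact: measurable_funM.
Qed.

Lemma mfunZ a F : mfun F -> mfun (fun z => a * F z).
Proof. by move=> mF; apply: mfunM => //; exact: mfun_cst. Qed.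

Lemma mfunN F : mfun F -> mfun (fun z => - F z).
Proof.
by move=> mF; under eq_fun do rewrite -mulN1r; exact: mfunZ.
Qed.

Lemma mfunB F G : mfun F -> mfun G -> mfun (F \- G).
Proof. by move=> mF mG; apply: mfunD => //; exact: mfunN. Qed.

Lemma mfunJ F : mfun F -> mfun (conj_fun F).
Proof.
move=> /mfunP[F1 F2]; apply/mfunP; split; rewrite /conj_fun.
  by under eq_fun do rewrite ReJ.
by under eq_fun do rewrite ImJ; exact: measurable_funN.
Qed.

Lemma mfunX F k : mfun F -> mfun (fun z => F z ^+ k).
Proof.
move=> mF; elim: k => [|k ih]; first exact: mfun_cst.
by under eq_fun do rewrite exprS; exact: mfunM.
Qed.

Lemma mfun_sum (I : Type) (s : seq I) (P : pred I) (F : I -> T -> C) :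
  (forall i, mfun (F i)) -> mfun (fun z => \sum_(i <- s | P i) F i z).
Proof.
move=> mF; elim: s => [|i s ih].
  by under eq_fun do rewrite big_nil; exact: mfun_cst.
under eq_fun do rewrite big_cons; case: (P i) => //.
exact: mfunD.
Qed.

Lemma mfun_prod (I : Type) (s : seq I) (P : pred I) (F : I -> T -> C) :
  (forall i, mfun (F i)) -> mfun (fun z => \prod_(i <- s | P i) F i z).
Proof.
move=> mF; elim: s => [|i s ih].
  by under eq_fun do rewrite big_nil; exact: mfun_cst.
under eq_fun do rewrite big_cons; case: (P i) => //.
exact: mfunM.
Qed.

Lemma mfun_nc F : mfun F -> measurable_fun [set: T] (fun z => nc (F z)).
Proof.
move=> /mfunP[F1 F2].
have -> : (fun z => nc (F z)) =
    (fun z => Num.sqrt (Re (F z) ^+ 2 + Im (F z) ^+ 2)).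
  by apply/funext => z; rewrite -normc_sqr sqrtr_sqr ger0_norm// nc_ge0.
apply: measurableT_comp; first exact: continuous_measurable_fun (@sqrt_continuous R).
by apply: measurable_funD; exact: measurable_funX.
Qed.

Lemma mfun_nc2 F : mfun F -> measurable_fun [set: T] (fun z => nc (F z) ^+ 2).
Proof. by move=> mF; apply: measurable_funX; exact: mfun_nc. Qed.

Lemma mfun_cvg (G : nat -> T -> C) F : (forall k, mfun (G k)) ->
  (forall z, (nc (G k z - F z)) @[k --> \oo] --> (0 : R)) -> mfun F.
Proof.
move=> mG GF; apply/mfunP; split.
- apply: (@measurable_fun_cvg _ _ _ _ (fun k z => Re (G k z))).
    by move=> k; exact: mfun_Re.
  move=> z _; apply/cvgrPdist_lt => e e0.
  have /cvgr0Pnorm_lt/(_ _ e0) := GF z.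
  apply: filterS => k; rewrite distrC ger0_norm ?nc_ge0// -ReN -ReD.
  exact: le_lt_trans (normc_ge_absRe _).
- apply: (@measurable_fun_cvg _ _ _ _ (fun k z => Im (G k z))).
    by move=> k; exact: mfun_Im.
  move=> z _; apply/cvgrPdist_lt => e e0.
  have /cvgr0Pnorm_lt/(_ _ e0) := GF z.
  apply: filterS => k; rewrite distrC ger0_norm ?nc_ge0// -ImN -ImD.
  exact: le_lt_trans (normc_ge_absIm _).
Qed.

Definition L1 : set (T -> C) := [set F | mfun F /\ (L1norm F < +oo)%E].

Lemma L1norm_ge0 F : (0 <= L1norm F)%E.
Proof. by apply: integral_ge0 => z _; rewrite lee_fin nc_ge0. Qed.

Lemma L2norm2_ge0 F : (0 <= L2norm2 F)%E.
Proof. by apply: integral_ge0 => z _; rewrite lee_fin sqr_ge0. Qed.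

Lemma L1_nc F : L1 F -> sigma.-integrable setT (EFin \o (fun z => nc (F z))).
Proof.
move=> [mF F1]; apply/integrableP; split.
  by apply/measurable_EFinP; exact: mfun_nc.
by under eq_integral do rewrite /= ger0_norm ?nc_ge0//.
Qed.

Lemma L1_Re F : L1 F -> sigma.-integrable setT (EFin \o (fun z => Re (F z))).
Proof.
move=> LF; apply: (le_integrable _ _ _ (L1_nc LF)) => //.
  by apply/measurable_EFinP; apply: mfun_Re; case: LF.
move=> z _ /=; rewrite lee_fin (ger0_norm (nc_ge0 _)).
exact: normc_ge_absRe.
Qed.

Lemma L1_Im F : L1 F -> sigma.-integrable setT (EFin \o (fun z => Im (F z))).
Proof.
move=> LF; apply: (le_integrable _ _ _ (L1_nc LF)) => //.
  by apply/measurable_EFinP; apply: mfun_Im; case: LF.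
move=> z _ /=; rewrite lee_fin (ger0_norm (nc_ge0 _)).
exact: normc_ge_absIm.
Qed.

Lemma L1_dom F G : mfun F -> L1 G -> (forall z, nc (F z) <= nc (G z)) -> L1 F.
Proof.
move=> mF [mG G1] FG; split => //; apply: le_lt_trans G1.
apply: ge0_le_integral => //; [|exact/measurable_EFinP/mfun_nc..|].
  by move=> z _; rewrite lee_fin nc_ge0.
by move=> z _; rewrite lee_fin.
Qed.

Lemma integral_sigma_cst (r : \bar R) : (\int[sigma]_z r = r)%E.
Proof.
transitivity (r * 1)%E; last by rewrite mule1.
rewrite -(@probability_setT _ _ _ sigma).
exact: (@integral_cst _ _ _ sigma setT measurableT r).
Qed.

Lemma L1D F G : L1 F -> L1 G -> L1 (F \+ G).
Proof.
move=> [mF F1] [mG G1]; split; first exact: mfunD.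
apply: (@le_lt_trans _ _ (L1norm F + L1norm G)%E); last exact: lte_add_pinfty.
rewrite /L1norm -ge0_integralD//; first last.
- exact/measurable_EFinP/mfun_nc.
- by move=> z _; rewrite lee_fin nc_ge0.
- exact/measurable_EFinP/mfun_nc.
- by move=> z _; rewrite lee_fin nc_ge0.
apply: ge0_le_integral => //.
- by move=> z _; rewrite lee_fin nc_ge0.
- by apply/measurable_EFinP; apply: mfun_nc; exact: mfunD.
- by apply: emeasurable_funD; exact/measurable_EFinP/mfun_nc.
- by move=> z _; rewrite -EFinD lee_fin le_normcD.
Qed.

Lemma L1normZ a F : mfun F -> L1norm (fun z => a * F z) = ((nc a)%:E * L1norm F)%E.
Proof.
move=> mF; rewrite /L1norm -ge0_integralZl_EFin ?nc_ge0//.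
- by apply: eq_integral => z _; rewrite Normc.normcM EFinM.
- by move=> z _; rewrite lee_fin nc_ge0.
- exact/measurable_EFinP/mfun_nc.
Qed.

Lemma L1Z a F : L1 F -> L1 (fun z => a * F z).
Proof.
move=> [mF F1]; split; first exact: mfunZ.
by rewrite L1normZ// lte_mul_pinfty// lee_fin nc_ge0.
Qed.

Lemma CI_D F G : L1 F -> L1 G ->
  complex_integral (F \+ G) = complex_integral F + complex_integral G.
Proof.
move=> LF LG; apply: complex_ext; rewrite ?ReD ?ImD /=.
  rewrite -RintegralD//; [|exact: L1_Re..].
  by apply: eq_Rintegral => z _; rewrite ReD.
rewrite -RintegralD//; [|exact: L1_Im..].
by apply: eq_Rintegral => z _; rewrite ImD.
Qed.

Lemma CI_Z a F : L1 F ->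
  complex_integral (fun z => a * F z) = a * complex_integral F.
Proof.
move=> LF; have iR := L1_Re LF; have iI := L1_Im LF.
have iZ (k : R) (g : T -> R) : sigma.-integrable setT (EFin \o g) ->
    sigma.-integrable setT (EFin \o (fun z => k * g z)).
  by move=> ig; have := integrableZl measurableT k ig.
apply: complex_ext; rewrite ?ReM ?ImM /=.
  rewrite -!RintegralZl// -RintegralB//; [|exact: iZ..].
  by apply: eq_Rintegral => z _; rewrite ReM.
rewrite -!RintegralZl// -RintegralD//; [|exact: iZ..].
by apply: eq_Rintegral => z _; rewrite ImM.
Qed.

Lemma CI_J F : L1 F -> complex_integral (conj_fun F) = conjc (complex_integral F).
Proof.
move=> LF; apply: complex_ext; rewrite ?ReJ ?ImJ /=.
  by apply: eq_Rintegral => z _; rewrite /conj_fun ReJ.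
rewrite -mulN1r -RintegralZl//; last exact: L1_Im.
by apply: eq_Rintegral => z _; rewrite /conj_fun ImJ mulN1r.
Qed.

Lemma CI_real (g : T -> R) :
  complex_integral (fun z => (g z)%:C) = (\int[sigma]_z g z)%R%:C.
Proof. by apply: complex_ext => //=; rewrite Rintegral_cst// mul0r. Qed.

Lemma CI_cst a : complex_integral (fun _ : T => a) = a.
Proof.
by apply: complex_ext; rewrite /= /Rintegral integral_sigma_cst.
Qed.

Lemma L1norm_fin F : L1 F -> ((\int[sigma]_z nc (F z))%R%:E = L1norm F)%E.
Proof.
move=> LF; rewrite /Rintegral fineK//.
exact: (integrable_fin_num measurableT (L1_nc LF)).
Qed.

Lemma CI_le F : L1 F -> ((nc (complex_integral F))%:E <= L1norm F)%E.
Proof.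
move=> LF; rewrite -L1norm_fin// lee_fin.
have [u [u1 uE]] := nc_polar (complex_integral F).
have := CI_Z u LF; rewrite uE => /(congr1 (@complex.Re R))/= <-.
have LuF := L1Z u LF.
apply: le_Rintegral => //; [exact: L1_Re|exact: L1_nc|move=> z _].
rewrite (le_trans (ler_norm _))// (le_trans (normc_ge_absRe _))//.
by rewrite Normc.normcM u1 mul1r.
Qed.

Lemma L2_m F : L2 F -> mfun F. Proof. by case. Qed.

Lemma L2_dom F G : mfun F -> L2 G -> (forall z, nc (F z) <= nc (G z)) -> L2 F.
Proof.
move=> mF [mG G1] FG; split => //; apply: le_lt_trans G1.
apply: ge0_le_integral => //; [|exact/measurable_EFinP/mfun_nc2..|].
  by move=> z _; rewrite lee_fin sqr_ge0.
by move=> z _; rewrite lee_fin ler_pXn2r ?nnegrE ?nc_ge0.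
Qed.

Lemma L2_cst a : L2 (fun _ : T => a).
Proof.
split; first exact: mfun_cst.
by rewrite /L2norm2 integral_sigma_cst ltry.
Qed.

Lemma L2normZ a F : mfun F ->
  L2norm2 (fun z => a * F z) = ((nc a ^+ 2)%:E * L2norm2 F)%E.
Proof.
move=> mF; rewrite /L2norm2 -ge0_integralZl_EFin ?sqr_ge0//.
- by apply: eq_integral => z _; rewrite Normc.normcM exprMn EFinM.
- by move=> z _; rewrite lee_fin sqr_ge0.
- exact/measurable_EFinP/mfun_nc2.
Qed.

Lemma L2Z a F : L2 F -> L2 (fun z => a * F z).
Proof.
move=> [mF F1]; split; first exact: mfunZ.
by rewrite L2normZ// lte_mul_pinfty// lee_fin sqr_ge0.
Qed.

Lemma L2D F G : L2 F -> L2 G -> L2 (F \+ G).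
Proof.
move=> LF LG; have [mF F1] := L2Z 2 LF; have [mG G1] := L2Z 2 LG; split.
  by apply: mfunD; apply: L2_m.
apply: (@le_lt_trans _ _ (L2norm2 (fun z => 2 * F z)%R + L2norm2 (fun z => 2 * G z)%R)%E);
  last exact: lte_add_pinfty.
rewrite /L2norm2 -ge0_integralD//; first last.
- exact/measurable_EFinP/mfun_nc2.
- by move=> z _; rewrite lee_fin sqr_ge0.
- exact/measurable_EFinP/mfun_nc2.
- by move=> z _; rewrite lee_fin sqr_ge0.
apply: ge0_le_integral => //.
- by move=> z _; rewrite lee_fin sqr_ge0.
- by apply/measurable_EFinP; apply: mfun_nc2; apply: mfunD; exact: L2_m.
- by apply: emeasurable_funD; exact/measurable_EFinP/mfun_nc2.
- move=> z _; rewrite -EFinD lee_fin !Normc.normcM nc_nat.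
  have h := le_normcD (F z) (G z).
  have h2 : nc (F z + G z) ^+ 2 <= (nc (F z) + nc (G z)) ^+ 2.
    by rewrite ler_pXn2r ?nnegrE ?addr_ge0 ?nc_ge0.
  apply: (le_trans h2).
  have := sqr_ge0 (nc (F z)); have := sqr_ge0 (nc (G z)).
  by have := sqr_ge0 (nc (F z) - nc (G z)); nra.
Qed.

Lemma L2J F : L2 F -> L2 (conj_fun F).
Proof.
move=> LF; apply: (L2_dom _ LF); first by apply: mfunJ; case: LF.
by move=> z; rewrite ncJ.
Qed.

Lemma L1_sqr F : L2 F -> L1 (fun z => (nc (F z) ^+ 2)%:C).
Proof.
move=> [mF F2]; split.
  apply/mfunP; split; first exact: mfun_nc2.
  exact: measurable_cst.
by rewrite /L1norm; under eq_integral do rewrite ncR_ge0 ?sqr_ge0//.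
Qed.

Lemma L1M F G : L2 F -> L2 G -> L1 (F \* G).
Proof.
move=> LF LG.
apply: (L1_dom _ (L1D (L1_sqr LF) (L1_sqr LG))).
  by apply: mfunM; exact: L2_m.
move=> z; rewrite [leLHS]Normc.normcM.
have -> : ((fun z0 => (nc (F z0) ^+ 2)%:C) \+ (fun z0 => (nc (G z0) ^+ 2)%:C)) z =
  (nc (F z) ^+ 2 + nc (G z) ^+ 2)%:C by rewrite rmorphD.
rewrite ncR_ge0 ?addr_ge0 ?sqr_ge0//.
have := sqr_ge0 (nc (F z)); have := sqr_ge0 (nc (G z)).
by have := sqr_ge0 (nc (F z) - nc (G z)); nra.
Qed.

Lemma L2_L1 F : L2 F -> L1 F.
Proof.
move=> LF; have := L1M LF (L2_cst 1).
by congr L1; apply/funext => z; rewrite /= mulr1.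
Qed.

Lemma L2dotE F : L2 F -> L2dot F F = (fine (L2norm2 F))%:C.
Proof.
move=> LF; rewrite /L2dot.
rewrite (_ : _ \* _ = fun z => (nc (F z) ^+ 2)%:C) ?CI_real//.
by apply/funext => z /=; rewrite /conj_fun mulcJ.
Qed.

Lemma L2_semi_hilbert : semi_hilbert (@L2 R n) L2dot.
Proof.
split.
- exact: L2_cst.
- by move=> a F G LF LG; apply: L2D => //; exact: L2Z.
- move=> a F G H LF LG LH; rewrite /L2dot.
  rewrite -CI_Z; last by apply: L1M => //; exact: L2J.
  rewrite -CI_D; last by apply: L1M => //; exact: L2J.
  + congr complex_integral; apply/funext => z /=.
    by rewrite mulrDl mulrA.
  + by apply: L1Z; apply: L1M => //; exact: L2J.
- move=> F G LF LG; rewrite /L2dot -CI_J; last by apply: L1M => //; exact: L2J.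
  congr complex_integral; apply/funext => z.
  by rewrite /conj_fun /= conjcM cJK mulrC.
- move=> F LF; rewrite L2dotE// lecR fine_ge0//; exact: L2norm2_ge0.
Qed.

Local Notation SH := L2_semi_hilbert.
Local Notation N2 := (hn (@L2dot R n)).

Lemma L2norm2E F : L2 F -> L2norm2 F = (N2 F ^+ 2)%:E.
Proof.
move=> LF; have := dotff SH LF; rewrite L2dotE// => /complexI <-.
by rewrite fineK// ge0_fin_numE ?L2norm2_ge0//; case: LF.
Qed.

Lemma N2_le F (e : R) : L2 F -> 0 <= e -> (N2 F <= e) = (L2norm2 F <= (e ^+ 2)%:E)%E.
Proof.
by move=> LF e0; rewrite L2norm2E// lee_fin ler_pXn2r ?nnegrE// hn_ge0.
Qed.

Lemma L2norm2_ltP F (e : R) : mfun F -> (L2norm2 F <= e%:E)%E -> L2 F.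
Proof. by move=> mF Fe; split => //; apply: le_lt_trans Fe _; rewrite ltry. Qed.

(** Cauchy-Schwarz against the constant 1, which has norm 1 because the surface measure is a
    probability. *)
Lemma L1norm_le F : L2 F -> (L1norm F <= (N2 F)%:E)%E.
Proof.
move=> LF; pose G z : C := (nc (F z))%:C.
have LG : L2 G.
  apply: (L2_dom _ LF) => [|z]; last by rewrite ncR_ge0 ?nc_ge0.
  by apply/mfunP; split; [apply: mfun_nc; exact: L2_m|exact: measurable_cst].
have := cauchy_schwarz SH LG (L2_cst 1).
have -> : L2dot G (fun=> 1) = (\int[sigma]_z nc (F z))%R%:C.
  rewrite /L2dot -CI_real; congr complex_integral; apply/funext => z.
  by rewrite /= /conj_fun conjc1 mulr1.
have -> : N2 (fun=> 1) = 1.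
  rewrite /hn /L2dot (_ : _ \* _ = (fun=> 1)) ?CI_cst ?sqrtr1//.
  by apply/funext => z /=; rewrite /conj_fun conjc1 mulr1.
have -> : N2 G = N2 F.
  apply/eqP; rewrite -(@eqrXn2 _ 2)// ?hn_ge0//; apply/eqP/EFin_inj.
  rewrite -!L2norm2E//; apply: eq_integral => z _.
  by rewrite ncR_ge0 ?nc_ge0.
rewrite mulr1 -L1norm_fin; last exact: L2_L1.
by rewrite lee_fin => /(le_trans _)->//; rewrite ncR ler_norm.
Qed.

Lemma N2_eq0 F : L2 F -> N2 F = 0 -> F = (fun=> 0) %[ae sigma].
Proof.
move=> LF F0; have := L2norm2E LF; rewrite F0 expr0n /= => I0.
have mF := L2_m LF.
have : ae_eq sigma setT (fun z => (nc (F z) ^+ 2)%:E) (cst 0%E).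
  apply/ae_eq_integral_abs => //; first exact/measurable_EFinP/mfun_nc2.
  by rewrite -[RHS]I0; apply: eq_integral => z _; rewrite /= ger0_norm ?sqr_ge0.
apply: filterS => z /(_ I) /= [] /eqP; rewrite sqrf_eq0 nc_eq0 => /eqP-> //.
Qed.

Lemma N2_sub_eq0 F G : L2 F -> L2 G -> N2 (F - G) = 0 -> F = G %[ae sigma].
Proof.
move=> LF LG FG; have /(N2_eq0)/(_ FG) : L2 (F - G) by exact: (shB SH).
by apply: filterS => z /(_ I)/= /eqP; rewrite subr_eq0 => /eqP.
Qed.

(** Carries norm bounds to limits that exist almost everywhere. It serves for Cauchy sequences in
    L^2 and for functions on the ball that are limits of polynomials. *)
Lemma L2_fatou (G : nat -> T -> C) F (e : R) : (forall k, mfun (G k)) -> mfun F ->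
  {ae sigma, forall z, (nc (G k z - F z)) @[k --> \oo] --> (0 : R)} ->
  (forall k, (L2norm2 (G k) <= e%:E)%E) -> (L2norm2 F <= e%:E)%E.
Proof.
move=> mG mF GF Ge.
have ncvg z : (nc (G k z - F z)) @[k --> \oo] --> (0 : R) ->
    (nc (G k z) ^+ 2)%:E @[k --> \oo] --> (nc (F z) ^+ 2)%:E.
  move=> h; apply: cvg_EFin; first exact: nearW.
  rewrite (_ : _ \o _ = (fun k => nc (G k z) ^+ 2)); last by apply/funext.
  suff h1 : nc (G k z) @[k --> \oo] --> nc (F z) by rewrite expr2; under eq_fun do rewrite expr2; exact: cvgM.
  apply/cvgrPdist_lt => d d0; have /cvgr0Pnorm_lt/(_ _ d0) := h.
  apply: filterS => k; rewrite ger0_norm ?nc_ge0//; apply: le_lt_trans.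
  rewrite ler_norml; apply/andP; split.
    rewrite lerNl opprB lerBlDl.
    by have := le_normcD (F z) (G k z - F z); rewrite addrC subrK.
  rewrite lerBlDl ncBC.
  by have := le_normcD (G k z) (F z - G k z); rewrite addrC subrK.
have mg k : measurable_fun setT (fun z : T => (nc (G k z) ^+ 2)%:E).
  exact/measurable_EFinP/mfun_nc2.
have := @fatou _ _ _ sigma setT measurableT (fun k z => (nc (G k z) ^+ 2)%:E) mg.
move=> /(_ ltac:(by move=> k z _; rewrite lee_fin sqr_ge0)) h.
apply: (@le_trans _ _ (limn_einf (fun k => L2norm2 (G k)))); last first.
  rewrite limn_einf_lim; apply: lime_le; first exact: is_cvg_einfs.
  by apply: nearW => k; apply: (le_trans _ (Ge k)); apply: ereal_inf_lbound; exists k => /=.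
apply: le_trans h.
apply: ae_ge0_le_integral => //.
- by move=> z _; rewrite lee_fin sqr_ge0.
- exact/measurable_EFinP/mfun_nc2.
- move=> z _; rewrite limn_einf_lim; apply: lime_ge; first exact: is_cvg_einfs.
  apply: nearW => k; apply: le_ereal_inf_tmp => _ [j _ <-].
  by rewrite lee_fin sqr_ge0.
(* The lower limit is measurable as the opposite of an upper limit. *)
- rewrite (_ : (fun z => _) =
      (fun z => - limn_esup (fun k => - (nc (G k z) ^+ 2)%:E))%E).
    apply: measurableT_comp => //; apply: measurable_fun_limn_esup => k.
    exact: measurableT_comp.
  apply/funext => z; rewrite -limn_einfN; congr limn_einf.
  by apply/funext => k; rewrite /comp oppeK.
- move: GF; apply: filterS => z /ncvg h _.
  rewrite is_cvg_limn_einfE; last by apply/cvg_ex; eexists; exact: h.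
  by have /cvg_lim -> := h.
Qed.

End sphere_integral.

(** * Riesz-Fischer theorem on the sphere *)

Section L2_complete.
Context {R : realType} {n : nat}.
Local Notation C := R[i].
Local Notation T := 'rV[R[i]]_n.
Local Notation sigma := (@sphere_measure R n).
Local Notation SH := (@L2_semi_hilbert R n).
Local Notation N2 := (hn (@L2dot R n)).

Lemma cvg_nc_ReIm (u : nat -> C) (l : C) :
  Re (u k) @[k --> \oo] --> Re l -> Im (u k) @[k --> \oo] --> Im l ->
  nc (u k - l) @[k --> \oo] --> (0 : R).
Proof.
move=> /cvgrPdist_lt uR /cvgrPdist_lt uI; apply/cvgr0Pnorm_lt => e e0.
have e2 : 0 < e / 2 by rewrite divr_gt0.
near=> k; rewrite ger0_norm ?nc_ge0//.
rewrite (le_lt_trans (nc_le_ReIm _))// (splitr e) ltrD//.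
  by rewrite ReD ReN; near: k; have := uR _ e2; apply: filterS => k; rewrite distrC.
by rewrite ImD ImN; near: k; have := uI _ e2; apply: filterS => k; rewrite distrC.
Unshelve. all: by end_near. Qed.

Lemma is_cvg_summable_diff (v : nat -> R) (M : R) :
  (forall m, \sum_(0 <= k < m) `|v k.+1 - v k| <= M) -> cvgn v.
Proof.
move=> vM.
have -> : v = (fun k => v 0%N + series (telescope v) k).
  by apply/funext => k; rewrite -eq_sum_telescope.
apply: is_cvgD; first exact: is_cvg_cst.
apply: normed_cvg; apply: nondecreasing_is_cvgn.
  by apply: nondecreasing_series => k _ _; exact: normr_ge0.
by exists M => _ [m _ <-]; exact: vM.
Qed.

Lemma sum_half (m : nat) : \sum_(0 <= k < m) (2^-1 : R) ^+ k.+1 = 1 - 2^-1 ^+ m.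
Proof.
elim: m => [|m ih]; first by rewrite big_geq// expr0 subrr.
rewrite big_nat_recr//= ih exprS; set x := _ ^+ m.
by lra.
Qed.

Lemma L2_hn_complete : hn_complete (@L2dot R n) (@L2 R n).
Proof.
move=> u Lu uc.
have /choice[N NP] (m : nat) : exists N, forall k l, (N <= k)%N -> (N <= l)%N ->
    N2 (u k - u l) <= 2^-1 ^+ m.+1.
  by apply: uc; rewrite exprn_gt0// invr_gt0.
(* A nondecreasing choice of indices with [phi m] beyond [N m]; the summand [m] makes it tend to
   infinity. *)
pose phi m := (m + \sum_(i < m.+1) N i)%N.
have phiN m : (N m <= phi m)%N.
  by rewrite /phi big_ord_recr/= addnA leq_addl.
have phiS m : (phi m <= phi m.+1)%N.
  by rewrite /phi (big_ord_recr m.+1)/= leq_add// leq_addr.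
have phi_id m : (m <= phi m)%N by rewrite leq_addr.
pose v m := u (phi m).
have Lv m : L2 (v m) by exact: Lu.
(* The total variation of the subsequence. Its integral is at most 1 because L^1 norms are below L^2
   norms, so it is finite almost everywhere and the subsequence converges there. *)
pose g z : \bar R := (\sum_(0 <= k <oo) (nc (v k.+1 z - v k z))%:E)%E.
have Ld k : L2 (v k.+1 - v k) by exact: (shB SH).
have md k : measurable_fun setT (fun z : T => (nc (v k.+1 z - v k z))%:E).
  by apply/measurable_EFinP; apply: mfun_nc; exact: (L2_m (Ld k)).
have mg : measurable_fun setT g.
  by apply: ge0_emeasurable_sum => // k z _; rewrite lee_fin nc_ge0.
have g0 z : (0 <= g z)%E by apply: nneseries_ge0 => k _ _; rewrite lee_fin nc_ge0.
have ig : (\int[sigma]_z g z <= 1)%E.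
  rewrite /g integral_nneseries//; last by move=> k z _; rewrite lee_fin nc_ge0.
  apply: lime_le.
    apply: is_cvg_nneseries => k _ _; apply: integral_ge0 => z _.
    by rewrite lee_fin nc_ge0.
  apply: nearW => m.
  apply: (@le_trans _ _ (\sum_(0 <= k < m) (2^-1 ^+ k.+1)%:E)%E).
    apply: lee_sum => k _; apply: (le_trans (L1norm_le (Ld k))).
    by rewrite lee_fin NP// (leq_trans (phiN k)).
  by rewrite sumEFin lee_fin sum_half gerBl exprn_ge0// invr_ge0.
pose E := [set z | (g z < +oo)%E].
have mE : measurable E.
  by rewrite -[E]setTI; apply: emeasurable_fun_infty_o => //; exact: measurableT.
have aeE : {ae sigma, forall z, E z}.
  have : sigma.-integrable setT g.
    apply/integrableP; split => //.
    under eq_integral do rewrite gee0_abs//.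
    by rewrite (le_lt_trans ig)// ltry.
  move=> /(integrable_ae measurableT); apply: filterS => z /(_ I).
  by rewrite ge0_fin_numE.
have bnd z m : E z -> \sum_(0 <= k < m) nc (v k.+1 z - v k z) <= fine (g z).
  move=> Ez; rewrite -lee_fin fineK ?ge0_fin_numE// -sumEFin.
  by apply: nneseries_lim_ge => k _ _; rewrite lee_fin nc_ge0.
(* Cut off to [E], the sequence converges at every point, which makes the limit measurable. *)
pose w k z : C := (\1_E z)%:C * v k z.
have mw k : mfun (w k).
  apply: mfunM; last exact: L2_m.
  apply/mfunP; split; last exact: measurable_cst.
  exact: measurable_indic.
have wE k z : E z -> w k z = v k z.
  by move=> Ez; rewrite /w indicE mem_set// mul1r.
have wnE k z : ~ E z -> w k z = 0.
  by move=> Ez; rewrite /w indicE memNset// mul0r.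
have cR z : cvgn (fun k => Re (w k z)).
  have [Ez|Ez] := pselect (E z); last first.
    by under eq_fun do rewrite wnE//; exact: is_cvg_cst.
  under eq_fun do rewrite wE//.
  apply: (@is_cvg_summable_diff _ (fine (g z))) => m; apply: le_trans (bnd _ m Ez).
  by apply: ler_sum => k _; rewrite -ReN -ReD normc_ge_absRe.
have cI z : cvgn (fun k => Im (w k z)).
  have [Ez|Ez] := pselect (E z); last first.
    by under eq_fun do rewrite wnE//; exact: is_cvg_cst.
  under eq_fun do rewrite wE//.
  apply: (@is_cvg_summable_diff _ (fine (g z))) => m; apply: le_trans (bnd _ m Ez).
  by apply: ler_sum => k _; rewrite -ImN -ImD normc_ge_absIm.
pose F z : C := limn (fun k => Re (w k z)) +i* limn (fun k => Im (w k z)).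
have wF z : nc (w k z - F z) @[k --> \oo] --> (0 : R) by exact: cvg_nc_ReIm.
have mF : mfun F by exact: (mfun_cvg mw).
have est k j0 (e : R) : 0 <= e -> (forall j, (j0 <= j)%N -> N2 (u k - u j) <= e) ->
    L2 (u k - F) /\ N2 (u k - F) <= e.
  move=> e0 ke.
  have mkF : mfun (u k - F) by apply: mfunB => //; exact: L2_m.
  have h : (L2norm2 (u k - F)%R <= (e ^+ 2)%:E)%E.
    apply: (@L2_fatou _ _ (fun j => u k - v (j + j0)%N)) => //.
    - by move=> j; apply: mfunB; exact: L2_m.
    - move: aeE; apply: filterS => z Ez.
      have -> : (fun j => nc ((u k - v (j + j0)%N) z - (u k - F) z)) =
          (fun j => nc (w (j + j0)%N z - F z)).
        apply/funext => j; rewrite wE// -normcN; congr nc.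
        have fsubE (f1 f2 : T -> C) : (f1 - f2) z = f1 z - f2 z by [].
        by rewrite !fsubE; ring.
      by rewrite (cvg_shiftn j0 (fun j => nc (w j z - F z))).
    - move=> j; rewrite -N2_le//; last exact: (shB SH).
      by apply: ke; rewrite (leq_trans (leq_addl j j0)).
  have LkF := L2norm2_ltP mkF h.
  by split => //; rewrite N2_le.
have LF : L2 F.
  have [N0 N0P] := uc 1 ltac:(exact: ltr01).
  have [] := @est N0 N0 1 ler01; first by move=> j; exact: N0P.
  move=> h _; rewrite -[F](subKr (u N0)); exact: (shB SH).
exists F => // e e0; have [M MP] := uc e e0.
exists M => k Mk; have [] := @est k M e (ltW e0) => // j Mj.
exact: MP.
Qed.

End L2_complete.

(** * Rotation invariance of the surface measure *)

Section lebesgue_invariance.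
Context {R : realType}.
Local Notation lam := (@lebesgue_measure R).
Local Notation RR := (measurableTypeR R * measurableTypeR R)%type.

Lemma lebesgue_measure_translate (c : R) (A : set (measurableTypeR R)) :
  measurable A -> lam ((fun x => x + c) @^-1` A) = lam A.
Proof.
move=> mA; have mf : measurable_fun setT (fun x : measurableTypeR R => (x + c : measurableTypeR R)).
  by apply: measurable_funD => //; exact: measurable_cst.
apply/esym.
apply: (@lebesgue_measure_unique _
  (measure_function_pushforward__canonical__measure_function_Measure lam mf)) => //=.
move=> _ [[a b]] _ <-.
rewrite /pushforward /=.
have -> : (fun x => x + c) @^-1` `]a, b]%classic = `]a - c, b - c]%classic.
  by apply/seteqP; split => x /=; rewrite !in_itv/= ltrBlDr lerBrDr.
rewrite !lebesgue_measure_itv/= !lte_fin ltrD2r; case: ifP => // _.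
by rewrite -!EFinD; congr EFin; ring.
Qed.

Let shear1 (t : R) (p : RR) : RR := (p.1 + t * p.2, p.2).
Let shear2 (t : R) (p : RR) : RR := (p.1, p.2 + t * p.1).

Let measurable_shear1 t : measurable_fun setT (shear1 t).
Proof.
apply: measurable_fun_pair => //; apply: measurable_funD => //.
by apply: measurable_funM => //; exact: measurable_cst.
Qed.

Let measurable_shear2 t : measurable_fun setT (shear2 t).
Proof.
apply: measurable_fun_pair => //; apply: measurable_funD => //.
by apply: measurable_funM => //; exact: measurable_cst.
Qed.

Let product_swap (A : set RR) : measurable A -> (lam \x lam)%E A = (lam \x^ lam)%E A.
Proof.
move=> mA; apply: product_measure_unique => //= B D mB mD.
by rewrite product_measure2E.
Qed.

Let mpre (f : RR -> RR) (A : set RR) : measurable_fun setT f -> measurable A ->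
  measurable (f @^-1` A).
Proof. by move=> mf mA; rewrite -[X in measurable X]setTI; exact: mf. Qed.

Let shear2_invariant t (A : set RR) : measurable A ->
  (lam \x lam)%E (shear2 t @^-1` A) = (lam \x lam)%E A.
Proof.
move=> mA; apply: eq_integral => x _ /=.
transitivity (lam ((fun y => y + t * x) @^-1` xsection A x)); last first.
  by rewrite lebesgue_measure_translate//; exact: measurable_xsection.
congr (lam _); apply/seteqP; split => y /=; rewrite /xsection/= !inE//.
Qed.

Let shear1_invariant t (A : set RR) : measurable A ->
  (lam \x lam)%E (shear1 t @^-1` A) = (lam \x lam)%E A.
Proof.
move=> mA; rewrite !product_swap//; last exact: mpre.
apply: eq_integral => y _ /=.
transitivity (lam ((fun x => x + t * y) @^-1` ysection A y)); last first.
  by rewrite lebesgue_measure_translate//; exact: measurable_ysection.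
congr (lam _); apply/seteqP; split => x /=; rewrite /ysection/= !inE//.
Qed.

Let rotation (a b : R) (p : RR) : RR := (a * p.1 - b * p.2, b * p.1 + a * p.2).

(* A rotation by an angle other than pi is a product of three shears. *)
Let rotation_invariant_shear (a b : R) (A : set RR) : a ^+ 2 + b ^+ 2 = 1 ->
  1 + a != 0 -> measurable A ->
  (lam \x lam)%E (rotation a b @^-1` A) = (lam \x lam)%E A.
Proof.
(* Minus the tangent of half the angle. *)
move=> ab a1 mA; pose t := - b / (1 + a).
have -> : rotation a b = shear1 t \o shear2 b \o shear1 t.
  apply/funext => -[x y]; rewrite /rotation /shear1 /shear2 /t /=.
  have b2 : b ^+ 2 = (1 - a) * (1 + a) by rewrite -[1 in RHS]ab; have := ab; nra.
  congr pair.
    rewrite [RHS](_ : _ = x + - b / (1 + a) * y *+ 2 - b ^+ 2 / (1 + a) * x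
       + b ^+ 2 * b / (1 + a) ^+ 2 * y); last by field.
    by rewrite b2; field.
  rewrite [RHS](_ : _ = b * x + y - b ^+ 2 / (1 + a) * y); last by field.
  by rewrite b2; field.
rewrite !comp_preimage shear1_invariant ?shear2_invariant ?shear1_invariant//.
- by apply: mpre.
- by apply: mpre => //; exact: mpre.
Qed.

Let rotation_invariant (a b : R) (A : set RR) : a ^+ 2 + b ^+ 2 = 1 ->
  measurable A ->
  (lam \x lam)%E (rotation a b @^-1` A) = (lam \x lam)%E A.
Proof.
move=> ab mA; have [a1|] := eqVneq (1 + a) 0; last first.
  by move=> a1; exact: rotation_invariant_shear.
have aE : a = -1 by lra.
have bE : b = 0 by apply/eqP; rewrite -sqrf_eq0; apply/eqP; move: ab; rewrite aE; lra.
(* The half turn, which the shears do not reach, is the square of a quarter turn. *)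
have -> : rotation a b = rotation 0 1 \o rotation 0 1.
  by apply/funext => -[x y]; rewrite /rotation aE bE /=; congr pair; ring.
have m01 : measurable_fun setT (rotation 0 1).
  apply: measurable_fun_pair; [apply: measurable_funB|apply: measurable_funD];
    by apply: measurable_funM => //; exact: measurable_cst.
have h01 : (0 : R) ^+ 2 + 1 ^+ 2 = 1 by rewrite expr0n expr1n add0r.
have h10 : 1 + (0 : R) != 0 by rewrite addr0 oner_eq0.
rewrite comp_preimage rotation_invariant_shear ?rotation_invariant_shear//.
exact: mpre.
Qed.

Lemma lebesgue_complex_rotate (u : R[i]) (A : set R[i]) : nc u = 1 -> measurable A ->
  lebesgue_complex ((fun c => u * c) @^-1` A) = lebesgue_complex A.
Proof.
move=> u1 mA; rewrite /lebesgue_complex /pushforward.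
have mA' : measurable (@complex_of_pair R @^-1` A).
  by rewrite -[X in measurable X]setTI; exact: measurable_complex_of_pair.
have uu : Re u ^+ 2 + Im u ^+ 2 = 1 by rewrite -normc_sqr u1 expr1n.
rewrite -[RHS](rotation_invariant uu mA').
have E p : complex_of_pair (rotation (Re u) (Im u) p) = u * complex_of_pair p.
  by apply: complex_ext; rewrite ?ReM ?ImM /=; ring.
by congr ((lam \x lam)%E _); apply/seteqP; split => p; rewrite /= E.
Qed.

Lemma lebesgue_complex_square (a b c d : R) : a <= b -> c <= d ->
  lebesgue_complex [set z : R[i] | (a <= Re z <= b) && (c <= Im z <= d)] =
  ((b - a) * (d - c))%:E.
Proof.
move=> ab cd; rewrite /lebesgue_complex /pushforward.
have -> : @complex_of_pair R @^-1` [set z : R[i] | (a <= Re z <= b) && (c <= Im z <= d)] =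
    `[a, b]%classic `*` `[c, d]%classic.
  by apply/seteqP; split => -[x y] /=; rewrite !in_itv/= => /andP.
rewrite product_measure1E//= !lebesgue_measure_itv/= !lte_fin.
have E (x y : R) : x <= y -> (if (x < y)%R then y%:E + (- x)%:E else 0)%E = (y - x)%:E.
  rewrite le_eqVlt => /predU1P[->|xy]; first by rewrite ltxx subrr.
  by rewrite xy EFinD.
by rewrite !E// -EFinM.
Qed.

Lemma measurable_square (a b c d : R) :
  measurable [set z : R[i] | (a <= Re z <= b) && (c <= Im z <= d)].
Proof.
have /measurable_fun_complexP[mR mI] := @measurable_id _ R[i] setT.
have -> : [set z : R[i] | (a <= Re z <= b) && (c <= Im z <= d)] =
    (fun z => Re z) @^-1` `[a, b]%classic `&` (fun z => Im z) @^-1` `[c, d]%classic.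
  by apply/seteqP; split => z /=; rewrite !in_itv/= => /andP.
by apply: measurableI; rewrite -[X in measurable X]setTI; [exact: mR|exact: mI].
Qed.

End lebesgue_invariance.

(** * Boxes and coordinatewise rotations under Lebesgue measure *)

Section volume_facts.
Context {R : realType}.
Local Notation C := R[i].

Definition box n (D : 'I_n -> set C) : set 'rV[C]_n :=
  [set z | forall i, D i (z ord0 i)].

Lemma measurable_box n (D : 'I_n -> set C) :
  (forall i, measurable (D i)) -> measurable (box D).
Proof.
move=> mD; have -> : box D = \bigcap_(i in [set: 'I_n]) [set z : 'rV[C]_n | D i (z ord0 i)].
  apply/seteqP; split => z /= h i; first by move=> _; exact: h.
  exact: (h i I).
apply: fin_bigcap_measurable => // i _.
by rewrite -[X in measurable X]setTI; exact: (@measurable_row_coord R n i).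
Qed.

Lemma volume_box n (D : 'I_n -> set C) : (forall i, measurable (D i)) ->
  volume R n (box D) = (\prod_(i < n) lebesgue_complex (D i))%E.
Proof.
elim: n D => [|n ih] D mD.
  rewrite big_ord0 /= diracE mem_set//; by move=> [].
rewrite big_ord_recl /= /volume_step /pushforward.
have -> : @row_cons R n @^-1` box D = D ord0 `*` box (fun i => D (lift ord0 i)).
  apply/seteqP; split => -[c z] /=.
    move=> h; split => /=; first by have := h ord0; rewrite mxE unlift_none.
    by move=> i; have := h (lift ord0 i); rewrite mxE liftK.
  by move=> [h1 h2] i; rewrite mxE; case: unliftP => [j ->|->] //; exact: h2.
rewrite product_measure1E//; last exact: measurable_box.
by rewrite ih.
Qed.

Definition rot n (u : 'I_n -> C) (z : 'rV[C]_n) : 'rV[C]_n :=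
  \row_i (u i * z ord0 i).

Lemma measurable_rot n (u : 'I_n -> C) : measurable_fun setT (rot u).
Proof.
apply/measurable_fun_rowP => i; under eq_fun do rewrite mxE.
apply: (@mfunM R n (fun=> u i) (fun z => z ord0 i)).
  exact: mfun_cst.
exact: measurable_row_coord.
Qed.

(** Independent rotations of the coordinates suffice for the orthogonality of monomials. They factor
    along the recursive construction of [volume], so uniqueness of product measures on rectangles
    carries the induction. *)
Lemma volume_rot n (u : 'I_n -> C) A : (forall i, nc (u i) = 1) -> measurable A ->
  volume R n (rot u @^-1` A) = volume R n A.
Proof.
elim: n u A => [|n ih] u A u1 mA.
  congr (volume R 0 _); rewrite -[RHS]/(id @^-1` A); congr (_ @^-1` A).
  by apply/funext => z; apply/rowP => -[].
rewrite /= /volume_step /pushforward.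
pose f (p : C * 'rV[C]_n) := (u ord0 * p.1, rot (fun i => u (lift ord0 i)) p.2).
have mf0 : measurable_fun setT (fun c : C => u ord0 * c).
  have /measurable_fun_complexP[mR mI] := @measurable_id _ C setT.
  apply/measurable_fun_complexP; split.
    under eq_fun do rewrite ReM; apply: measurable_funB;
      by apply: measurable_funM => //; exact: measurable_cst.
  under eq_fun do rewrite ImM; apply: measurable_funD;
    by apply: measurable_funM => //; exact: measurable_cst.
have mf : measurable_fun setT f.
  apply: measurable_fun_pair; first exact: (measurableT_comp mf0).
  exact: (measurableT_comp (measurable_rot _)).
have -> : @row_cons R n @^-1` (rot u @^-1` A) = f @^-1` (@row_cons R n @^-1` A).
  have E p : row_cons (f p) = rot u (row_cons p).
    by apply/rowP => i; rewrite !mxE; case: unliftP => [j ->|->] //; rewrite mxE.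
  by apply/seteqP; split => p; rewrite /= E.
have mA' : measurable (@row_cons R n @^-1` A).
  by rewrite -[X in measurable X]setTI; exact: measurable_row_cons.
apply/esym.
apply: (@product_measure_unique _ _ _ _ _ _ _
  (measure_function_pushforward__canonical__measure_function_Measure
     (lebesgue_complex \x volume R n)%E mf)) => // B D mB mD.
rewrite /= /pushforward.
have -> : f @^-1` (B `*` D) = (fun c => u ord0 * c) @^-1` B `*`
    rot (fun i => u (lift ord0 i)) @^-1` D by [].
rewrite product_measure1E.
- by congr (_ * _)%E; [exact: (lebesgue_complex_rotate (u1 ord0) mB)|exact: (ih _ _ _ mD)].
- by rewrite -[X in measurable X]setTI; exact: mf0.
- by rewrite -[X in measurable X]setTI; exact: measurable_rot.
Qed.

End volume_facts.

(** * The Euclidean norm and the room left inside the ball *)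

Section enorm_facts.
Context {R : realType} {n : nat}.
Local Notation C := R[i].
Local Notation T := 'rV[C]_n.
Implicit Types (z w : T).

Lemma enorm_ge0 z : 0 <= enorm z.
Proof. exact: sqrtr_ge0. Qed.

Lemma enorm_sqr z : enorm z ^+ 2 = \sum_(i < n) nc (z ord0 i) ^+ 2.
Proof. by rewrite sqr_sqrtr// sumr_ge0// => i _; exact: sqr_ge0. Qed.

Lemma enormZ (a : C) z : enorm (a *: z) = nc a * enorm z.
Proof.
apply/eqP; rewrite -(@eqrXn2 _ 2)// ?mulr_ge0 ?enorm_ge0 ?nc_ge0//.
rewrite exprMn !enorm_sqr mulr_sumr; apply/eqP/eq_bigr => i _.
by rewrite mxE Normc.normcM exprMn.
Qed.

Lemma enormZr (r : R) z : 0 <= r -> enorm (r%:C *: z) = r * enorm z.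
Proof. by move=> r0; rewrite enormZ ncR_ge0. Qed.

Lemma enorm0 : enorm (0 : T) = 0.
Proof. by rewrite -(scale0r (0 : T)) enormZ nc0 mul0r. Qed.

Lemma enorm_eq0 z : enorm z = 0 -> z = 0.
Proof.
move=> z0; have := enorm_sqr z; rewrite z0 expr0n /= => /esym/eqP.
rewrite psumr_eq0 => [/allP h|i _]; last exact: sqr_ge0.
apply/rowP => i; rewrite mxE; apply/eqP.
by have := h i (mem_index_enum _); rewrite sqrf_eq0 nc_eq0.
Qed.

Lemma nc_le_enorm z i : nc (z ord0 i) <= enorm z.
Proof.
rewrite -(@ler_pXn2r _ 2)// ?nnegrE ?nc_ge0 ?enorm_ge0// enorm_sqr.
by rewrite (bigD1 i)//= lerDl sumr_ge0// => j _; exact: sqr_ge0.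
Qed.

Lemma enorm_le z w : (forall i, nc (z ord0 i) <= nc (w ord0 i)) ->
  enorm z <= enorm w.
Proof.
move=> zw; rewrite -(@ler_pXn2r _ 2)// ?nnegrE ?enorm_ge0// !enorm_sqr.
by apply: ler_sum => i _; rewrite ler_pXn2r ?nnegrE ?nc_ge0.
Qed.

Lemma unit_ballP z : unit_ball z <-> \sum_(i < n) nc (z ord0 i) ^+ 2 < 1.
Proof.
by rewrite -enorm_sqr /unit_ball/= expr_lt1 ?enorm_ge0.
Qed.

Lemma enorm_rot (u : 'I_n -> C) z : (forall i, nc (u i) = 1) ->
  enorm (rot u z) = enorm z.
Proof.
move=> u1; rewrite /enorm; congr Num.sqrt; apply: eq_bigr => i _.
by rewrite mxE Normc.normcM u1 mul1r.
Qed.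

Lemma radial_proj_rot (u : 'I_n -> C) z : (forall i, nc (u i) = 1) ->
  radial_proj (rot u z) = rot u (radial_proj z).
Proof.
move=> u1; rewrite /radial_proj enorm_rot//.
by apply/rowP => i; rewrite !mxE mulrCA.
Qed.

Lemma enorm_radial_proj z : z <> 0 -> enorm (radial_proj z) = 1.
Proof.
move=> z0; have z1 : enorm z != 0 by apply/eqP => /enorm_eq0.
by rewrite enormZr ?mulVf// invr_ge0 enorm_ge0.
Qed.

(** The moduli of the coordinates of a point of the ball may all be enlarged a little. The factor 3
    leaves space for a small box of side [e] placed beyond [a]. *)
Lemma ball_room (a : 'I_n -> R) : (forall i, 0 <= a i) ->
  \sum_(i < n) a i ^+ 2 < 1 ->
  exists2 e : R, 0 < e & \sum_(i < n) (a i + 3 * e) ^+ 2 < 1.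
Proof.
move=> a0 a1; pose s := \sum_(i < n) a i ^+ 2.
have ai i : a i <= 1.
  rewrite -(@ler_pXn2r _ 2)// ?nnegrE// expr1n (le_trans _ (ltW a1))//.
  by rewrite (bigD1 i)//= lerDl sumr_ge0// => j _; exact: sqr_ge0.
(* Since [a i] and [e] are at most 1, [(a i + 3 * e) ^+ 2] exceeds [a i ^+ 2] by at most [15 * e];
   the extra 1 gives the strict inequality. *)
pose k : R := 15 * n%:R + 1.
have k0 : 0 < k by rewrite ltr_wpDl// mulr_ge0.
pose e := Num.min 1 ((1 - s) / k).
have e0 : 0 < e by rewrite lt_min ltr01 divr_gt0// subr_gt0.
have e1 : e <= 1 by rewrite ge_min lexx.
have e2 : e * k <= 1 - s by rewrite -ler_pdivlMr// ge_min lexx orbT.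
exists e => //.
apply: (@le_lt_trans _ _ (s + 15 * e * n%:R)).
  rewrite -[n in leRHS]card_ord -sumr_const mulr_sumr -big_split/=.
  apply: ler_sum => i _; rewrite mulr1.
  have := ai i; have := a0 i; nra.
by move: e2; rewrite /k; nra.
Qed.

End enorm_facts.

(** * Rotation invariance and support of the surface measure *)

Section sphere_measure_facts.
Context {R : realType} {n : nat}.
Local Notation C := R[i].
Local Notation T := 'rV[C]_n.
Local Notation sigma := (@sphere_measure R n).
Local Notation vol := (volume R n).
Local Notation B := (@unit_ball R n).

(** A box of explicit volume on which the modulus of coordinate [i] is at least [a i], so that
    monomials are bounded below. For [e] and [a] equal to 0 it is the origin. *)
Definition corner (e : R) (a : 'I_n -> R) : set T :=
  box (fun i => [set c : C | (a i <= Re c <= a i + e) && (0 <= Im c <= e)]).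

Lemma measurable_corner e a : measurable (corner e a).
Proof. by apply: measurable_box => i; exact: measurable_square. Qed.

Lemma volume_corner e a : 0 <= e -> vol (corner e a) = (e ^+ n.*2)%:E.
Proof.
move=> e0; rewrite /corner volume_box; last by move=> i; exact: measurable_square.
rewrite (eq_bigr (fun=> (e ^+ 2)%:E)); last first.
  move=> i _; rewrite lebesgue_complex_square ?lerDl//.
  by rewrite addrAC subrr add0r subr0.
by rewrite prodEFin prodr_const card_ord -exprM mul2n.
Qed.

(** On this box the real parts are at most [a i + 2 * e] and the imaginary parts at most [e], which
    explains the 3. *)
Lemma corner_ball e a : 0 <= e -> (forall i, 0 <= a i) ->
  \sum_(i < n) (a i + 3 * e) ^+ 2 < 1 -> corner e (fun i => a i + e) `<=` B.
Proof.
move=> e0 a0 ae z zc; apply/unit_ballP; apply: le_lt_trans ae.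
apply: ler_sum => i _; have /= /andP[/andP[r1 r2] /andP[i1 i2]] := zc i.
rewrite ler_pXn2r ?nnegrE ?nc_ge0 ?addr_ge0 ?mulr_ge0//.
rewrite (le_trans (nc_le_ReIm _))// !ger0_norm//; first lra.
by rewrite (le_trans _ r1)// addr_ge0.
Qed.

Lemma volume_ball_gt0 : (0 < vol B)%E.
Proof.
have [e e0 e1] := @ball_room R n (fun=> 0) (fun=> lexx _)
  ltac:(by rewrite big1 ?ltr01// => i _; rewrite expr0n).
apply: (@lt_le_trans _ _ (vol (corner e (fun=> 0 + e)))).
  by rewrite volume_corner ?(ltW e0)// lte_fin exprn_gt0.
apply: le_measure; rewrite ?inE; [exact: measurable_corner|exact: measurable_unit_ball|].
by apply: (corner_ball (ltW e0)).
Qed.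

Lemma volume_ball_lty : (vol B < +oo)%E.
Proof.
pose D (i : 'I_n) := [set c : C | (-1 <= Re c <= 1) && (-1 <= Im c <= 1)].
have mD i : measurable (D i) by exact: measurable_square.
apply: (@le_lt_trans _ _ (vol (box D))).
  apply: le_measure; rewrite ?inE; [exact: measurable_unit_ball|exact: measurable_box|].
  move=> z zB i; have := ltW (le_lt_trans (nc_le_enorm z i) zB) => h.
  rewrite /D/= -!ler_norml; apply/andP; split; apply: le_trans h.
    exact: normc_ge_absRe.
  exact: normc_ge_absIm.
rewrite volume_box// (eq_bigr (fun=> 4%:E)) => [|i _].
  by rewrite prodEFin ltry.
by rewrite lebesgue_complex_square; [congr EFin; ring|lra|lra].
Qed.

Definition volB : R := fine (vol B).

Lemma volBE : vol B = volB%:E.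
Proof. by rewrite /volB fineK// ge0_fin_numE ?volume_ball_lty// ltW// volume_ball_gt0. Qed.

Lemma volB_gt0 : 0 < volB.
Proof. by rewrite -lte_fin -volBE volume_ball_gt0. Qed.

Lemma sphere_measureE A : sigma A =
  (vol ((@radial_proj R n) @^-1` A `&` B) * (volB^-1)%:E)%E.
Proof.
rewrite /sphere_measure /mnormalize /=.
have -> : cone_measure [set: T] = vol B.
  by rewrite /cone_measure /pushforward /mrestr preimage_setT setTI.
rewrite gt_eqF ?volume_ball_gt0// lt_eqF ?volume_ball_lty//=.
Qed.

Lemma preimage_measurable d1 d2 (T1 : measurableType d1) (T2 : measurableType d2)
  (f : T1 -> T2) A : measurable_fun setT f -> measurable A -> measurable (f @^-1` A).
Proof. by move=> mf mA; rewrite -[X in measurable X]setTI; exact: mf. Qed.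

Lemma sphere_measure_rot (u : 'I_n -> C) A : (forall i, nc (u i) = 1) ->
  measurable A -> sigma (rot u @^-1` A) = sigma A.
Proof.
move=> u1 mA; rewrite !sphere_measureE; congr (_ * _)%E.
have mA' : measurable (@radial_proj R n @^-1` A `&` B).
  apply: measurableI; last exact: measurable_unit_ball.
  exact: (preimage_measurable (@measurable_radial_proj R n)).
rewrite -(volume_rot u1 mA'); congr (vol _); apply/seteqP; split => z /=;
  by rewrite /unit_ball/= enorm_rot// radial_proj_rot.
Qed.

Lemma ge0_integral_rot (u : 'I_n -> C) (g : T -> \bar R) : (forall i, nc (u i) = 1) ->
  measurable_fun setT g -> (forall z, (0 <= g z)%E) ->
  (\int[sigma]_z g (rot u z) = \int[sigma]_z g z)%E.
Proof.
move=> u1 mg g0.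
have := ge0_integral_pushforward (measurable_rot u) sigma measurableT mg
  ltac:(by move=> z _; exact: g0).
rewrite preimage_setT /= => <-.
apply: eq_measure_integral; first exact: measurable_rot.
by move=> ? A mA _; exact: sphere_measure_rot.
Qed.

Lemma CI_rot (u : 'I_n -> C) (F : T -> C) : (forall i, nc (u i) = 1) -> L1 F ->
  complex_integral (F \o rot u) = complex_integral F.
Proof.
move=> u1 LF.
have key (g : T -> R) : sigma.-integrable setT (EFin \o g) ->
    (\int[sigma]_z g (rot u z))%R = (\int[sigma]_z g z)%R.
  move=> ig; rewrite /Rintegral; congr fine.
  have mg := measurable_int _ ig.
  rewrite [RHS]integralE -(ge0_integral_rot u1 (measurable_funepos mg))//.
  rewrite -(ge0_integral_rot u1 (measurable_funeneg mg))//.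
  rewrite [LHS]integralE.
  by congr (_ - _)%E; apply: eq_integral => z _; rewrite ?funeposE ?funenegE.
apply: complex_ext; first exact: (key (fun z => Re (F z)) (L1_Re LF)).
exact: (key (fun z => Im (F z)) (L1_Im LF)).
Qed.

Hypothesis n_gt0 : (0 < n)%N.

Let origin_corner : [set (0 : T)] = corner 0 (fun=> 0).
Proof.
apply/seteqP; split => [_ -> i /=|z zc].
  by rewrite mxE /= addr0 lexx.
apply/rowP => i; rewrite mxE.
have /= /andP[/andP[r1 r2] /andP[i1 i2]] := zc i.
apply: complex_ext => /=; apply/eqP; rewrite eq_le ?r1 ?i1 ?i2 ?andbT//.
by move: r2; rewrite addr0.
Qed.

Lemma volume_origin : vol [set 0] = 0%E.
Proof.
by rewrite origin_corner volume_corner// expr0n double_eq0 eqn0Ngt n_gt0.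
Qed.

(** Radial projection sends every point but the origin to the unit sphere, and the origin, a box of
    side 0, has volume 0 because [n] is positive. *)
Lemma ae_sphere : {ae sigma, forall z : T, enorm z = 1}.
Proof.
have mE : measurable [set z : T | enorm z != 1].
  have -> : [set z : T | enorm z != 1] = ~` (@enorm R n @^-1` [set 1]).
    by apply/seteqP; split => z /= /eqP.
  apply: measurableC; apply: (preimage_measurable (@measurable_enorm R n)).
  exact: measurable_set1.
exists [set z : T | enorm z != 1]; split => //; last by move=> z /= /eqP.
rewrite sphere_measureE; apply/eqP; rewrite mule_eq0; apply/orP; left.
apply/eqP; apply: (@subset_measure0 _ _ _ vol _ [set 0]) => //.
- apply: measurableI; last exact: measurable_unit_ball.
  exact: (preimage_measurable (@measurable_radial_proj R n)).
- by rewrite origin_corner; exact: measurable_corner.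
- move=> z [/= zr _]; apply: contrapT => z0; move/eqP: zr; apply.
  exact: enorm_radial_proj.
- exact: volume_origin.
Qed.

End sphere_measure_facts.

Import (canonicals, coercions) mpoly.

(** * Polynomials on the sphere *)

Section polynomial_functions.
Context {R : realType} {n : nat}.
Local Notation C := R[i].
Local Notation T := 'rV[C]_n.
Implicit Types (f g : T -> C) (z : T).

Definition is_poly f := exists p, f = @poly_fun R n p.

Lemma is_poly_cst (a : C) : is_poly (fun=> a).
Proof. by exists (mpoly.mpolyC n a); apply/funext => z; rewrite /poly_fun mpoly.mevalC. Qed.

Lemma is_poly_coord i : is_poly (fun z => z ord0 i).
Proof.
exists (mpoly.mpolyX _ (mpoly.mnm1 i)); apply/funext => z.
by rewrite /poly_fun mpoly.mevalXU.
Qed.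

Lemma is_polyD f g : is_poly f -> is_poly g -> is_poly (f \+ g).
Proof.
move=> [p ->] [q ->]; exists (p + q); apply/funext => z.
by rewrite /poly_fun mpoly.mevalD.
Qed.

Lemma is_polyM f g : is_poly f -> is_poly g -> is_poly (f \* g).
Proof.
move=> [p ->] [q ->]; exists (p * q); apply/funext => z.
by rewrite /poly_fun mpoly.mevalM.
Qed.

Lemma is_polyZ a f : is_poly f -> is_poly (fun z => a * f z).
Proof. by move=> pf; apply: is_polyM => //; exact: is_poly_cst. Qed.

Lemma is_polyB f g : is_poly f -> is_poly g -> is_poly (f \- g).
Proof.
move=> [p ->] [q ->]; exists (p - q); apply/funext => z.
by rewrite /poly_fun mpoly.mevalB.
Qed.

Lemma is_polyX f k : is_poly f -> is_poly (fun z => f z ^+ k).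
Proof.
move=> pf; elim: k => [|k ih]; first exact: is_poly_cst.
by under eq_fun do rewrite exprS; exact: is_polyM.
Qed.

Lemma is_poly_sum (I : Type) (s : seq I) (F : I -> T -> C) :
  (forall i, is_poly (F i)) -> is_poly (fun z => \sum_(i <- s) F i z).
Proof.
move=> pF; elim: s => [|i s ih].
  by under eq_fun do rewrite big_nil; exact: is_poly_cst.
by under eq_fun do rewrite big_cons; exact: is_polyD.
Qed.

Lemma is_poly_prod (I : Type) (s : seq I) (F : I -> T -> C) :
  (forall i, is_poly (F i)) -> is_poly (fun z => \prod_(i <- s) F i z).
Proof.
move=> pF; elim: s => [|i s ih].
  by under eq_fun do rewrite big_nil; exact: is_poly_cst.
by under eq_fun do rewrite big_cons; exact: is_polyM.
Qed.

Definition mon (a : 'I_n -> nat) z : C := \prod_(i < n) z ord0 i ^+ a i.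

Lemma is_poly_mon a : is_poly (mon a).
Proof. by apply: is_poly_prod => i; apply: is_polyX; exact: is_poly_coord. Qed.

(** Exponents below a common bound [D] form a finite type, so polynomials are sums over a fixed
    finite index set and orthogonality applies term by term. *)
Definition pfun D (c : {ffun 'I_n -> 'I_D} -> C) z : C :=
  \sum_a c a * mon (fun i => a i) z.

Lemma is_poly_pfun D (c : {ffun 'I_n -> 'I_D} -> C) : is_poly (pfun c).
Proof. by apply: is_poly_sum => a; apply: is_polyZ; exact: is_poly_mon. Qed.

Lemma is_polyP f : is_poly f -> exists D c, f = @pfun D c.
Proof.
move=> [p ->]; pose D := (\max_(m <- mpoly.msupp p) mpoly.mdeg m).+1.
pose mn (a : {ffun 'I_n -> 'I_D}) := mpoly.Multinom [tuple (a i : nat) | i < n].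
have mnE a i : mn a i = a i by rewrite mpoly.mnmE.
exists D, (fun a => if mn a \in mpoly.msupp p then mpoly.mcoeff (mn a) p else 0).
apply/funext => z; rewrite /poly_fun mpoly.mevalE.
have perm : perm_eq (mpoly.msupp p)
    [seq mn a | a <- enum {ffun 'I_n -> 'I_D} & mn a \in mpoly.msupp p].
  apply: uniq_perm; first exact: mpoly.msupp_uniq.
    rewrite map_inj_uniq; first exact/filter_uniq/enum_uniq.
    move=> a b ab; apply/ffunP => i; apply/val_inj.
    by rewrite /= -!mnE ab.
  move=> m; apply/idP/mapP => [mp|[a + ->]]; last by rewrite mem_filter => /andP[].
  have mD i : (m i < D)%N.
    by rewrite ltnS (big_rem m mp)/= leq_max mpoly.mdegE (bigD1 i)//= leq_addr.
  have mE : m = mn [ffun i => Ordinal (mD i)].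
    by apply/mpoly.mnmP => i; rewrite mnE ffunE.
  by exists [ffun i => Ordinal (mD i)] => //; rewrite mem_filter -mE mp mem_enum.
rewrite (perm_big _ perm) big_map big_filter big_enum_cond/= /pfun big_mkcond/=.
apply: eq_bigr => a _; case: ifP => _; last by rewrite mul0r.
by congr (_ * _); apply: eq_bigr => i _; rewrite mnE.
Qed.

Lemma nc_mon a z : nc (mon a z) = \prod_(i < n) nc (z ord0 i) ^+ a i.
Proof. by rewrite nc_prod; apply: eq_bigr => i _; rewrite ncX. Qed.

Lemma monZ a (r : C) z : mon a (r *: z) = r ^+ (\sum_i a i) * mon a z.
Proof.
rewrite /mon -prodrXr -big_split; apply: eq_bigr => i _.
by rewrite mxE exprMn.
Qed.

Lemma mon_rot a (u : 'I_n -> C) z : mon a (rot u z) = mon a (\row_i u i) * mon a z.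
Proof.
by rewrite /mon -big_split; apply: eq_bigr => i _; rewrite !mxE exprMn.
Qed.

Lemma is_poly_dil f (r : C) : is_poly f -> is_poly (fun z => f (r *: z)).
Proof.
move=> /is_polyP[D [c ->]]; rewrite /pfun; apply: is_poly_sum => a.
apply: is_polyZ; under eq_fun do rewrite monZ; apply: is_polyZ.
exact: is_poly_mon.
Qed.

Lemma is_poly_mfun f : is_poly f -> mfun f.
Proof.
move=> /is_polyP[D [c ->]]; apply: mfun_sum => a; apply: mfunZ.
apply: mfun_prod => i; apply: (@mfunX _ _ (fun z => z ord0 i)).
exact: measurable_row_coord.
Qed.

Lemma is_poly_bounded f : is_poly f ->
  exists2 M : R, 0 <= M & forall z, enorm z <= 1 -> nc (f z) <= M.
Proof.
move=> /is_polyP[D [c ->]]; exists (\sum_a nc (c a)).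
  by apply: sumr_ge0 => a _; exact: nc_ge0.
move=> z z1; rewrite (le_trans (nc_sum _ _ _))//; apply: ler_sum => a _.
rewrite Normc.normcM ler_piMr ?nc_ge0// nc_mon.
apply: prodr_ile1 => i _; rewrite exprn_ge0 ?nc_ge0//=.
by rewrite exprn_ile1 ?nc_ge0// (le_trans (nc_le_enorm _ _)).
Qed.

End polynomial_functions.

Section cis.
Context {R : realType}.

Definition cis (t : R) : R[i] := cos t +i* sin t.

Lemma cisD s t : cis (s + t) = cis s * cis t.
Proof. by apply: complex_ext; rewrite ?ReM ?ImM /= ?cosD ?sinD//; ring. Qed.

Lemma cis0 : cis 0 = 1.
Proof. by rewrite /cis cos0 sin0. Qed.

Lemma cisX t k : cis t ^+ k = cis (k%:R * t).
Proof.
elim: k => [|k ih]; first by rewrite mul0r cis0.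
by rewrite exprS ih -cisD; congr cis; rewrite -[in RHS]natr1; ring.
Qed.

Lemma nc_cis t : nc (cis t) = 1.
Proof. by rewrite /= cos2Dsin2 sqrtr1. Qed.

Lemma cis_pi : cis pi = -1.
Proof. by rewrite /cis cospi sinpi; apply: complex_ext => //=; rewrite oppr0. Qed.

Lemma cisJ t : conjc (cis t) = cis (- t).
Proof. by rewrite /cis cosN sinN. Qed.

Lemma exists_unit_power (k : nat) : (0 < k)%N -> exists w : R[i], nc w = 1 /\ w ^+ k = -1.
Proof.
move=> k0; exists (cis (pi / k%:R)); split; first exact: nc_cis.
by rewrite cisX mulrC divfK ?pnatr_eq0 -?lt0n// cis_pi.
Qed.

End cis.

(** * Orthogonality of monomials and evaluation at points of the ball *)

Section polynomials_on_sphere.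
Context {R : realType} {n : nat}.
Local Notation C := R[i].
Local Notation T := 'rV[C]_n.
Local Notation sigma := (@sphere_measure R n).
Local Notation SH := (@L2_semi_hilbert R n).
Local Notation N2 := (hn (@L2dot R n)).
Hypothesis n_gt0 : (0 < n)%N.

Lemma L2_ae_bounded (F : T -> C) (M : R) : 0 <= M -> mfun F ->
  {ae sigma, forall z, nc (F z) <= M} -> L2 F /\ N2 F <= M.
Proof.
move=> M0 mF FM.
have h : (L2norm2 F <= (M ^+ 2)%:E)%E.
  rewrite -(@integral_sigma_cst R n (M ^+ 2)%:E); apply: ae_ge0_le_integral => //.
  - by move=> z _; rewrite lee_fin sqr_ge0.
  - exact/measurable_EFinP/mfun_nc2.
  - by move=> z _; rewrite lee_fin sqr_ge0.
  - by move: FM; apply: filterS => z h _; rewrite lee_fin ler_pXn2r ?nnegrE ?nc_ge0.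
have LF := L2norm2_ltP mF h.
by split => //; rewrite N2_le.
Qed.

Lemma L2_sphere_bounded (F : T -> C) (M : R) : 0 <= M -> mfun F ->
  (forall z, enorm z = 1 -> nc (F z) <= M) -> L2 F /\ N2 F <= M.
Proof.
move=> M0 mF FM; apply: L2_ae_bounded => //.
by have := @ae_sphere R n n_gt0; apply: filterS => z; exact: FM.
Qed.

Lemma is_poly_L2 (f : T -> C) : is_poly f -> L2 f.
Proof.
move=> pf; have [M M0 fM] := is_poly_bounded pf.
have [] // := L2_sphere_bounded M0 (is_poly_mfun pf).
by move=> z z1; apply: fM; rewrite z1.
Qed.

Lemma mon_L2 (a : 'I_n -> nat) : L2 (mon a : T -> C).
Proof. exact/is_poly_L2/is_poly_mon. Qed.

Lemma L2dot_rot (u : 'I_n -> C) (F G : T -> C) : (forall i, nc (u i) = 1) ->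
  L2 F -> L2 G -> L2dot (F \o rot u) (G \o rot u) = L2dot F G.
Proof.
move=> u1 LF LG; rewrite /L2dot -[RHS](CI_rot u1)//.
by apply: L1M => //; exact: L2J.
Qed.

(** If the exponents differ at [i], a rotation of coordinate [i] by some [w] whose power of order
    the difference is -1 preserves the measure and changes the sign of the inner product. *)
Lemma mon_orth (a b : 'I_n -> nat) : a <> b -> L2dot (mon a : T -> C) (mon b) = 0.
Proof.
move=> ab.
have key (c d : 'I_n -> nat) i : (c i < d i)%N -> L2dot (mon c : T -> C) (mon d) = 0.
  move=> cd.
  have [w [w1 wk]] := @exists_unit_power R (d i - c i) ltac:(by rewrite subn_gt0).
  pose u j : C := if j == i then w else 1.
  have u1 j : nc (u j) = 1 by rewrite /u; case: ifP; rewrite ?nc1.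
  have monu (e : 'I_n -> nat) : mon e (\row_j u j) = w ^+ e i.
    rewrite /mon (bigD1 i)//= big1 ?mulr1 => [|j ji]; last first.
      by rewrite mxE /u (negPf ji) expr1n.
    by rewrite mxE /u eqxx.
  have := L2dot_rot u1 (mon_L2 c) (mon_L2 d).
  have E (e : 'I_n -> nat) : mon e \o rot u = w ^+ e i *: (mon e : T -> C).
    by apply/funext => z; rewrite /= mon_rot monu.
  rewrite !E (shdotZl SH); [|exact: mon_L2|by apply: (shZ SH); exact: mon_L2].
  rewrite (shdotZr SH); [|exact: mon_L2|exact: mon_L2].
  have -> : conjc (w ^+ d i) = - conjc (w ^+ c i).
    by rewrite -(subnKC (ltnW cd)) exprD wk mulrN1 rmorphN.
  rewrite mulNr mulrN mulrA mulcJ ncX w1 expr1n expr1n mul1r => /eqP.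
  by rewrite eq_sym -subr_eq0 opprK -mulr2n mulrn_eq0 => /eqP.
have [j] : exists j, a j <> b j.
  by apply/existsNP => h; apply: ab; apply/funext.
move=> /eqP; rewrite neq_ltn => /orP[h|h]; first exact: key h.
by rewrite (shdotC SH (mon_L2 b) (mon_L2 a)) (key _ _ _ h) conjc0.
Qed.

Lemma sh_sum (V : lmodType C) (D : set V) (dot : V -> V -> C) (I : Type)
  (s : seq I) (f : I -> V) : semi_hilbert D dot -> (forall i, D (f i)) ->
  D (\sum_(i <- s) f i).
Proof.
move=> H Df; elim: s => [|i s ih]; first by rewrite big_nil; exact: (sh0 H).
by rewrite big_cons; exact: (shD H).
Qed.

Lemma shdot_suml (V : lmodType C) (D : set V) (dot : V -> V -> C) (I : Type)
  (s : seq I) (f : I -> V) g : semi_hilbert D dot -> (forall i, D (f i)) -> D g ->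
  dot (\sum_(i <- s) f i) g = \sum_(i <- s) dot (f i) g.
Proof.
move=> H Df Dg; elim: s => [|i s ih]; first by rewrite !big_nil (shdot0l H).
by rewrite !big_cons (shdotDl H) ?ih//; exact: (sh_sum _ H).
Qed.

Lemma shdot_sumr (V : lmodType C) (D : set V) (dot : V -> V -> C) (I : Type)
  (s : seq I) (f : I -> V) g : semi_hilbert D dot -> (forall i, D (f i)) -> D g ->
  dot g (\sum_(i <- s) f i) = \sum_(i <- s) dot g (f i).
Proof.
move=> H Df Dg.
rewrite (shdotC H (sh_sum s H Df) Dg) (shdot_suml _ H)// rmorph_sum; apply: eq_bigr => i _ /=.
by rewrite -(shdotC H).
Qed.

Lemma pfunE D (c : {ffun 'I_n -> 'I_D} -> C) :
  pfun c = \sum_a c a *: (mon (fun i => a i) : T -> C).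
Proof. by apply/funext => z; rewrite /pfun fct_sumE. Qed.

Lemma mon_ffun_orth D (a b : {ffun 'I_n -> 'I_D}) : a != b ->
  L2dot (mon (fun i => a i) : T -> C) (mon (fun i => b i)) = 0.
Proof.
move=> /eqP ab; apply: mon_orth => h; apply: ab; apply/ffunP => i.
by apply: val_inj; exact: (congr1 (fun g => g i) h).
Qed.

Lemma pfun_dot D (c d : {ffun 'I_n -> 'I_D} -> C) :
  L2dot (pfun c : T -> C) (pfun d) =
  \sum_a c a * conjc (d a) * (N2 (mon (fun i => a i)) ^+ 2)%:C.
Proof.
have Lm D' (c' : {ffun 'I_n -> 'I_D'} -> C) a : L2 (c' a *: (mon (fun i => a i) : T -> C)).
  by apply: (shZ SH); exact: mon_L2.
rewrite !pfunE (shdot_suml _ SH)//; last first.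
  by rewrite -pfunE; exact/is_poly_L2/is_poly_pfun.
apply: eq_bigr => a _; rewrite (shdot_sumr _ SH)// (bigD1 a)//= big1 ?addr0.
  rewrite (shdotZl SH)//; [|exact: mon_L2].
  rewrite (shdotZr SH); [|exact: mon_L2|exact: mon_L2].
  by rewrite (dotff SH) ?mulrA//; exact: mon_L2.
move=> b ba; rewrite (shdotZl SH)//; [|exact: mon_L2].
rewrite (shdotZr SH); [|exact: mon_L2|exact: mon_L2].
by rewrite mon_ffun_orth 1?eq_sym// !mulr0.
Qed.

Lemma pfun_N2 D (c : {ffun 'I_n -> 'I_D} -> C) :
  N2 (pfun c) ^+ 2 = \sum_a nc (c a) ^+ 2 * N2 (mon (fun i => a i)) ^+ 2.
Proof.
apply: complexI; rewrite -(dotff SH); last exact/is_poly_L2/is_poly_pfun.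
rewrite pfun_dot rmorph_sum; apply: eq_bigr => a _ /=.
by rewrite mulcJ -rmorphM.
Qed.

Definition dil (r : R) (f : T -> C) : T -> C := fun z => f (r%:C *: z).

Lemma dil_pfun D (c : {ffun 'I_n -> 'I_D} -> C) r :
  dil r (pfun c) = pfun (fun a => c a * (r ^+ (\sum_i a i))%:C).
Proof.
apply/funext => z; rewrite /dil /pfun; apply: eq_bigr => a _.
by rewrite monZ -mulrA rmorphXn.
Qed.

(** By orthogonality a monomial of degree d contributes with the factor [(r * s) ^+ d], so only the
    product of the radii matters. The geometric mean of two radii thus computes inner products of
    dilations, which later makes the dilations of an [H2] function a Cauchy sequence. *)
Lemma dil_dot (p : T -> C) (r s t : R) : is_poly p -> r * s = t ^+ 2 ->
  L2dot (dil r p) (dil s p) = (N2 (dil t p) ^+ 2)%:C.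
Proof.
move=> /is_polyP[D [c ->]] rst; rewrite !dil_pfun pfun_dot pfun_N2.
rewrite rmorph_sum; apply: eq_bigr => a _ /=.
rewrite conjcM conjc_real mulrACA mulcJ Normc.normcM ncR exprMn.
rewrite real_normK ?num_real// -!rmorphM; congr (_ * _)%:C; congr (_ * _).
by rewrite -exprMn rst -!exprM mulnC.
Qed.

Lemma dil_N2_le (p : T -> C) (r s : R) : is_poly p -> 0 <= r -> r <= s ->
  N2 (dil r p) <= N2 (dil s p).
Proof.
move=> /is_polyP[D [c ->]] r0 rs.
have hn_le x y : N2 x ^+ 2 <= N2 y ^+ 2 -> N2 x <= N2 y.
  by rewrite ler_pXn2r ?nnegrE ?hn_ge0.
apply: hn_le; rewrite !dil_pfun [leLHS]pfun_N2 [leRHS]pfun_N2.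
apply: ler_sum => a _; rewrite ler_wpM2r ?sqr_ge0//.
rewrite ler_pXn2r ?nnegrE ?nc_ge0// !Normc.normcM ler_wpM2l ?nc_ge0//.
have s0 := le_trans r0 rs.
by rewrite !ncR_ge0 ?exprn_ge0// lerXn2r.
Qed.

(* On the ball [|z^a| <= |(z/|z|)^a|], so integrating over a small box bounds the
   norm on the sphere from below. *)
Lemma N2_mon_ge (b : 'I_n -> R) (e : R) (a : 'I_n -> nat) : 0 < e ->
  (forall i, 0 <= b i) -> \sum_(i < n) (b i + 3 * e) ^+ 2 < 1 ->
  (e ^+ n.*2 / @volB R n) * \prod_(i < n) (b i + e) ^+ (2 * a i) <=
  N2 (mon a : T -> C) ^+ 2.
Proof.
move=> e0 b0 be; set q := \prod_(i < n) _.
have q0 : 0 <= q by apply: prodr_ge0 => i _; rewrite exprn_ge0// addr_ge0// ltW.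
rewrite -lee_fin -(L2norm2E (mon_L2 a)).
have mm := mfun_nc2 (L2_m (mon_L2 a)).
pose A := [set z : T | q <= nc (mon a z) ^+ 2].
have mA : measurable A.
  have -> : A = (fun z => nc (mon a z) ^+ 2) @^-1` `[q, +oo[%classic.
    by apply/seteqP; split => z /=; rewrite in_itv/= andbT.
  exact: preimage_measurable.
apply: (@le_trans _ _ (q%:E * sigma A)%E).
  rewrite mulrC EFinM; apply: lee_pmul => //; rewrite ?lee_fin ?divr_ge0//.
    by rewrite exprn_ge0// ltW.
    exact/ltW/volB_gt0.
  rewrite sphere_measureE EFinM -(volume_corner (fun i => b i + e) (ltW e0)).
  apply: lee_wpmul2r; first by rewrite lee_fin invr_ge0 ltW// volB_gt0.
  apply: le_measure; rewrite ?inE.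
  - exact: measurable_corner.
  - apply: measurableI; last exact: measurable_unit_ball.
    exact: (preimage_measurable (@measurable_radial_proj R n)).
  - move=> z zc; have zB := corner_ball (ltW e0) b0 be zc; split => //=.
    have zi i : b i + e <= nc (z ord0 i).
      have /= /andP[/andP[r1 _] _] := zc i.
      by rewrite (le_trans r1)// (le_trans (ler_norm _))// normc_ge_absRe.
    have zn0 : 0 < enorm z.
      apply: lt_le_trans (nc_le_enorm z (Ordinal n_gt0)).
      by apply: lt_le_trans (zi _); rewrite ltr_wpDl.
    rewrite /A/= nc_mon -prodrXl; apply: ler_prod => i _.
    rewrite exprn_ge0 ?addr_ge0 ?(ltW e0)//= exprM exprAC mxE.
    apply: lerXn2r; rewrite ?nnegrE ?exprn_ge0 ?nc_ge0 ?addr_ge0 ?(ltW e0)//.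
    apply: lerXn2r; rewrite ?nnegrE ?nc_ge0 ?addr_ge0 ?(ltW e0)//.
    rewrite Normc.normcM ncR_ge0 ?invr_ge0 ?enorm_ge0// (le_trans (zi i))//.
    by rewrite ler_peMl ?nc_ge0// invr_ge1 ?unitfE ?gt_eqF// ltW.
rewrite /L2norm2 -(setIT A) -integral_indic// -ge0_integralZl_EFin//; first last.
- exact/measurable_EFinP.
- apply: ge0_le_integral => //.
  + by move=> z _; rewrite -EFinM lee_fin mulr_ge0.
  + by apply/measurable_EFinP; apply: measurable_funM => //; exact: measurable_cst.
  + exact/measurable_EFinP.
  + move=> z _; rewrite -EFinM lee_fin indicE; case: (boolP (z \in A)) => [/set_mem|] zA.
      by rewrite mulr1.
    by rewrite mulr0 sqr_ge0.
Qed.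

Lemma geometric_le (q : R) k : 0 <= q -> q < 1 -> \sum_(i < k) q ^+ i <= (1 - q)^-1.
Proof.
move=> q0 q1; have q1' : 0 < 1 - q by rewrite subr_gt0.
rewrite -[leRHS]mul1r ler_pdivlMr//.
by have := subrX1 q k; have := exprn_ge0 k q0; lra.
Qed.

(** Evaluation at [z] is the inner product with a truncated reproducing kernel, with coefficients
    the conjugate of z^a over the squared norm of z^a. The lower bound [N2_mon_ge] dominates the
    squared norm of the kernel by a product of geometric series, independently of the degree.
    Uniformity near [z0] is what turns L^2 convergence into locally uniform convergence. *)
Lemma point_evaluation (z0 : T) : unit_ball z0 -> exists e K : R,
  [/\ 0 < e, 0 <= K & forall p, is_poly p -> forall z : T,
      (forall i, nc (z ord0 i) <= nc (z0 ord0 i) + e) -> nc (p z) <= K * N2 p].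
Proof.
move=> /unit_ballP z0B.
have [e e0 be] := ball_room (fun i => nc_ge0 (z0 ord0 i)) z0B.
pose b i := nc (z0 ord0 i).
have b0 i : 0 <= b i by exact: nc_ge0.
pose kappa := e ^+ n.*2 / @volB R n.
have k0 : 0 < kappa by rewrite divr_gt0 ?exprn_gt0 ?volB_gt0.
(* The ratio of the geometric series: the evaluation point has moduli up to [b i + e / 2], whereas
   the norms of the monomials are bounded below with [b i + e]. *)
pose q i := ((b i + e / 2) / (b i + e)) ^+ 2.
have q0 i : 0 <= q i by exact: sqr_ge0.
have be0 i : 0 < b i + e by rewrite ltr_wpDl.
have q1 i : q i < 1.
  rewrite expr_lt1//; last by rewrite divr_ge0// ?(ltW (be0 i))// addr_ge0// ltW// divr_gt0.
  by rewrite ltr_pdivrMr// mul1r ltrD2l ltr_pdivrMr// ltr_pMr// ltr1n.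
pose K2 := kappa^-1 * \prod_i (1 - q i)^-1.
have K20 : 0 <= K2.
  rewrite mulr_ge0 ?invr_ge0 ?(ltW k0)//; apply: prodr_ge0 => i _.
  by rewrite invr_ge0 subr_ge0 ltW.
exists (e / 2), (Num.sqrt K2); split; rewrite ?divr_gt0 ?sqrtr_ge0//.
move=> _ /is_polyP[D [c ->]] z zi.
pose m (a : {ffun 'I_n -> 'I_D}) := N2 (mon (fun i => a i) : T -> C) ^+ 2.
have mge (a : {ffun 'I_n -> 'I_D}) := N2_mon_ge (fun i => (a i : nat)) e0 b0 be.
have m0 a : 0 < m a.
  apply: lt_le_trans (mge a); rewrite mulr_gt0//.
  by apply: prodr_gt0 => i _; rewrite exprn_gt0.
pose k : T -> C := pfun (fun a => conjc (mon (fun i => a i) z) * (m a)^-1%:C).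
have pE : pfun c z = L2dot (pfun c) k.
  rewrite pfun_dot; apply: eq_bigr => a _; rewrite -/(m a).
  rewrite conjcM cJK conjc_real -!mulrA -rmorphM mulVf ?gt_eqF//.
  by rewrite rmorph1 mulr1.
have Lp : L2 (pfun c : T -> C) by exact/is_poly_L2/is_poly_pfun.
have Lk : L2 k by exact/is_poly_L2/is_poly_pfun.
rewrite pE (le_trans (cauchy_schwarz SH Lp Lk))// mulrC ler_wpM2r ?hn_ge0//.
rewrite -(@ler_pXn2r _ 2)// ?nnegrE ?hn_ge0 ?sqrtr_ge0// [leRHS]sqr_sqrtr// /k pfun_N2.
apply: (@le_trans _ _ (\sum_(a : {ffun 'I_n -> 'I_D}) kappa^-1 * \prod_i q i ^+ a i)).
  apply: ler_sum => a _; rewrite -/(m a) Normc.normcM ncJ ncR_ge0 ?invr_ge0 ?(ltW (m0 a))//.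
  have -> : (nc (mon (fun i => a i) z) / m a) ^+ 2 * m a = nc (mon (fun i => a i) z) ^+ 2 / m a.
    by field; rewrite gt_eqF.
  rewrite ler_pdivrMr//; apply: le_trans (ler_wpM2l _ (mge a)); last first.
    by rewrite mulr_ge0 ?invr_ge0 ?(ltW k0)//; apply: prodr_ge0 => i _; rewrite exprn_ge0.
  rewrite -/kappa mulrACA mulVf ?gt_eqF// mul1r -big_split/=.
  rewrite nc_mon -prodrXl; apply: ler_prod => i _; rewrite exprn_ge0 ?exprn_ge0 ?nc_ge0//=.
  have qE : q i * (b i + e) ^+ 2 = (b i + e / 2) ^+ 2 by rewrite /q; field; rewrite gt_eqF.
  have c0 : 0 <= b i + e / 2 by rewrite addr_ge0// ltW// divr_gt0.
  rewrite (exprM _ 2) -exprMn qE -!exprM (mulnC (a i)).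
  by apply: lerXn2r; rewrite ?nnegrE ?nc_ge0//; exact: zi.
rewrite -mulr_sumr ler_wpM2l ?invr_ge0 ?(ltW k0)//.
rewrite -(bigA_distr_bigA (fun i (j : 'I_D) => q i ^+ j)).
apply: ler_prod => i _; rewrite geometric_le// andbT.
by apply: sumr_ge0 => j _; rewrite exprn_ge0.
Qed.

End polynomials_on_sphere.

(** * Goursat theorem *)

Section interval_integral.
Context {R : realType}.
Local Notation lam := (@lebesgue_measure R).
Implicit Types (w : R -> R) (a b : R).

Definition In a b w : R := (\int[lam]_(x in `[a, b]) w x)%R.

Lemma In_integrable a b w : continuous w -> lam.-integrable `[a, b] (EFin \o w).
Proof.
move=> cw; apply: continuous_compact_integrable; first exact: segment_compact.
exact: continuous_subspaceT.
Qed.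

Lemma In_split a m b w : continuous w -> a <= m -> m <= b ->
  In a b w = In a m w + In m b w.
Proof.
move=> cw am mb; apply/eqP; rewrite addrC -subr_eq; apply/eqP.
rewrite /In Rintegral_itvB ?bnd_simp//; last exact: In_integrable.
rewrite Rintegral_itv_obnd_cbnd//.
apply: integrableS (In_integrable m b cw) => //.
by apply: subset_itvr; rewrite bnd_simp.
Qed.

Lemma InD a b v w : continuous v -> continuous w ->
  In a b (fun x => v x + w x) = In a b v + In a b w.
Proof. by move=> cv cw; rewrite /In RintegralD//; exact: In_integrable. Qed.

Lemma InB a b v w : continuous v -> continuous w ->
  In a b (fun x => v x - w x) = In a b v - In a b w.
Proof. by move=> cv cw; rewrite /In RintegralB//; exact: In_integrable. Qed.

Lemma InZ a b (k : R) w : continuous w -> In a b (fun x => k * w x) = k * In a b w.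
Proof. by move=> cw; rewrite /In RintegralZl//; exact: In_integrable. Qed.

Lemma In_cst a b (k : R) : a <= b -> In a b (fun=> k) = k * (b - a).
Proof.
move=> ab; rewrite /In Rintegral_cst//= lebesgue_measure_itv/= lte_fin.
by move: ab; rewrite le_eqVlt => /predU1P[->|->]//; rewrite ltxx subrr.
Qed.

Lemma In_le a b v w : continuous v -> continuous w ->
  (forall x, a <= x <= b -> v x <= w x) -> In a b v <= In a b w.
Proof.
by move=> cv cw vw; apply: le_Rintegral => //; exact: In_integrable.
Qed.

Lemma eq_In a b v w : (forall x, a <= x <= b -> v x = w x) -> In a b v = In a b w.
Proof.
move=> vw; apply: eq_Rintegral => x; rewrite inE/= in_itv/=; exact: vw.
Qed.

Lemma In_near_cst a b (k M : R) w : continuous w -> a <= b ->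
  (forall x, a <= x <= b -> `|w x - k| <= M) ->
  `|In a b w - k * (b - a)| <= M * (b - a).
Proof.
move=> cw ab wM; rewrite -!In_cst//.
have cc (l : R) : continuous (fun _ : R => l) by move=> x; exact: cvg_cst.
rewrite ler_norml lerBlDr lerBrDr; apply/andP; split.
  have : In a b (fun=> k - M) <= In a b w.
    by apply: In_le => // x /wM; rewrite ler_norml => /andP[]; lra.
  by rewrite !In_cst//; lra.
have : In a b w <= In a b (fun=> k + M).
  by apply: In_le => // x /wM; rewrite ler_norml => /andP[]; lra.
by rewrite !In_cst//; lra.
Qed.

Lemma In_shift a b (p : R) w : continuous w ->
  In a b (fun x => w (x + p)) = In (a + p) (b + p) w.
Proof.
move=> cw; rewrite /In /Rintegral; congr fine.
have mp : measurable_fun setT (fun x : measurableTypeR R => (x + p : measurableTypeR R)).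
  by apply: measurable_funD => //; exact: measurable_cst.
have E : (fun x => x + p) @^-1` `[a + p, b + p]%classic = `[a, b]%classic.
  by apply/seteqP; split => x /=; rewrite !in_itv/= !lerD2r.
have cwp : continuous (fun x => w (x + p)).
  by move=> x; apply: (@continuous_comp _ _ _ (fun x => x + p) w);
    [apply: cvgD; [exact: cvg_id|exact: cvg_cst]|exact: cw].
have mw : measurable_fun setT (EFin \o w).
  by apply/measurable_EFinP; exact: continuous_measurable_fun.
have := @integral_pushforward _ _ _ _ _ _ mp lam `[a + p, b + p]%classic (EFin \o w) mw.
rewrite E => /(_ (In_integrable _ _ cwp)) <-//.
apply: (@eq_measure_integral _ _ _ _ lam
  (measure_function_pushforward__canonical__measure_function_Measure lam mp)).
by move=> A mA _; rewrite /= /pushforward lebesgue_measure_translate.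
Qed.

(* The imaginary part of the contour integral of [u + i v] around the boundary
   of the rectangle [a, b] x [c, d]. *)
Definition contour (u v : R -> R -> R) a b c d : R :=
  In a b (fun x => v x c - v x d) + In c d (fun y => u b y - u a y).

(** Complex differentiability of [u + i v] with derivative [al + i be], in real coordinates: the
    Cauchy-Riemann equations are the sharing of [al] and [be]. *)
Definition locally_holo (u v : R -> R -> R) (x0 y0 : R) := exists al be : R,
  forall eta : R, 0 < eta -> exists2 de : R, 0 < de &
    forall x y, `|x - x0| <= de -> `|y - y0| <= de ->
    `|u x y - u x0 y0 - (al * (x - x0) - be * (y - y0))|
       <= eta * (`|x - x0| + `|y - y0|) /\
    `|v x y - v x0 y0 - (be * (x - x0) + al * (y - y0))|
       <= eta * (`|x - x0| + `|y - y0|).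

Section goursat.
Variables (u v : R -> R -> R).
Hypothesis cux : forall y, continuous (u ^~ y).
Hypothesis cuy : forall x, continuous (u x).
Hypothesis cvx : forall y, continuous (v ^~ y).
Hypothesis cvy : forall x, continuous (v x).

Let cB (f g : R -> R) : continuous f -> continuous g -> continuous (fun x => f x - g x).
Proof. by move=> cf cg x; apply: cvgB; [exact: cf|exact: cg]. Qed.

Let contour_split a m b c p d : a <= m -> m <= b -> c <= p -> p <= d ->
  contour u v a b c d = contour u v a m c p + contour u v m b c p +
    (contour u v a m p d + contour u v m b p d).
Proof.
move=> am mb cp pd; rewrite /contour.
rewrite !InB ?(In_split (@cvx c) am mb) ?(In_split (@cvx d) am mb)//.
rewrite (In_split (@cuy a) cp pd) (In_split (@cuy b) cp pd); ring.
Qed.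

(** The affine approximation contributes [al * (c - d) * (b - a)] and [al * (b - a) * (d - c)],
    which cancel. In the error, one factor [(b - a) + (d - c)] is the size of the remainder and the
    other the length of the sides. *)
Let contour_small a b c d x0 y0 (al be eta : R) :
  a <= x0 <= b -> c <= y0 <= d -> 0 <= eta ->
  (forall x y, a <= x <= b -> c <= y <= d ->
    `|u x y - u x0 y0 - (al * (x - x0) - be * (y - y0))|
       <= eta * ((b - a) + (d - c)) /\
    `|v x y - v x0 y0 - (be * (x - x0) + al * (y - y0))|
       <= eta * ((b - a) + (d - c))) ->
  `|contour u v a b c d| <= 2 * eta * ((b - a) + (d - c)) ^+ 2.
Proof.
move=> /andP[ax xb] /andP[cy yd] e0 H.
have ab := le_trans ax xb; have cd := le_trans cy yd.
have h1 : `|In a b (fun x => v x c - v x d) - (al * (c - d)) * (b - a)|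
    <= (2 * eta * ((b - a) + (d - c))) * (b - a).
  apply: In_near_cst => //; first exact: cB.
  move=> x xab.
  have [_ hc] := H x c xab ltac:(by rewrite lexx).
  have [_ hd] := H x d xab ltac:(by rewrite lexx andbT).
  by move: hc hd; rewrite !ler_norml => /andP[? ?] /andP[? ?]; apply/andP; split; lra.
have h2 : `|In c d (fun y => u b y - u a y) - (al * (b - a)) * (d - c)|
    <= (2 * eta * ((b - a) + (d - c))) * (d - c).
  apply: In_near_cst => //; first exact: cB.
  move=> y ycd.
  have [hb _] := H b y ltac:(by rewrite lexx andbT) ycd.
  have [ha _] := H a y ltac:(by rewrite lexx) ycd.
  by move: ha hb; rewrite !ler_norml => /andP[? ?] /andP[? ?]; apply/andP; split; lra.
by move: h1 h2; rewrite /contour !ler_norml => /andP[? ?] /andP[? ?]; apply/andP; split; lra.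
Qed.

(** Some quarter of each rectangle carries at least a quarter of the contour integral. The nested
    rectangles shrink to a point, where differentiability makes the integral too small compared with
    their area. *)
Lemma goursat a b c d : a <= b -> c <= d ->
  (forall x y, a <= x <= b -> c <= y <= d -> locally_holo u v x y) ->
  contour u v a b c d = 0.
Proof.
move=> ab cd holo; apply/eqP; rewrite -normr_le0 leNgt; apply/negP => A0.
set A := `|_| in A0.
pose s := b - a; pose t := d - c.
have s0 : 0 <= s by rewrite subr_ge0.
have t0 : 0 <= t by rewrite subr_ge0.
pose h k : R := 2^-1 ^+ k.
have h0 k : 0 <= h k by rewrite exprn_ge0// invr_ge0.
have hS k : h k = h k.+1 + h k.+1.
  by rewrite /h exprS; lra.
(* A rectangle of generation [k] is determined by its lower left corner, so the nested sequence is
   recorded as a sequence of points. *)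
pose J k (q : R * R) := contour u v q.1 (q.1 + s * h k) q.2 (q.2 + t * h k).
have step k (q : R * R) : exists q' : R * R,
    [/\ q'.1 = q.1 \/ q'.1 = q.1 + s * h k.+1,
        q'.2 = q.2 \/ q'.2 = q.2 + t * h k.+1 &
        `|J k q| <= 4 * `|J k.+1 q'|].
  case: q => x y /=.
  have sp := @contour_split x (x + s * h k.+1) (x + s * h k)
    y (y + t * h k.+1) (y + t * h k).
  have sh : s * h k = s * h k.+1 + s * h k.+1 by rewrite -mulrDr -hS.
  have th : t * h k = t * h k.+1 + t * h k.+1 by rewrite -mulrDr -hS.
  have sk : 0 <= s * h k.+1 by rewrite mulr_ge0.
  have tk : 0 <= t * h k.+1 by rewrite mulr_ge0.
  have w1 (r r' : R) : 0 <= r' -> r <= r + r' by rewrite lerDl.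
  have {}sp := sp (w1 _ _ sk) ltac:(by rewrite sh addrA w1) (w1 _ _ tk) ltac:(by rewrite th addrA w1).
  apply: contrapT => nex.
  have ne q' : (q'.1 = x \/ q'.1 = x + s * h k.+1) ->
      (q'.2 = y \/ q'.2 = y + t * h k.+1) -> 4 * `|J k.+1 q'| < `|J k (x, y)|.
    by move=> h1 h2; rewrite ltNge; apply/negP => h3; apply: nex; exists q'.
  have e1 := ne (x, y) (or_introl erefl) (or_introl erefl).
  have e2 := ne (x + s * h k.+1, y) (or_intror erefl) (or_introl erefl).
  have e3 := ne (x, y + t * h k.+1) (or_introl erefl) (or_intror erefl).
  have e4 := ne (x + s * h k.+1, y + t * h k.+1) (or_intror erefl) (or_intror erefl).
  have E0 : J k (x, y) = J k.+1 (x, y) + J k.+1 (x + s * h k.+1, y) +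
     (J k.+1 (x, y + t * h k.+1) + J k.+1 (x + s * h k.+1, y + t * h k.+1)).
    rewrite /J /=.
    have -> : x + s * h k.+1 + s * h k.+1 = x + s * h k by rewrite -addrA -sh.
    by have -> : y + t * h k.+1 + t * h k.+1 = y + t * h k by rewrite -addrA -th.
  move: E0 e1 e2 e3 e4; move: (J k _) (J k.+1 _) (J k.+1 _) (J k.+1 _) (J k.+1 _).
  move=> c0 c4 c3 c2 c1 -> e1 e2 e3 e4.
  have := le_trans (ler_normD (c1 + c2) (c3 + c4))
    (lerD (ler_normD c1 c2) (ler_normD c3 c4)).
  by lra.
have /choice[next nextP] (kq : nat * (R * R)) : exists q' : R * R,
    [/\ q'.1 = kq.2.1 \/ q'.1 = kq.2.1 + s * h kq.1.+1,
        q'.2 = kq.2.2 \/ q'.2 = kq.2.2 + t * h kq.1.+1 &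
        `|J kq.1 kq.2| <= 4 * `|J kq.1.+1 q'|] by exact: step.
pose q := fix q k : R * R := if k is k'.+1 then next (k', q k') else (a, c).
have qS k := nextP (k, q k).
have AJ k : A <= 4 ^+ k * `|J k (q k)|.
  elim: k => [|k ih].
    by rewrite expr0 mul1r /J /= /h expr0 !mulr1 /s /t !(addrC _ (_ - _)) !subrK.
  have [_ _ /= hk] := qS k.
  rewrite (le_trans ih)// exprSr -mulrA ler_wpM2l// exprn_ge0//.
have mono (f : nat -> R) (l : R) : 0 <= l ->
    (forall k, f k.+1 = f k \/ f k.+1 = f k + l * h k.+1) ->
    forall j k, f k <= f (j + k)%N /\ f (j + k)%N + l * h (j + k)%N <= f k + l * h k.
  move=> l0 fS j k; elim: j => [|j [ih1 ih2]]; first by rewrite add0n.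
  have lh := mulr_ge0 l0 (h0 (j + k).+1).
  have hh : l * h (j + k)%N = l * h (j + k).+1 + l * h (j + k).+1.
    by rewrite -mulrDr -hS.
  by rewrite addSn; case: (fS (j + k)%N) => ->; clear - ih1 ih2 lh hh; split; lra.
have lim (f : nat -> R) (l : R) : 0 <= l ->
    (forall k, f k.+1 = f k \/ f k.+1 = f k + l * h k.+1) ->
    exists x, forall k, f k <= x <= f k + l * h k.
  move=> l0 fS; have M := mono f l l0 fS.
  have ub k : ubound (range f) (f k + l * h k).
    move=> _ [j _ <-]; have [jk|/ltnW kj] := leqP j k.
      have := (M (k - j)%N j).1; rewrite subnK// => /le_trans->//.
      by rewrite lerDl mulr_ge0.
    have := (M (j - k)%N k).2; rewrite subnK//.
    by apply: le_trans; rewrite lerDl mulr_ge0.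
  exists (sup (range f)) => k; apply/andP; split.
    by apply: ub_le_sup; [exists (f 0%N + l * h 0%N); exact: ub|exists k].
  by apply: ge_sup; [exists (f 0%N); exists 0%N|exact: ub].
have [x0 x0P] := lim (fun k => (q k).1) s s0 (fun k => let: And3 h _ _ := qS k in h).
have [y0 y0P] := lim (fun k => (q k).2) t t0 (fun k => let: And3 _ h _ := qS k in h).
have x0ab : a <= x0 <= b.
  by have := x0P 0%N; rewrite /= /h expr0 mulr1 /s (addrC a) subrK.
have y0cd : c <= y0 <= d.
  by have := y0P 0%N; rewrite /= /h expr0 mulr1 /t (addrC c) subrK.
have [al [be loc]] := holo _ _ x0ab y0cd.
(* Makes the final bound [2 * eta * (s + t) ^+ 2] at most [A / 2], a contradiction. *)
pose eta := A / (4 * ((s + t) ^+ 2 + 1)).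
have st1 : 0 < (s + t) ^+ 2 + 1 by rewrite ltr_wpDl// sqr_ge0.
have eta0 : 0 < eta by rewrite divr_gt0// mulr_gt0.
have [de de0 deP] := loc _ eta0.
have [k kP] : exists k, (s + t) * h k <= de.
  have : (fun k => (s + t) * h k) @ \oo --> (s + t) * 0.
    by apply: cvgM; [exact: cvg_cst|apply: cvg_expr; rewrite ger0_norm ?invr_ge0// invf_lt1// ltr1n].
  rewrite mulr0 => /cvgrPdist_lt/(_ _ de0)[k _ kP]; exists k.
  have := kP k (leqnn _); rewrite sub0r normrN => /ltW/(le_trans _)->//.
  exact: ler_norm.
have small : `|J k (q k)| <= 2 * eta * ((s + t) * h k) ^+ 2.
  have E1 : (q k).1 + s * h k - (q k).1 = s * h k by rewrite addrC addKr.
  have E2 : (q k).2 + t * h k - (q k).2 = t * h k by rewrite addrC addKr.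
  have := @contour_small (q k).1 ((q k).1 + s * h k) (q k).2 ((q k).2 + t * h k)
    x0 y0 al be eta (x0P k) (y0P k) (ltW eta0).
  rewrite E1 E2 -mulrDl; apply => x y xk yk.
  have shk := mulr_ge0 s0 (h0 k); have thk := mulr_ge0 t0 (h0 k).
  have hx : `|x - x0| <= s * h k.
    have := x0P k; move: xk; rewrite ler_norml => /andP[i1 i2] /andP[i3 i4].
    by clear - i1 i2 i3 i4; apply/andP; split; lra.
  have hy : `|y - y0| <= t * h k.
    have := y0P k; move: yk; rewrite ler_norml => /andP[i1 i2] /andP[i3 i4].
    by clear - i1 i2 i3 i4; apply/andP; split; lra.
  have sth : (s + t) * h k = s * h k + t * h k by rewrite mulrDl.
  have kP' : s * h k + t * h k <= de by rewrite -sth.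
  have [||r1 r2] := deP x y.
  - by apply: le_trans hx (le_trans _ kP'); rewrite lerDl.
  - by apply: le_trans hy (le_trans _ kP'); rewrite lerDr.
  have le : eta * (`|x - x0| + `|y - y0|) <= eta * (s * h k + t * h k).
    by rewrite ler_pM2l// lerD.
  by rewrite sth; split; [exact: le_trans r1 le|exact: le_trans r2 le].
have := AJ k => hA.
have hh : 4 ^+ k * h k ^+ 2 = 1.
  rewrite /h -exprM mulnC exprM -exprMn.
  have -> : 4 * 2^-1 ^+ 2 = 1 :> R by field.
  by rewrite expr1n.
have : A <= 2 * eta * (s + t) ^+ 2.
  rewrite (le_trans hA)//.
  have -> : 2 * eta * (s + t) ^+ 2 = 4 ^+ k * (2 * eta * ((s + t) * h k) ^+ 2).
    rewrite exprMn.
    have -> : 4 ^+ k * (2 * eta * ((s + t) ^+ 2 * h k ^+ 2)) =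
      2 * eta * (s + t) ^+ 2 * (4 ^+ k * h k ^+ 2) by ring.
    by rewrite hh mulr1.
  by rewrite ler_wpM2l// exprn_ge0.
have etaE : eta * (4 * ((s + t) ^+ 2 + 1)) = A by rewrite /eta divfK// gt_eqF// mulr_gt0.
by have := sqr_ge0 (s + t); move: ((s + t) ^+ 2) etaE => m; clear - A0 eta0; nra.
Qed.

End goursat.

End interval_integral.

(** * Limits of polynomials are analytic *)

Section complex_topology.
Context {R : realType}.
Local Notation C := R[i].

Lemma posC (e : C) : 0 < e -> e = (Re e)%:C /\ 0 < Re e.
Proof. by case: e => a b; rewrite ltcE /= => /andP[/eqP -> a0]. Qed.

Lemma nbhs_complexP (x : C) (A : set C) :
  nbhs x A <-> exists2 d : R, 0 < d & forall y, nc (y - x) < d -> A y.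
Proof.
split=> [/nbhs_ballP[e /= e0 eA]|[d d0 dA]].
  have [eE e1] := posC e0; exists (Re e) => // y yx; apply: eA.
  by rewrite -ball_normE /ball_/= normE eE ltcR ncBC.
apply/nbhs_ballP; exists d%:C => /=; first by rewrite ltcR.
move=> y; rewrite -ball_normE /ball_/= normE ltcR => yx.
by apply: dA; rewrite ncBC.
Qed.

Lemma cvg_complexP (T : Type) (F : set_system T) (f : T -> C) (l : C) (FF : Filter F) :
  f x @[x --> F] --> l <-> forall e : R, 0 < e -> \forall x \near F, nc (f x - l) < e.
Proof.
split=> [fl e e0|fl A /nbhs_complexP[d d0 dA]].
  have := fl [set y | nc (y - l) < e]; apply.
  by apply/nbhs_complexP; exists e.
rewrite /= nbhs_simpl; have := fl _ d0; apply: filterS => x; exact: dA.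
Qed.

Lemma nbhs_rVP n (x : 'rV[C]_n) (A : set 'rV[C]_n) :
  nbhs x A <-> exists2 d : R, 0 < d &
    forall y : 'rV[C]_n, (forall i, nc (y ord0 i - x ord0 i) < d) -> A y.
Proof.
split=> [/nbhs_ballP[e /= e0 eA]|[d d0 dA]].
  have [eE e1] := posC e0; exists (Re e) => // y yx; apply: eA.
  split=> // i j; rewrite (ord1 i) -ball_normE /ball_/= normE eE ltcR ncBC.
  exact: yx.
apply/nbhs_ballP; exists d%:C => /=; first by rewrite ltcR.
move=> y [_ xy]; apply: dA => i; have := xy ord0 i.
by rewrite -ball_normE /ball_/= normE ltcR ncBC.
Qed.

Lemma nc_le_mx_norm n (h : 'rV[C]_n) i : (nc (h ord0 i))%:C <= `|h|.
Proof.
have h0 : 0 <= `|h| by [].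
have hE : `|h| = (Re `|h|)%:C.
  by move: h0; case: `|h| => a b; rewrite lecE /= => /andP[/eqP -> _].
rewrite hE lecR; apply/ler_addgt0Pr => e e0.
have : ball 0 (Re `|h| + e)%:C h.
  by rewrite -ball_normE /ball_/= sub0r normrN {1}hE ltcR ltrDl.
move=> [_ hb]; have := hb ord0 i; rewrite -ball_normE /ball_/= mxE sub0r normrN normE ltcR.
exact: ltW.
Qed.

Definition lform n (a : 'I_n -> C) (h : 'rV[C]_n) : C := \sum_i a i * h ord0 i.

Lemma lform_is_linear n (a : 'I_n -> C) : linear (lform a : _ -> C).
Proof.
move=> k u v; rewrite /lform scaler_sumr -big_split; apply: eq_bigr => i _.
by rewrite !mxE mulrDr mulrCA.
Qed.

HB.instance Definition _ n (a : 'I_n -> C) :=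
  GRing.isLinear.Build C 'rV[C]_n C _ (lform a) (lform_is_linear a).

Lemma lform_le n (a : 'I_n -> C) (h : 'rV[C]_n) (s : R) :
  (forall i, nc (h ord0 i) <= s) -> nc (lform a h) <= (\sum_i nc (a i)) * s.
Proof.
move=> hs; rewrite (le_trans (nc_sum _ _ _))// mulr_suml; apply: ler_sum => i _.
by rewrite Normc.normcM ler_wpM2l ?nc_ge0.
Qed.

(** Second-order Taylor bounds pass to uniform limits of polynomials, whereas the little-o condition
    does not do so directly; differentiability of limits is therefore read off from such a bound. *)
Lemma differentiable_quadratic n (f : 'rV[C]_n -> C) (x : 'rV[C]_n) (a : 'I_n -> C) (K d : R) :
  0 < d ->
  (forall (s : R) (h : 'rV[C]_n), s <= d -> (forall i, nc (h ord0 i) <= s) ->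
     nc (f (x + h) - f x - lform a h) <= K * s ^+ 2) ->
  differentiable f x.
Proof.
move=> d0 H.
have clf : continuous (lform a).
  move=> h; apply/(cvg_complexP _ _ (nbhs_filter h)) => e e0.
  pose M := \sum_i nc (a i) + 1.
  have M0 : 0 < M by rewrite ltr_wpDl// sumr_ge0// => i _; exact: nc_ge0.
  apply/nbhs_rVP; exists (e / M); first by rewrite divr_gt0.
  move=> y yh.
  have -> : lform a y - lform a h = lform a (y - h) by rewrite linearB.
  have := @lform_le n a (y - h) (e / M) => /(_ _)/le_lt_trans; apply.
    by move=> i; rewrite !mxE; exact/ltW/yh.
  rewrite mulrA ltr_pdivrMr// mulrC ltr_pM2l//.
  by rewrite /M ltrDl.
have E : f \o shift x = cst (f x) + lform a +o_ 0 id.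
  apply/eqaddoP => e e0; have [eE e1] := posC e0.
  pose K1 := Num.max K 1.
  have K10 : 0 < K1 by rewrite lt_max ltr01 orbT.
  pose r := Num.min d (Re e / K1).
  have r0 : 0 < r by rewrite lt_min d0 divr_gt0.
  apply/nbhs_rVP; exists r => // h hr.
  have hE : `|h| = (Re `|h|)%:C.
    have : 0 <= `|h| by [].
    by case: `|h| => u v; rewrite lecE /= => /andP[/eqP -> _].
  have h0 : 0 <= Re `|h| by have : 0 <= `|h| by []; rewrite {1}hE ler0c.
  have hi i : nc (h ord0 i) <= Re `|h| by rewrite -lecR -hE nc_le_mx_norm.
  have hr' : Re `|h| < r.
    have : ball 0 r%:C h.
      split=> [|i j]; first by rewrite ltcR.
      rewrite (ord1 i) -ball_normE /ball_/= mxE sub0r normrN normE ltcR.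
      by have := hr j; rewrite mxE subr0.
    by rewrite -ball_normE /ball_/= sub0r normrN hE ltcR.
  rewrite /= normE eE hE -rmorphM lecR.
  have -> : (f \o shift x - (cst (f x) + lform a)) h = f (x + h) - f x - lform a h.
    by rewrite [x + h]addrC -[RHS]addrA -opprD.
  apply: le_trans (H _ _ _ hi) _.
    by rewrite (le_trans (ltW hr'))// ge_min lexx.
  have : Re `|h| * K1 <= Re e.
    by rewrite -ler_pdivlMr// (le_trans (ltW hr'))// ge_min lexx orbT.
  have : K <= K1 by rewrite le_max lexx.
  by nra.
have dE := diff_unique clf E.
by apply/diff_locallyP; rewrite dE; split.
Qed.

(** An epsilon-delta form in terms of moduli, halfway between [differentiable] on rows, from which
    it is derived, and [locally_holo], to which it is fed. *)
Definition cdiff (g : C -> C) (w : C) := exists A : C,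
  forall eta : R, 0 < eta -> exists2 d : R, 0 < d & forall h, nc h < d ->
    nc (g (w + h) - g w - A * h) <= eta * nc h.

Lemma cdiffM (f g : C -> C) w : cdiff f w -> cdiff g w -> cdiff (fun z => f z * g z) w.
Proof.
move=> [A fA] [B gB]; exists (A * g w + f w * B) => eta eta0.
pose M := nc (f w) + nc (g w) + 1.
have M0 : 0 < M by rewrite ltr_wpDl// addr_ge0 ?nc_ge0.
pose K := (nc A + 1) * (nc B + 1).
have K0 : 0 < K by rewrite mulr_gt0// ltr_wpDl ?nc_ge0.
pose e1 := Num.min 1 (eta / (2 * M)).
have e10 : 0 < e1 by rewrite lt_min ltr01 divr_gt0// mulr_gt0.
have [d1 d10 fd] := fA _ e10; have [d2 d20 gd] := gB _ e10.
pose d := Num.min (Num.min d1 d2) (eta / (2 * K)).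
have d0 : 0 < d by rewrite !lt_min d10 d20 divr_gt0// mulr_gt0.
exists d => // h; rewrite !lt_min => /andP[/andP[h1 h2] h3].
have {}fd := fd h h1; have {}gd := gd h h2.
set rf := f (w + h) - f w - A * h in fd; set rg := g (w + h) - g w - B * h in gd.
have -> : f (w + h) * g (w + h) - f w * g w - (A * g w + f w * B) * h =
   f w * rg + g w * rf + (f (w + h) - f w) * (g (w + h) - g w).
  by rewrite /rf /rg; ring.
have e11 : e1 <= 1 by rewrite ge_min lexx.
have e12 : e1 * (2 * M) <= eta.
  by rewrite -ler_pdivlMr ?mulr_gt0// ge_min lexx orbT.
have h0 := nc_ge0 h.
have bf : nc (f (w + h) - f w) <= (nc A + 1) * nc h.
  have -> : f (w + h) - f w = rf + A * h by rewrite /rf subrK.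
  rewrite (le_trans (le_normcD _ _))// Normc.normcM mulrDl mul1r addrC lerD2l.
  by rewrite (le_trans fd)// ler_piMl.
have bg : nc (g (w + h) - g w) <= (nc B + 1) * nc h.
  have -> : g (w + h) - g w = rg + B * h by rewrite /rg subrK.
  rewrite (le_trans (le_normcD _ _))// Normc.normcM mulrDl mul1r addrC lerD2l.
  by rewrite (le_trans gd)// ler_piMl.
have -> : eta * nc h = eta / 2 * nc h + eta / 2 * nc h by lra.
rewrite (le_trans (le_normcD _ _))// lerD//.
  rewrite (le_trans (le_normcD _ _))// !Normc.normcM.
  apply: (@le_trans _ _ (nc (f w) * (e1 * nc h) + nc (g w) * (e1 * nc h))).
    by apply: lerD; rewrite ler_wpM2l ?nc_ge0.
  rewrite -mulrDl mulrA ler_wpM2r//.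
  have : nc (f w) + nc (g w) <= M by rewrite lerDl.
  have := nc_ge0 (f w); have := nc_ge0 (g w); nra.
rewrite Normc.normcM.
apply: (@le_trans _ _ (((nc A + 1) * nc h) * ((nc B + 1) * nc h))).
  by apply: ler_pM => //; exact: nc_ge0.
rewrite mulrACA -/K mulrA ler_wpM2r//.
have : nc h * (2 * K) < eta by rewrite -ltr_pdivlMr// mulr_gt0.
by lra.
Qed.

Lemma cdiff_comp (f g : C -> C) w : cdiff g w -> cdiff f (g w) -> cdiff (f \o g) w.
Proof.
move=> [B gB] [A fA]; exists (A * B) => eta eta0.
pose e1 := eta / (2 * (nc B + 1)).
have B1 : 0 < nc B + 1 by rewrite ltr_wpDl ?nc_ge0.
have e10 : 0 < e1 by rewrite divr_gt0// mulr_gt0.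
pose e2 := Num.min 1 (eta / (2 * (nc A + 1))).
have A1 : 0 < nc A + 1 by rewrite ltr_wpDl ?nc_ge0.
have e20 : 0 < e2 by rewrite lt_min ltr01 divr_gt0// mulr_gt0.
have [d1 d10 fd] := fA _ e10; have [d2 d20 gd] := gB _ e20.
exists (Num.min d2 (d1 / (nc B + 1))); first by rewrite lt_min d20 divr_gt0.
move=> h; rewrite lt_min => /andP[h2 h1]; have {}gd := gd h h2.
set rg := g (w + h) - g w - B * h in gd.
have e21 : e2 <= 1 by rewrite ge_min lexx.
have e22 : e2 * (2 * (nc A + 1)) <= eta.
  by rewrite -ler_pdivlMr ?mulr_gt0// ge_min lexx orbT.
pose k := g (w + h) - g w.
have h0 := nc_ge0 h.
have bg : nc k <= (nc B + 1) * nc h.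
  have -> : k = rg + B * h by rewrite /rg /k subrK.
  rewrite (le_trans (le_normcD _ _))// Normc.normcM mulrDl mul1r addrC lerD2l.
  by rewrite (le_trans gd)// ler_piMl.
have kd : nc k < d1 by rewrite (le_lt_trans bg)// mulrC -ltr_pdivlMr.
have {}fd := fd k kd.
have gk : g w + k = g (w + h) by rewrite /k addrC subrK.
rewrite gk in fd; set rf := _ - A * k in fd.
have -> : (f \o g) (w + h) - (f \o g) w - A * B * h = rf + A * rg.
  by rewrite /rf /rg /k /=; ring.
have -> : eta * nc h = eta / 2 * nc h + eta / 2 * nc h by lra.
rewrite (le_trans (le_normcD _ _))// lerD//.
  rewrite (le_trans fd)// (le_trans (ler_wpM2l (ltW e10) bg))//.
  rewrite mulrA ler_wpM2r// /e1 le_eqVlt; apply/orP; left; apply/eqP.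
  by field; rewrite gt_eqF.
rewrite Normc.normcM (le_trans (ler_wpM2l (nc_ge0 _) gd))// mulrA ler_wpM2r//.
have := nc_ge0 A; nra.
Qed.

Lemma cdiff_scale (a w : C) : cdiff (fun z => a * z) w.
Proof.
exists a => eta eta0; exists 1 => // h _.
have -> : a * (w + h) - a * w - a * h = 0 by ring.
by rewrite nc0 mulr_ge0 ?nc_ge0// ltW.
Qed.

Definition cexp (w : C) : C := (expR (Re w))%:C * cis (Im w).

Lemma cexpD v w : cexp (v + w) = cexp v * cexp w.
Proof. by rewrite /cexp ReD ImD expRD cisD rmorphM mulrACA. Qed.

Lemma derive_at0 (g : R -> R) (l : R) : is_derive (0 : R) (1 : R) g l ->
  forall eta : R, 0 < eta -> exists2 d : R, 0 < d & forall x, `|x| < d ->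
    `|g x - g 0 - l * x| <= eta * `|x|.
Proof.
move=> [dg gl] eta eta0.
have := derivable_nbhs dg; rewrite gl => /eqaddoP/(_ _ eta0).
move=> /nbhs_ballP[d /= d0 dP]; exists d => // x xd.
have /= := dP x; rewrite -ball_normE /ball_/= sub0r normrN => /(_ xd).
have -> : ((fun h : R => (g \o shift 0) (h *: 1)) -
   (cst (g 0) + (fun h : R => h *: l))) x = g x - g 0 - l * x.
  rewrite -[LHS]/(g (x *: 1 + 0) - (g 0 + x *: l)) addr0 opprD addrA.
  by rewrite -[x *: 1]/(x * 1) mulr1 -[x *: l]/(x * l) [x * l]mulrC.
by [].
Qed.

(** The real arithmetic behind the derivative of the exponential at 0: [x], [y], [z] stand for e^a,
    cos b and sin b, and [N] for the modulus of a + ib. *)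
Lemma cexp_error (x y z a b e N : R) : 0 <= x -> 0 < e -> e <= 1 -> N < e / 2 ->
  `|a| <= N -> `|b| <= N -> `|x - 1 - a| <= e * `|a| -> `|y - 1| <= e * `|b| ->
  `|z - b| <= e * `|b| ->
  `|x * y - 1 - a| <= 3 * e * N /\ `|x * z - b| <= 3 * e * N.
Proof.
move=> x0 e0 e1 Ne aN bN xa yb zb.
have ea : e * `|a| <= e * N by rewrite ler_pM2l.
have eb : e * `|b| <= e * N by rewrite ler_pM2l.
have xa' := le_trans xa ea; have yb' := le_trans yb eb; have zb' := le_trans zb eb.
have x2 : x <= 2.
  by move: xa' aN; rewrite !ler_norml => /andP[_ h1] /andP[_ h2]; clear - h1 h2 Ne e0 e1; nra.
have x1 : `|x - 1| <= e.
  have -> : x - 1 = (x - 1 - a) + a by rewrite subrK.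
  apply: le_trans (ler_normD _ _) (le_trans (lerD xa' aN) _).
  by clear - Ne e0 e1; nra.
split.
  have -> : x * y - 1 - a = x * (y - 1) + (x - 1 - a) by ring.
  apply: le_trans (ler_normD _ _) _; rewrite normrM (ger0_norm x0).
  have h : x * `|y - 1| <= 2 * (e * N) by apply: ler_pM.
  apply: le_trans (lerD h xa') _; rewrite le_eqVlt; apply/orP; left; apply/eqP; ring.
have -> : x * z - b = x * (z - b) + b * (x - 1) by ring.
apply: le_trans (ler_normD _ _) _; rewrite !normrM (ger0_norm x0).
have h : x * `|z - b| <= 2 * (e * N) by apply: ler_pM.
have h' : `|b| * `|x - 1| <= N * e by apply: ler_pM.
by apply: le_trans (lerD h h') _; rewrite le_eqVlt; apply/orP; left; apply/eqP; ring.
Qed.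

Lemma cdiff_cexp w : cdiff cexp w.
Proof.
exists (cexp w) => eta eta0.
have W0 : 0 < nc (cexp w) + 1 by rewrite ltr_wpDl ?nc_ge0.
pose e := Num.min 1 (eta / (6 * (nc (cexp w) + 1))).
have e0 : 0 < e by rewrite lt_min ltr01 divr_gt0// mulr_gt0.
have e1 : e <= 1 by rewrite ge_min lexx.
have e2 : e * (6 * (nc (cexp w) + 1)) <= eta.
  by rewrite -ler_pdivlMr ?mulr_gt0// ge_min lexx orbT.
have [d1 d10 xP] := derive_at0 (is_derive_expR 0) e0.
have [d2 d20 cP] := derive_at0 (is_derive_cos 0) e0.
have [d3 d30 sP] := derive_at0 (is_derive_sin 0) e0.
pose d := Num.min (Num.min d1 d2) (Num.min d3 (e / 2)).
have d0 : 0 < d by rewrite !lt_min d10 d20 d30 divr_gt0.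
exists d => // h; rewrite !lt_min => /andP[/andP[h1 h2] /andP[h3 h4]].
have ha := normc_ge_absRe h; have hb := normc_ge_absIm h.
set N := nc h in h1 h2 h3 h4 ha hb *.
set a := Re h in ha; set b := Im h in hb.
have {}xP := xP a (le_lt_trans ha h1).
have {}cP := cP b (le_lt_trans hb h2).
have {}sP := sP b (le_lt_trans hb h3).
rewrite expR0 mul1r in xP; rewrite cos0 sin0 oppr0 mul0r subr0 in cP.
rewrite sin0 cos0 mul1r subr0 in sP.
rewrite cexpD -[X in _ - X - _]mulr1 -!mulrBr Normc.normcM.
have key : nc (cexp h - 1 - h) <= 6 * e * N.
  rewrite (le_trans (nc_le_ReIm _))//.
  have -> : Re (cexp h - 1 - h) = expR a * cos b - 1 - a.
    by rewrite /cexp !ReD !ReN ReMr.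
  have -> : Im (cexp h - 1 - h) = expR a * sin b - b.
    by rewrite /cexp !ImD !ImN ImMr /= subr0.
  have N0 : 0 <= N by exact: nc_ge0.
  have x0 := expR_ge0 a.
  have [n1 n2] := cexp_error x0 e0 e1 h4 ha hb xP cP sP.
  by apply: le_trans (lerD n1 n2) _; rewrite -mulrDl -mulrDl -natrD.
apply: (@le_trans _ _ (nc (cexp w) * (6 * e * N))); first by rewrite ler_wpM2l ?nc_ge0.
rewrite mulrA ler_wpM2r ?nc_ge0//.
have := nc_ge0 (cexp w); nra.
Qed.

End complex_topology.

(** * Polynomial approximation of analytic functions *)

Section circle_mean.
Context {R : realType}.
Local Notation C := R[i].
Local Notation tau := (2 * pi : R).
Implicit Types (g h : R -> C).

Lemma tau_gt0 : 0 < tau.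
Proof. by rewrite mulr_gt0// pi_gt0. Qed.

Lemma ccontP g : continuous g <-> forall y (e : R), 0 < e ->
  exists2 d : R, 0 < d & forall x, `|x - y| < d -> nc (g x - g y) < e.
Proof.
split=> [cg y e e0|H y].
  have /(cvg_complexP _ _ (nbhs_filter y))/(_ _ e0) := cg y.
  move=> /nbhs_ballP[d /= d0 dP]; exists d => // x xy; apply: dP.
  by rewrite -ball_normE /ball_/= distrC.
apply/(cvg_complexP _ _ (nbhs_filter y)) => e e0.
have [d d0 dP] := H y e e0; apply/nbhs_ballP; exists d => //= x.
by rewrite -ball_normE /ball_/= distrC; exact: dP.
Qed.

Lemma ccont_ReIm g : continuous g <->
  continuous (fun x => Re (g x)) /\ continuous (fun x => Im (g x)).
Proof.
split=> [cg|[cr ci]].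
  split=> y; apply/cvgrPdist_lt => e e0;
    have /(cvg_complexP _ _ (nbhs_filter y))/(_ _ e0) := cg y;
    apply: filterS => x; apply: le_lt_trans; rewrite distrC.
  - by rewrite -ReN -ReD normc_ge_absRe.
  - by rewrite -ImN -ImD normc_ge_absIm.
move=> y; apply/(cvg_complexP _ _ (nbhs_filter y)) => e e0.
have e2 : 0 < e / 2 by rewrite divr_gt0.
have /cvgrPdist_lt/(_ _ e2) := cr y; have /cvgrPdist_lt/(_ _ e2) := ci y.
apply: filterS2 => x; rewrite distrC => xi; rewrite distrC => xr.
by rewrite (le_lt_trans (nc_le_ReIm _))// ReD ImD ReN ImN; lra.
Qed.

Lemma ccontD g h : continuous g -> continuous h -> continuous (fun x => g x + h x).
Proof.
move=> /ccont_ReIm[gr gi] /ccont_ReIm[hr hi]; apply/ccont_ReIm; split => y.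
  by under eq_fun do rewrite ReD; apply: cvgD; [exact: gr|exact: hr].
by under eq_fun do rewrite ImD; apply: cvgD; [exact: gi|exact: hi].
Qed.

Lemma ccontM g h : continuous g -> continuous h -> continuous (fun x => g x * h x).
Proof.
move=> /ccont_ReIm[gr gi] /ccont_ReIm[hr hi]; apply/ccont_ReIm; split => y.
  by under eq_fun do rewrite ReM; apply: cvgB; apply: cvgM; move: y.
by under eq_fun do rewrite ImM; apply: cvgD; apply: cvgM; move: y.
Qed.

Lemma ccont_cst (a : C) : continuous (fun _ : R => a).
Proof. by move=> x; exact: cvg_cst. Qed.

Lemma ccont_cis (k : R) : continuous (fun y => cis (k * y)).
Proof.
have ck : continuous (fun y : R => k * y) by move=> x; apply: cvgM; [exact: cvg_cst|exact: cvg_id].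
apply/ccont_ReIm; split => y.
  by apply: (@continuous_comp _ _ _ (fun y => k * y) cos); [exact: ck|exact: continuous_cos].
by apply: (@continuous_comp _ _ _ (fun y => k * y) sin); [exact: ck|exact: continuous_sin].
Qed.

Lemma ccont_shift g (p : R) : continuous g -> continuous (fun y => g (y + p)).
Proof.
move=> cg y; apply: (@continuous_comp _ _ _ (fun x => x + p) g); last exact: cg.
by apply: cvgD; [exact: cvg_id|exact: cvg_cst].
Qed.

Lemma ccont_sum (I : Type) (s : seq I) (G : I -> R -> C) :
  (forall i, continuous (G i)) -> continuous (fun y => \sum_(i <- s) G i y).
Proof.
move=> cG; elim: s => [|i s ih].
  by under eq_fun do rewrite big_nil; exact: ccont_cst.
have -> : (fun y => \sum_(j <- i :: s) G j y) = (fun y => G i y + \sum_(j <- s) G j y).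
  by apply/funext => y; rewrite big_cons.
exact: (ccontD (cG i) ih).
Qed.

Definition rmean (w : R -> R) : R := tau^-1 * In 0 tau w.

Definition mean g : C :=
  rmean (fun y => Re (g y)) +i* rmean (fun y => Im (g y)).

Lemma meanD g h : continuous g -> continuous h ->
  mean (fun y => g y + h y) = mean g + mean h.
Proof.
move=> /ccont_ReIm[gr gi] /ccont_ReIm[hr hi]; rewrite /mean /rmean.
under eq_fun do rewrite ReD; under [X in _ +i* (_ * In _ _ X)]eq_fun do rewrite ImD.
by rewrite !InD// !mulrDr.
Qed.

Lemma meanZ (a : C) g : continuous g -> mean (fun y => a * g y) = a * mean g.
Proof.
move=> /ccont_ReIm[gr gi]; rewrite /mean /rmean.
under eq_fun do rewrite ReM; under [X in _ +i* (_ * In _ _ X)]eq_fun do rewrite ImM.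
have cZ (k : R) (w : R -> R) : continuous w -> continuous (fun y => k * w y : R).
  by move=> cw y; apply: cvgM; [exact: cvg_cst|exact: cw].
rewrite InB ?InD ?InZ//; try exact: cZ.
by apply: complex_ext; rewrite ?ReM ?ImM /=; ring.
Qed.

Lemma mean_cst (a : C) : mean (fun=> a) = a.
Proof.
have t0 := tau_gt0; rewrite /mean /rmean !In_cst ?ltW// subr0.
have tV (x : R) : tau^-1 * (x * tau) = x by rewrite mulrCA mulVf ?mulr1// gt_eqF.
by rewrite !tV; case: a.
Qed.

Lemma mean_sum (I : Type) (s : seq I) (G : I -> R -> C) :
  (forall i, continuous (G i)) ->
  mean (fun y => \sum_(i <- s) G i y) = \sum_(i <- s) mean (G i).
Proof.
move=> cG; elim: s => [|i s ih].
  by under eq_fun do rewrite big_nil; rewrite mean_cst big_nil.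
under eq_fun do rewrite big_cons.
by rewrite meanD ?ih ?big_cons//; exact: ccont_sum.
Qed.

Lemma meanB g h : continuous g -> continuous h ->
  mean (fun y => g y - h y) = mean g - mean h.
Proof.
move=> cg ch; under eq_fun do rewrite -mulN1r.
have cN := ccontM (@ccont_cst (-1)) ch.
by rewrite (meanD cg cN) (meanZ _ ch) mulN1r.
Qed.

Lemma mean_le_rmean g (b : R -> R) : continuous g -> continuous b ->
  (forall y, 0 <= y <= tau -> nc (g y) <= b y) -> nc (mean g) <= rmean b.
Proof.
move=> cg cb gb; have [u [u1 uE]] := nc_polar (mean g).
have := meanZ u cg; rewrite uE => /(congr1 (@complex.Re R))/= <-.
have /ccont_ReIm[cr _] := ccontM (@ccont_cst u) cg.
rewrite ler_wpM2l ?invr_ge0 ?(ltW tau_gt0)//; apply: In_le => // y yt.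
rewrite (le_trans (ler_norm _))// (le_trans (normc_ge_absRe _))// Normc.normcM u1 mul1r.
exact: gb.
Qed.

Lemma rmean_cst (b : R) : rmean (fun=> b) = b.
Proof.
rewrite /rmean In_cst ?(ltW tau_gt0)// subr0 mulrCA mulVf ?mulr1// gt_eqF//.
exact: tau_gt0.
Qed.

Lemma mean_le g (M : R) : continuous g ->
  (forall y, 0 <= y <= tau -> nc (g y) <= M) -> nc (mean g) <= M.
Proof.
move=> cg gM; rewrite -[M]rmean_cst; apply: mean_le_rmean => // x; exact: cvg_cst.
Qed.

Lemma rmean_shift (w : R -> R) (p : R) : continuous w -> (forall y, w (y + tau) = w y) ->
  0 <= p <= tau -> rmean (fun y => w (y + p)) = rmean w.
Proof.
move=> cw wt /andP[p0 pt]; congr (_ * _).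
rewrite In_shift// add0r [RHS](In_split cw p0 pt).
have t0 := tau_gt0.
rewrite (@In_split _ p tau (tau + p)) ?lerDl// [RHS]addrC; congr (_ + _).
have := In_shift 0 p tau cw; rewrite add0r [p + _]addrC => <-.
by apply: eq_In => y _; rewrite wt.
Qed.

Lemma mean_shift g (p : R) : continuous g -> (forall y, g (y + tau) = g y) ->
  0 <= p <= tau -> mean (fun y => g (y + p)) = mean g.
Proof.
move=> /ccont_ReIm[cr ci] gt pt; congr Complex.
  by apply: (rmean_shift cr) => // y; rewrite gt.
by apply: (rmean_shift ci) => // y; rewrite gt.
Qed.

Lemma cis_int (k : int) : cis (k%:~R * tau) = 1.
Proof.
have c1 : cis tau = 1.
  have -> : tau = pi + pi :> R by rewrite mulr_natl mulr2n.
  by rewrite cisD cis_pi mulrNN mulr1.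
case: k => k; first by rewrite -pmulrn -cisX c1 expr1n.
by rewrite NegzE mulrNz mulNr -cisJ -pmulrn -cisX c1 expr1n; apply: complex_ext => //=; rewrite oppr0.
Qed.

(** A shift by the half-period pi / |k| multiplies the mean by -1, and by periodicity leaves it
    unchanged. *)
Lemma mean_cis (k : int) : mean (fun y => cis (k%:~R * y)) = (k == 0)%:R.
Proof.
have [->|k0] := eqVneq k 0.
  by under eq_fun do rewrite mul0r cis0; rewrite mean_cst.
have ck := @ccont_cis k%:~R.
have E p : 0 <= p <= tau -> cis (k%:~R * p) * mean (fun y => cis (k%:~R * y)) =
    mean (fun y => cis (k%:~R * y)).
  move=> pt; rewrite -meanZ// -[RHS](mean_shift ck _ pt).
    by congr mean; apply/funext => y; rewrite -cisD mulrDr addrC.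
  by move=> y; rewrite mulrDr cisD cis_int mulr1.
have kR : (k%:~R : R) != 0 by rewrite intr_eq0.
have kn : 1 <= `|k%:~R : R|.
  by rewrite -intr_norm (_ : 1 = 1%:~R)// ler_int -gtz0_ge1 normr_gt0.
have := E (pi / `|k%:~R|).
have -> : cis (k%:~R * (pi / `|k%:~R : R|)) = -1.
  have [kp|kn0] := ltrP 0 (k%:~R : R).
    by rewrite gtr0_norm// mulrCA mulfV// mulr1 cis_pi.
  rewrite ler0_norm// invrN mulrN mulrN mulrCA mulfV// mulr1 -cisJ cis_pi.
  by apply: complex_ext; rewrite ?ReJ ?ImJ//= !oppr0.
have p0 := pi_gt0 R.
rewrite mulN1r => /(_ _)/eqP; rewrite eqNr; move=> h; apply/eqP; apply: h.
have k1 : 0 < `|k%:~R : R| := lt_le_trans ltr01 kn.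
apply/andP; split; first by rewrite divr_ge0// ltW.
rewrite ler_pdivrMr//.
by rewrite (@le_trans _ _ (tau * 1))// ?ler_pM2l ?tau_gt0//; lra.
Qed.

Lemma In_riemann (w : R -> R) (d e : R) (N : nat) : continuous w -> 0 <= d ->
  (forall x y, `|x - y| <= d -> `|w x - w y| <= e) ->
  `|In 0 (N%:R * d) w - d * \sum_(m < N) w (m%:R * d)| <= e * (N%:R * d).
Proof.
move=> cw d0 we; elim: N => [|N ih].
  have w0 : `|In 0 0 w - w 0 * (0 - 0)| <= 0 * (0 - 0).
    apply: In_near_cst => // x; rewrite andbC => /le_anti ->.
    by rewrite subrr normr0.
  by move: w0; rewrite big_ord0 subrr !mulr0 !mul0r mulr0.
have Nd : 0 <= N%:R * d by rewrite mulr_ge0.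
have Sd : N.+1%:R * d = N%:R * d + d by rewrite -natr1 mulrDl mul1r.
rewrite big_ord_recr /= (@In_split _ 0 (N%:R * d))// ?Sd ?lerDl//.
have := @In_near_cst R (N%:R * d) (N%:R * d + d) (w (N%:R * d)) e w cw.
rewrite lerDl addrAC subrr add0r => /(_ d0) h.
have {h} h : `|In (N%:R * d) (N%:R * d + d) w - w (N%:R * d) * d| <= e * d.
  apply: h => x /andP[x1 x2]; apply: we; rewrite ger0_norm ?subr_ge0//; lra.
rewrite !mulrDr.
have -> : forall a b c s : R, a + b - (s + c) = (a - s) + (b - c) by move=> *; ring.
rewrite (le_trans (ler_normD _ _))// lerD// [d * _]mulrC; exact: h.
Qed.

(** An explicit error makes Riemann sums converge uniformly in parameters. The factor 2 comes from
    treating real and imaginary parts separately. *)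
Lemma mean_riemann g (e : R) (N : nat) : continuous g -> (0 < N)%N ->
  (forall x y, `|x - y| <= tau / N%:R -> nc (g x - g y) <= e) ->
  nc (mean g - N%:R^-1 * \sum_(m < N) g (m%:R * (tau / N%:R))) <= 2 * e.
Proof.
move=> /ccont_ReIm[cr ci] N0 ge; have t0 := tau_gt0.
pose d := tau / N%:R.
have NR : (0 : R) < N%:R by rewrite ltr0n.
have d0 : 0 <= d by rewrite divr_ge0// ltW.
have Nd : N%:R * d = tau by rewrite /d mulrCA mulfV ?mulr1// gt_eqF.
have H (w : R -> R) : continuous w ->
    (forall x y, `|x - y| <= d -> `|w x - w y| <= e) ->
    `|rmean w - N%:R^-1 * \sum_(m < N) w (m%:R * d)| <= e.
  move=> cw we; have := In_riemann N cw d0 we; rewrite Nd => h.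
  rewrite -(ler_pM2r t0) -{1}[tau](gtr0_norm t0) -normrM mulrBl.
  have -> : rmean w * tau = In 0 tau w by rewrite /rmean mulrAC mulVf ?mul1r// gt_eqF.
  by have -> : N%:R^-1 * (\sum_(m < N) w (m%:R * d)) * tau = d * \sum_(m < N) w (m%:R * d)
    by rewrite /d; ring.
have Nc : N%:R^-1 = (N%:R^-1 : R)%:C by rewrite fmorphV rmorph_nat.
have sR (F : 'I_N -> C) : Re (\sum_m F m) = \sum_m Re (F m).
  by apply: (big_morph (@complex.Re R) ReD).
have sI (F : 'I_N -> C) : Im (\sum_m F m) = \sum_m Im (F m).
  by apply: (big_morph (@complex.Im R) ImD).
have -> : 2 * e = e + e by lra.
rewrite (le_trans (nc_le_ReIm _))// ReD ImD ReN ImN Nc ReMr ImMr sR sI.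
apply: lerD; apply: H => // x y xy; apply: le_trans (ge _ _ xy).
  by rewrite -ReN -ReD normc_ge_absRe.
by rewrite -ImN -ImD normc_ge_absIm.
Qed.

End circle_mean.

(** * Fourier coefficients along the rotation of one coordinate *)

Section fourier_coefficients.
Context {R : realType} {n : nat}.
Local Notation C := R[i].
Local Notation T := 'rV[C]_n.
Local Notation tau := (2 * pi : R).
Implicit Types (f g : T -> C) (z w : T) (i j : 'I_n).

Definition scl i (a : C) z : T := rot (fun k => if k == i then a else 1) z.

Lemma scl_scl i a b z : scl i a (scl i b z) = scl i (a * b) z.
Proof. by apply/rowP => k; rewrite !mxE; case: eqP => _; rewrite ?mul1r// mulrA. Qed.

Lemma scl_comm i j a b z : i != j -> scl i a (scl j b z) = scl j b (scl i a z).
Proof.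
move=> ij; apply/rowP => k; rewrite !mxE; case: eqP => [->|_]; last by rewrite !mul1r.
by rewrite (negbTE ij) !mul1r.
Qed.

Lemma scl1 i z : scl i 1 z = z.
Proof. by apply/rowP => k; rewrite !mxE; case: ifP; rewrite mul1r. Qed.

Lemma enorm_scl i a z : nc a = 1 -> enorm (scl i a z) = enorm z.
Proof. by move=> a1; apply: enorm_rot => k; case: ifP; rewrite ?nc1. Qed.

Lemma enorm_scl_le i a z : nc a <= 1 -> enorm (scl i a z) <= enorm z.
Proof.
move=> a1; apply: enorm_le => k; rewrite mxE Normc.normcM ler_piMl ?nc_ge0//.
by case: ifP; rewrite ?nc1.
Qed.

Lemma ball_scl i a z : nc a <= 1 -> unit_ball z -> unit_ball (scl i a z).
Proof. by move=> a1; apply: le_lt_trans; exact: enorm_scl_le. Qed.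

Lemma scl_near i a b z r : enorm z <= r -> r < 1 ->
  forall k, nc (scl i a z ord0 k - scl i b z ord0 k) <= nc (a - b).
Proof.
move=> zr r1 k; rewrite !mxE -mulrBl Normc.normcM.
have z1 : nc (z ord0 k) <= 1.
  by rewrite (le_trans (nc_le_enorm _ _))// (le_trans zr)// ltW.
case: ifP => _; first by rewrite ler_piMr ?nc_ge0.
by rewrite subrr nc0 mul0r nc_ge0.
Qed.

(** Uniformity on each smaller ball is part of the definition: compactness is used once, for
    analytic functions, and the closure properties below are plain estimates. *)
Definition ucont f := forall r e : R, r < 1 -> 0 < e -> exists2 d : R, 0 < d &
  forall z w, enorm z <= r -> enorm w <= r ->
    (forall i, nc (z ord0 i - w ord0 i) <= d) -> nc (f z - f w) <= e.

(** The segment from 0 to [z] is cut into finitely many steps, on each of which [f] moves by at most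
    1. *)
Lemma ucont_bounded f r : ucont f -> r < 1 ->
  exists2 B : R, 0 <= B & forall z, enorm z <= r -> nc (f z) <= B.
Proof.
move=> uf r1; have [d d0 dP] := uf r 1 r1 ltr01.
have [N Nd] : exists N : nat, d^-1 < N.+1%:R.
  exists (Num.truncn d^-1); exact: truncnS_gt.
have N1 : (0 : R) < N.+1%:R by rewrite ltr0n.
exists (nc (f 0) + N.+1%:R); first by rewrite addr_ge0 ?nc_ge0.
move=> z zr; have r0 := le_trans (enorm_ge0 z) zr.
pose p m : T := (m%:R / N.+1%:R : R)%:C *: z.
have pr m : (m <= N.+1)%N -> enorm (p m) <= r.
  move=> mN; rewrite enormZr; last by rewrite divr_ge0.
  rewrite (le_trans _ zr)// ler_piMl ?enorm_ge0// ler_pdivrMr// mul1r ler_nat//.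
have key m : (m <= N.+1)%N -> nc (f (p m) - f (p 0%N)) <= m%:R.
  elim: m => [|m ih] mN; first by rewrite subrr nc0.
  rewrite -(subrKA (f (p m))) addrC; apply: le_trans (le_normcD _ _) _; rewrite -natr1.
  apply: (lerD (ih (ltnW mN))).
  apply: dP; rewrite ?pr// ?(ltnW mN)// => k.
  rewrite !mxE -mulrBl -rmorphB -mulrBl -natr1 addrAC subrr add0r mul1r.
  rewrite Normc.normcM ncR_ge0; last by rewrite invr_ge0.
  rewrite ler_pdivrMl//.
  have : nc (z ord0 k) <= 1 by rewrite (le_trans (nc_le_enorm _ _))// (le_trans zr)// ltW.
  move=> /le_trans -> //; rewrite -ler_pdivrMr// mul1r; exact: ltW.
have := key N.+1 (leqnn _).
have -> : p N.+1 = z by rewrite /p divff ?gt_eqF// scale1r.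
have -> : p 0%N = 0 by rewrite /p mul0r scale0r.
move=> h; have -> : f z = f 0 + (f z - f 0) by rewrite addrC subrK.
by rewrite (le_trans (le_normcD _ _))// lerD.
Qed.

Lemma cis_ucont (e : R) : 0 < e ->
  exists2 d : R, 0 < d & forall x y, `|x - y| <= d -> nc (cis x - cis y) <= e.
Proof.
move=> e0; have /ccontP/(_ 0 e e0)[d d0 dP] := @ccont_cis R 1.
exists (d / 2); first by rewrite divr_gt0.
move=> x y xy.
have -> : cis x - cis y = cis y * (cis (x - y) - 1).
  by rewrite mulrBr -cisD mulr1 [y + _]addrC subrK.
rewrite Normc.normcM nc_cis mul1r; have := dP (x - y).
rewrite subr0 mul1r mulr0 cis0 => /(_ _)/ltW; apply.
by rewrite (le_lt_trans xy)//; lra.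
Qed.

Lemma ucont_orbit f i r e : ucont f -> r < 1 -> 0 < e -> exists2 d : R, 0 < d &
  forall x y z, enorm z <= r -> `|x - y| <= d ->
    nc (f (scl i (cis x) z) - f (scl i (cis y) z)) <= e.
Proof.
move=> uf r1 e0; have [d d0 dP] := uf r e r1 e0.
have [d' d'0 d'P] := cis_ucont d0; exists d' => // x y z zr xy.
apply: dP => [||k]; rewrite ?enorm_scl ?nc_cis//.
by rewrite (le_trans (scl_near _ _ _ zr r1 _))// d'P.
Qed.

Lemma orbit_cont f i z : ucont f -> unit_ball z ->
  continuous (fun y => f (scl i (cis y) z)).
Proof.
move=> uf bz; apply/ccontP => y e e0.
have [d d0 dP] := @ucont_orbit f i (enorm z) (e / 2) uf bz ltac:(by rewrite divr_gt0).
exists d => // x /ltW xy; rewrite (le_lt_trans (dP _ _ _ _ xy))//; lra.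
Qed.

(** For a power series this is the part of degree [k] in the coordinate [i]. It is kept as a
    function of [z], so that coefficients in another coordinate can be taken next. *)
Definition coef i (k : int) f z : C :=
  mean (fun y => f (scl i (cis y) z) * cis ((- k)%:~R * y)).

Let coef_cont f i (k : int) z : ucont f -> unit_ball z ->
  continuous (fun y => f (scl i (cis y) z) * cis ((- k)%:~R * y)).
Proof. by move=> uf bz; apply: ccontM; [exact: orbit_cont|exact: ccont_cis]. Qed.

Lemma coef_le f i k z B : ucont f -> unit_ball z ->
  (forall w, enorm w = enorm z -> nc (f w) <= B) -> nc (coef i k f z) <= B.
Proof.
move=> uf bz fB; apply: mean_le; first exact: coef_cont.
move=> y _; rewrite Normc.normcM nc_cis mulr1; apply: fB.
by rewrite enorm_scl ?nc_cis.
Qed.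

Lemma coefB_le f g i k z w e : ucont f -> ucont g -> unit_ball z -> unit_ball w ->
  (forall y, nc (f (scl i (cis y) z) - g (scl i (cis y) w)) <= e) ->
  nc (coef i k f z - coef i k g w) <= e.
Proof.
move=> uf ug bz bw fg; rewrite /coef -meanB; [|exact: coef_cont..].
apply: mean_le.
  apply: ccontD; first exact: coef_cont.
  under eq_fun do rewrite -mulN1r.
  by apply: ccontM; [exact: ccont_cst|exact: coef_cont].
by move=> y _; rewrite -mulrBl Normc.normcM nc_cis mulr1.
Qed.

Lemma ucont_coef f i k : ucont f -> ucont (coef i k f).
Proof.
move=> uf r e r1 e0; have [d d0 dP] := uf r e r1 e0; exists d => // z w zr wr zw.
apply: coefB_le => //; try exact: (le_lt_trans _ r1).
move=> y; apply: dP => [||l]; rewrite ?enorm_scl ?nc_cis//.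
rewrite !mxE -mulrBr Normc.normcM.
by case: ifP; rewrite ?nc_cis ?nc1 mul1r.
Qed.

Lemma ucontZ a f : ucont f -> ucont (fun z => a * f z).
Proof.
move=> uf r e r1 e0; have a1 : 0 < nc a + 1 by rewrite ltr_wpDl ?nc_ge0.
have [d d0 dP] := uf r (e / (nc a + 1)) r1 ltac:(by rewrite divr_gt0).
exists d => // z w zr wr zw; rewrite -mulrBr Normc.normcM.
have := dP z w zr wr zw; rewrite ler_pdivlMr// => h.
have := nc_ge0 (f z - f w); nra.
Qed.

Lemma ucont_sum N (F : 'I_N -> T -> C) : (forall m, ucont (F m)) ->
  ucont (fun z => \sum_m F m z).
Proof.
move=> uF r e r1 e0.
have N0 : 0 < N%:R + 1 :> R by rewrite ltr_wpDl.
have /choice[d dP] m : exists d, 0 < d /\ forall z w, enorm z <= r -> enorm w <= r ->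
    (forall i, nc (z ord0 i - w ord0 i) <= d) -> nc (F m z - F m w) <= e / (N%:R + 1).
  by have [|d d0 dP] := uF m r (e / (N%:R + 1)) r1; [rewrite divr_gt0|exists d].
exists (\big[Num.min/1]_m d m).
  by apply: (big_ind (fun x : R => 0 < x)) => // [x y x0 y0|m _]; [rewrite lt_min x0|have [] := dP m].
move=> z w zr wr zw; rewrite -sumrB (le_trans (nc_sum _ _ _))//.
apply: (@le_trans _ _ (\sum_(m < N) (e / (N%:R + 1)))).
  apply: ler_sum => m _; have [_ h] := dP m; apply: h => // l.
  by rewrite (le_trans (zw l))//; exact: bigmin_le_cond.
rewrite sumr_const card_ord -[X in X <= _]mulr_natr mulrAC ler_pdivrMr// ler_pM2l//.
by rewrite lerDl.
Qed.

Lemma ucont_scl f j u : nc u = 1 -> ucont f -> ucont (fun z => f (scl j u z)).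
Proof.
move=> u1 uf r e r1 e0; have [d d0 dP] := uf r e r1 e0; exists d => // z w zr wr zw.
apply: dP => [||l]; rewrite ?enorm_scl// !mxE -mulrBr Normc.normcM.
by case: ifP; rewrite ?nc1 ?u1 mul1r.
Qed.

(** The trace of analyticity used for approximation. Unlike differentiability, it is inherited by
    the coefficients through locally uniform limits, which allows an induction on the
    coordinates. *)
Definition dilates f := forall i (k : int) (x : R) z, x <= 0 -> unit_ball z ->
  coef i k f (scl i (expR x)%:C z) = (expR (k%:~R * x))%:C * coef i k f z.

Definition good f := ucont f /\ dilates f.

Lemma nc_exp (x : R) : nc (expR x)%:C = expR x.
Proof. by rewrite ncR_ge0 ?expR_ge0. Qed.

Lemma nc_le_small (a : C) (K : R) : (forall e : R, 0 < e -> nc a <= K * e) -> a = 0.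
Proof.
move=> h; apply/eqP; rewrite -nc_eq0 eq_le nc_ge0 andbT.
apply/ler_addgt0Pr => e e0; rewrite add0r.
have K1 : 0 < `|K| + 1 by rewrite ltr_wpDl.
rewrite (le_trans (h (e / (`|K| + 1)) _)) ?divr_gt0// mulrCA ger_pMr//.
rewrite ler_pdivrMr// mul1r (le_trans (ler_norm _))// lerDl//.
Qed.

Lemma good_lim f : ucont f ->
  (forall r e : R, r < 1 -> 0 < e -> exists2 g, good g &
    forall z, enorm z <= r -> nc (f z - g z) <= e) -> good f.
Proof.
move=> uf H; split=> // i k x z x0 bz.
have ex : expR x <= 1 by rewrite -expR0 ler_expR.
apply/eqP; rewrite -subr_eq0; apply/eqP.
apply: (@nc_le_small _ (1 + expR (k%:~R * x))) => e e0.
have [g [ug gg] fg] := H (enorm z) e bz e0.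
pose sz := scl i (expR x)%:C z.
have zz : enorm sz <= enorm z by apply: enorm_scl_le; rewrite nc_exp.
have bs : unit_ball sz by exact: le_lt_trans bz.
have h1 : nc (coef i k f sz - coef i k g sz) <= e.
  by apply: coefB_le => // y; apply: fg; rewrite enorm_scl ?nc_cis.
have h2 : nc (coef i k g z - coef i k f z) <= e.
  by rewrite ncBC; apply: coefB_le => // y; apply: fg; rewrite enorm_scl ?nc_cis.
have -> : coef i k f sz - (expR (k%:~R * x))%:C * coef i k f z =
  (coef i k f sz - coef i k g sz) + (expR (k%:~R * x))%:C * (coef i k g z - coef i k f z).
  by rewrite gg//; ring.
rewrite (le_trans (le_normcD _ _))// mulrDl mul1r lerD// Normc.normcM nc_exp.
by rewrite ler_pM2l ?expR_gt0.
Qed.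

Lemma coefZ a f i k z : ucont f -> unit_ball z ->
  coef i k (fun z => a * f z) z = a * coef i k f z.
Proof.
move=> uf bz; rewrite /coef -meanZ; last exact: coef_cont.
by congr mean; apply/funext => y; rewrite mulrA.
Qed.

Lemma coef_sum N (F : 'I_N -> T -> C) i k z : (forall m, ucont (F m)) -> unit_ball z ->
  coef i k (fun z => \sum_m F m z) z = \sum_m coef i k (F m) z.
Proof.
move=> uF bz; rewrite /coef -mean_sum; last by move=> m; exact: coef_cont.
by congr mean; apply/funext => y; rewrite mulr_suml.
Qed.

Lemma coef_scl f i j k u z : coef i k (fun z => f (scl j u z)) z = coef i k f (scl j u z).
Proof.
congr mean; apply/funext => y; congr (f _ * _).
have [->|ij] := eqVneq i j; last exact/esym/scl_comm.
by rewrite !scl_scl mulrC.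
Qed.

Lemma good_scl f j u : nc u = 1 -> good f -> good (fun z => f (scl j u z)).
Proof.
move=> u1 [uf df]; split; first exact: ucont_scl.
move=> i k x z x0 bz; rewrite !coef_scl.
have -> : scl j u (scl i (expR x)%:C z) = scl i (expR x)%:C (scl j u z).
  have [->|ij] := eqVneq i j; first by rewrite !scl_scl [u * _]mulrC.
  exact/esym/scl_comm.
by apply: df => //; apply: ball_scl; rewrite ?u1.
Qed.

Lemma goodZ a f : good f -> good (fun z => a * f z).
Proof.
move=> [uf df]; split; first exact: ucontZ.
move=> i k x z x0 bz; rewrite !coefZ//; first by rewrite df// mulrCA.
by apply: ball_scl => //; rewrite nc_exp -expR0 ler_expR.
Qed.

Lemma good_sum N (F : 'I_N -> T -> C) : (forall m, good (F m)) ->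
  good (fun z => \sum_m F m z).
Proof.
move=> gF; have uF m : ucont (F m) by have [] := gF m.
split; first exact: ucont_sum.
move=> i k x z x0 bz; rewrite !coef_sum//.
  by rewrite mulr_sumr; apply: eq_bigr => m _; have [_ ->] := gF m.
by apply: ball_scl => //; rewrite nc_exp -expR0 ler_expR.
Qed.

(** A coefficient is a locally uniform limit of Riemann sums, and these are finite combinations of
    rotated copies of [f]. Iterated integrals are thereby avoided. *)
Lemma good_coef f i k : good f -> good (coef i k f).
Proof.
move=> gf; have [uf df] := gf; apply: good_lim; first exact: ucont_coef.
move=> r e r1 e0; have [B B0 fB] := ucont_bounded uf r1.
have e4 : 0 < e / 4 by rewrite divr_gt0.
have e5 : 0 < e / 4 / (B + 1) by rewrite divr_gt0// ltr_wpDl.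
have [d1 d10 d1P] := ucont_orbit i uf r1 e4.
have [d2 d20 d2P] := cis_ucont e5.
pose kk := `|(- k)%:~R : R| + 1.
have kk0 : 0 < kk by rewrite ltr_wpDl.
pose d := Num.min d1 (d2 / kk).
have d0 : 0 < d by rewrite lt_min d10 divr_gt0.
have [N Nd] : exists N : nat, tau / d < N.+1%:R.
  exists (Num.truncn (tau / d)); exact: truncnS_gt.
have N1 : (0 : R) < N.+1%:R by rewrite ltr0n.
pose th (m : 'I_N.+1) : R := m%:R * (tau / N.+1%:R).
exists (fun z => \sum_(m < N.+1) (N.+1%:R^-1 * cis ((- k)%:~R * th m)) * f (scl i (cis (th m)) z)).
  by apply: good_sum => m; apply: goodZ; apply: good_scl => //; rewrite nc_cis.
move=> z zr; have bz : unit_ball z by exact: le_lt_trans r1.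
have -> : \sum_(m < N.+1) (N.+1%:R^-1 * cis ((- k)%:~R * th m)) * f (scl i (cis (th m)) z) =
   N.+1%:R^-1 * \sum_(m < N.+1) f (scl i (cis (th m)) z) * cis ((- k)%:~R * th m).
  by rewrite mulr_sumr; apply: eq_bigr => m _; rewrite -mulrA [cis _ * _]mulrC.
have -> : e = 2 * (e / 4 + e / 4) by lra.
apply: mean_riemann => //; first exact: coef_cont.
move=> x y xy.
have {}xy : `|x - y| <= d.
  by rewrite (le_trans xy)// ler_pdivrMr// [d * _]mulrC -ler_pdivrMr// ltW.
set a := f _; set b := f _; set u := cis (_ * x); set v := cis (_ * y).
have -> : a * u - b * v = (a - b) * u + b * (u - v) by ring.
rewrite (le_trans (le_normcD _ _))// !Normc.normcM nc_cis mulr1 lerD//.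
  by apply: d1P => //; rewrite (le_trans xy)// ge_min lexx.
have hb : nc b <= B by apply: fB; rewrite enorm_scl ?nc_cis.
have huv : nc (u - v) <= e / 4 / (B + 1).
  apply: d2P; rewrite -mulrBr normrM.
  have : `|x - y| <= d2 / kk by rewrite (le_trans xy)// ge_min lexx orbT.
  rewrite ler_pdivlMr// => /(le_trans _) -> //.
  by rewrite mulrC ler_wpM2l// lerDl.
rewrite (le_trans (ler_pM (nc_ge0 _) (nc_ge0 _) hb huv))//.
by rewrite mulrCA ger_pMr// ler_pdivrMr ?ltr_wpDl// mul1r lerDl.
Qed.

Lemma cis_surj (u : C) : nc u = 1 -> exists2 t : R, 0 <= t <= tau & u = cis t.
Proof.
move=> u1; have p0 := pi_gt0 R.
have h : Re u ^+ 2 + Im u ^+ 2 = 1 by rewrite -normc_sqr u1 expr1n.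
have r1 : -1 <= Re u <= 1.
  by rewrite -ler_norml (le_trans (normc_ge_absRe u))// u1.
have a0 := acos_ge0 r1; have api := acos_lepi r1.
have ca := acosK r1.
have sa : sin (acos (Re u)) = `|Im u|.
  by rewrite sin_acos// -h [_ + Im u ^+ 2]addrC addrK sqrtr_sqr.
have [i0|i0] := leP 0 (Im u).
  exists (acos (Re u)); first by apply/andP; split; lra.
  by apply: complex_ext; rewrite /= ?ca ?sa ?ger0_norm.
exists (tau - acos (Re u)); first by apply/andP; split; lra.
have -> : tau - acos (Re u) = - acos (Re u) + pi + pi by lra.
by apply: complex_ext; rewrite /= ?cosDpi ?sinDpi ?cosN ?sinN !opprK ?ca ?sa// ltr0_norm// opprK.
Qed.

Definition hom i f (k : nat) := forall (a : C) z, nc a <= 1 -> unit_ball z ->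
  f (scl i a z) = a ^+ k * f z.

(** As [x] tends to minus infinity the factor [expR (k%:~R * x)] blows up while the coefficients
    stay bounded. At [x = - e^-1] the factor is at least [e^-1], whence a bound [B * e]. *)
Lemma coef_neg f i k z : good f -> k < 0 -> unit_ball z -> coef i k f z = 0.
Proof.
move=> [uf df] k0 bz; have [B B0 fB] := ucont_bounded uf bz.
apply: (@nc_le_small _ B) => e e0.
have k1 : (k%:~R : R) <= -1 by rewrite (_ : -1 = (-1)%:~R)// ler_int -ltzD1 addrC subrr.
have eV : 0 < e^-1 by rewrite invr_gt0.
have := df i k (- e^-1) z ltac:(by rewrite oppr_le0 ltW) bz.
move=> /(congr1 (@nc R)); rewrite Normc.normcM nc_exp => E.
have bs : unit_ball (scl i (expR (- e^-1))%:C z).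
  by apply: ball_scl => //; rewrite nc_exp -expR0 ler_expR oppr_le0 ltW.
have : nc (coef i k f (scl i (expR (- e^-1))%:C z)) <= B.
  apply: coef_le => // w wE; apply: fB; rewrite wE.
  by apply: enorm_scl_le => //; rewrite nc_exp -expR0 ler_expR oppr_le0 ltW.
rewrite E mulrN => h.
have := @expR_ge1Dx R (- (k%:~R * e^-1)) => hx.
rewrite -ler_pdivrMr//.
apply: le_trans h; rewrite mulrC ler_wpM2r ?nc_ge0//.
by apply: le_trans hx; nra.
Qed.

(** For unimodular [a] this is a shift of the mean, for positive [a] it is the dilation law, and the
    polar form combines both. The value at [a = 0] follows by continuity from small positive [t]. *)
Lemma coef_hom f i (k : nat) : good f -> hom i (coef i k f) k.
Proof.
move=> gf; have [uf df] := gf.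
have hu u z : nc u = 1 -> unit_ball z -> coef i k f (scl i u z) = u ^+ k * coef i k f z.
  move=> /cis_surj[t tt ->] bz.
  have cy y : cis ((- (k%:Z))%:~R * (y + tau)) = cis ((- k%:Z)%:~R * y) :> C.
    by rewrite mulrDr cisD cis_int mulr1.
  have pt y : cis (y + tau) = cis y :> C.
    by rewrite cisD -[tau]mul1r (cis_int (1 : int)) mulr1.
  have := @mean_shift R (fun y => f (scl i (cis y) z) * cis ((- k%:Z)%:~R * y)) t.
  rewrite -/(coef i k f z) => <- //; last 2 first.
  - exact: coef_cont.
  - by move=> y; rewrite cy pt.
  rewrite -meanZ; last by apply: (@ccont_shift _ (fun y => f (scl i (cis y) z) * cis ((- k%:Z)%:~R * y))); exact: coef_cont.
  congr mean; apply/funext => y; rewrite scl_scl -cisD mulrCA; congr (_ * _).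
  by rewrite cisX -cisD; congr cis; rewrite mulrNz -pmulrn; ring.
have hn a z : a != 0 -> nc a <= 1 -> unit_ball z -> coef i k f (scl i a z) = a ^+ k * coef i k f z.
  move=> a0 a1 bz; have na : 0 < nc a by rewrite nc_gt0.
  have [u [u1 uE]] := nc_polar a.
  have aE : a = conjc u * (expR (ln (nc a)))%:C.
    rewrite lnK ?posrE// -uE mulrA [conjc u * u]mulrC mulcJ u1 expr1n mul1r//.
  have l0 : ln (nc a) <= 0 by apply: ln_le0.
  rewrite aE -scl_scl hu ?ncJ//; last first.
    by apply: ball_scl => //; rewrite nc_exp -expR0 ler_expR.
  rewrite df// exprMn -mulrA; congr (_ * (_ * _)).
  by rewrite -pmulrn expRM_natl rmorphXn.
move=> a z a1 bz; have [->|a0] := eqVneq a 0; last exact: hn.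
apply/eqP; rewrite -subr_eq0; apply/eqP.
pose c := coef i k f z.
apply: (@nc_le_small _ 2) => e e0.
have [d d0 dP] := @ucont_coef f i k uf _ e bz e0.
have c1 : 0 < nc c + 1 by rewrite ltr_wpDl ?nc_ge0.
pose t := Num.min (Num.min 1 d) (e / (nc c + 1)).
have t0 : 0 < t by rewrite !lt_min ltr01 d0 divr_gt0.
have t1 : t <= 1 by rewrite !ge_min lexx.
have td : t <= d by rewrite !ge_min lexx orbT.
have te : t * (nc c + 1) <= e by rewrite -ler_pdivlMr// ge_min lexx orbT.
have tn : nc t%:C = t by rewrite ncR_ge0// ltW.
have h : nc (coef i k f (scl i 0 z) - t%:C ^+ k * c) <= e.
  rewrite -hn ?tn//; last by rewrite -nc_eq0 tn gt_eqF.
  apply: dP => [||l].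
  - by apply: enorm_scl_le; rewrite nc0.
  - by apply: enorm_scl_le; rewrite tn.
  by rewrite (le_trans (scl_near _ _ _ (lexx _) bz _))// ncBC subr0 tn.
have -> : coef i k f (scl i 0 z) - 0 ^+ k * coef i k f z =
   (coef i k f (scl i 0 z) - t%:C ^+ k * c) + (t%:C ^+ k - 0 ^+ k) * c by rewrite -/c; ring.
have -> : 2 * e = e + e by lra.
rewrite (le_trans (le_normcD _ _))// lerD// Normc.normcM.
apply: le_trans te; apply: ler_pM; rewrite ?nc_ge0//; last by rewrite lerDl.
case: (k) => [|l]; first by rewrite !expr0 subrr nc0 ltW.
rewrite expr0n/= subr0 ncX tn exprS ger_pMr// exprn_ile1// ltW//.
Qed.

Lemma coef_hom_ex f i k : good f -> exists l, hom i (coef i k f) l.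
Proof.
move=> gf; case: k => k; first by exists k; exact: coef_hom.
by exists 0%N => a z a1 bz; rewrite !coef_neg ?mulr0//; exact: ball_scl.
Qed.

Lemma hom_coef f i j k l : ucont f -> i != j -> hom j f l -> hom j (coef i k f) l.
Proof.
move=> uf ij hf a z a1 bz; rewrite /coef -meanZ; last exact: coef_cont.
congr mean; apply/funext => y; rewrite scl_comm// hf// ?mulrA//.
by apply: ball_scl; rewrite ?nc_cis.
Qed.

End fourier_coefficients.

(** * Approximation by sums of homogeneous parts *)

Section polynomial_approximation.
Context {R : realType} {n : nat}.
Local Notation C := R[i].
Local Notation T := 'rV[C]_n.
Implicit Types (f g : T -> C) (z w : T) (i j : 'I_n).

(** Coefficients of the nonnegative trigonometric polynomial (2 + 2 cos y)^M, divided by the central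
    one so that the kernel has mean 1. The index [k] stands for the frequency [k - M]. *)
Definition kercoef (M k : nat) : R := 'C(M.*2, k)%:R / 'C(M.*2, M)%:R.

Definition kernel (M : nat) (y : R) : C :=
  \sum_(k < M.*2.+1) (kercoef M k)%:C * cis ((k%:Z - M%:Z)%:~R * y).

Lemma mul_1D_unit (u v : C) : u * v = 1 -> (1 + v) * (1 + u) = u * (1 + v) ^+ 2.
Proof.
move=> uv; have -> : u * (1 + v) ^+ 2 = u + (u * v) * (2 + v) by ring.
have -> : (1 + v) * (1 + u) = 1 + u + v + u * v by ring.
by rewrite uv; ring.
Qed.

Lemma kernelE M y :
  kernel M y = ((nc (1 + cis y) ^+ 2) ^+ M / 'C(M.*2, M)%:R)%:C.
Proof.
have h : (nc (1 + cis y) ^+ 2)%:C = cis (- y) * (1 + cis y) ^+ 2 :> C.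
  rewrite -mulcJ conjcD cisJ.
  have -> : conjc 1 = 1 :> C by apply: complex_ext => //=; rewrite oppr0.
  have : cis (- y) * cis y = 1 :> C by rewrite -cisD addNr cis0.
  exact: mul_1D_unit.
rewrite rmorphM (rmorphXn _ M) /= h exprMn -exprM mul2n exprDn /kernel mulr_sumr mulr_suml.
apply: eq_bigr => k _; rewrite expr1n mul1r /kercoef rmorphM mulrAC.
rewrite !fmorphV !rmorph_nat; congr (_ / _).
rewrite !cisX -[cis _ *+ _]mulr_natl mulrCA -cisD; congr (_ * cis _).
by rewrite rmorphB /= -!pmulrn; ring.
Qed.

Lemma kernel_real M y : kernel M y = (Re (kernel M y))%:C /\ 0 <= Re (kernel M y).
Proof.
by rewrite kernelE /=; split => //; rewrite mulr_ge0 ?invr_ge0 ?exprn_ge0 ?sqr_ge0.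
Qed.

Lemma kernel_cont M : continuous (kernel M).
Proof. by apply: ccont_sum => k; apply: ccontM; [exact: ccont_cst|exact: ccont_cis]. Qed.

Lemma mean_kernel M (l : int) :
  mean (fun y => cis (l%:~R * y) * kernel M y) =
  \sum_(k < M.*2.+1) (kercoef M k)%:C * (l + (k%:Z - M%:Z) == 0)%:R.
Proof.
have -> : (fun y => cis (l%:~R * y) * kernel M y) =
    (fun y => \sum_(k < M.*2.+1) (kercoef M k)%:C * cis ((l + (k%:Z - M%:Z))%:~R * y)).
  apply/funext => y; rewrite mulr_sumr; apply: eq_bigr => k _.
  by rewrite mulrCA -cisD -mulrDl -rmorphD.
rewrite mean_sum => [|k]; last by apply: ccontM; [exact: ccont_cst|exact: ccont_cis].
by apply: eq_bigr => k _; rewrite meanZ ?mean_cis//; exact: ccont_cis.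
Qed.

Lemma mean_kernel0 M : mean (kernel M) = 1.
Proof.
have -> : kernel M = (fun y => cis ((0 : int)%:~R * y) * kernel M y).
  by apply/funext => y; rewrite mul0r cis0 mul1r.
rewrite mean_kernel.
have MM : (M < M.*2.+1)%N by rewrite ltnS -addnn leq_addr.
rewrite (bigD1 (Ordinal MM))//= subrr addr0 eqxx mulr1 big1 ?addr0 => [|k kM].
  by rewrite /kercoef divff// pnatr_eq0 -lt0n bin_gt0 -addnn leq_addr.
rewrite add0r subr_eq0 eqz_nat; have -> : (k == M :> nat) = false.
  by apply/negP => /eqP kE; move/negP: kM; apply; apply/eqP/val_inj.
by rewrite mulr0.
Qed.

(** The quotient of the binomial coefficient next to the centre by the central one is (m + 1) / (m +
    2). Its distance from 1 measures how far the kernel is from being concentrated at 0. *)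
Lemma mean_kernel1 m :
  mean (fun y => cis y * kernel m.+1 y) = (1 - (m.+2%:R)^-1 : R)%:C.
Proof.
have -> : (fun y => cis y * kernel m.+1 y) = (fun y => cis ((1 : int)%:~R * y) * kernel m.+1 y).
  by apply/funext => y; rewrite mul1r.
rewrite mean_kernel.
have MM : (m < m.+1.*2.+1)%N by rewrite doubleS -addnn !ltnS leqW// leqW// leq_addr.
have E (k : nat) : ((1 : int) + (k%:Z - m.+1%:Z) == 0) = (k == m).
  have -> : (1 : int) + (k%:Z - m.+1%:Z) = k%:Z - m%:Z by rewrite -addn1 PoszD; ring.
  by rewrite subr_eq0 eqz_nat.
rewrite (bigD1 (Ordinal MM))//= E eqxx mulr1 big1 ?addr0 => [|k kM].
  congr (_%:C); rewrite /kercoef.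
  have B0 : 'C(m.+1.*2, m.+1)%:R != 0 :> R.
    by rewrite pnatr_eq0 -lt0n bin_gt0 -addnn leq_addr.
  have := mul_bin_left m.+1.*2 m; have -> : (m.+1.*2 - m = m.+2)%N.
    by rewrite doubleS -addnn -[(m + m).+2]addn2 -addnA addKn addn2.
  move=> /(congr1 (fun k => k%:R : R)); rewrite !natrM => h.
  have m2 : m.+2%:R != 0 :> R by rewrite pnatr_eq0.
  apply: (mulIf m2); rewrite mulrAC [_ * m.+2%:R]mulrC -h mulfK//.
  by rewrite mulrBl mul1r mulVf// -[m.+2%:R]natr1 addrK.
rewrite E; have -> : (k == m :> nat) = false.
  by apply/negP => /eqP kE; move/negP: kM; apply; apply/eqP/val_inj.
by rewrite mulr0.
Qed.

Lemma nc_1Bcis (y : R) : nc (1 - cis y) ^+ 2 = 2 - 2 * Re (cis y).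
Proof.
rewrite normc_sqr ReD ReN ImD ImN /= add0r sqrrN; have := cos2Dsin2 y; lra.
Qed.

(* Korovkin's argument with the kernel |1 + e^{iy}|^{2M} / 'C(2M, M). *)
Lemma coef_approx f i (r e : R) : good f -> r < 1 -> 0 < e ->
  exists N (a : 'I_N -> C) (k : 'I_N -> int), forall z, enorm z <= r ->
    nc (f z - \sum_m a m * coef i (k m) f z) <= e.
Proof.
move=> [uf _] r1 e0; have [B B0 fB] := ucont_bounded uf r1.
have e2 : 0 < e / 2 by rewrite divr_gt0.
have [d d0 dP] := uf r _ r1 e2.
(* Where [nc (1 - cis y)] exceeds [d], the trivial bound [2 * B] on the oscillation is below
   [D * nc (1 - cis y) ^+ 2]. *)
pose D := 2 * B / d ^+ 2.
have D0 : 0 <= D by apply: divr_ge0; [exact: mulr_ge0|exact: sqr_ge0].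
have [m mP] : exists m : nat, 4 * D / e < m.+2%:R.
  exists (Num.truncn (4 * D / e)); rewrite (lt_trans (truncnS_gt _))// ltr_nat//.
pose M := m.+1.
exists M.*2.+1, (fun k => (kercoef M k)%:C), (fun k => - (k%:Z - M%:Z)) => z zr.
have bz : unit_ball z by exact: le_lt_trans r1.
pose F y := f (scl i (cis y) z).
have cF : continuous F by exact: orbit_cont.
have cK := @kernel_cont M.
have -> : \sum_(k < M.*2.+1) (kercoef M k)%:C * coef i (- (k%:Z - M%:Z)) f z =
    mean (fun y => F y * kernel M y).
  have cc k : continuous (fun y => F y * cis ((- - (k%:Z - M%:Z))%:~R * y)).
    exact: (ccontM cF (@ccont_cis _ _)).
  have -> : (fun y => F y * kernel M y) = (fun y => \sum_(k < M.*2.+1)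
     (kercoef M k)%:C * (F y * cis ((- - (k%:Z - M%:Z))%:~R * y))).
    by apply/funext => y; rewrite mulr_sumr; apply: eq_bigr => k _; rewrite opprK mulrCA.
  rewrite mean_sum => [|k]; last exact: (ccontM (@ccont_cst _ _) (cc k)).
  by apply: eq_bigr => k _; rewrite (meanZ _ (cc k)).
have -> : f z = mean (fun y => f z * kernel M y) by rewrite (meanZ _ cK) mean_kernel0 mulr1.
have cfK : continuous (fun y => f z * kernel M y) := ccontM (@ccont_cst _ (f z)) cK.
have cFK : continuous (fun y => F y * kernel M y) := ccontM cF cK.
rewrite -(meanB cfK cFK).
(* Its real part is [e / 2 + D * nc (1 - cis y) ^+ 2] times the kernel, and its mean involves only
   the Fourier coefficients of the kernel at frequencies 0 and 1 in absolute value. *)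
pose h y : C := ((e / 2 + 2 * D)%:C + (- (2 * D))%:C * cis y) * kernel M y.
have hE : h = (fun y => (e / 2 + 2 * D)%:C * kernel M y + (- (2 * D))%:C * (cis y * kernel M y)).
  by apply/funext => y; rewrite /h mulrDl mulrA.
have cc1 : continuous (fun y : R => cis y : C).
  have -> : (fun y : R => cis y : C) = (fun y => cis (1 * y)) by apply/funext => y; rewrite mul1r.
  exact: ccont_cis.
have cc2 : continuous (fun y => cis y * kernel M y) := ccontM cc1 cK.
have c1 : continuous (fun y => (e / 2 + 2 * D)%:C * kernel M y).
  exact: (ccontM (@ccont_cst _ _) cK).
have c2 : continuous (fun y => (- (2 * D))%:C * (cis y * kernel M y)).
  exact: (ccontM (@ccont_cst _ _) cc2).
have ch : continuous h by rewrite hE; exact: (ccontD c1 c2).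
have mh : mean h = (e / 2 + 2 * D * m.+2%:R^-1)%:C.
  rewrite hE (meanD c1 c2) (meanZ _ cK) (meanZ _ cc2) mean_kernel0 mean_kernel1 mulr1 -rmorphM -rmorphD.
  by congr (_%:C); ring.
have key : nc (mean (fun y => f z * kernel M y - F y * kernel M y)) <= rmean (fun y => Re (h y)).
  apply: mean_le_rmean.
  - apply: (ccontD cfK); under eq_fun do rewrite -mulN1r.
    exact: (ccontM (@ccont_cst _ _) cFK).
  - by have /ccont_ReIm[] := ch.
  move=> y _; rewrite -mulrBl Normc.normcM.
  have [kE k0] := kernel_real M y; rewrite /h kE.
  rewrite ncR_ge0// [X in _ <= Re X]mulrC ReMr mulrC ler_wpM2l// ReD ReMr.
  have -> : Re (e / 2 + 2 * D)%:C + - (2 * D) * Re (cis y) = e / 2 + D * nc (1 - cis y) ^+ 2.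
    by rewrite nc_1Bcis /=; lra.
  have n0 := nc_ge0 (1 - cis y : C).
  have sn k : nc (z ord0 k - scl i (cis y) z ord0 k) <= nc (1 - cis y).
    by have := @scl_near _ _ i 1 (cis y) z r zr r1 k; rewrite scl1.
  have zs : enorm (scl i (cis y) z) <= r by rewrite enorm_scl ?nc_cis.
  have [le_d|gt_d] := leP (nc (1 - cis y)) d.
    rewrite (le_trans (dP z _ zr zs _))//; last by rewrite lerDl mulr_ge0 ?sqr_ge0.
    by move=> k; exact: le_trans (sn k) le_d.
  apply: (@le_trans _ _ (D * nc (1 - cis y) ^+ 2)); last by rewrite lerDr ltW.
  apply: (@le_trans _ _ (D * d ^+ 2)); last first.
    by rewrite ler_wpM2l// ler_pXn2r ?nnegrE// ltW.
  rewrite /D divfK ?gt_eqF ?exprn_gt0//.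
  by rewrite (le_trans (ncB _ _))// mulr_natl mulr2n lerD// fB.
apply: (le_trans key).
have -> : rmean (fun y => Re (h y)) = Re (mean h) by [].
rewrite mh -[Re _]/(e / 2 + 2 * D / m.+2%:R); have m2 : 0 < m.+2%:R :> R by [].
have : 4 * D / m.+2%:R <= e.
  by rewrite ler_pdivrMr// [e * _]mulrC -ler_pdivrMr// ltW.
have -> : 4 * D / m.+2%:R = 2 * (2 * D / m.+2%:R) by ring.
by move: (2 * D / _) => q; lra.
Qed.

Lemma hom_rot f (k : 'I_n -> nat) (a : 'I_n -> C) z : (forall i, hom i f (k i)) ->
  (forall i, nc (a i) <= 1) -> unit_ball z ->
  f (rot a z) = (\prod_i a i ^+ k i) * f z.
Proof.
move=> hf a1 bz.
pose p (s : seq 'I_n) i := if i \in s then a i else 1.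
have bp s : unit_ball (rot (p s) z).
  apply: le_lt_trans bz; apply: enorm_le => i; rewrite mxE Normc.normcM ler_piMl ?nc_ge0//.
  by rewrite /p; case: ifP; rewrite ?nc1.
have key s : uniq s -> f (rot (p s) z) = (\prod_(i <- s) a i ^+ k i) * f z.
  elim: s => [|i s ih] /=.
    by move=> _; rewrite big_nil mul1r; congr f; apply/rowP => i; rewrite mxE mul1r.
  move=> /andP[ns us]; rewrite big_cons -mulrA -ih// -hf//; congr f.
  apply/rowP => j; rewrite !mxE /p inE; case: eqP => [->|_] /=; last by rewrite mul1r.
  by rewrite (negbTE ns) mul1r.
have := key (enum 'I_n) (enum_uniq _); rewrite big_enum /= => <-; congr (f (rot _ _)).
by apply/funext => i; rewrite /p mem_enum.
Qed.

(** The value of [f] at b z is computed in two ways, scaling [z] by b or scaling the point (b, ...,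
    b) by the coordinates of [z]. The natural base point (1, ..., 1) is not in the ball. *)
Lemma hom_mon f (k : 'I_n -> nat) : (forall i, hom i f (k i)) ->
  exists2 p, is_poly p & forall z, unit_ball z -> f z = p z.
Proof.
(* Small enough for [n * b ^+ 2 < 1]. *)
move=> hf; pose b : R := n.+1%:R^-1.
have b0 : 0 < b by rewrite invr_gt0.
have b1 : b <= 1 by rewrite invf_le1// ler1n.
have bC : b%:C != 0 by rewrite -nc_eq0 ncR_ge0 ?gt_eqF// ltW.
pose w : T := \row_i b%:C.
have bw : unit_ball w.
  apply/unit_ballP; under eq_bigr do rewrite mxE (ncR_ge0 (ltW b0)).
  rewrite sumr_const card_ord -[X in X < _]mulr_natr.
  have : b * n.+1%:R = 1 by rewrite mulVf// pnatr_eq0.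
  rewrite -natr1 => h; have : (0 : R) <= n%:R by []. nra.
exists (fun z => (\prod_i b%:C ^+ k i)^-1 * f w * mon k z).
  by apply: is_polyZ; exact: is_poly_mon.
move=> z bz.
have E : rot (fun i => z ord0 i) w = rot (fun=> b%:C) z.
  by apply/rowP => i; rewrite !mxE mulrC.
have E1 := hom_rot hf (fun i => le_trans (nc_le_enorm z i) (ltW bz)) bw.
have := @hom_rot _ _ (fun=> b%:C) z hf; rewrite -E E1 => /(_ _ bz) h.
have P0 : \prod_i b%:C ^+ k i != 0 by apply/prodf_neq0 => i _; rewrite expf_neq0.
apply: (mulfI P0); rewrite -h; last by move=> i; rewrite ncR_ge0 ?(ltW b0).
by rewrite mulrA mulVKf// mulrC.
Qed.

(** Induction on the coordinates in which homogeneity is still missing. The coefficients in one of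
    them approximate [f], gain homogeneity there and keep it in the coordinates already treated; at
    the end only monomials remain. *)
Lemma good_poly_approx (s : seq 'I_n) f : good f ->
  (forall i, i \notin s -> exists k, hom i f k) -> forall r e : R, r < 1 -> 0 < e ->
  exists2 p, is_poly p & forall z, enorm z <= r -> nc (f z - p z) <= e.
Proof.
elim: s f => [|i s ih] f gf hf r e r1 e0.
  have /choice[k kP] i : exists k, hom i f k by exact: hf.
  have [p pp fp] := hom_mon kP; exists p => // z zr.
  by rewrite fp ?subrr ?nc0 ?ltW//; exact: le_lt_trans r1.
have e2 : 0 < e / 2 by rewrite divr_gt0.
have [N [a [k kP]]] := coef_approx i gf r1 e2.
pose S := \sum_m nc (a m) + 1.
have S0 : 0 < S by rewrite ltr_wpDl// sumr_ge0// => m _; exact: nc_ge0.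
have /choice[p pP] m : exists p, is_poly p /\
    forall z, enorm z <= r -> nc (coef i (k m) f z - p z) <= e / 2 / S.
  have [||||p pp cp] := ih (coef i (k m) f) _ _ r (e / 2 / S) => //.
  - exact: good_coef.
  - move=> j js; have [->|ij] := eqVneq j i; first exact: coef_hom_ex.
    have [|l hl] := hf j; first by rewrite inE negb_or ij.
    by exists l; apply: hom_coef => //; [exact: (proj1 gf)|rewrite eq_sym].
  - by rewrite divr_gt0.
  by exists p.
exists (fun z => \sum_m a m * p m z).
  by apply: is_poly_sum => m; apply: is_polyZ; have [] := pP m.
move=> z zr.
have -> : f z - \sum_m a m * p m z = (f z - \sum_m a m * coef i (k m) f z) +
   \sum_m a m * (coef i (k m) f z - p m z).
  under [X in _ = _ + X]eq_bigr do rewrite mulrBr.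
  by rewrite sumrB addrA subrK.
have -> : e = e / 2 + e / 2 by lra.
rewrite (le_trans (le_normcD _ _))// lerD ?kP// (le_trans (nc_sum _ _ _))//.
apply: (@le_trans _ _ (\sum_m nc (a m) * (e / 2 / S))).
  apply: ler_sum => m _; rewrite Normc.normcM ler_wpM2l ?nc_ge0//.
  by have [_] := pP m; exact.
by rewrite -mulr_suml mulrCA ger_pMr// ler_pdivrMr// mul1r lerDl.
Qed.

End polynomial_approximation.

(** * The dilation law for analytic functions *)

Section analytic_good.
Context {R : realType} {n : nat}.
Local Notation C := R[i].
Local Notation T := 'rV[C]_n.
Local Notation tau := (2 * pi : R).
Implicit Types (f g : T -> C) (z : T) (i j : 'I_n).

Lemma differentiable_near f z : differentiable f z -> forall e : R, 0 < e ->
  exists2 d : R, 0 < d & forall w : T, (forall i, nc (w ord0 i - z ord0 i) < d) ->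
    nc (f w - f z) < e.
Proof.
move=> /differentiable_continuous cf e e0.
by have /(cvg_complexP _ _ (nbhs_filter z))/(_ _ e0)/nbhs_rVP := cf.
Qed.

Lemma compact_cube : compact [set z : T | forall i, `|Re (z ord0 i)| <= 1 /\ `|Im (z ord0 i)| <= 1].
Proof.
pose S : set C := [set c | `|Re c| <= 1 /\ `|Im c| <= 1].
suff cS : compact S by exact: (@rV_compact C n (fun=> S) (fun=> cS)).
pose g (p : R * R) : C := p.1 +i* p.2.
have -> : S = g @` (`[-1, 1]%classic `*` `[-1, 1]%classic).
  apply/seteqP; split => [c [cr ci]|_ [[a b] [/= a1 b1] <-]] /=.
    exists (Re c, Im c); last by case: c cr ci.
    by split; rewrite /= in_itv/= -ler_norml.
  by move: a1 b1; rewrite !in_itv/= -!ler_norml.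
apply: continuous_compact; last by apply: compact_setX; exact: segment_compact.
apply: continuous_subspaceT => p.
apply/(cvg_complexP _ _ (nbhs_filter p)) => e e0.
have e2 : 0 < e / 2 by rewrite divr_gt0.
exists (ball p.1 (e / 2), ball p.2 (e / 2)) => /=.
  by split; exact: nbhsx_ballx.
move=> q [h1 h2].
have q1 : `|p.1 - q.1| < e / 2 by have := h1; rewrite -ball_normE.
have q2 : `|p.2 - q.2| < e / 2 by have := h2; rewrite -ball_normE.
rewrite -[X in X < _]/(nc (g q - g p)); apply: le_lt_trans (nc_le_ReIm _) _; rewrite ReD ImD ReN ImN /= distrC [X in _ + X]distrC; lra.
Qed.

(** Near a point outside the ball there are no points of norm at most [r], so the local condition is
    void there. This allows compactness of a cube to be used for the closed ball of radius [r]. *)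
Lemma enorm_far z (r : R) : r < 1 -> 1 <= enorm z -> exists2 d : R, 0 < d &
  forall w, enorm w <= r -> ~ (forall i, nc (w ord0 i - z ord0 i) <= d).
Proof.
move=> r1 z1; have [r0|rn] := leP 0 r; last first.
  by exists 1 => // w wr; have := enorm_ge0 w; lra.
have n0 : 0 < 3 * n%:R + 1 :> R by rewrite ltr_wpDl// mulr_ge0.
(* For [x] and [d] in [0, 1], [(x + d) ^+ 2 <= x ^+ 2 + 3 * d]; summed over the coordinates this
   stays below 1. *)
pose d := (1 - r ^+ 2) / (3 * n%:R + 1).
have r2 : 0 < 1 - r ^+ 2 by rewrite subr_gt0 expr_lt1.
have d0 : 0 < d by rewrite divr_gt0.
have dE : d * (3 * n%:R + 1) = 1 - r ^+ 2 by rewrite divfK// gt_eqF.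
have nn : 0 <= n%:R :> R by [].
have d1 : d <= 1 by have := sqr_ge0 r; nra.
exists d => // w wr zw.
have : enorm z ^+ 2 <= r ^+ 2 + 3 * n%:R * d.
  apply: (@le_trans _ _ (\sum_i (nc (w ord0 i) ^+ 2 + 3 * d))).
    rewrite enorm_sqr; apply: ler_sum => i _.
    have w0 := nc_ge0 (w ord0 i); have z0 := nc_ge0 (z ord0 i).
    have w1 : nc (w ord0 i) <= 1.
      by rewrite (le_trans (nc_le_enorm w i))// (le_trans wr)// ltW.
    have : nc (z ord0 i) <= nc (w ord0 i) + d.
      have -> : z ord0 i = w ord0 i + (z ord0 i - w ord0 i) by rewrite addrC subrK.
      by rewrite (le_trans (le_normcD _ _))// lerD2l ncBC; exact: zw.
    by move: (nc _) (nc _) w0 z0 w1 => a b *; nra.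
  rewrite big_split /= -enorm_sqr sumr_const card_ord -[(3 * d) *+ n]mulr_natr.
  by apply: lerD; [rewrite ler_pXn2r ?nnegrE ?enorm_ge0//|rewrite mulrAC].
have : 1 <= enorm z ^+ 2 by rewrite expr_ge1// enorm_ge0.
by nra.
Qed.

Lemma analytic_ucont f : (forall z, unit_ball z -> differentiable f z) -> ucont f.
Proof.
move=> df r e r1 e0.
have := @compact_cube; rewrite compact_near_coveringP => /(_ R (0^'+)
  (fun d z => forall w, enorm z <= r -> enorm w <= r ->
     (forall i, nc (z ord0 i - w ord0 i) <= d) -> nc (f z - f w) <= e)).
case=> [z _|d /= d0 dP].
  have [z1|z1] := leP 1 (enorm z).
    have [d d0 dP] := enorm_far r1 z1.
    exists ([set w : T | forall i, nc (w ord0 i - z ord0 i) < d], setT) => /=.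
      by split; [apply/nbhs_rVP; exists d|exact: filterT].
    move=> [w h] [/= wz _] v wr; exfalso; apply: (dP w wr) => i; exact/ltW/wz.
  have e2 : 0 < e / 2 by rewrite divr_gt0.
  have [d d0 dP] := differentiable_near (df z z1) e2.
  have d2 : 0 < d / 2 by rewrite divr_gt0.
  exists ([set w : T | forall i, nc (w ord0 i - z ord0 i) < d / 2], [set x | x < d / 2]) => /=.
    split; first by apply/nbhs_rVP; exists (d / 2).
    exact: nbhs_right_lt.
  move=> [w h] [/= wz hd] v wr vr wv.
  have -> : f w - f v = (f w - f z) - (f v - f z) by ring.
  have h1 : nc (f w - f z) < e / 2.
    by apply: dP => i; rewrite (lt_trans (wz i))//; lra.
  have h2 : nc (f v - f z) < e / 2.
    apply: dP => i.
    have -> : v ord0 i - z ord0 i = (w ord0 i - z ord0 i) - (w ord0 i - v ord0 i) by ring.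
    rewrite (le_lt_trans (ncB _ _))//; have := wz i; have := wv i; lra.
  rewrite (le_trans (ncB _ _))//; lra.
exists (d / 2); first by rewrite divr_gt0.
move=> z w zr wr zw.
have dd : ball 0 d (d / 2).
  rewrite -ball_normE /ball_/= sub0r normrN gtr0_norm ?divr_gt0//; lra.
apply: (dP (d / 2) dd _ z) => //; first by rewrite divr_gt0.
move=> i; have zi := le_trans (nc_le_enorm z i) (le_trans zr (ltW r1)).
by split; [rewrite (le_trans (normc_ge_absRe _))|rewrite (le_trans (normc_ge_absIm _))].
Qed.

Lemma cdiff_continuous (G : C -> C) w (e : R) : cdiff G w -> 0 < e ->
  exists2 d : R, 0 < d & forall h, nc h < d -> nc (G (w + h) - G w) < e.
Proof.
move=> [A GA] e0; have [d d0 dP] := GA 1 ltr01.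
have A1 : 0 < nc A + 1 by rewrite ltr_wpDl ?nc_ge0.
exists (Num.min d (e / (nc A + 1))); first by rewrite lt_min d0 divr_gt0.
move=> h; rewrite lt_min => /andP[hd he].
have -> : G (w + h) - G w = (G (w + h) - G w - A * h) + A * h by rewrite subrK.
rewrite (le_lt_trans (le_normcD _ _))// Normc.normcM.
move: he; rewrite ltr_pdivlMr// => he.
have := dP h hd; lra.
Qed.

Lemma cdiff_path (G : C -> C) (p : R -> C) : continuous p -> (forall y, cdiff G (p y)) ->
  continuous (fun y => G (p y)).
Proof.
move=> cp dG; apply/ccontP => y e e0.
have [d d0 dP] := cdiff_continuous (dG y) e0.
have /ccontP/(_ y d d0)[d' d'0 d'P] := cp.
exists d' => // x xy; have := dP (p x - p y) (d'P x xy).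
by rewrite [p y + _]addrC subrK.
Qed.

(** The horizontal sides of the rectangle of height [tau] cancel by periodicity, so the two vertical
    sides have equal integrals. *)
Lemma goursat_strip (G : C -> C) (x0 x1 : R) : x0 <= 0 -> 0 < x1 ->
  (forall w, Re w < x1 -> cdiff G w) -> (forall x y, G (x +i* (y + tau)) = G (x +i* y)) ->
  rmean (fun y => Re (G (x0 +i* y))) = rmean (fun y => Re (G (0 +i* y))).
Proof.
move=> x00 x10 dG pG; have t0 := @tau_gt0 R.
pose x2 := x1 / 2; have x20 : 0 < x2 by rewrite divr_gt0.
have x21 : x2 < x1 by rewrite /x2; lra.
(* [goursat] asks for continuity on the whole line, whereas [G] is controlled only to the left of
   [x1]. Clipping the abscissa at [x2] changes nothing near the rectangle, as [x2] is positive. *)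
pose m (x : R) : R := Num.min x x2.
have dm x y : cdiff G (m x +i* y).
  by apply: dG => /=; rewrite gt_min x21 orbT.
have cm : continuous m.
  by move=> x; apply: (@continuous_min _ _ id (fun=> x2)); [exact: cvg_id|exact: cvg_cst].
have c1 y : continuous (fun x => G (m x +i* y)).
  apply: (@cdiff_path G (fun x => m x +i* y)) => //.
  by apply/ccont_ReIm; split => //= x; exact: cvg_cst.
have c2 x : continuous (fun y => G (m x +i* y)).
  apply: (@cdiff_path G (fun y => m x +i* y)) => //.
  by apply/ccont_ReIm; split => //= y; [exact: cvg_cst|exact: cvg_id].
have := @goursat R (fun x y => Re (G (m x +i* y))) (fun x y => Im (G (m x +i* y))).
have /= r1 y := (proj1 (ccont_ReIm _) (c1 y)).
have /= r2 y := (proj1 (ccont_ReIm _) (c2 y)).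
move=> /(_ (fun y => (r2 y).1) (fun y => (r1 y).2)).
move=> /(_ x0 0 0 tau x00 (ltW t0)).
have mE x : x <= x2 -> m x = x by move=> h; rewrite /m; exact/min_idPl.
have holo x y : x0 <= x <= 0 -> 0 <= y <= tau ->
    locally_holo (fun x y => Re (G (m x +i* y))) (fun x y => Im (G (m x +i* y))) x y.
  move=> /andP[_ xn] _.
  have xm : m x = x by apply: mE; lra.
  have [A GA] := dm x y; exists (Re A), (Im A) => eta eta0.
  have [d d0 dP] := GA _ eta0.
  exists (Num.min (d / 3) x2); first by rewrite lt_min x20 divr_gt0.
  move=> x' y'; rewrite !le_min => /andP[xd xx2] /andP[yd _].
  have xm' : m x' = x' by apply: mE; move: xx2; rewrite ler_norml; lra.
  have := dP ((x' - x) +i* (y' - y)).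
  have le_h : nc ((x' - x) +i* (y' - y)) <= `|x' - x| + `|y' - y| := nc_le_ReIm _.
  have -> : (m x +i* y) + ((x' - x) +i* (y' - y)) = x' +i* y'.
    by rewrite xm; apply: complex_ext => /=; ring.
  rewrite xm' => /(_ _) hh.
  have {}hh : nc (G (x' +i* y') - G (m x +i* y) - A * ((x' - x) +i* (y' - y))) <=
      eta * (`|x' - x| + `|y' - y|).
    apply: le_trans (hh _) _; first by rewrite (le_lt_trans le_h)//; lra.
    by rewrite ler_pM2l.
  split; apply: le_trans hh.
    apply: le_trans (normc_ge_absRe _).
    by rewrite !ReD !ReN ReM /= lexx.
  apply: le_trans (normc_ge_absIm _).
  by rewrite !ImD !ImN ImM /= [Re A * _ + _]addrC lexx.
move=> /(_ holo); rewrite /contour.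
have -> : In x0 0 (fun x => Im (G (m x +i* 0)) - Im (G (m x +i* tau))) = 0.
  rewrite (_ : (fun x => _) = (fun=> 0)) ?In_cst ?mul0r//.
  by apply/funext => x; rewrite -[tau]add0r pG subrr.
rewrite add0r InB; [|exact: (r2 _).1..].
move=> /eqP; rewrite subr_eq0 mE ?(ltW x20)// mE; last lra.
by move=> /eqP h; rewrite /rmean h.
Qed.

(** Imaginary parts are the real parts of [- i * G]. *)
Lemma goursat_mean (G : C -> C) (x0 x1 : R) : x0 <= 0 -> 0 < x1 ->
  (forall w, Re w < x1 -> cdiff G w) -> (forall x y, G (x +i* (y + tau)) = G (x +i* y)) ->
  mean (fun y => G (x0 +i* y)) = mean (fun y => G (0 +i* y)).
Proof.
move=> x00 x10 dG pG; apply: complex_ext => /=; first exact: goursat_strip x10 dG pG.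
have := @goursat_strip (fun w => (- 'i%C) * G w) x0 x1 x00 x10.
have E w : Re (- 'i%C * G w) = Im (G w) by rewrite ReM /= oppr0 mul0r add0r mulN1r opprK.
have -> : (fun y => Re (- 'i%C * G (x0 +i* y))) = (fun y => Im (G (x0 +i* y))).
  by apply/funext => y.
have -> : (fun y => Re (- 'i%C * G (0 +i* y))) = (fun y => Im (G (0 +i* y))).
  by apply/funext => y.
apply => [w wx|x y]; last by rewrite pG.
have cs := cdiff_scale (- 'i%C) (G w); exact: (cdiff_comp (dG w wx) cs).
Qed.

Lemma cdiff_scl f i z (c : C) : differentiable f (scl i c z) -> cdiff (fun c => f (scl i c z)) c.
Proof.
set z0 := scl i c z => /diff_locallyP[_ /eqaddoP fE].
pose v : T := \row_k (if k == i then z ord0 i else 0).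
have vE h : scl i (c + h) z = h *: v + z0.
  apply/rowP => k; rewrite !mxE; case: eqP => [->|_]; last by rewrite mulr0 add0r.
  by rewrite mulrDl addrC.
have nvE : `|v| = (Re `|v|)%:C.
  have : 0 <= `|v| by [].
  by case: `|v| => a b; rewrite lecE /= => /andP[/eqP -> _].
have nv0 : 0 <= Re `|v| by have : 0 <= `|v| by []; rewrite {1}nvE ler0c.
have N1 : 0 < Re `|v| + 1 by rewrite ltr_wpDl.
exists ('d f z0 v) => eta eta0.
have e0 : 0 < eta / (Re `|v| + 1) by rewrite divr_gt0.
have /nbhs_rVP[d d0 dP] := fE (eta / (Re `|v| + 1))%:C ltac:(by rewrite ltcR).
pose S := \sum_k nc (v ord0 k) + 1.
have S0 : 0 < S by rewrite ltr_wpDl// sumr_ge0// => k _; exact: nc_ge0.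
exists (d / S); first by rewrite divr_gt0.
move=> h; rewrite ltr_pdivlMr// => hd.
have := dP (h *: v).
have -> : (f \o shift z0 - (cst (f z0) + 'd f z0)) (h *: v) =
    f (scl i (c + h) z) - f z0 - 'd f z0 v * h.
  rewrite vE -[LHS]/(f (h *: v + z0) - (f z0 + 'd f z0 (h *: v))) linearZ /=.
  by rewrite [_ * h]mulrC opprD addrA.
rewrite /= normE normrZ normE nvE -!rmorphM lecR => hh.
apply: le_trans (hh _) _.
  move=> k; rewrite !mxE subr0 Normc.normcM (le_lt_trans _ hd)// ler_wpM2l ?nc_ge0//.
  rewrite /S (bigD1 k)//= mxE -addrA lerDl addr_ge0// sumr_ge0// => l _; exact: nc_ge0.
rewrite mulrCA [X in _ <= X]mulrC ler_wpM2l ?nc_ge0// mulrAC ler_pdivrMr// ler_wpM2l// ?lerDl//.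
exact: ltW.
Qed.

(** The function [G] multiplies coordinate [i] by e^w and the result by e^(-kw). Its mean on the
    vertical line of abscissa x is e^(-kx) times the coefficient at the point scaled by e^x, and
    this mean does not depend on x. *)
Lemma analytic_good f : (forall z, unit_ball z -> differentiable f z) -> good f.
Proof.
move=> df; have uf := analytic_ucont df; split => // i k x0 z x00 bz.
have [e e0 eP] := @ball_room R n (fun k => nc (z ord0 k)) (fun k => nc_ge0 _)
  (proj1 (unit_ballP z) bz).
have e1 : 0 < 1 + e by rewrite ltr_pwDl// ltW.
(* As long as [Re w < x1], scaling coordinate [i] by e^w stays in the ball; a positive [x1] puts the
   line of abscissa 0 inside the strip. *)
pose x1 := ln (1 + e).
have x10 : 0 < x1 by rewrite ln_gt0// ltrDl.
pose G w : C := f (scl i (cexp w) z) * cexp ((- k)%:~R * w).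
have bG w : Re w < x1 -> unit_ball (scl i (cexp w) z).
  move=> wx; apply/unit_ballP; apply: le_lt_trans eP; apply: ler_sum => l _.
  have e3 : 0 <= 3 * e by rewrite mulr_ge0// ltW.
  rewrite ler_pXn2r ?nnegrE ?nc_ge0 ?addr_ge0 ?nc_ge0//.
  rewrite mxE Normc.normcM; have z0 := nc_ge0 (z ord0 l).
  have z1 := le_trans (nc_le_enorm z l) (ltW bz).
  case: ifP => _; last by rewrite nc1 mul1r lerDl.
  rewrite /cexp Normc.normcM nc_cis mulr1 nc_exp.
  have : expR (Re w) <= 1 + e by rewrite -[1 + e]lnK ?posrE// ler_expR ltW.
  by nra.
have dG w : Re w < x1 -> cdiff G w.
  move=> /bG bw; apply: cdiffM.
    apply: (@cdiff_comp _ (fun c => f (scl i c z)) cexp); first exact: cdiff_cexp.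
    exact/cdiff_scl/df.
  apply: (@cdiff_comp _ cexp (fun w => (- k)%:~R * w)); first exact: cdiff_scale.
  exact: cdiff_cexp.
have kC (x y : R) : (- k)%:~R * (x +i* y) = ((- k)%:~R * x) +i* ((- k)%:~R * y) :> C.
  have -> : (- k)%:~R = ((- k)%:~R : R)%:C by rewrite rmorph_int.
  by apply: complex_ext; rewrite ?ReMr ?ImMr.
have GE x y : G (x +i* y) = (expR ((- k)%:~R * x))%:C *
    (f (scl i (cis y) (scl i (expR x)%:C z)) * cis ((- k)%:~R * y)).
  by rewrite /G kC /cexp /= scl_scl [cis y * _]mulrC mulrCA.
have pG x y : G (x +i* (y + tau)) = G (x +i* y).
  rewrite !GE; congr (_ * (f (scl _ _ _) * _)).
    by rewrite cisD -[tau]mul1r (cis_int (1 : int)) mulr1.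
  by rewrite mulrDr cisD cis_int mulr1.
have := goursat_mean x00 x10 dG pG.
have cc x : x <= 0 -> mean (fun y => G (x +i* y)) = (expR ((- k)%:~R * x))%:C * coef i k f (scl i (expR x)%:C z).
  move=> xn; rewrite -meanZ; last first.
    apply: ccontM; last exact: ccont_cis.
    apply: orbit_cont => //; apply: ball_scl => //.
    by rewrite nc_exp -expR0 ler_expR.
  by congr mean; apply/funext => y; rewrite GE.
have c1 := cc x0 x00; have c2 := cc 0 (lexx 0).
rewrite mulr0 expR0 mul1r scl1 in c2; rewrite c1 c2 => <-.
by rewrite mulrA -rmorphM -expRD mulrNz mulNr addrN expR0 mul1r.
Qed.

Theorem analytic_poly_approx f (r e : R) : (forall z, unit_ball z -> differentiable f z) ->
  r < 1 -> 0 < e ->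
  exists2 p, is_poly p & forall z, enorm z <= r -> nc (f z - p z) <= e.
Proof.
move=> df; apply: (@good_poly_approx _ _ (enum 'I_n)); first exact: analytic_good.
by move=> i; rewrite mem_enum.
Qed.

End analytic_good.

(** * Differentiability of locally uniform limits of polynomials *)

Section locally_uniform_limits.
Context {R : realType} {n : nat}.
Local Notation C := R[i].
Local Notation T := 'rV[C]_n.
Implicit Types (f p : T -> C) (x u z : T).

(** On every complex line through [x] the function is a one-variable polynomial whose linear
    coefficient is a linear form in the direction. This brings Cauchy estimates back to one
    variable. *)
Definition taylor p x := exists a : 'I_n -> C, forall u, exists P : {poly C},
  [/\ forall l, p (x + l *: u) = P.[l], P`_0 = p x & P`_1 = lform a u].

Lemma taylor_cst (c : C) x : taylor (fun=> c) x.
Proof.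
exists (fun=> 0) => u; exists c%:P; split=> [l||]; rewrite ?hornerC ?coefC//=.
by rewrite /lform big1// => i _; rewrite mul0r.
Qed.

Lemma taylorD p q x : taylor p x -> taylor q x -> taylor (fun z => p z + q z) x.
Proof.
move=> [a pa] [b qb]; exists (fun i => a i + b i) => u.
have [P [P1 P2 P3]] := pa u; have [Q [Q1 Q2 Q3]] := qb u.
exists (P + Q); split=> [l||]; rewrite ?hornerD ?coefD ?P1 ?Q1 ?P2 ?Q2 ?P3 ?Q3//.
by rewrite /lform -big_split; apply: eq_bigr => i _; rewrite mulrDl.
Qed.

Lemma taylorM p q x : taylor p x -> taylor q x -> taylor (fun z => p z * q z) x.
Proof.
move=> [a pa] [b qb]; exists (fun i => p x * b i + a i * q x) => u.
have [P [P1 P2 P3]] := pa u; have [Q [Q1 Q2 Q3]] := qb u.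
exists (P * Q); split=> [l||]; rewrite ?hornerM ?P1 ?Q1//.
  by rewrite coefM big_ord1 P2 Q2.
rewrite coefM big_ord_recl big_ord1 /= P2 Q2 P3 Q3 /lform mulr_sumr mulr_suml -big_split.
by apply: eq_bigr => i _; rewrite /= mulrDl mulrA [a i * _ * _]mulrAC.
Qed.

Lemma taylor_coord i x : taylor (fun z => z ord0 i) x.
Proof.
exists (fun j => (j == i)%:R) => u; exists ((x ord0 i)%:P + (u ord0 i)%:P * 'X).
split=> [l||].
- by rewrite !mxE hornerD hornerM !hornerC hornerX mulrC.
- by rewrite coefD coefC coefMX /= addr0.
rewrite coefD coefC coefMX /= add0r coefC /= /lform (bigD1 i)//= eqxx mul1r.
by rewrite big1 ?addr0// => j /negbTE ->; rewrite mul0r.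
Qed.

Lemma taylor_poly p x : is_poly p -> taylor p x.
Proof.
move=> /is_polyP[D [c ->]]; rewrite /pfun.
have ts (I : Type) (s : seq I) (F : I -> T -> C) : (forall i, taylor (F i) x) ->
    taylor (fun z => \sum_(i <- s) F i z) x.
  move=> tF; elim: s => [|i s ih].
    by under eq_fun do rewrite big_nil; exact: taylor_cst.
  by under eq_fun do rewrite big_cons; exact: taylorD.
have tp (I : Type) (s : seq I) (F : I -> T -> C) : (forall i, taylor (F i) x) ->
    taylor (fun z => \prod_(i <- s) F i z) x.
  move=> tF; elim: s => [|i s ih].
    by under eq_fun do rewrite big_nil; exact: taylor_cst.
  by under eq_fun do rewrite big_cons; exact: taylorM.
apply: ts => a; apply: taylorM; first exact: taylor_cst.
apply: tp => i; elim: (a i : nat) => [|k ih].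
  by under eq_fun do rewrite expr0; exact: taylor_cst.
by under eq_fun do rewrite exprS; apply: taylorM => //; exact: taylor_coord.
Qed.

Lemma circle_poly_cont (P : {poly C}) (r : R) : continuous (fun y => P.[r%:C * cis y]).
Proof.
have -> : (fun y => P.[r%:C * cis y]) =
    (fun y => \sum_(j < size P) (P`_j * r%:C ^+ j) * cis (j%:R * y)).
  apply/funext => y; rewrite horner_coef; apply: eq_bigr => j _.
  by rewrite exprMn cisX mulrA.
by apply: ccont_sum => j; apply: ccontM; [exact: ccont_cst|exact: ccont_cis].
Qed.

Lemma circle_coef (P : {poly C}) (r : R) (j : nat) :
  mean (fun y => P.[r%:C * cis y] * cis ((- j%:Z)%:~R * y)) = P`_j * r%:C ^+ j.
Proof.
have -> : (fun y => P.[r%:C * cis y] * cis ((- j%:Z)%:~R * y)) =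
    (fun y => \sum_(l < size P) (P`_l * r%:C ^+ l) * cis ((l%:Z - j%:Z)%:~R * y)).
  apply/funext => y; rewrite horner_coef mulr_suml; apply: eq_bigr => l _.
  rewrite exprMn cisX !mulrA -[in LHS]mulrA -cisD; congr (_ * cis _).
  by rewrite rmorphD /= -pmulrn mulrDl.
rewrite mean_sum => [|l]; last by apply: ccontM; [exact: ccont_cst|exact: ccont_cis].
transitivity (\sum_(l < size P) P`_l * r%:C ^+ l * (l%:Z - j%:Z == 0)%:R).
  by apply: eq_bigr => l _; rewrite (meanZ _ (@ccont_cis _ _)) mean_cis.
have [jP|Pj] := ltnP j (size P).
  rewrite (bigD1 (Ordinal jP))//= subrr eqxx mulr1 big1 ?addr0// => l lj.
  rewrite subr_eq0 eqz_nat; have -> : (l == j :> nat) = false.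
    by apply/negP => /eqP lE; move/negP: lj; apply; apply/eqP/val_inj.
  by rewrite mulr0.
rewrite (nth_default _ Pj) mul0r big1// => l _.
rewrite subr_eq0 eqz_nat; have -> : (l == j :> nat) = false.
  by apply/negP => /eqP lE; have := ltn_ord l; rewrite lE ltnNge Pj.
by rewrite mulr0.
Qed.

Lemma cauchy_estimate (P : {poly C}) (r M : R) (j : nat) : 0 <= r ->
  (forall l, nc l = r -> nc P.[l] <= M) -> nc P`_j * r ^+ j <= M.
Proof.
move=> r0 PM; have := circle_coef P r j => /(congr1 (@nc R)).
rewrite Normc.normcM ncX ncR_ge0// => <-.
apply: mean_le; first by apply: ccontM; [exact: circle_poly_cont|exact: ccont_cis].
move=> y _; rewrite Normc.normcM nc_cis mulr1; apply: PM.
by rewrite Normc.normcM nc_cis mulr1 ncR_ge0.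
Qed.

(** Cauchy estimates bound the tail by a geometric series of ratio at most 1/2, whence the factor
    2. *)
Lemma poly_remainder (P : {poly C}) (r M : R) (l : C) : 0 < r ->
  (forall l, nc l = r -> nc P.[l] <= M) -> nc l <= r / 2 ->
  nc (P.[l] - P`_0 - P`_1 * l) <= 2 * M * (nc l / r) ^+ 2.
Proof.
move=> r0 PM lr; have r1 := ltW r0.
have M0 : 0 <= M.
  by apply: le_trans (PM r%:C _); rewrite ?nc_ge0// ncR_ge0.
pose q := nc l / r; have q0 : 0 <= q by rewrite divr_ge0// nc_ge0.
have q2 : q <= 2^-1 by rewrite ler_pdivrMr// mulrC.
have -> : P.[l] - P`_0 - P`_1 * l = \sum_(j < size P) P`_(j.+2) * l ^+ j.+2.
  have PE : P.[l] = \sum_(j < (size P).+2) P`_j * l ^+ j.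
    by rewrite (horner_coef_wide _ (leq_trans (leqnSn _) (leqnSn _))).
  rewrite PE -(big_mkord xpredT (fun j => P`_j * l ^+ j)) !big_nat_recl// big_mkord.
  by rewrite expr0 expr1; ring.
rewrite (le_trans (nc_sum _ _ _))//.
apply: (@le_trans _ _ (\sum_(j < size P) M * q ^+ 2 * q ^+ j)).
  apply: ler_sum => j _; rewrite Normc.normcM ncX -mulrA -exprD.
  have -> : nc l = r * q by rewrite /q mulrCA mulfV ?mulr1// gt_eqF.
  by rewrite exprMn mulrA ler_wpM2r ?exprn_ge0// cauchy_estimate.
rewrite -mulr_sumr -/q (_ : 2 * M * q ^+ 2 = M * q ^+ 2 * 2); last by ring.
apply: ler_wpM2l; first by rewrite mulr_ge0// sqr_ge0.
rewrite (le_trans (geometric_le _ q0 _))//; first by rewrite (le_lt_trans q2)// invf_lt1 ?ltr1n.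
rewrite -[leRHS]invrK lef_pV2 ?posrE ?invr_gt0//; last by rewrite subr_gt0 (le_lt_trans q2)// invf_lt1 ?ltr1n.
by move: q2; lra.
Qed.

Lemma poly_taylor p x (r M : R) : is_poly p -> 0 < r ->
  (forall w : T, (forall i, nc (w ord0 i - x ord0 i) <= r) -> nc (p w) <= M) ->
  forall (a : 'I_n -> C), (forall u, exists P : {poly C},
    [/\ forall l, p (x + l *: u) = P.[l], P`_0 = p x & P`_1 = lform a u]) ->
  forall (s : R) (h : T), 0 < s -> s <= r / 2 -> (forall i, nc (h ord0 i) <= s) ->
  nc (p (x + h) - p x - lform a h) <= 2 * M * (s / r) ^+ 2.
Proof.
(* The coordinates of this direction have modulus at most 1, so the circle of radius [r] on the line
   stays in the polydisc where [p] is bounded. *)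
move=> pp r0 pM a pa s h s0 sr hs; have [P [P1 P2 P3]] := pa (s^-1%:C *: h).
have sC : s%:C != 0 :> C by rewrite -nc_eq0 ncR_ge0 ?gt_eqF// ltW.
have hE : h = s%:C *: (s^-1%:C *: h) by rewrite scalerA -rmorphM mulfV ?scale1r// gt_eqF.
have PM l : nc l = r -> nc P.[l] <= M.
  move=> lr; rewrite -P1; apply: pM => i.
  rewrite !mxE addrAC subrr add0r !Normc.normcM lr -[leRHS]mulr1 ler_wpM2l ?(ltW r0)//.
  by rewrite ncR_ge0 ?invr_ge0 ?(ltW s0)// ler_pdivrMl// mulr1.
have := @poly_remainder P r M s%:C r0 PM.
rewrite ncR_ge0 ?(ltW s0)// => /(_ sr); rewrite P2 P3 -P1 -hE.
suff -> : lform a h = lform a (s^-1%:C *: h) * s%:C by [].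
by rewrite {1}hE linearZ mulrC.
Qed.

Lemma lform_delta (a : 'I_n -> C) i : lform a (delta_mx ord0 i) = a i.
Proof.
rewrite /lform (bigD1 i)//= mxE !eqxx mulr1 big1 ?addr0// => j ji.
by rewrite mxE eqxx (negbTE ji) mulr0.
Qed.

(** Candidates for the partial derivatives are Cauchy integrals over circles in the coordinate
    directions. They make sense for [f] itself and depend continuously on it, so the quadratic
    Taylor bound passes from the polynomials to [f]. *)
Lemma lim_poly_differentiable f x (r : R) : 0 < r ->
  (forall e : R, 0 < e -> exists2 p, is_poly p &
    forall w : T, (forall i, nc (w ord0 i - x ord0 i) <= r) -> nc (f w - p w) <= e) ->
  differentiable f x.
Proof.
move=> r0 fp; have r1 := ltW r0.
pose cir i y : T := x + (r%:C * cis y) *: delta_mx ord0 i.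
have cirP i y k : nc (cir i y ord0 k - x ord0 k) <= r.
  rewrite !mxE addrAC subrr add0r !Normc.normcM nc_cis ncR_ge0// mulr1 ler_piMr//.
  by rewrite nc_nat; case: (_ && _); rewrite ?ler01.
have ccp p i : is_poly p -> continuous (fun y => p (cir i y)).
  move=> pp; have [a pa] := taylor_poly x pp.
  have [P [P1 _ _]] := pa (delta_mx ord0 i).
  have -> : (fun y => p (cir i y)) = (fun y => P.[r%:C * cis y]) by apply/funext => y; rewrite P1.
  exact: circle_poly_cont.
have ccf i : continuous (fun y => f (cir i y)).
  apply/ccontP => y e e0; have e3 : 0 < e / 3 by rewrite divr_gt0.
  have [p pp fpe] := fp _ e3.
  have /ccontP/(_ y _ e3)[d d0 dP] := ccp p i pp.
  exists d => // z zy.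
  have spl (a1 a2 b1 b2 : C) : a1 - a2 = (a1 - b1) + ((b1 - b2) - (a2 - b2)) by ring.
  rewrite (spl _ _ (p (cir i z)) (p (cir i y))).
  apply: le_lt_trans (le_normcD _ _) _.
  have -> : e = e / 3 + (e / 3 + e / 3) by lra.
  apply: ler_ltD; first exact/fpe/cirP.
  apply: le_lt_trans (ncB _ _) _; apply: ltr_leD; [exact: dP|exact/fpe/cirP].
pose A g i : C := (r^-1)%:C * mean (fun y => g (cir i y) * cis ((- (1%N)%:Z)%:~R * y)).
have [p1 pp1 fp1] := fp 1 ltr01.
have x_near i : nc (x ord0 i - x ord0 i) <= r by rewrite subrr nc0.
have [M M0 fM] : exists2 M : R, 0 <= M & forall w : T,
    (forall i, nc (w ord0 i - x ord0 i) <= r) -> nc (f w) <= M.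
  have [B B0 pB] : exists2 B : R, 0 <= B & forall w : T,
    (forall i, nc (w ord0 i - x ord0 i) <= r) -> nc (p1 w) <= B.
    have [D [c p1E]] := is_polyP pp1.
    pose X := enorm x + r; have X0 : 0 <= X by rewrite addr_ge0 ?enorm_ge0.
    exists (\sum_a nc (c a) * \prod_i X ^+ a i).
      by apply: sumr_ge0 => a _; rewrite mulr_ge0 ?nc_ge0// prodr_ge0// => i _; rewrite exprn_ge0.
    move=> w wx; rewrite p1E (le_trans (nc_sum _ _ _))//; apply: ler_sum => a _.
    rewrite Normc.normcM ler_wpM2l ?nc_ge0// nc_mon; apply: ler_prod => i _.
    rewrite exprn_ge0 ?nc_ge0//=; apply: lerXn2r; rewrite ?nnegrE ?nc_ge0//.
    have -> : w ord0 i = x ord0 i + (w ord0 i - x ord0 i) by rewrite addrC subrK.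
    by rewrite (le_trans (le_normcD _ _))// lerD ?wx// nc_le_enorm.
  exists (B + 1) => [|w wx]; first by rewrite addr_ge0.
  have -> : f w = p1 w + (f w - p1 w) by rewrite addrC subrK.
  by rewrite (le_trans (le_normcD _ _))// lerD ?pB ?fp1.
apply: (@differentiable_quadratic _ _ f x (A f) (2 * (M + 1) / r ^+ 2) (r / 2)).
  by rewrite divr_gt0.
move=> s h sr hs.
have [s0|s0] := pselect (0 < s); last first.
  have -> : h = 0.
    apply/rowP => i; rewrite mxE; apply/eqP; rewrite -nc_eq0 eq_le nc_ge0 andbT.
    by rewrite (le_trans (hs i))// leNgt; apply/negP.
  rewrite linear0 addr0 subr0 subrr nc0 mulr_ge0 ?sqr_ge0// divr_ge0 ?sqr_ge0//.
  by rewrite mulr_ge0// addr_ge0.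
apply/ler_addgt0Pr => e e0.
(* [d * S] collects the errors of the approximation: two values of the function, the linear part,
   and the bound [M + d] in place of [M]. *)
pose S : R := 2 + n%:R * (s / r) + 2 * (s / r) ^+ 2.
have sr0 : 0 <= s / r by rewrite divr_ge0// ltW.
have nsr : 0 <= n%:R * (s / r) by rewrite mulr_ge0.
have S0 : 0 < S by rewrite /S; have := sqr_ge0 (s / r); lra.
pose d := Num.min 1 (e / S).
have d0 : 0 < d by rewrite lt_min ltr01 divr_gt0.
have d1 : d <= 1 by rewrite ge_min lexx.
have dS : d * S <= e by rewrite -ler_pdivlMr// ge_min lexx orbT.
have [p pp fpd] := fp d d0.
have [a pa] := taylor_poly x pp.
have aE i : a i = A p i.
  have [P [P1 _ P3]] := pa (delta_mx ord0 i); rewrite lform_delta in P3.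
  rewrite /A.
  have -> : (fun y => p (cir i y) * cis ((- 1%N%:Z)%:~R * y)) =
    (fun y => P.[r%:C * cis y] * cis ((- 1%N%:Z)%:~R * y)).
    by apply/funext => y; rewrite P1.
  rewrite circle_coef expr1 P3 mulrCA -rmorphM mulVf ?mulr1// gt_eqF//.
have pM (w : T) : (forall i, nc (w ord0 i - x ord0 i) <= r) -> nc (p w) <= M + d.
  move=> wx; have -> : p w = f w - (f w - p w) by rewrite opprB addrC subrK.
  by rewrite (le_trans (ncB _ _))// lerD ?fM ?fpd.
have key := poly_taylor pp r0 pM pa s0 sr hs.
have Af i : nc (A f i - a i) <= d / r.
  rewrite aE /A -mulrBr Normc.normcM ncR_ge0 ?invr_ge0// mulrC ler_pM2r ?invr_gt0//.
  have c1 (g : T -> C) : continuous (fun y => g (cir i y)) ->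
     continuous (fun y => g (cir i y) * cis ((- 1%N%:Z)%:~R * y)).
    by move=> cg; exact: (ccontM cg (@ccont_cis _ _)).
  rewrite -(meanB (c1 _ (ccf i)) (c1 _ (ccp p i pp))); apply: mean_le.
    apply: (ccontD (c1 _ (ccf i))); under eq_fun do rewrite -mulN1r.
    exact: (ccontM (@ccont_cst _ _) (c1 _ (ccp p i pp))).
  by move=> y _; rewrite -mulrBl Normc.normcM nc_cis mulr1 fpd.
have xh i : nc ((x + h) ord0 i - x ord0 i) <= r.
  by rewrite mxE addrAC subrr add0r (le_trans (hs i))// (le_trans sr)// ler_pdivrMr// ler_peMr// ler1n.
have -> : f (x + h) - f x - lform (A f) h = (f (x + h) - p (x + h)) - (f x - p x)
   - lform (fun i => A f i - a i) h + (p (x + h) - p x - lform a h).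
  have -> : lform (fun i => A f i - a i) h = lform (A f) h - lform a h.
    by rewrite /lform -sumrB; apply: eq_bigr => i _; rewrite mulrBl.
  by ring.
have b1 := fpd _ xh; have b2 := fpd _ x_near.
have b3 : nc (lform (fun i => A f i - a i) h) <= d * (n%:R * (s / r)).
  rewrite (le_trans (lform_le _ hs))//.
  have : \sum_i nc (A f i - a i) <= \sum_(i < n) d / r by apply: ler_sum => i _.
  rewrite sumr_const card_ord -[(d / r) *+ n]mulr_natr => hsum.
  rewrite (le_trans (ler_wpM2r (ltW s0) hsum))// le_eqVlt; apply/orP; left; apply/eqP; ring.
have E : 2 * (M + d) * (s / r) ^+ 2 = 2 * M * (s / r) ^+ 2 + d * (2 * (s / r) ^+ 2) by ring.
have E2 : 2 * (M + 1) / r ^+ 2 * s ^+ 2 = 2 * M * (s / r) ^+ 2 + 2 * (s / r) ^+ 2.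
  by rewrite expr_div_n; ring.
rewrite E in key; rewrite E2; rewrite /S mulrDr mulrDr in dS.
apply: le_trans (le_normcD _ _) _.
have k1 := le_trans (ncB _ _) (lerD (le_trans (ncB _ _) (lerD b1 b2)) b3).
apply: le_trans (lerD k1 key) _.
have w0 := sqr_ge0 (s / r).
by move: (s / r) dS w0 => q dS w0; lra.
Qed.

End locally_uniform_limits.

(** * Hardy space and boundary functions *)

Section complex_sequences.
Context {R : realType}.
Local Notation C := R[i].
Implicit Types (u v : nat -> C) (a b : C).

Definition ncvg u a := forall e : R, 0 < e -> exists N, forall k, (N <= k)%N -> nc (u k - a) <= e.

Lemma ncvgM u v a b : ncvg u a -> ncvg v b -> ncvg (fun k => u k * v k) (a * b).
Proof.
move=> ua vb e e0.
have a1 : 0 < nc a + 1 by rewrite ltr_wpDl ?nc_ge0.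
have b1 : 0 < nc b + 1 by rewrite ltr_wpDl ?nc_ge0.
pose d := Num.min 1 (e / 2 / (nc a + 1)).
have d0 : 0 < d by rewrite lt_min ltr01 !divr_gt0.
have d1 : d <= 1 by rewrite ge_min lexx.
have da : d * (nc a + 1) <= e / 2 by rewrite -ler_pdivlMr// ge_min lexx orbT.
have [N NP] := ua (e / 2 / (nc b + 1)) ltac:(by rewrite !divr_gt0).
have [M MP] := vb d d0.
exists (maxn N M) => k; rewrite geq_max => /andP[k1 k2].
have hu := NP k k1; have hv := MP k k2; rewrite ler_pdivlMr// in hu.
have bv : nc (v k) <= nc b + 1.
  rewrite -[v k](subrK b) addrC (le_trans (le_normcD _ _))// lerD2l.
  exact: le_trans hv d1.
have -> : u k * v k - a * b = (u k - a) * v k + a * (v k - b) by ring.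
apply: le_trans (le_normcD _ _) _; rewrite !Normc.normcM.
have -> : e = e / 2 + e / 2 by lra.
apply: lerD.
  by apply: le_trans hu; rewrite ler_wpM2l ?nc_ge0.
apply: le_trans da; rewrite mulrC; apply: ler_pM; rewrite ?nc_ge0//.
by rewrite lerDl.
Qed.

Lemma ncvgL (c : C) u v a b : ncvg u a -> ncvg v b -> ncvg (fun k => c * u k + v k) (c * a + b).
Proof.
move=> ua vb e e0; have c1 : 0 < nc c + 1 by rewrite ltr_wpDl ?nc_ge0.
have [N NP] := ua (e / 2 / (nc c + 1)) ltac:(by rewrite !divr_gt0).
have [M MP] := vb (e / 2) ltac:(by rewrite divr_gt0).
exists (maxn N M) => k; rewrite geq_max => /andP[k1 k2].
have -> : c * u k + v k - (c * a + b) = c * (u k - a) + (v k - b) by ring.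
apply: le_trans (le_normcD _ _) _; rewrite Normc.normcM.
have -> : e = e / 2 + e / 2 by lra.
apply: lerD; last exact: MP.
have := NP k k1; rewrite ler_pdivlMr// => /(le_trans _); apply.
by rewrite mulrC ler_wpM2l ?nc_ge0// lerDl.
Qed.

Lemma ncvg_complete u :
  (forall e : R, 0 < e -> exists N, forall k l, (N <= k)%N -> (N <= l)%N -> nc (u k - u l) <= e) ->
  exists a, ncvg u a.
Proof.
move=> uc.
have H (g : C -> R) : (forall x y, `|g x - g y| <= nc (x - y)) -> cvgn (g \o u).
  move=> gle; apply/cauchy_cvgP/cauchy_ballP => e e0.
  have [N NP] := uc (e / 2) ltac:(by rewrite divr_gt0).
  pose A := [set g (u k) | k in [set k | (N <= k)%N]].
  exists (A, A) => /=; first by split; exists N => // k Nk; exists k.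
  move=> [_ _] /= [[k Nk <-] [l Nl <-]]; rewrite -ball_normE /ball_/= (le_lt_trans (gle _ _))//.
  by rewrite (le_lt_trans (NP _ _ Nk Nl))//; lra.
have cR : cvgn (fun k => Re (u k)) by apply: (H (@complex.Re R)) => x y; rewrite -ReN -ReD normc_ge_absRe.
have cI : cvgn (fun k => Im (u k)) by apply: (H (@complex.Im R)) => x y; rewrite -ImN -ImD normc_ge_absIm.
exists (limn (fun k => Re (u k)) +i* limn (fun k => Im (u k))) => e e0.
have /cvgr0Pnorm_lt/(_ e e0)[N _ NP] := @cvg_nc_ReIm R u (limn (fun k => Re (u k)) +i* limn (fun k => Im (u k))) cR cI.
by exists N => k Nk; have := NP k Nk; rewrite ger0_norm ?nc_ge0// => /ltW.
Qed.

Lemma natSinv_le (e : R) : 0 < e -> exists N, forall k, (N <= k)%N -> k.+1%:R^-1 <= e.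
Proof.
move=> e0; exists (Num.truncn e^-1) => k Nk.
rewrite -[e]invrK lef_pV2 ?posrE ?invr_gt0//.
by rewrite (le_trans (ltW (truncnS_gt _)))// ler_nat.
Qed.

End complex_sequences.

(** * Dilations and limits of polynomials in the ball *)

Section hardy_boundary.
Context {R : realType} {n : nat}.
Hypothesis n_gt0 : (0 < n)%N.
Local Notation C := R[i].
Local Notation T := 'rV[C]_n.
Local Notation SH := (@L2_semi_hilbert R n).
Local Notation N2 := (hn (@L2dot R n)).
Local Notation cvg2 := (hn_cvg (@L2dot R n)).
Implicit Types (f g p : T -> C) (F G : T -> C) (z : T).

Lemma ball_nbhd z : unit_ball z -> exists r r' : R, [/\ 0 < r, r' < 1 &
  forall w : T, (forall i, nc (w ord0 i - z ord0 i) <= r) -> enorm w <= r'].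
Proof.
move=> /unit_ballP bz; have [e e0 eP] := ball_room (fun i => nc_ge0 (z ord0 i)) bz.
exists e, (Num.sqrt (\sum_(i < n) (nc (z ord0 i) + 3 * e) ^+ 2)); split=> //.
  by rewrite -[ltRHS]sqrtr1 ltr_sqrt.
move=> w wz; rewrite ler_sqrt; last by apply: sumr_ge0 => i _; exact: sqr_ge0.
apply: ler_sum => i _.
have e3 : 0 <= 3 * e by rewrite mulr_ge0// ltW.
rewrite ler_pXn2r ?nnegrE ?nc_ge0 ?addr_ge0 ?nc_ge0//.
have -> : w ord0 i = z ord0 i + (w ord0 i - z ord0 i) by rewrite addrC subrK.
by rewrite (le_trans (le_normcD _ _))// lerD2l (le_trans (wz i))//; lra.
Qed.

Lemma analytic_diff f : analytic f -> forall z, unit_ball z -> differentiable f z.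
Proof. by case. Qed.

(** Goes through the polynomial criterion: near [z], polynomials approximating [f] approximate [g]
    as well. *)
Lemma analytic_local f g : (forall z, unit_ball z -> differentiable f z) ->
  (forall z, unit_ball z -> f z = g z) -> forall z, unit_ball z -> differentiable g z.
Proof.
move=> df fg z bz; have [r [r' [r0 r'1 rP]]] := ball_nbhd bz.
apply: (@lim_poly_differentiable _ _ g z r r0) => e e0.
have [p pp fp] := analytic_poly_approx df r'1 e0.
exists p => // w wz; rewrite -fg ?fp ?rP//.
by rewrite /unit_ball/= (le_lt_trans (rP _ wz)).
Qed.

Lemma is_poly_differentiable p z : is_poly p -> differentiable p z.
Proof.
by move=> pp; apply: (@lim_poly_differentiable _ _ p z 1 ltr01) => e e0;
  exists p => // w _; rewrite subrr nc0 ltW.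
Qed.

Lemma on_ballE f z : unit_ball z -> on_ball f z = f z.
Proof. by move=> bz; rewrite /on_ball patchE mem_set. Qed.

Lemma analytic_on_ball f : (forall z, unit_ball z -> differentiable f z) -> analytic (on_ball f).
Proof.
move=> df; split; last by move=> z nz; rewrite /on_ball patchE memNset.
by apply: (analytic_local df) => z bz; rewrite on_ballE.
Qed.

Lemma analytic_poly p : is_poly p -> analytic (on_ball p).
Proof. by move=> pp; apply: analytic_on_ball => z _; exact: is_poly_differentiable. Qed.

Lemma analyticL a f g : analytic f -> analytic g -> analytic (a *: f + g).
Proof.
move=> [df f0] [dg g0]; split=> [z bz|z nz]; last first.
  by rewrite -[LHS]/(a * f z + g z) f0// g0// mulr0 add0r.
by apply: differentiableD; [apply: differentiableZ; exact: df|exact: dg].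
Qed.

Lemma analyticM f g : analytic f -> analytic g -> analytic (f \* g).
Proof.
move=> [df f0] [dg g0]; split=> [z bz|z nz]; last by rewrite /= f0// mul0r.
by apply: differentiableM; [exact: df|exact: dg].
Qed.

(** The sigma-algebra on rows is generated by the coordinates, so measurability is taken from
    polynomials: cut off to the ball, suitable ones converge to [f] at every point. *)
Lemma analytic_mfun f : analytic f -> mfun f.
Proof.
move=> [df f0].
have rk k : 1 - k.+1%:R^-1 < 1 :> R by rewrite ltrBlDr ltrDl.
have ek k : 0 < k.+1%:R^-1 :> R by [].
have /choice[p pP] k : exists p, is_poly p /\
    forall z, enorm z <= 1 - k.+1%:R^-1 -> nc (f z - p z) <= k.+1%:R^-1.
  by have [p pp pf] := analytic_poly_approx df (rk k) (ek k); exists p.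
apply: (@mfun_cvg _ _ (fun k z => (\1_unit_ball z)%:C * p k z)) => [k|z].
  apply: mfunM; last by apply: is_poly_mfun; have [] := pP k.
  apply/mfunP; split; last exact: measurable_cst.
  exact: measurable_indic (@measurable_unit_ball R n).
apply/cvgr0Pnorm_le => e e0.
have [bz|nbz] := pselect (unit_ball z); last first.
  near=> k; rewrite indicE memNset// mul0r f0// subrr nc0 normr0 ltW//.
have z1 : 0 < 1 - enorm z by rewrite subr_gt0.
have [N1 N1P] := natSinv_le z1; have [N2 N2P] := natSinv_le e0.
exists (maxn N1 N2) => // k /=; rewrite geq_max => /andP[k1 k2].
rewrite ger0_norm ?nc_ge0// indicE mem_set// mul1r ncBC.
apply: le_trans (N2P k k2); have [_] := pP k; apply.
by rewrite lerBrDr -lerBrDl N1P.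
Unshelve. all: end_near. Qed.

Lemma mfun_dil f r : mfun f -> mfun (dil r f).
Proof.
move=> mf; have mr := @measurable_rot R n (fun=> r%:C).
have -> : dil r f = f \o rot (fun=> r%:C).
  by apply/funext => z; congr f; apply/rowP => i; rewrite !mxE.
exact: measurableT_comp.
Qed.

Lemma dil_enorm r s z : 0 <= r -> r <= s -> enorm z = 1 -> enorm (r%:C *: z : T) <= s.
Proof. by move=> r0 rs z1; rewrite enormZr// z1 mulr1. Qed.

Lemma dil_L2 f r : analytic f -> 0 <= r -> r < 1 -> L2 (dil r f).
Proof.
move=> af r0 r1; have uf := analytic_ucont (analytic_diff af).
have [B B0 fB] := ucont_bounded uf r1.
have [] // := @L2_sphere_bounded R n n_gt0 (dil r f) B B0 (mfun_dil r (analytic_mfun af)).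
by move=> z z1; apply/fB/dil_enorm.
Qed.

Lemma dil_dist_le f g r (e : R) : mfun f -> mfun g -> 0 <= r -> 0 <= e ->
  (forall z, enorm z <= r -> nc (f z - g z) <= e) -> N2 (dil r f - dil r g) <= e.
Proof.
move=> mf mg r0 e0 fg.
have [] // := @L2_sphere_bounded R n n_gt0 (dil r f - dil r g) e e0.
  by apply: mfunB; exact: mfun_dil.
by move=> z z1; apply/fg/dil_enorm.
Qed.

Lemma dil1 f : dil 1 f = f.
Proof. by apply/funext => z; rewrite /dil scale1r. Qed.

(** Each monomial contributes through [1 - r ^+ m <= m * (1 - r)], with a constant valid on the
    whole closed ball. *)
Lemma poly_dil_lip p : is_poly p -> exists2 L : R, 0 <= L &
  forall r z, 0 <= r -> r <= 1 -> enorm z <= 1 -> nc (p (r%:C *: z) - p z) <= L * (1 - r).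
Proof.
move=> /is_polyP[D [c ->]].
exists (\sum_a nc (c a) * (\sum_i a i)%N%:R).
  by apply: sumr_ge0 => a _; rewrite mulr_ge0 ?nc_ge0.
move=> r z r0 r1 z1; rewrite /pfun -sumrB (le_trans (nc_sum _ _ _))// mulr_suml.
apply: ler_sum => a _; rewrite -mulrBr Normc.normcM -mulrA ler_wpM2l ?nc_ge0//.
rewrite monZ -[X in _ - X]mul1r -mulrBl Normc.normcM.
set m := (\sum_i a i)%N.
have m1 : nc (mon (fun i => a i) z) <= 1.
  rewrite nc_mon; apply: prodr_ile1 => i _; rewrite exprn_ge0 ?nc_ge0//=.
  by rewrite exprn_ile1 ?nc_ge0// (le_trans (nc_le_enorm _ _)).
have -> : r%:C ^+ m - 1 = (r ^+ m - 1)%:C by rewrite rmorphB rmorphXn.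
rewrite ncR ler0_norm ?subr_le0 ?exprn_ile1// opprB.
apply: (@le_trans _ _ (1 - r ^+ m)); first by rewrite ler_piMr// subr_ge0 exprn_ile1.
elim: m => [|m ih]; first by rewrite expr0 subrr mul0r.
rewrite exprS -natr1; have := exprn_ge0 m r0.
have : r ^+ m <= 1 by rewrite exprn_ile1.
nra.
Qed.

Lemma poly_dil_cvg p (e : R) : is_poly p -> 0 < e -> exists2 r0 : R, 0 <= r0 < 1 &
  forall r, r0 <= r -> r <= 1 -> N2 (dil r p - p) <= e.
Proof.
move=> pp e0; have [L L0 LP] := poly_dil_lip pp.
have L1 : 0 < L + 1 by rewrite ltr_wpDl.
pose d := Num.min 1 (e / (L + 1)).
have d0 : 0 < d by rewrite lt_min ltr01 divr_gt0.
have d1 : d <= 1 by rewrite ge_min lexx.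
have dL : d * (L + 1) <= e by rewrite -ler_pdivlMr// ge_min lexx orbT.
exists (1 - d); first by apply/andP; split; lra.
move=> r rd r1; have r0 : 0 <= r by lra.
have mp := is_poly_mfun pp.
have [] // := @L2_sphere_bounded R n n_gt0 (dil r p - p) e (ltW e0).
  by apply: mfunB => //; exact: mfun_dil.
move=> z z1; apply: le_trans (LP r z r0 r1 _) _; first by rewrite z1.
by nra.
Qed.

(** By [point_evaluation] convergence in L^2 of the sphere forces locally uniform convergence in the
    ball. *)
Lemma poly_lim_analytic (p : nat -> T -> C) F : (forall k, is_poly (p k)) -> L2 F -> cvg2 p F ->
  exists2 f, analytic f & forall z, unit_ball z -> ncvg (p ^~ z) (f z).
Proof.
move=> pp LF pF; have Lp k := is_poly_L2 n_gt0 (pp k).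
have pc (e : R) : 0 < e -> exists N, forall k l, (N <= k)%N -> (N <= l)%N -> N2 (p k - p l) <= e.
  move=> e0; have [N NP] := pF (e / 2) ltac:(by rewrite divr_gt0).
  exists N => k l Nk Nl; rewrite (le_trans (hn_tri SH (Lp k) (Lp l) LF))//.
  by have := NP k Nk; have := NP l Nl; rewrite (hnBC SH LF (Lp l)); lra.
have loc z : unit_ball z -> exists r : R, 0 < r /\ forall e : R, 0 < e ->
    exists N, forall k l, (N <= k)%N -> (N <= l)%N -> forall w : T,
      (forall i, nc (w ord0 i - z ord0 i) <= r) -> nc (p k w - p l w) <= e.
  move=> bz; have [r [K [r0 K0 rK]]] := point_evaluation n_gt0 bz.
  exists r; split=> // e e0; have K1 : 0 < K + 1 by rewrite ltr_wpDl.
  have [N NP] := pc (e / (K + 1)) ltac:(by rewrite divr_gt0).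
  exists N => k l Nk Nl w wz.
  have := rK (p k \- p l) (is_polyB (pp k) (pp l)) w.
  move=> /(_ _)/le_trans; apply=> [i|].
    have -> : w ord0 i = z ord0 i + (w ord0 i - z ord0 i) by rewrite addrC subrK.
    by rewrite (le_trans (le_normcD _ _))// lerD2l.
  have := NP k l Nk Nl; rewrite ler_pdivlMr// => h.
  have : 0 <= N2 (p k - p l) by exact: hn_ge0.
  rewrite -[N2 (_ \- _)]/(N2 (p k - p l)); nra.
have zz z i : nc (z ord0 i - z ord0 i : C) <= 0 by rewrite subrr nc0.
have /choice[f fP] z : exists c, unit_ball z -> ncvg (p ^~ z) c.
  have [bz|nbz] := pselect (unit_ball z); last by exists 0.
  have [r [r0 rP]] := loc z bz.
  have [|c cP] := @ncvg_complete R (p ^~ z); last by exists c.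
  move=> e e0; have [N NP] := rP e e0; exists N => k l Nk Nl; apply: NP => // i.
  by rewrite (le_trans (zz z i))// ltW.
exists (on_ball f); last by move=> z bz; rewrite on_ballE//; exact: fP.
apply: analytic_on_ball => z bz.
have [r1 [r1' [r10 r1'1 r1P]]] := ball_nbhd bz.
have [r [r0 rP]] := loc z bz.
pose s := Num.min r r1.
have s0 : 0 < s by rewrite lt_min r0.
apply: (@lim_poly_differentiable _ _ f z s s0) => e e0.
have e2 : 0 < e / 2 by rewrite divr_gt0.
have [N NP] := rP _ e2; exists (p N) => // w wz.
have w1 i : nc (w ord0 i - z ord0 i) <= r by rewrite (le_trans (wz i))// ge_min lexx.
have bw : unit_ball w.
  by apply: le_lt_trans r1'1; apply: r1P => i; rewrite (le_trans (wz i))// ge_min lexx orbT.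
have [N' N'P] := fP w bw _ e2.
have := N'P (maxn N N') (leq_maxr _ _); have := NP N (maxn N N') (leqnn _) (leq_maxl _ _) w w1.
set a := p N w; set b := p _ w => h1 h2.
rewrite ncBC (_ : a - f w = (a - b) + (b - f w)); last by ring.
by rewrite (le_trans (le_normcD _ _))//; lra.
Qed.

End hardy_boundary.

(** * The relation between functions on the ball and boundary functions *)

Section hardy_space.
Context {R : realType} {n : nat}.
Hypothesis n_gt0 : (0 < n)%N.
Local Notation C := R[i].
Local Notation T := 'rV[C]_n.
Local Notation sigma := (@sphere_measure R n).
Local Notation SH := (@L2_semi_hilbert R n).
Local Notation N2 := (hn (@L2dot R n)).
Local Notation cvg2 := (hn_cvg (@L2dot R n)).
Implicit Types (f g p : T -> C) (F G : T -> C) (z : T).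

(* [F] is the boundary value of [f], as witnessed by polynomials converging to
   [F] in L^2 and to [f] pointwise on the ball. *)
Definition bval f F := [/\ analytic f, L2 F & exists p : nat -> T -> C,
  [/\ forall k, is_poly (p k), cvg2 p F & forall z, unit_ball z -> ncvg (p ^~ z) (f z)]].

Lemma ae_ball_dil r : 0 <= r -> r < 1 -> {ae sigma, forall z : T, unit_ball (r%:C *: z)}.
Proof.
move=> r0 r1; have := @ae_sphere R n n_gt0; apply: filterS => z z1.
by rewrite /unit_ball/= enormZr// z1 mulr1.
Qed.

Lemma cvg2_cauchy (p : nat -> T -> C) F : (forall k, L2 (p k)) -> L2 F -> cvg2 p F ->
  hn_cauchy (@L2dot R n) p.
Proof.
move=> Lp LF pF e e0; have [N NP] := pF (e / 2) ltac:(by rewrite divr_gt0).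
exists N => k l Nk Nl; rewrite (le_trans (hn_tri SH (Lp k) (Lp l) LF))//.
by have := NP k Nk; have := NP l Nl; rewrite (hnBC SH LF (Lp l)); lra.
Qed.

(** The approximation is uniform in the radius: dilating a polynomial does not increase its norm,
    and Fatou's lemma carries the Cauchy estimate to [f]. *)
Lemma bval_dil_tail f F : bval f F -> exists p : nat -> T -> C,
  [/\ forall k, is_poly (p k), cvg2 p F, (forall z, unit_ball z -> ncvg (p ^~ z) (f z)) &
    forall e : R, 0 < e -> exists N, forall k, (N <= k)%N -> forall r, 0 <= r -> r < 1 ->
      N2 (dil r f - dil r (p k)) <= e].
Proof.
move=> [af LF [p [pp pF pf]]]; exists p; split=> // e e0.
have Lp k := is_poly_L2 n_gt0 (pp k).
have [N NP] := cvg2_cauchy Lp LF pF e0.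
exists N => k Nk r r0 r1.
have mf := analytic_mfun af.
have md q : is_poly q -> mfun (dil r q) by move=> /is_poly_mfun mq; exact: mfun_dil.
have Ldf := dil_L2 n_gt0 af r0 r1.
have Ldp l : L2 (dil r (p l)).
  by apply: (is_poly_L2 n_gt0); exact: is_poly_dil.
rewrite N2_le ?(ltW e0)//; last exact: (shB SH).
apply: (@L2_fatou R n (fun l => dil r (p (N + l)%N) - dil r (p k))).
- by move=> l; apply: mfunB; exact: md.
- by apply: mfunB; [exact: mfun_dil|exact: md].
- have := ae_ball_dil r0 r1; apply: filterS => z bz.
  apply/cvgr0Pnorm_le => d d0; have [M MP] := pf _ bz d d0.
  exists M => // l /= Ml; rewrite ger0_norm ?nc_ge0//.
  have -> : dil r (p (N + l)%N) z - dil r (p k) z - (dil r f z - dil r (p k) z) =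
    p (N + l)%N (r%:C *: z) - f (r%:C *: z) by rewrite /dil; ring.
  by apply: MP; rewrite (leq_trans Ml)// leq_addl.
move=> l; rewrite -N2_le ?(ltW e0)//; last exact: (shB SH).
rewrite -[dil r _ - _]/(dil r (p (N + l)%N \- p k)).
apply: le_trans (NP (N + l)%N k (leq_addr _ _) Nk).
rewrite -[leRHS](congr1 N2 (dil1 _)).
by apply: dil_N2_le => //; [exact: is_polyB|exact: ltW].
Qed.

Lemma bval_dil_le f F r : bval f F -> 0 <= r -> r < 1 -> N2 (dil r f) <= N2 F.
Proof.
move=> bf r0 r1; have [af LF _] := bf.
have [p [pp pF pf tail]] := bval_dil_tail bf.
apply/ler_addgt0Pr => e e0; have e2 : 0 < e / 2 by rewrite divr_gt0.
have [N1 N1P] := tail _ e2; have [N2' N2P] := pF _ e2.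
pose k := maxn N1 N2'; have Lp := is_poly_L2 n_gt0 (pp k).
have Ldp : L2 (dil r (p k)) by apply: (is_poly_L2 n_gt0); exact: is_poly_dil.
have Ldf := dil_L2 n_gt0 af r0 r1.
have h1 := N1P k (leq_maxl _ _) r r0 r1.
have h2 := N2P k (leq_maxr _ _).
have h3 : N2 (dil r (p k)) <= N2 (p k).
  rewrite -[leRHS](congr1 N2 (dil1 _)).
  by apply: dil_N2_le => //; exact: ltW.
have h4 : N2 (dil r f) <= N2 (dil r f - dil r (p k)) + N2 (dil r (p k)).
  by rewrite -{1}[dil r f](subrK (dil r (p k))); apply: (hnD SH) => //; exact: (shB SH).
have h5 : N2 (p k) <= N2 (p k - F) + N2 F.
  by rewrite -{1}[p k](subrK F); apply: (hnD SH) => //; exact: (shB SH).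
rewrite (splitr e) addrC -addrA.
exact: le_trans h4 (lerD h1 (le_trans h3 (le_trans h5 (lerD h2 (lexx _))))).
Qed.

Lemma bval_dil_cvg f F (e : R) : bval f F -> 0 < e -> exists2 r0 : R, 0 <= r0 < 1 &
  forall r, r0 <= r -> r < 1 -> N2 (dil r f - F) <= e.
Proof.
move=> bf e0; have [af LF _] := bf.
have [p [pp pF pf tail]] := bval_dil_tail bf.
have e3 : 0 < e / 3 by rewrite divr_gt0.
have [N1 N1P] := tail _ e3; have [N2' N2P] := pF _ e3.
pose k := maxn N1 N2'; have Lp := is_poly_L2 n_gt0 (pp k).
have [r0 r01 r0P] := poly_dil_cvg n_gt0 (pp k) e3.
exists r0 => // r rr r1; have rp : 0 <= r by case/andP: r01 => h _; exact: le_trans rr.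
have Ldp : L2 (dil r (p k)) by apply: (is_poly_L2 n_gt0); exact: is_poly_dil.
have Ldf := dil_L2 n_gt0 af rp r1.
have h1 := N1P k (leq_maxl _ _) r rp r1.
have h2 := N2P k (leq_maxr _ _).
have h3 := r0P r rr (ltW r1).
have h4 := hn_tri SH Ldf LF Ldp.
have h5 := hn_tri SH Ldp LF Lp.
have -> : e = e / 3 + (e / 3 + e / 3) by field.
exact: le_trans h4 (lerD h1 (le_trans h5 (lerD h3 h2))).
Qed.

Lemma bval_hardy f F : bval f F -> hardy_norm2 f = (N2 F ^+ 2)%:E.
Proof.
move=> bf; have [af LF _] := bf.
apply/eqP; rewrite eq_le; apply/andP; split.
  apply: ge_ereal_sup => _ [r /andP[r0 r1] <-].
  rewrite -[X in (X <= _)%E]/(L2norm2 (dil r f)) -N2_le ?hn_ge0//.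
    exact: bval_dil_le bf (ltW r0) r1.
  by apply: (dil_L2 n_gt0) => //; exact: ltW.
apply/lee_addgt0Pr => e e0.
have F1 : 0 < 2 * N2 F + 1 by rewrite ltr_wpDl// mulr_ge0 ?hn_ge0.
have ee : 0 < e / (2 * N2 F + 1) by rewrite divr_gt0.
have [r0 /andP[r00 r01] r0P] := bval_dil_cvg bf ee.
(* [hardy_norm2] ranges over positive radii, while [r0] may be 0. *)
pose r := Num.max r0 2^-1.
have rp : 0 < r by rewrite lt_max invr_gt0 ltr0n orbT.
have r1 : r < 1 by rewrite gt_max r01 invf_lt1// ltr1n.
have rr : r0 <= r by rewrite le_max lexx.
have Ldf := dil_L2 n_gt0 af (ltW rp) r1.
have h := r0P r rr r1.
have h4 : N2 F <= N2 (dil r f) + N2 (dil r f - F).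
  rewrite -(hnBC SH LF Ldf) -{1}[F](subrK (dil r f)) addrC.
  by rewrite [leRHS]addrC addrC; apply: (hnD SH) => //; exact: (shB SH).
apply: (@le_trans _ _ (L2norm2 (dil r f) + e%:E)%E); last first.
  by apply: leeD => //; apply: ereal_sup_ubound; exists r => //=; apply/andP.
rewrite L2norm2E// -EFinD lee_fin.
have := bval_dil_le bf (ltW rp) r1.
have := hn_ge0 (@L2dot R n) (dil r f).
have := hn_ge0 (@L2dot R n) F.
move: h; rewrite ler_pdivlMr//.
have := hn_ge0 (@L2dot R n) (dil r f - F).
move: (N2 (dil r f - F)) (N2 (dil r f)) (N2 F) h4 => a b c *; nra.
Qed.

Lemma bval_H2 f F : bval f F -> H2 f.
Proof. by move=> bf; split; [case: bf|rewrite (bval_hardy bf) ltry]. Qed.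

Lemma bval_H2S f F : bval f F -> H2S F.
Proof.
move=> [af LF [p [pp pF pf]]]; split=> // e e0.
pose d := Num.min 1 (e / 2); have d0 : 0 < d by rewrite lt_min ltr01 divr_gt0.
have d1 : d <= 1 by rewrite ge_min lexx.
have de : d <= e / 2 by rewrite ge_min lexx orbT.
have [N NP] := pF d d0; have [q qE] := pp N; exists q; rewrite -qE.
have Lp := is_poly_L2 n_gt0 (pp N).
rewrite -[F \- p N]/(F - p N) L2norm2E; last exact: (shB SH).
rewrite lte_fin (hnBC SH LF Lp); have := NP N (leqnn _).
by have := hn_ge0 (@L2dot R n) (p N - F); nra.
Qed.

Lemma H2S_bval F : H2S F -> exists f, bval f F.
Proof.
move=> [LF Fp].
have /choice[p pP] k : exists p, is_poly p /\ N2 (p - F) <= k.+1%:R^-1.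
  have k0 : 0 < (k.+1%:R^-1) ^+ 2 :> R by rewrite exprn_gt0.
  have [p pF] := Fp _ k0; have pp : is_poly (poly_fun p) by exists p.
  exists (poly_fun p); split=> //; have Lp := is_poly_L2 n_gt0 pp.
  by rewrite (hnBC SH Lp LF) N2_le ?ltW//; exact: (shB SH).
have pp k : is_poly (p k) by have [] := pP k.
have pF : cvg2 p F.
  move=> e e0; have [N NP] := natSinv_le e0; exists N => k Nk.
  by apply: le_trans (NP k Nk); have [] := pP k.
have [f af pf] := poly_lim_analytic n_gt0 pp LF pF.
by exists f; split => //; exists p.
Qed.

Lemma bvalL a f g F G : bval f F -> bval g G -> bval (a *: f + g) (a *: F + G).
Proof.
move=> [af LF [p [pp pF pf]]] [ag LG [q [qq qG qg]]]; split.
- exact: analyticL.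
- exact: (shL SH).
have Lp k := is_poly_L2 n_gt0 (pp k); have Lq k := is_poly_L2 n_gt0 (qq k).
exists (fun k => a *: p k + q k); split.
- by move=> k; apply: is_polyD => //; exact: is_polyZ.
- move=> e e0; have a1 : 0 < nc a + 1 by rewrite ltr_wpDl ?nc_ge0.
  have [N1 N1P] := pF (e / 2 / (nc a + 1)) ltac:(by rewrite !divr_gt0).
  have [M MP] := qG (e / 2) ltac:(by rewrite divr_gt0).
  exists (maxn N1 M) => k; rewrite geq_max => /andP[k1 k2].
  have -> : a *: p k + q k - (a *: F + G) = a *: (p k - F) + (q k - G).
    by rewrite scalerBr opprD addrACA.
  have L1 : L2 (p k - F) by exact: (shB SH).
  rewrite (le_trans (hnD SH (shZ SH a L1) (shB SH (Lq k) LG)))// (hnZ SH)//.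
  have := N1P k k1; rewrite ler_pdivlMr// => h; have := MP k k2.
  have := hn_ge0 (@L2dot R n) (p k - F); nra.
move=> z bz; exact: (ncvgL a (pf z bz) (qg z bz)).
Qed.

Lemma bval_poly p : is_poly p -> bval (on_ball p) p.
Proof.
move=> pp; have Lp := is_poly_L2 n_gt0 pp; split => //; first exact: analytic_poly.
exists (fun=> p); split => // [e e0|z bz e e0].
  by exists 0%N => k _; rewrite subrr (hn0 SH) ltW.
by exists 0%N => k _; rewrite on_ballE// subrr nc0 ltW.
Qed.

Lemma bval0 : bval 0 0.
Proof.
have := bval_poly (is_poly_cst 0); rewrite (_ : on_ball _ = 0)//.
by apply/funext => z; rewrite /on_ball patchE; case: ifP.
Qed.

(** The difference is a boundary function of 0, and its norm is determined by the function on the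
    ball. *)
Lemma bval_unique f F F' : bval f F -> bval f F' -> F = F' %[ae sigma].
Proof.
move=> b1 b2; have := bvalL (-1) b1 b2; rewrite scaleN1r addNr => b3.
have [_ L1 _] := b1; have [_ L2' _] := b2.
have E : N2 (F' - F) = 0.
  rewrite addrC -scaleN1r; have := bval_hardy b3; rewrite (bval_hardy bval0).
  by rewrite (hn0 SH) expr0n => -[] /esym/eqP; rewrite sqrf_eq0 => /eqP.
have := N2_sub_eq0 L2' L1 E; apply: filterS => z h zT; exact/esym/h.
Qed.

Lemma N2_mul_le F G (c : R) : 0 <= c -> mfun F -> L2 G ->
  {ae sigma, forall z, nc (F z) <= c} -> L2 (F \* G) /\ N2 (F \* G) <= c * N2 G.
Proof.
move=> c0 mF LG Fc; have mG : mfun G by case: LG.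
have mFG := mfunM mF mG.
have h : (L2norm2 (F \* G)%R <= L2norm2 (fun z => c%:C * G z)%R)%E.
  apply: ae_ge0_le_integral => //; [|exact/measurable_EFinP/mfun_nc2| |exact/measurable_EFinP/mfun_nc2/mfunZ|].
  - by move=> z _; rewrite lee_fin sqr_ge0.
  - by move=> z _; rewrite lee_fin sqr_ge0.
  move: Fc; apply: filterS => z hz _; rewrite lee_fin ler_pXn2r ?nnegrE ?nc_ge0//.
  by rewrite !Normc.normcM ncR_ge0// ler_wpM2r ?nc_ge0.
have LcG : L2 (c%:C *: G) by exact: (shZ SH).
have LFG : L2 (F \* G) by split => //; apply: le_lt_trans h _; case: LcG.
split => //; rewrite N2_le ?mulr_ge0 ?hn_ge0//; apply: le_trans h _.
by rewrite -[X in L2norm2 X]/(c%:C *: G) L2norm2E// (hnZ SH)// ncR_ge0.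
Qed.

(** The polynomials tending to the bounded [F] need not be uniformly bounded, so products of terms
    of equal index are not controlled; the indices are chosen diagonally. *)
Lemma bvalM f g F G (c : R) : 0 <= c -> {ae sigma, forall z, nc (F z) <= c} ->
  bval f F -> bval g G -> bval (f \* g) (F \* G).
Proof.
move=> c0 Fc [af LF [p [pp pF pf]]] [ag LG [q [qq qG qg]]].
have mF : mfun F by case: LF.
have Lp k := is_poly_L2 n_gt0 (pp k); have Lq k := is_poly_L2 n_gt0 (qq k).
have /choice[B BP] k : exists B : R, 0 <= B /\ forall z, enorm z <= 1 -> nc (q k z) <= B.
  by have [B B0 qB] := is_poly_bounded (qq k); exists B.
(* [p l] is taken so close to [F] that the error stays small after multiplication by [q k], bounded
   by [B k]. *)
have /choice[l lP] k : exists l, (k <= l)%N /\ N2 (p l - F) <= k.+1%:R^-1 / (B k + 1).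
  have Bk : 0 < B k + 1 by rewrite ltr_wpDl//; case: (BP k).
  have [|N NP] := pF (k.+1%:R^-1 / (B k + 1)); first by rewrite divr_gt0.
  by exists (maxn k N); split; [exact: leq_maxl|apply/NP/leq_maxr].
have [LFG _] := N2_mul_le c0 mF LG Fc.
split; [exact: analyticM|exact: LFG|].
exists (fun k => p (l k) \* q k); split.
- by move=> k; exact: is_polyM.
- move=> e e0.
  have [N1 N1P] := natSinv_le (ltac:(by rewrite divr_gt0) : 0 < e / 2).
  have c1 : 0 < c + 1 by rewrite ltr_wpDl.
  have [M MP] := qG (e / 2 / (c + 1)) ltac:(by rewrite !divr_gt0).
  exists (maxn N1 M) => k; rewrite geq_max => /andP[k1 k2].
  have [B0 qB] := BP k; have [_ lk] := lP k.
  have qBae : {ae sigma, forall z, nc (q k z) <= B k}.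
    by have := @ae_sphere R n n_gt0; apply: filterS => z z1; apply: qB; rewrite z1.
  have Lpl : L2 (p (l k) - F) by exact: (shB SH).
  have LqG : L2 (q k - G) by exact: (shB SH).
  have [Lx hx] := N2_mul_le B0 (is_poly_mfun (qq k)) Lpl qBae.
  have [Ly hy] := N2_mul_le c0 mF LqG Fc.
  have -> : p (l k) \* q k - F \* G = q k \* (p (l k) - F) + F \* (q k - G).
    apply/funext => z.
    rewrite -[LHS]/(p (l k) z * q k z - F z * G z) -[RHS]/(q k z * (p (l k) z - F z) + F z * (q k z - G z)).
    by ring.
  apply: le_trans (hnD SH Lx Ly) _.
  have B1 : 0 < B k + 1 by rewrite ltr_wpDl.
  move: lk; rewrite ler_pdivlMr// => lk; have := MP k k2; rewrite ler_pdivlMr// => mk.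
  have := N1P k k1.
  have := hn_ge0 (@L2dot R n) (p (l k) - F); have := hn_ge0 (@L2dot R n) (q k - G).
  move: (N2 (p (l k) - F)) (N2 (q k - G)) (k.+1%:R^-1) hx hy lk mk => a b d *; nra.
move=> z bz; have h1 := pf z bz; apply: (@ncvgM _ (fun k => p (l k) z) (q ^~ z)); last exact: qg.
move=> e e0; have [N NP] := h1 e e0; exists N => k Nk.
by apply: NP; rewrite (leq_trans Nk)//; case: (lP k).
Qed.

End hardy_space.

(** * Existence of boundary functions *)

Section hardy_boundary_existence.
Context {R : realType} {n : nat}.
Hypothesis n_gt0 : (0 < n)%N.
Local Notation C := R[i].
Local Notation T := 'rV[C]_n.
Local Notation SH := (@L2_semi_hilbert R n).
Local Notation N2 := (hn (@L2dot R n)).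
Implicit Types (f g p : T -> C) (F G : T -> C) (z : T).

Lemma dil_poly_approx f (m e : R) : analytic f -> m < 1 -> 0 < e ->
  exists2 p, is_poly p & forall r, 0 <= r -> r <= m -> N2 (dil r f - dil r p) <= e.
Proof.
move=> af m1 e0; have [p pp fp] := analytic_poly_approx (analytic_diff af) m1 e0.
exists p => // r r0 rm; apply: dil_dist_le => //; first exact: analytic_mfun.
- exact: is_poly_mfun.
- exact: ltW.
by move=> z zr; apply: fp; exact: le_trans rm.
Qed.

Lemma N2_rev F G : L2 F -> L2 G -> N2 F <= N2 G + N2 (F - G).
Proof.
move=> LF LG; rewrite -{1}[F](subrK G) addrC.
by apply: (hnD SH) => //; exact: (shB SH).
Qed.

Lemma dil_mono f r s : analytic f -> 0 <= r -> r <= s -> s < 1 ->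
  N2 (dil r f) <= N2 (dil s f).
Proof.
move=> af r0 rs s1; apply/ler_addgt0Pr => e e0.
have s0 := le_trans r0 rs.
have [p pp pf] := dil_poly_approx af s1 (ltac:(by rewrite divr_gt0) : 0 < e / 2).
have Lr := dil_L2 n_gt0 af r0 (le_lt_trans rs s1).
have Ls := dil_L2 n_gt0 af s0 s1.
have Lp t : L2 (dil t p) by apply: (is_poly_L2 n_gt0); exact: is_poly_dil.
have h1 := N2_rev Lr (Lp r); have h2 := N2_rev (Lp s) Ls.
have h3 := dil_N2_le n_gt0 pp r0 rs.
have h4 := pf r r0 rs; have h5 := pf s s0 (lexx s).
rewrite (hnBC SH (Lp s) Ls) in h2; rewrite (splitr e) addrA.
exact: le_trans h1 (lerD (le_trans h3 (le_trans h2 (lerD (lexx _) h5))) h4).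
Qed.

Lemma dot_error_bound (e e0 x y b a c a' : R) : 0 <= y -> 0 <= b -> 0 <= a -> 0 <= c ->
  0 <= a' -> 0 < e -> e <= 1 -> e <= e0 -> x <= e -> y <= e -> a' <= a + x ->
  x * b + a' * y + e * (2 * c + 1) <= (b + a + 2 * c + 2) * e0.
Proof.
move=> y0 b0 a0 c0 a'0 e_gt0 e1 ee xe ye a'a.
have : x * b <= e * b by rewrite ler_wpM2r.
have : a' * y <= (a + 1) * e by apply: ler_pM => //; lra.
have : e * b <= e0 * b by rewrite ler_wpM2r.
have : (a + 1) * e <= (a + 1) * e0 by rewrite ler_wpM2l// addr_ge0.
have : e * (2 * c + 1) <= e0 * (2 * c + 1) by rewrite ler_wpM2r// addr_ge0// mulr_ge0.
by lra.
Qed.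

Lemma dil_dot_analytic f r s t : analytic f -> 0 <= r -> r < 1 -> 0 <= s -> s < 1 ->
  0 <= t -> t < 1 -> r * s = t ^+ 2 ->
  L2dot (dil r f) (dil s f) = (N2 (dil t f) ^+ 2)%:C.
Proof.
move=> af r0 r1 s0 s1 t0 t1 rst.
have La := dil_L2 n_gt0 af r0 r1; have Lb := dil_L2 n_gt0 af s0 s1.
have Lc := dil_L2 n_gt0 af t0 t1.
apply/eqP; rewrite -subr_eq0; apply/eqP.
apply: (@nc_le_small _ _ (N2 (dil s f) + N2 (dil r f) + 2 * N2 (dil t f) + 2)) => e0 e00.
pose e := Num.min 1 e0.
have ep : 0 < e by rewrite lt_min ltr01.
have e1 : e <= 1 by rewrite ge_min lexx.
have ee : e <= e0 by rewrite ge_min lexx orbT.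
pose m := Num.max r (Num.max s t).
have m1 : m < 1 by rewrite !gt_max r1 s1.
have [p pp pf] := dil_poly_approx af m1 ep.
have Lp u : L2 (dil u p) by apply: (is_poly_L2 n_gt0); exact: is_poly_dil.
have ha := pf r r0 ltac:(by rewrite !le_max lexx).
have hb := pf s s0 ltac:(by rewrite !le_max lexx orbT).
have hc := pf t t0 ltac:(by rewrite !le_max lexx !orbT).
have h1 := N2_rev (Lp r) La; rewrite (hnBC SH (Lp r) La) in h1.
have h2 := N2_rev (Lp t) Lc; rewrite (hnBC SH (Lp t) Lc) in h2.
have h3 := N2_rev Lc (Lp t).
have Lda : L2 (dil r f - dil r p) by exact: (shB SH).
have Ldb : L2 (dil s f - dil s p) by exact: (shB SH).
have -> : L2dot (dil r f) (dil s f) - (N2 (dil t f) ^+ 2)%:C =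
    L2dot (dil r f - dil r p) (dil s f) + L2dot (dil r p) (dil s f - dil s p) +
    (N2 (dil t p) ^+ 2 - N2 (dil t f) ^+ 2)%:C.
  rewrite (shdotBl SH)// (shdotBr SH)// rmorphB /= -(dil_dot n_gt0 pp rst).
  by ring.
have k1 := cauchy_schwarz SH Lda Lb; have k2 := cauchy_schwarz SH (Lp r) Ldb.
have k3 : nc (N2 (dil t p) ^+ 2 - N2 (dil t f) ^+ 2)%:C <= e * (2 * N2 (dil t f) + 1).
  rewrite ncR subr_sqr normrM.
  have := hn_ge0 (@L2dot R n) (dil t f); have := hn_ge0 (@L2dot R n) (dil t p).
  move: h2 h3 hc.
  move: (N2 (dil t f - dil t p)) (N2 (dil t f)) (N2 (dil t p)) => x y w h2 h3 hc w0 y0.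
  clear - h2 h3 hc w0 y0 e1.
  apply: ler_pM; rewrite ?normr_ge0//.
    by rewrite ler_norml; apply/andP; split; lra.
  by rewrite ger0_norm ?addr_ge0//; lra.
apply: le_trans (le_normcD _ _) _.
apply: le_trans (lerD (le_trans (le_normcD _ _) (lerD k1 k2)) k3) _.
have n0 F := hn_ge0 (@L2dot R n) F.
exact: (dot_error_bound (n0 _) (n0 _) (n0 _) (n0 _) (n0 _) ep e1 ee ha hb h1).
Qed.

Definition radius (k : nat) : R := 1 - k.+1%:R^-1.

Lemma radius_ge0 k : 0 <= radius k.
Proof. by rewrite subr_ge0 invf_le1 ?ler1n. Qed.

Lemma radius_lt1 k : radius k < 1.
Proof. by rewrite ltrBlDr ltrDl. Qed.

Lemma radius_cvg (r : R) : r < 1 -> exists N, forall k, (N <= k)%N -> r <= radius k.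
Proof.
move=> r1; have [|N NP] := @natSinv_le R (1 - r); first by rewrite subr_gt0.
by exists N => k /NP; rewrite lerBrDl -lerBrDr.
Qed.

Lemma parallelogram_bound (a b c d S x : R) : S - x / 2 < d -> a <= S -> b <= S -> d <= c ->
  a + b - 2 * c <= x.
Proof. lra. Qed.

(** With t the geometric mean of r and s, the squared distance of the dilations is the sum of the
    squared norms at r and s minus twice that at t. For large radii all three are near their
    supremum. *)
Lemma H2_dil_cauchy f : H2 f -> hn_cauchy (@L2dot R n) (fun k => dil (radius k) f).
Proof.
move=> [af fH].
have Ld r : 0 <= r -> r < 1 -> L2 (dil r f) by exact: dil_L2.
have [B BP] : exists B : R, hardy_norm2 f = B%:E.
  exists (fine (hardy_norm2 f)); rewrite fineK// ge0_fin_numE//.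
  apply: le_trans (ereal_sup_ubound _); last first.
    by exists 2^-1 => /=; last reflexivity; rewrite invr_gt0 ltr0n invf_lt1 ?ltr1n.
  exact: L2norm2_ge0.
have MB r : 0 < r -> r < 1 -> N2 (dil r f) ^+ 2 <= B.
  move=> r0 r1; rewrite -lee_fin -BP -(L2norm2E (Ld r (ltW r0) r1)).
  by apply: ereal_sup_ubound; exists r => //=; apply/andP.
pose S := [set N2 (dil r f) ^+ 2 | r in [set r : R | 0 < r < 1]].
have hS : has_sup S.
  split; last by exists B => _ [r /andP[r0 r1] <-]; exact: MB.
  by exists (N2 (dil 2^-1 f) ^+ 2); exists 2^-1 => //=; rewrite invr_gt0 ltr0n invf_lt1 ?ltr1n.
move=> e e0; have ee : 0 < e ^+ 2 / 2 by rewrite divr_gt0// exprn_gt0.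
have [_ [r0 /andP[r00 r01] <-] r0P] := sup_adherent ee hS.
have [N NP] := radius_cvg r01.
exists N => k l /NP rr /NP ss.
move: (radius k) (radius l) rr ss (radius_lt1 k) (radius_lt1 l) => {k l} r s rr ss r1 s1.
have rp := lt_le_trans r00 rr; have sp := lt_le_trans r00 ss.
have [t t0 rst] : exists2 t, 0 <= t & r * s = t ^+ 2.
  by exists (Num.sqrt (r * s)); rewrite ?sqrtr_ge0// sqr_sqrtr// mulr_ge0 ?ltW.
have r0t : r0 <= t.
  rewrite -(@ler_pXn2r _ 2)// ?nnegrE ?(ltW r00)// -rst expr2.
  by apply: ler_pM => //; exact: ltW.
have t1 : t < 1.
  rewrite -(@ltr_pXn2r _ 2)// ?nnegrE// -rst expr1n.
  by rewrite mulr_ilt1 ?ltW.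
have dt := dil_dot_analytic af (ltW rp) r1 (ltW sp) s1 t0 t1 rst.
have Lr := Ld r (ltW rp) r1; have Ls := Ld s (ltW sp) s1.
have := hn_sqrB SH Lr Ls; rewrite dt /= => E.
rewrite -(@ler_pXn2r _ 2)// ?nnegrE ?hn_ge0 ?(ltW e0)// E.
have u1 : N2 (dil r f) ^+ 2 <= sup S by apply: ub_le_sup; [case: hS|exists r => //=; apply/andP].
have u2 : N2 (dil s f) ^+ 2 <= sup S by apply: ub_le_sup; [case: hS|exists s => //=; apply/andP].
have u3 : N2 (dil r0 f) ^+ 2 <= N2 (dil t f) ^+ 2.
  apply: lerXn2r; [exact: hn_ge0|exact: hn_ge0|exact: (dil_mono af (ltW r00) r0t t1)].
exact: parallelogram_bound r0P u1 u2 u3.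
Qed.

(** The witnesses are dilations of polynomials close to [f] on the ball of radius [radius k]: this
    gives closeness to the dilation of [f] in L^2 and, by uniform continuity, to [f] at each
    point. *)
Lemma H2_bval f : H2 f -> exists F, bval f F.
Proof.
move=> Hf; have [af _] := Hf.
have Ld k : L2 (dil (radius k) f) by apply: (dil_L2 n_gt0 af); [exact: radius_ge0|exact: radius_lt1].
have [F LF uF] := L2_hn_complete Ld (H2_dil_cauchy Hf).
exists F; split=> //.
have k0 k : 0 < k.+1%:R^-1 :> R by [].
have /choice[q qP] k : exists q, is_poly q /\ forall z, enorm z <= radius k -> nc (f z - q z) <= k.+1%:R^-1.
  by have [q qq fq] := analytic_poly_approx (analytic_diff af) (radius_lt1 k) (k0 k); exists q.
have pp k : is_poly (dil (radius k) (q k)) by apply: is_poly_dil; case: (qP k).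
exists (fun k => dil (radius k) (q k)); split => //.
  move=> e e0; have e2 : 0 < e / 2 by rewrite divr_gt0.
  have [N1 N1P] := uF _ e2; have [M MP] := natSinv_le e2.
  exists (maxn N1 M) => k; rewrite geq_max => /andP[k1 k2].
  have Lp := is_poly_L2 n_gt0 (pp k).
  apply: le_trans (hn_tri SH Lp LF (Ld k)) _.
  have h1 : N2 (dil (radius k) f - dil (radius k) (q k)) <= k.+1%:R^-1.
    have [qq fq] := qP k; apply: dil_dist_le => //; first exact: analytic_mfun.
    - exact: is_poly_mfun.
    - exact: radius_ge0.
  rewrite (hnBC SH Lp (Ld k)); have := N1P k k1; have := MP k k2.
  by move: h1; move: (N2 _) (N2 _) (k.+1%:R^-1) => x y w; lra.
move=> z bz e e0; have e2 : 0 < e / 2 by rewrite divr_gt0.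
have [d d0 dP] := analytic_ucont (analytic_diff af) bz e2.
have [N1 N1P] := natSinv_le d0; have [M MP] := natSinv_le e2.
exists (maxn N1 M) => k; rewrite geq_max => /andP[k1 k2].
have r0 := radius_ge0 k; have r1 := radius_lt1 k.
have z1 : enorm z <= 1 := ltW bz.
have h1 : nc (f ((radius k)%:C *: z) - q k ((radius k)%:C *: z)) <= k.+1%:R^-1.
  by have [_] := qP k; apply; rewrite enormZr// ler_piMr.
have h2 : nc (f ((radius k)%:C *: z) - f z) <= e / 2.
  apply: dP => // [|i]; first by rewrite enormZr// ler_piMl ?enorm_ge0// ltW.
  rewrite mxE -[X in _ - X]mul1r -mulrBl Normc.normcM.
  rewrite (_ : (radius k)%:C - 1 = (- (k.+1%:R^-1))%:C); last first.
    by rewrite /radius rmorphB /= addrAC subrr add0r rmorphN.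
  rewrite ncR normrN gtr0_norm//; apply: le_trans (N1P k k1).
  by rewrite ler_piMr// (le_trans (nc_le_enorm z i)).
rewrite /dil (_ : _ - f z = (f ((radius k)%:C *: z) - f z) -
  (f ((radius k)%:C *: z) - q k ((radius k)%:C *: z))); last by ring.
apply: le_trans (ncB _ _) _.
by have := MP k k2; move: h1 h2; move: (nc _) (nc _) (k.+1%:R^-1) => x y w; lra.
Qed.

End hardy_boundary_existence.

(** * Radial limits *)

Section maximal_inequality.
Context {R : realType} {n : nat}.
Hypothesis n_gt0 : (0 < n)%N.
Local Notation C := R[i].
Local Notation T := 'rV[C]_n.
Local Notation sigma := (@sphere_measure R n).
Local Notation tau := (2 * pi : R).
Implicit Types (z : T) (g : T -> R).

(** The largest of the sums of [g - la] over the first L points of the orbit of [z] under [w], for L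
    from 0 to [K], in the recursive form on which Garsia's argument rests. *)
Fixpoint runmax (w : C) g (la : R) (K : nat) z : R :=
  if K is k.+1 then Num.max 0 (g z - la + runmax w g la k (w *: z)) else 0.

Lemma runmax_ge0 w g la K z : 0 <= runmax w g la K z.
Proof. by case: K => [|k] //=; rewrite le_max lexx. Qed.

Lemma runmax_le w g la K z : runmax w g la K z <= runmax w g la K.+1 z.
Proof.
elim: K z => [|K ih] z; first exact: runmax_ge0.
by rewrite /= ge_max !le_max lexx /= lerD2l ih orbT.
Qed.

Lemma runmax_sum w g la K L z : (L <= K)%N ->
  \sum_(m < L) (g (w ^+ m *: z) - la) <= runmax w g la K z.
Proof.
elim: L K z => [|L ih] K z LK; first by rewrite big_ord0 runmax_ge0.
case: K LK => // K LK; rewrite big_ord_recl expr0 scale1r /= le_max lerD2l.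
apply/orP; right; apply: le_trans (ih K (w *: z) LK).
by apply: ler_sum => m _; rewrite scalerA -exprSr.
Qed.

Lemma measurable_scale (w : C) : measurable_fun setT (fun z : T => w *: z).
Proof.
have -> : (fun z : T => w *: z) = rot (fun=> w); last exact: measurable_rot.
by apply/funext => z; apply/rowP => i; rewrite !mxE.
Qed.

Lemma measurable_runmax w g la K : measurable_fun setT g -> measurable_fun setT (runmax w g la K).
Proof.
move=> mg; elim: K => [|K ih]; first exact: measurable_cst.
apply: measurable_maxr; first exact: measurable_cst.
apply: measurable_funD; first by apply: measurable_funB => //; exact: measurable_cst.
exact: (measurableT_comp ih (measurable_scale w)).
Qed.

Lemma integral_scale (w : C) (h : T -> \bar R) : nc w = 1 -> measurable_fun setT h ->
  (forall z, (0 <= h z)%E) -> (\int[sigma]_z h (w *: z)%R = \int[sigma]_z h z)%E.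
Proof.
move=> w1 mh h0; rewrite -(@ge0_integral_rot R n (fun=> w) h (fun=> w1) mh h0).
by apply: eq_integral => z _; congr h; apply/rowP => i; rewrite !mxE.
Qed.

(* Garsia's proof of the maximal ergodic inequality. *)
Lemma maximal_ergodic w g (la : R) K : nc w = 1 -> 0 <= la -> measurable_fun setT g ->
  (forall z, 0 <= g z) -> (\int[sigma]_z (g z)%:E < +oo)%E ->
  (la%:E * sigma [set z | (0 < runmax w g la K z)%R] <= \int[sigma]_z (g z)%:E)%E.
Proof.
move=> w1 la0 mg g0 gfin.
pose M k := runmax w g la k; have mM k : measurable_fun setT (M k) by exact: measurable_runmax.
have meM k : measurable_fun setT (EFin \o M k) by exact/measurable_EFinP.
have mwM k : measurable_fun setT (fun z => M k (w *: z)).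
  exact: (measurableT_comp (mM k) (measurable_scale w)).
have meg : measurable_fun setT (EFin \o g) by exact/measurable_EFinP.
have M0 k z : (0 <= (M k z)%:E)%E by rewrite lee_fin runmax_ge0.
have eg0 z : (0 <= (g z)%:E)%E by rewrite lee_fin.
have Mw k : (\int[sigma]_z (M k (w *: z))%:E = \int[sigma]_z (M k z)%:E)%E.
  exact: (@integral_scale w (EFin \o M k) w1 (meM k) (M0 k)).
have Mfin k : (\int[sigma]_z (M k z)%:E < +oo)%E.
  elim: k => [|k ih]; first by rewrite /M /= integral0 ltry.
  apply: (@le_lt_trans _ _ (\int[sigma]_z ((g z)%:E + (M k (w *: z))%:E))%E).
    apply: ge0_le_integral => //.
    - exact: meM.
    - by apply: emeasurable_funD => //; exact/measurable_EFinP.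
    move=> z _; rewrite -EFinD lee_fin /M /= ge_max addr_ge0 ?runmax_ge0//=.
    by rewrite lerD2r gerBl.
  rewrite ge0_integralD//; last exact/measurable_EFinP.
  by rewrite Mw lte_add_pinfty.
case: K => [|K].
  rewrite (_ : [set z | _] = set0) ?measure0 ?mule0; last first.
    by apply/seteqP; split => z //=; rewrite ltxx.
  by apply: integral_ge0 => z _.
set E := [set z | _]; have mE : measurable E.
  by rewrite -[X in measurable X]setTI; apply: measurable_fun_ltr => //; exact: measurable_cst.
(* Pointwise, [la] times the indicator of [E] plus [M K.+1 z] is at most [g z] plus [M K.+1] at the
   rotated point. The integrals of [M K.+1] agree by invariance and are finite, hence cancel. *)
have key : (la%:E * sigma E + \int[sigma]_z (M K.+1 z)%:E <=
    \int[sigma]_z (g z)%:E + \int[sigma]_z (M K.+1 z)%:E)%E.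
  have -> : (la%:E * sigma E = \int[sigma]_z (la * \1_E z)%:E)%E.
    under eq_integral do rewrite EFinM.
    rewrite ge0_integralZl_EFin//; last by apply/measurable_EFinP; exact: measurable_indic.
    by rewrite integral_indic// setIT.
  rewrite -{2}Mw -!ge0_integralD//.
  - apply: ge0_le_integral => //.
    + by move=> z _; rewrite adde_ge0// lee_fin mulr_ge0.
    + apply: emeasurable_funD; last exact: meM.
      by apply/measurable_EFinP/measurable_funM; [exact: measurable_cst|exact: measurable_indic].
    + by apply: emeasurable_funD => //; exact/measurable_EFinP.
    move=> z _; rewrite -!EFinD lee_fin indicE.
    have [Ez|Ez] := boolP (z \in E).
      have hle := @runmax_le w g la K (w *: z).
      move: Ez; rewrite inE /E /M /= => Ez.
      move: (Ez); rewrite lt_max ltxx /= => Ez'.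
      rewrite (max_idPr (ltW Ez')) mulr1 addrA addrC.
      move: hle => /=; move: (runmax _ _ _ _ _) (Num.max _ _) => a b; lra.
    move: Ez; rewrite notin_setE /E /= => /negP; rewrite -leNgt => Ez.
    rewrite mulr0 add0r; apply: (@le_trans _ _ 0); last by rewrite addr_ge0 ?runmax_ge0.
    exact: Ez.
  - exact/measurable_EFinP.
  - by move=> z _; rewrite lee_fin mulr_ge0.
  - by apply/measurable_EFinP/measurable_funM; [exact: measurable_cst|exact: measurable_indic].
  - exact: meM.
by move: key; rewrite leeD2rE// ge0_fin_numE// integral_ge0.
Qed.

(** Summation by parts: a sum with decreasing nonnegative weights is a nonnegative combination of
    partial sums. *)
Lemma weighted_sum_le (k h : nat -> R) (H : nat) (la : R) :
  (forall m, (m < H)%N -> k m.+1 <= k m) -> (forall m, (m <= H)%N -> 0 <= k m) ->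
  (forall L, (L <= H.+1)%N -> \sum_(m < L) (h m - la) <= 0) ->
  \sum_(m < H.+1) k m * h m <= la * \sum_(m < H.+1) k m.
Proof.
move=> kd k0 hL.
have key j : (j <= H)%N -> \sum_(m < j.+1) k m * (h m - la) <= k j * \sum_(m < j.+1) (h m - la).
  elim: j => [|j ih] jH; first by rewrite !big_ord1.
  rewrite big_ord_recr /= [in leRHS]big_ord_recr /= [leRHS]mulrDr lerD2r.
  apply: le_trans (ih (ltnW jH)) _.
  have := hL j.+1 (leqW jH); have := kd j jH; nra.
have := key H (leqnn _); have := hL H.+1 (leqnn _); have := k0 H (leqnn _).
move=> kH hH hk; rewrite -subr_le0 mulr_sumr -sumrB.
have -> : \sum_(m < H.+1) (k m * h m - la * k m) = \sum_(m < H.+1) k m * (h m - la).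
  by apply: eq_bigr => m _; rewrite mulrBr [la * _]mulrC.
by apply: le_trans hk _; rewrite mulr_ge0_le0.
Qed.

Lemma conjcX (x : C) k : conjc (x ^+ k) = conjc x ^+ k.
Proof.
elim: k => [|k ih]; first by apply: complex_ext => //=; rewrite oppr0.
by rewrite !exprS conjcM ih.
Qed.

Lemma conjc_sum (I : Type) (s : seq I) (F : I -> C) :
  conjc (\sum_(i <- s) F i) = \sum_(i <- s) conjc (F i).
Proof.
apply: (big_morph (@conjc R)); first exact: conjcD.
by apply: complex_ext => //=; rewrite oppr0.
Qed.

Section poisson.
Variables (N : nat) (r : R).
Hypotheses (N_gt0 : (0 < N)%N) (r_ge0 : 0 <= r) (r_lt1 : r < 1).
Let om : C := cis (tau / N%:R).

(** The Poisson kernel at the angle 2 pi m / N, divided by N. Because of aliasing the weights do not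
    sum to 1 but to (1 + r^N) / (1 - r^N), whence the factors [1 - r ^+ N] below. *)
Definition poisson (m : nat) : R :=
  (1 - r ^+ 2) / (N%:R * (1 - 2 * r * cos (m%:R * (tau / N%:R)) + r ^+ 2)).

Let NR : (0 : R) < N%:R. Proof. by rewrite ltr0n. Qed.

Lemma omX m : om ^+ m = cis (m%:R * (tau / N%:R)).
Proof. exact: cisX. Qed.

Lemma omN : om ^+ N = 1.
Proof.
rewrite omX mulrCA mulfV ?gt_eqF// mulr1 -[tau]mul1r.
exact: (@cis_int R 1).
Qed.

Lemma nc_om m : nc (om ^+ m) = 1.
Proof. by rewrite omX nc_cis. Qed.

Lemma om_neq1 m : (0 < m < N)%N -> om ^+ m != 1.
Proof.
move=> /andP[m0 mN]; apply/eqP; rewrite omX => E.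
pose t := m%:R * pi / N%:R : R.
have t0 : 0 < t by rewrite divr_gt0// mulr_gt0 ?ltr0n ?pi_gt0.
have tpi : t < pi.
  by rewrite /t ltr_pdivrMr// mulrC ltr_pM2l ?pi_gt0// ltr_nat.
have := sin_gt0_pi (introT andP (conj t0 tpi)).
have Et : m%:R * (tau / N%:R) = t + t by rewrite /t; ring.
have : cos (t + t) = 1 by rewrite -Et; have /(congr1 (@complex.Re R)) := E.
rewrite cosD => h s0; have := cos2Dsin2 t; nra.
Qed.

Lemma om_inj a b : (a < N)%N -> (b < N)%N -> om ^+ a = om ^+ b -> a = b.
Proof.
move=> aN bN; wlog ab : a b aN bN / (a <= b)%N.
  by move=> H E; have [/H->//|/ltnW/H<-//] := leqP a b.
move=> E; apply/eqP; rewrite eqn_leq ab /= leqNgt; apply/negP => lt_ab.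
have om0 : om ^+ a != 0 by rewrite -nc_eq0 nc_om oner_eq0.
have : om ^+ (b - a) = 1.
  by apply: (mulfI om0); rewrite -exprD subnKC// mulr1.
by apply/eqP; apply: om_neq1; rewrite subn_gt0 lt_ab (leq_ltn_trans (leq_subr _ _)).
Qed.

Lemma sum_unity (w : C) : w ^+ N = 1 -> \sum_(m < N) w ^+ m = if w == 1 then N%:R else 0.
Proof.
move=> wN; case: eqP => [->|/eqP w1].
  by under eq_bigr do rewrite expr1n; rewrite sumr_const card_ord.
apply/eqP; have := subrX1 w N; rewrite wN subrr => /esym/eqP; rewrite mulf_eq0 subr_eq0.
by rewrite (negbTE w1).
Qed.

(** The finite geometric sums of r times a root of unity and of its conjugate close up, since the
    N-th power of the root is 1. *)
Lemma poissonE m : ((1 - r ^+ N) * N%:R * poisson m)%:C =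
  \sum_(l < N) (r%:C ^+ l) * (om ^+ (l * m) + conjc (om ^+ (l * m))) - (1 - r ^+ N)%:C.
Proof.
pose x : C := r%:C * om ^+ m.
have xN : x ^+ N = (r ^+ N)%:C by rewrite exprMn -exprM mulnC exprM omN expr1n mulr1 rmorphXn.
have xl l : x ^+ l = r%:C ^+ l * om ^+ (l * m) by rewrite exprMn -exprM mulnC.
have xlJ l : conjc x ^+ l = r%:C ^+ l * conjc (om ^+ (l * m)).
  by rewrite -conjcX xl conjcM -rmorphXn conjc_real.
have q : (1 - x) * conjc (1 - x) = (1 - 2 * r * cos (m%:R * (tau / N%:R)) + r ^+ 2)%:C.
  rewrite mulcJ normc_sqr ReD ImD ReN ImN ReMr ImMr omX /=.
  congr (_%:C); have := cos2Dsin2 (m%:R * (tau / N%:R)); move: (cos _) (sin _) => c s cs.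
  have -> : (1 - r * c) ^+ 2 + (0 - r * s) ^+ 2 = 1 - 2 * r * c + r ^+ 2 * (c ^+ 2 + s ^+ 2) by ring.
  by rewrite cs mulr1.
have x1 : nc x < 1 by rewrite Normc.normcM nc_om mulr1 ncR_ge0.
have q0 : (1 - 2 * r * cos (m%:R * (tau / N%:R)) + r ^+ 2) != 0.
  apply/eqP => E; move/eqP: q; rewrite E mulcJ eq_complex /= eqxx andbT sqrf_eq0 nc_eq0.
  rewrite subr_eq0 => /eqP xE; by move: x1; rewrite -xE nc1 ltxx.
have q0C : (1 - x) * conjc (1 - x) != 0 by rewrite q eq_complex /= negb_and q0.
apply: (mulfI q0C).
have g1 : (1 - x) * \sum_(l < N) x ^+ l = (1 - r ^+ N)%:C.
  have := subrX1 x N; rewrite xN rmorphB /= => E.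
  by rewrite -[LHS]opprK -mulNr opprB -E opprB.
have g2 : conjc (1 - x) * \sum_(l < N) conjc x ^+ l = (1 - r ^+ N)%:C.
  have -> : \sum_(l < N) conjc x ^+ l = conjc (\sum_(l < N) x ^+ l).
    by rewrite conjc_sum; apply: eq_bigr => l _; rewrite conjcX.
  by rewrite -conjcM g1 conjc_real.
have -> : \sum_(l < N) r%:C ^+ l * (om ^+ (l * m) + conjc (om ^+ (l * m))) =
    \sum_(l < N) x ^+ l + \sum_(l < N) conjc x ^+ l.
  by rewrite -big_split; apply: eq_bigr => l _; rewrite mulrDr xl xlJ.
have -> : (1 - x) * conjc (1 - x) * (\sum_(l < N) x ^+ l + \sum_(l < N) conjc x ^+ l - (1 - r ^+ N)%:C) =
   conjc (1 - x) * ((1 - x) * \sum_(l < N) x ^+ l) + (1 - x) * (conjc (1 - x) * \sum_(l < N) conjc x ^+ l)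
     - (1 - x) * conjc (1 - x) * (1 - r ^+ N)%:C by ring.
rewrite g1 g2 -!mulrDl -mulrBl q.
have -> : conjc (1 - x) + (1 - x) = (2 - 2 * r * cos (m%:R * (tau / N%:R)))%:C.
  apply: complex_ext; rewrite ?ReD ?ImD ?ReJ ?ImJ ?ReN ?ImN ?ReD ?ImD ?ReN ?ImN ?ReMr ?ImMr ?omX /=.
    by ring.
  by rewrite addNr.
rewrite -rmorphB -!rmorphM; congr (_%:C).
rewrite /poisson; field; rewrite q0 /= gt_eqF//.
Qed.

(** The second term is the alias of frequency [j]: on N-th roots of unity the frequencies [j] and
    [j - N] coincide. It is small when [j] stays far below [N]. *)
Lemma poisson_fourier j : (j < N)%N ->
  (1 - r ^+ N)%:C * \sum_(m < N) (poisson m)%:C * om ^+ (j * m) =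
  r%:C ^+ j + r%:C ^+ (N - j).
Proof.
move=> jN; have NC : N%:R != 0 :> C by rewrite pnatr_eq0 -lt0n.
apply: (mulfI NC); rewrite !mulr_sumr.
have -> : \sum_(m < N) N%:R * ((1 - r ^+ N)%:C * ((poisson m)%:C * om ^+ (j * m))) =
    \sum_(m < N) (\sum_(l < N) (r%:C ^+ l) * (om ^+ (l * m) + conjc (om ^+ (l * m)))
      - (1 - r ^+ N)%:C) * om ^+ (j * m).
  apply: eq_bigr => m _; rewrite -poissonE !rmorphM rmorph_nat /=; ring.
have S1 l : (l < N)%N -> \sum_(m < N) om ^+ (l * m) * om ^+ (j * m) =
    if (l + j == N)%N || ((l == 0%N) && (j == 0%N)) then N%:R else 0.
  move=> lN; rewrite (eq_bigr (fun m : 'I_N => (om ^+ (l + j)) ^+ m)); last first.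
    by move=> m _; rewrite -exprD -mulnDl exprM.
  rewrite sum_unity; last by rewrite -exprM mulnC exprM omN expr1n.
  case: ifPn => [/eqP E|E].
    case: ifPn => //; rewrite negb_or => /andP[lj] h.
    have [lt|] := ltnP (l + j) N.
      have : (0 < l + j < N)%N by rewrite lt andbT addn_gt0 !lt0n -negb_and.
      by move=> /om_neq1; rewrite E eqxx.
    rewrite leq_eqVlt eq_sym (negbTE lj) /= => gt.
    have lt2 : (0 < l + j - N < N)%N.
      by rewrite subn_gt0 gt ltn_subLR ?(ltnW gt)// (leq_trans _ (leq_add lN (ltnW jN)))// addSn.
    have := om_neq1 lt2; rewrite -{1}(mul1r (om ^+ _)) -omN -exprD subnKC ?(ltnW gt)//.
    by rewrite E omN eqxx.
  case: ifP => // /orP[/eqP ljN|/andP[/eqP l0 /eqP j0]].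
    by move: E; rewrite ljN omN eqxx.
  by move: E; rewrite l0 j0 eqxx.
have S2 l : (l < N)%N -> \sum_(m < N) conjc (om ^+ (l * m)) * om ^+ (j * m) =
    if l == j then N%:R else 0.
  move=> lN; rewrite (eq_bigr (fun m : 'I_N => (conjc (om ^+ l) * om ^+ j) ^+ m)); last first.
    by move=> m _; rewrite exprMn -!conjcX -!exprM.
  rewrite sum_unity; last first.
    by rewrite exprMn -conjcX -!exprM ![(_ * N)%N]mulnC !exprM omN !expr1n (conjcX 1 0) expr0 mulr1.
  have om0 : om ^+ l != 0 by rewrite -nc_eq0 nc_om oner_eq0.
  have -> : (conjc (om ^+ l) * om ^+ j == 1) = (om ^+ j == om ^+ l).
    apply/eqP/eqP => E; last by rewrite E mulrC mulcJ nc_om expr1n.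
    by rewrite -[RHS]mulr1 -E mulrA mulcJ nc_om expr1n mul1r.
  have [->|lj] := eqVneq l j; first by rewrite eqxx.
  by case: eqP => // /(om_inj jN lN) E; rewrite E eqxx in lj.
have S3 : \sum_(m < N) om ^+ (j * m) = if j == 0%N then N%:R else 0.
  rewrite -(@eq_bigr _ _ _ _ _ _ (fun m : 'I_N => conjc (om ^+ (0 * m)) * om ^+ (j * m))).
    by rewrite S2// eq_sym.
  by move=> m _; rewrite mul0n expr0 rmorph1 mul1r.
under eq_bigr do rewrite mulrBl mulr_suml.
rewrite sumrB exchange_big /= -mulr_sumr S3.
have -> : \sum_(l < N) \sum_(m < N) r%:C ^+ l * (om ^+ (l * m) + conjc (om ^+ (l * m))) * om ^+ (j * m) =
   \sum_(l < N) r%:C ^+ l * (if ((l + j)%N == N) || ((l == 0%N :> nat) && (j == 0%N)) then N%:R else 0) +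
   \sum_(l < N) r%:C ^+ l * (if l == j :> nat then N%:R else 0).
  rewrite -big_split; apply: eq_bigr => l _ /=.
  rewrite -S1// -S2// -mulrDr -big_split mulr_sumr; apply: eq_bigr => m _ /=.
  by rewrite -mulrA mulrDl.
have -> : \sum_(l < N) r%:C ^+ l * (if l == j :> nat then N%:R else 0) = r%:C ^+ j * N%:R.
  rewrite (bigD1 (Ordinal jN))//= eqxx big1 ?addr0// => l lj.
  have -> : (l == j :> nat) = false.
    by apply/negP => /eqP lE; move/negP: lj; apply; apply/eqP/val_inj.
  by rewrite mulr0.
have [j0|j0] := posnP j.
  rewrite j0 /= (bigD1 (Ordinal N_gt0))//= orbT big1 ?addr0; last first.
    move=> l l0; have -> : (l + 0 == N)%N = false by rewrite addn0 ltn_eqF.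
    have -> : (l == 0%N :> nat) = false.
      by apply/negP => /eqP lE; move/negP: l0; apply; apply/eqP/val_inj.
    by rewrite mulr0.
  by rewrite subn0 !expr0 rmorphB rmorph1 rmorphXn /=; ring.
have lt : (N - j < N)%N by rewrite ltn_subrL N_gt0 j0.
rewrite mulr0 subr0 (bigD1 (Ordinal lt))//= subnK ?(ltnW jN)// eqxx /=.
rewrite big1 ?addr0; first by ring.
move=> l ll; rewrite andbF orbF; have -> : (l + j == N)%N = false.
  apply/negP => /eqP lE; move/negP: ll; apply; apply/eqP/val_inj => /=.
  by apply/eqP; rewrite -(eqn_add2r j) lE subnK// ltnW.
by rewrite mulr0.
Qed.

Lemma poisson_den_gt0 m : 0 < 1 - 2 * r * cos (m%:R * (tau / N%:R)) + r ^+ 2.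
Proof.
have := cos_le1 (m%:R * (tau / N%:R)); move: (cos _) => c c1.
have : 0 < (1 - r) ^+ 2 by rewrite exprn_gt0// subr_gt0.
have := mulr_ge0 r_ge0 (ltac:(by rewrite subr_ge0) : 0 <= 1 - c); lra.
Qed.

Lemma poisson_ge0 m : 0 <= poisson m.
Proof.
rewrite divr_ge0 ?subr_ge0 ?expr_le1 ?(ltW r_lt1)//.
by rewrite mulr_ge0 ?(ltW (poisson_den_gt0 m))// ltW.
Qed.

Lemma poisson_sum : (1 - r ^+ N) * \sum_(m < N) poisson m = 1 + r ^+ N.
Proof.
apply: complexI; have := poisson_fourier N_gt0.
rewrite expr0 subn0 -rmorphXn -rmorphD rmorphM rmorph_sum /= => <-.
by congr (_ * _); apply: eq_bigr => m _; rewrite mul0n expr0 mulr1.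
Qed.

Lemma poisson_decr m : (m.+1.*2 <= N)%N -> poisson m.+1 <= poisson m.
Proof.
move=> mN; have d1 := poisson_den_gt0 m.+1; have d0 := poisson_den_gt0 m.
have p0 := pi_gt0 R.
have bd (k : nat) : (k.*2 <= N)%N -> k%:R * (tau / N%:R) \in `[0, pi].
  move=> kN; rewrite in_itv /=; apply/andP; split.
    by rewrite mulr_ge0// divr_ge0// ltW// mulr_gt0.
  rewrite mulrA ler_pdivrMr// mulrA -natrM muln2 mulrC ler_pM2l//.
  by rewrite ler_nat.
have cc : cos (m.+1%:R * (tau / N%:R)) <= cos (m%:R * (tau / N%:R)).
  have mN' : (m.*2 <= N)%N by rewrite (leq_trans _ mN)// leq_double.
  have := @ltr_cos R _ _ (bd _ mN) (bd m mN').
  have lt : m%:R * (tau / N%:R) < m.+1%:R * (tau / N%:R).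
    by rewrite ltr_pM2r ?ltr_nat// divr_gt0// mulr_gt0.
  by rewrite (lt_gtF lt) => /negbT; rewrite -leNgt.
rewrite /poisson ler_wpM2l ?subr_ge0 ?expr_le1 ?(ltW r_lt1)//.
rewrite lef_pV2 ?posrE ?mulr_gt0// ler_pM2l//.
rewrite lerD2r lerD2l lerN2 ler_wpM2l// mulr_ge0//.
Qed.

Lemma poisson_sym m : (m <= N)%N -> poisson (N - m) = poisson m.
Proof.
move=> mN; rewrite /poisson; congr (_ / (_ * (1 - _ * _ + _))).
rewrite natrB// mulrBl mulrCA mulfV ?gt_eqF// mulr1.
have : cis (tau - m%:R * (tau / N%:R)) = conjc (cis (m%:R * (tau / N%:R))).
  have c1 : cis tau = 1 by rewrite -[tau]mul1r; exact: (@cis_int R 1).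
  by rewrite cisD c1 mul1r cisJ.
by move=> /(congr1 (@complex.Re R)); rewrite ReJ.
Qed.

End poisson.

End maximal_inequality.

(** * Weak-type estimate and almost everywhere radial convergence *)

Section radial_limits.
Context {R : realType} {n : nat}.
Hypothesis n_gt0 : (0 < n)%N.
Local Notation C := R[i].
Local Notation T := 'rV[C]_n.
Local Notation sigma := (@sphere_measure R n).
Local Notation SH := (@L2_semi_hilbert R n).
Local Notation tau := (2 * pi : R).
Local Notation N2 := (hn (@L2dot R n)).
Implicit Types (f p : T -> C) (F : T -> C) (z : T).

Lemma poly_slices p : is_poly p -> exists d, forall z, exists P : {poly C},
  (size P <= d)%N /\ forall l, p (l *: z) = P.[l].
Proof.
move=> /is_polyP[D [c ->]]; exists (n * D).+1 => z.
exists (\sum_a (c a * mon (fun i => a i) z) *: 'X^(\sum_i a i)); split.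
  apply: leq_trans (size_sum _ _ _) _; apply/bigmax_leqP => a _.
  apply: leq_trans (size_scale_leq _ _) _; rewrite size_polyXn ltnS.
  rewrite -[n in leqRHS]card_ord -sum_nat_const.
  by apply: leq_sum => i _; exact/ltnW/ltn_ord.
move=> l; rewrite horner_sum /pfun; apply: eq_bigr => a _.
by rewrite hornerZ hornerXn monZ mulrCA mulrC.
Qed.

Lemma poisson_repr (P : {poly C}) (N : nat) (r : R) : (0 < N)%N -> 0 <= r -> r < 1 ->
  (size P <= N)%N ->
  (1 - r ^+ N)%:C * \sum_(m < N) (poisson N r m)%:C * P.[cis (tau / N%:R) ^+ m] =
  P.[r%:C] + \sum_(j < N) P`_j * r%:C ^+ (N - j).
Proof.
move=> N0 r0 r1 PN; rewrite (horner_coef_wide _ PN) -big_split /=.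
under eq_bigr do rewrite (horner_coef_wide _ PN) mulr_sumr.
rewrite exchange_big /= mulr_sumr; apply: eq_bigr => j _.
rewrite -mulrDr -poisson_fourier// mulrCA; congr (_ * _); rewrite mulr_sumr.
by apply: eq_bigr => m _; rewrite mulrCA -exprM mulnC.
Qed.

Lemma poisson_bound (P : {poly C}) (N d : nat) (r M : R) : (0 < N)%N -> 0 <= r -> r < 1 ->
  (size P <= d)%N -> (d <= N)%N -> (forall l, nc l = 1 -> nc P.[l] <= M) ->
  nc P.[r%:C] <= d%:R * M * r ^+ (N - d) +
    (1 - r ^+ N) * \sum_(m < N) poisson N r m * nc P.[cis (tau / N%:R) ^+ m].
Proof.
move=> N0 r0 r1 Pd dN PM; have PN := leq_trans Pd dN.
have E := poisson_repr N0 r0 r1 PN.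
have -> : P.[r%:C] = (1 - r ^+ N)%:C * \sum_(m < N) (poisson N r m)%:C * P.[cis (tau / N%:R) ^+ m]
   - \sum_(j < N) P`_j * r%:C ^+ (N - j) by rewrite E addrK.
have rN : 0 <= 1 - r ^+ N by rewrite subr_ge0 exprn_ile1// ltW.
rewrite addrC (le_trans (le_normcD _ _))// lerD//; last first.
  rewrite Normc.normcM ncR_ge0// ler_wpM2l// (le_trans (nc_sum _ _ _))//.
  by apply: ler_sum => m _; rewrite Normc.normcM ncR_ge0// poisson_ge0.
rewrite -mulN1r Normc.normcM (_ : nc (-1) = 1) ?mul1r; last first.
  by rewrite -[-1 : C]sub0r ncBC subr0 nc1.
rewrite (le_trans (nc_sum _ _ _))//.
have M0 : 0 <= M by apply: le_trans (PM 1 nc1); rewrite ?nc_ge0// nc1.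
rewrite -(subnKC dN) big_split_ord /= [X in _ + X]big1 ?addr0 => [|j _]; last first.
  by rewrite nth_default ?mul0r ?nc0// (leq_trans Pd)// leq_addr.
rewrite subnKC//.
apply: (@le_trans _ _ (\sum_(j < d) M * r ^+ (N - d))); last first.
  by rewrite sumr_const card_ord -[(M * _) *+ d]mulr_natl mulrA.
apply: ler_sum => j _; rewrite Normc.normcM ncX ncR_ge0//; apply: ler_pM; rewrite ?nc_ge0 ?exprn_ge0//.
  by have := @cauchy_estimate R P 1 M j ler01 PM; rewrite expr1n mulr1.
by apply: ler_wiXn2l => //; [exact: ltW|rewrite leq_sub2l// ltnW].
Qed.

Lemma integral_nc_poly p : is_poly p -> (\int[sigma]_z (nc (p z))%:E <= (N2 p)%:E)%E.
Proof. by move=> pp; exact/L1norm_le/is_poly_L2. Qed.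

Lemma exp_small (q c e : R) : 0 <= q -> q < 1 -> 0 < e -> exists k, c * q ^+ k <= e.
Proof.
move=> q0 q1 e0.
have : (fun k => c * q ^+ k) @ \oo --> c * 0.
  by apply: cvgM; [exact: cvg_cst|apply: cvg_expr; rewrite ger0_norm].
rewrite mulr0 => /cvgrPdist_lt/(_ _ e0)[k _ kP]; exists k.
have := kP k (leqnn _); rewrite sub0r normrN => /ltW; apply: le_trans; exact: ler_norm.
Qed.

(** The exceptional set is where a running sum along [om] or along its conjugate is positive.
    Elsewhere the Poisson weights, decreasing on each half circle, turn the bounds on the averages
    into a bound on the Poisson mean. *)
Lemma weak_type p (la : R) : is_poly p -> 0 < la -> exists B : set T,
  [/\ measurable B, (la%:E * sigma B <= (2 * N2 p)%:E)%E &
    forall z, enorm z = 1 -> ~ B z -> forall r, 0 <= r -> r <= 1 ->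
      nc (p (r%:C *: z)) <= 6 * la].
Proof.
move=> pp la0; have [L L0 LP] := poly_dil_lip pp.
have [M M0 MP] := is_poly_bounded pp.
have [d dP] := poly_slices pp.
(* Beyond [r0] the Lipschitz bound compares [p] with its value on the sphere; only radii below [r0]
   are left to the Poisson mean, which permits a fixed [N]. *)
pose r0 : R := Num.max 0 (1 - la / (L + 1)).
have L1 : 0 < L + 1 by rewrite ltr_wpDl.
have r00 : 0 <= r0 by rewrite le_max lexx.
have r01 : r0 < 1 by rewrite gt_max ltr01 ltrBlDr ltrDl divr_gt0.
have [k0 k0P] := exp_small (d%:R * M) r00 r01 la0.
(* [N] is odd: the indices 0 to [H] are run forward, the remaining [H] ones are reflected to 1 to
   [H] along the conjugate root. [N - d] is at least [k0], so the alias term is at most [la]. *)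
pose H := (k0 + d)%N; pose N := (H.+1 + H)%N.
have N0 : (0 < N)%N by [].
have dN : (d <= N)%N by rewrite /N /H addSn -addnS addnAC leq_addl.
have k0N : (k0 <= N - d)%N by rewrite leq_subRL// addnC /N -/H addSn ltnW// ltnS leq_addr.
pose om := cis (tau / N%:R) : C.
pose g z := nc (p z).
have mg : measurable_fun setT g by apply: mfun_nc; exact: is_poly_mfun.
have g0 z : 0 <= g z by exact: nc_ge0.
have gfin : (\int[sigma]_z (g z)%:E < +oo)%E by apply: le_lt_trans (integral_nc_poly pp) _; rewrite ltry.
have om1 : nc om = 1 by exact: nc_cis.
have omJ1 : nc (conjc om) = 1 by rewrite ncJ.
pose E w := [set z | 0 < runmax w g la H.+1 z].
have mE w : measurable (E w).
  have mr := measurable_runmax w la H.+1 mg.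
  by rewrite -[X in measurable X]setTI; apply: measurable_fun_ltr => //; exact: measurable_cst.
have E_le w : nc w = 1 -> (la%:E * sigma (E w) <= (N2 p)%:E)%E.
  move=> w1; apply: le_trans (integral_nc_poly pp).
  exact: (maximal_ergodic H.+1 w1 (ltW la0) mg g0 gfin).
exists (E om `|` E (conjc om)); split.
- exact: measurableU.
- apply: (@le_trans _ _ (la%:E * (sigma (E om) + sigma (E (conjc om))))%E).
    by rewrite lee_pmul2l// ?lte_fin//; exact: measureU2.
  rewrite muleDr//; last by rewrite ge0_adde_def// inE measure_ge0.
  by rewrite mulrDl mul1r EFinD leeD// E_le.
move=> z z1 nB r r_0 r_1.
have avg w : nc w = 1 -> ~ E w z -> forall K, (K <= H.+1)%N ->
    \sum_(m < K) (g (w ^+ m *: z) - la) <= 0.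
  move=> w1 nE K KH; apply: le_trans (runmax_sum w g la z KH) _.
  by rewrite leNgt; apply/negP.
have nE1 : ~ E om z by move=> h; apply: nB; left.
have nE2 : ~ E (conjc om) z by move=> h; apply: nB; right.
have gz : g z <= la.
  by have := avg om om1 nE1 1%N isT; rewrite big_ord1 expr0 scale1r subr_le0.
have [r0r|rr0] := leP r0 r.
  have -> : p (r%:C *: z) = p z + (p (r%:C *: z) - p z) by rewrite addrC subrK.
  rewrite (le_trans (le_normcD _ _))//.
  have := LP r z r_0 r_1 ltac:(by rewrite z1).
  have : 1 - la / (L + 1) <= r by apply: le_trans r0r; rewrite le_max lexx orbT.
  rewrite lerBlDr -lerBlDl ler_pdivlMr// => h1 h2.
  move: gz; rewrite /g; move: (nc _) (nc _) h2 => a b h2 gz; nra.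
have r1 : r < 1 := lt_trans rr0 r01.
have [P [Pd PE]] := dP z.
have PM l : nc l = 1 -> nc P.[l] <= M.
  by move=> l1; rewrite -PE; apply: MP; rewrite enormZ l1 z1 mulr1.
rewrite PE (le_trans (poisson_bound N0 r_0 r1 Pd dN PM))//.
have b1 : d%:R * M * r ^+ (N - d) <= la.
  apply: le_trans k0P; rewrite ler_wpM2l ?mulr_ge0//.
  apply: le_trans (ler_wiXn2l r_0 r_1 k0N) _.
  by apply: lerXn2r => //; exact: ltW.
pose k := poisson N r.
have kd m : (m < H)%N -> k m.+1 <= k m.
  move=> mH; apply: poisson_decr => //; rewrite /N addSn addnn.
  by rewrite (leq_trans _ (leqnSn _))// leq_double.
have kge m : 0 <= k m by exact: poisson_ge0.
have S_le w : nc w = 1 -> ~ E w z -> \sum_(m < H.+1) k m * g (w ^+ m *: z) <= la * \sum_(m < H.+1) k m.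
  by move=> w1 nE; apply: (@weighted_sum_le R k (fun m => g (w ^+ m *: z))) => //; exact: avg.
have kS : \sum_(m < H.+1) k m <= \sum_(m < N) k m.
  by rewrite big_split_ord /= lerDl sumr_ge0.
have omNJ j : (j <= N)%N -> om ^+ (N - j) = conjc om ^+ j.
  move=> jN; have omj0 : om ^+ j != 0 by rewrite -nc_eq0 ncX om1 expr1n oner_eq0.
  apply: (mulIf omj0); rewrite -exprD subnK// -exprMn mulrC mulcJ om1 expr1n.
  by rewrite expr1n; exact: omN.
have tot : \sum_(m < N) k m * nc P.[om ^+ m] <= 2 * la * \sum_(m < N) k m.
  have -> : \sum_(m < N) k m * nc P.[om ^+ m] = \sum_(m < N) k m * g (om ^+ m *: z).
    by apply: eq_bigr => m _; rewrite /g PE.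
  rewrite big_split_ord /= -mulrA mulr_natl mulr2n.
  have S2 : \sum_(i < H) k (H.+1 + i)%N * g (om ^+ (H.+1 + i) *: z) <=
      \sum_(m < H.+1) k m * g (conjc om ^+ m *: z).
    rewrite (reindex_inj rev_ord_inj) [leRHS]big_ord_recl.
    apply: ler_wpDl; first exact: mulr_ge0.
    apply: ler_sum => i _.
    have -> : nat_of_ord (lift ord0 i) = i.+1 by [].
    have -> : nat_of_ord (rev_ord i) = (H - i.+1)%N by [].
    have -> : (H.+1 + (H - i.+1) = N - i.+1)%N by rewrite addnBA.
    have iN : (i.+1 <= N)%N by rewrite (leq_trans (ltn_ord i))// leq_addl.
    by rewrite /k poisson_sym// omNJ.
  apply: lerD.
    by apply: le_trans (S_le _ om1 nE1) _; rewrite ler_wpM2l// ltW.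
  by apply: le_trans S2 (le_trans (S_le _ omJ1 nE2) _); rewrite ler_wpM2l// ltW.
have rN : 0 <= 1 - r ^+ N by rewrite subr_ge0 exprn_ile1// ltW.
have := ler_wpM2l rN tot.
have := poisson_sum N0 r_0 r1; rewrite -/k => kE.
have -> : (1 - r ^+ N) * (2 * la * \sum_(m < N) k m) = 2 * la * ((1 - r ^+ N) * \sum_(m < N) k m) by ring.
rewrite kE => h2; have rN1 : r ^+ N <= 1 by rewrite exprn_ile1.
(* [la + 2 * la * (1 + r ^+ N)] is at most [5 * la]. *)
apply: le_trans (lerD b1 h2) _; nra.
Qed.

Lemma geometric_tail (u : nat -> C) (c : R) (K : nat) :
  (forall k, (K <= k)%N -> nc (u k.+1 - u k) <= c * 2^-1 ^+ k) -> 0 <= c ->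
  forall k l, (K <= k)%N -> (k <= l)%N -> nc (u l - u k) <= 2 * c * 2^-1 ^+ k.
Proof.
move=> uc c0 k l Kk /subnK <-.
have : nc (u (l - k + k)%N - u k) <= 2 * c * (2^-1 ^+ k - 2^-1 ^+ (l - k + k)).
  elim: (l - k)%N => [|m ih]; first by rewrite subrr nc0 subrr mulr0.
  have -> : u (m.+1 + k)%N - u k = (u (m + k).+1 - u (m + k)%N) + (u (m + k)%N - u k).
    by rewrite addSn addrA subrK.
  apply: le_trans (le_normcD _ _) _.
  have h := uc (m + k)%N (leq_trans Kk (leq_addl _ _)).
  apply: le_trans (lerD h ih) _; rewrite addSn exprS; lra.
move=> h; apply: le_trans h _; rewrite ler_wpM2l ?mulr_ge0//.
by rewrite gerBl exprn_ge0// invr_ge0.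
Qed.

(** Borel-Cantelli along a fast subsequence of polynomials. Off a null set the differences of
    consecutive polynomials are eventually at most [6 * 2^-1 ^+ k] along the whole radius, so the
    convergence to [f] is uniform on that radius. *)
Lemma bval_radial f F : bval f F ->
  {ae sigma, forall z, forall e : R, 0 < e -> exists2 d : R, d < 1 &
     forall r, d < r -> r < 1 -> nc (f (r%:C *: z) - F z) <= e}.
Proof.
move=> [af LF [q [qq qF qf]]].
(* The rate 4^-k against the height 2^-k leaves exceptional sets of measure of order 2^-k, which is
   summable. *)
have /choice[l lP] k : exists l, (k <= l)%N /\ N2 (q l - F) <= 4^-1 ^+ k / 2.
  have [|N NP] := qF (4^-1 ^+ k / 2); first by rewrite divr_gt0// exprn_gt0// invr_gt0.
  by exists (maxn k N); split; [exact: leq_maxl|apply/NP/leq_maxr].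
pose p k := q (l k).
have pp k : is_poly (p k) by exact: qq.
have Lp k := is_poly_L2 n_gt0 (pp k).
have pF k : N2 (p k - F) <= 4^-1 ^+ k / 2 by case: (lP k).
have pf z : unit_ball z -> ncvg (p ^~ z) (f z).
  move=> bz e e0; have [N NP] := qf z bz e e0; exists N => k Nk.
  by apply: NP; rewrite (leq_trans Nk)//; case: (lP k).
have hh k : 0 < 2^-1 ^+ k :> R by rewrite exprn_gt0// invr_gt0.
have h42 k : 4^-1 ^+ k = 2^-1 ^+ k * 2^-1 ^+ k :> R.
  by rewrite -exprMn; congr (_ ^+ _); field.
have pS k : N2 (p k.+1 - p k) <= 4^-1 ^+ k.
  apply: le_trans (hn_tri SH (Lp _) (Lp _) LF) _.
  have h1 := pF k.+1; have h2 := pF k.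
  rewrite (hnBC SH LF (Lp k)); have : 0 < 4^-1 ^+ k :> R by rewrite exprn_gt0// invr_gt0.
  by move: h1 h2; rewrite exprS; move: (N2 _) (N2 _) (4^-1 ^+ k) => a b c; clear; lra.
have pSp k : is_poly (p k.+1 \- p k) by exact: is_polyB.
have /choice[B BP] k := weak_type (pSp k) (hh k).
have mp k : mfun (p k - F) by apply: mfunB; [exact: is_poly_mfun|case: LF].
(* Chebyshev's inequality, read off from the maximal inequality with the trivial rotation and a
   single term. *)
have sM (G : T -> C) (la : R) : 0 < la -> L2 G ->
    (la%:E * sigma [set z | (la < nc (G z))%R] <= (N2 G)%:E)%E.
  move=> la0 LG; have mG : mfun G by case: LG.
  have mg := mfun_nc mG.
  have := @maximal_ergodic R n 1 (fun z => nc (G z)) la 1 nc1 (ltW la0) mg (fun z => nc_ge0 _).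
  have GN : (\int[sigma]_z (nc (G z))%:E <= (N2 G)%:E)%E by exact: L1norm_le.
  move=> /(_ (le_lt_trans GN (ltry _))) h; apply: le_trans GN; apply: le_trans h.
  rewrite lee_pmul2l// ?lte_fin// (_ : [set z | _] = [set z | 0 < runmax 1 (fun z => nc (G z)) la 1 z])//.
  by apply/seteqP; split => z /=; rewrite addr0 lt_max ltxx /= subr_gt0.
pose D k := [set z | (2^-1 ^+ k < nc ((p k - F) z))%R].
have mD k : measurable (D k).
  have mg := mfun_nc (mp k).
  by rewrite -[X in measurable X]setTI; apply: measurable_fun_ltr => //; exact: measurable_cst.
have mB k : measurable (B k) by have [] := BP k.
pose A k := B k `|` D k.
have mA k : measurable (A k) by exact: measurableU.
have sA k : (sigma (A k) <= (3 * 2^-1 ^+ k)%:E)%E.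
  have sB : (sigma (B k) <= (2 * 2^-1 ^+ k)%:E)%E.
    have [_ h _] := BP k.
    rewrite -(@lee_pmul2l _ (2^-1 ^+ k)%:E)// ?lte_fin// (le_trans h)// -EFinM lee_fin.
    rewrite mulrCA -h42 ler_pM2l//; exact: pS.
  have sD : (sigma (D k) <= (2^-1 ^+ k)%:E)%E.
    rewrite -(@lee_pmul2l _ (2^-1 ^+ k)%:E)// ?lte_fin//.
    apply: le_trans (sM _ _ (hh k) (shB SH (Lp k) LF)) _; rewrite -EFinM lee_fin -h42.
    apply: le_trans (pF k) _; rewrite ler_pdivrMr// ler_peMr// ?ler1n//.
  apply: le_trans (measureU2 _ (mB k) (mD k)) _.
  have -> : 3 * 2^-1 ^+ k = 2 * 2^-1 ^+ k + 2^-1 ^+ k :> R by ring.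
  by rewrite EFinD leeD.
have null : sigma (lim_sup_set A) = 0.
  apply: lim_sup_set_cvg0 => //.
  apply: (@le_lt_trans _ _ 6%:E); last exact: ltry.
  apply: lime_le; first by apply: is_cvg_nneseries => k _ _; exact: measure_ge0.
  near=> m; apply: (@le_trans _ _ (\sum_(0 <= k < m) (3 * 2^-1 ^+ k)%:E)%E).
    by apply: lee_sum => k _; exact: sA.
  rewrite sumEFin lee_fin.
  have -> : \sum_(0 <= k < m) (3 * 2^-1 ^+ k) = 6 * \sum_(0 <= k < m) (2^-1 : R) ^+ k.+1.
    by rewrite mulr_sumr; apply: eq_bigr => k _; rewrite exprS; field.
  rewrite sum_half ler_piMr// gerBl; exact/ltW.
have mls : measurable (lim_sup_set A).
  by apply: bigcap_measurable => // k _; apply: bigcup_measurable => j _.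
have nls : {ae sigma, forall z, ~ lim_sup_set A z}.
  by exists (lim_sup_set A); split => // z /= /contrapT.
move: nls (@ae_sphere R n n_gt0); apply: filterS2 => z nz z1 e e0.
have [K KP] : exists K, forall k, (K <= k)%N -> ~ A k z.
  apply: contrapT => h; apply: nz => K _; apply: contrapT => h2.
  by apply: h; exists K => k Kk Ak; apply: h2; exists k.
have step r k : 0 <= r -> r <= 1 -> (K <= k)%N ->
    nc (p k.+1 (r%:C *: z) - p k (r%:C *: z)) <= 6 * 2^-1 ^+ k.
  move=> r0 r1 Kk; have [_ _ h] := BP k; apply: h => //.
  by move=> Bk; apply: (KP k Kk); left.
have e3 : 0 < e / 3 by rewrite divr_gt0.
have [k0 k0P] : exists k0, 12 * 2^-1 ^+ k0 <= e / 3.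
  by apply: exp_small => //; rewrite ?invr_ge0// invf_lt1// ltr1n.
pose k := maxn K k0.
have Kk : (K <= k)%N by exact: leq_maxl.
have hk : 12 * 2^-1 ^+ k <= e / 3.
  apply: le_trans k0P; rewrite ler_wpM2l//; apply: ler_wiXn2l; rewrite ?invr_ge0//.
    by rewrite invf_le1// ler1n.
  exact: leq_maxr.
have [L L0 LP] := poly_dil_lip (pp k).
have L1 : 0 < L + 1 by rewrite ltr_wpDl.
exists (Num.max 0 (1 - e / 3 / (L + 1))).
  by rewrite gt_max ltr01 ltrBlDr ltrDl divr_gt0.
move=> r; rewrite gt_max => /andP[r0 re] r1.
have bz : unit_ball (r%:C *: z) by rewrite /unit_ball/= enormZr ?ltW// z1 mulr1.
have h1 : nc (p k (r%:C *: z) - f (r%:C *: z)) <= 12 * 2^-1 ^+ k.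
  apply/ler_addgt0Pr => d d0; have [N NP] := pf _ bz d d0.
  pose m := maxn k N.
  have := @geometric_tail (p ^~ (r%:C *: z)) 6 K (fun k => step r k (ltW r0) (ltW r1)) ltac:(by [])
    k m Kk (leq_maxl _ _).
  have := NP m (leq_maxr _ _) => h2 h3.
  have -> : p k (r%:C *: z) - f (r%:C *: z) =
    (p m (r%:C *: z) - f (r%:C *: z)) - (p m (r%:C *: z) - p k (r%:C *: z)) by ring.
  apply: le_trans (ncB _ _) _; rewrite addrC; apply: lerD => //.
  by apply: le_trans h3 _; rewrite le_eqVlt; apply/orP; left; apply/eqP; ring.
have h2 : nc (p k (r%:C *: z) - p k z) <= e / 3.
  apply: le_trans (LP r z (ltW r0) (ltW r1) _) _; first by rewrite z1.
  move: re; rewrite ltrBlDr -ltrBlDl ltr_pdivlMr// => re.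
  by move: (e / 3) re => x; clear - r1 L0; nra.
have h3 : nc (p k z - F z) <= 12 * 2^-1 ^+ k.
  have : ~ D k z by move=> Dk; apply: (KP k Kk); right.
  rewrite /D /= => /negP; rewrite -leNgt => h; apply: le_trans h _.
  by rewrite ler_peMl ?ler1n// ltW.
have -> : f (r%:C *: z) - F z = (p k (r%:C *: z) - p k z) + (p k z - F z) -
  (p k (r%:C *: z) - f (r%:C *: z)) by ring.
apply: le_trans (ncB _ _) _; apply: le_trans (lerD (le_normcD _ _) h1) _.
have -> : e = e / 3 + e / 3 + e / 3 by lra.
apply: lerD => //; apply: lerD => //; exact: le_trans h3 hk.
Unshelve. all: end_near. Qed.

Lemma bval_boundary f F : bval f F -> boundary_value f = F %[ae sigma].
Proof.
move=> /bval_radial; apply: filterS => z h _.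
apply: cvg_lim; first exact: norm_hausdorff.
apply/(cvg_complexP _ _ (at_left_proper_filter _)) => e e0.
have [d d1 dP] := h (e / 2) ltac:(by rewrite divr_gt0).
near=> r; apply: (@le_lt_trans _ _ (e / 2)); last by lra.
by apply: dP; near: r; [exact: nbhs_left_gt|exact: nbhs_left_lt].
Unshelve. all: end_near. Qed.

End radial_limits.

(** * Hilbert space structure of the Hardy space *)

Section integral_ae.
Context {d : measure_display} {X : measurableType d} {R : realType}.
Variable mu : {measure set X -> \bar R}.
Import HBNNSimple.

(* [boundary_value f] is only known to agree almost everywhere with a measurable
   function, hence the absence of measurability hypotheses. *)
Lemma ge0_ae_le_integral_nomeas (f g : X -> \bar R) : (forall x, (0 <= f x)%E) ->
  (forall x, (0 <= g x)%E) -> {ae mu, forall x, (f x <= g x)%E} ->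
  (\int[mu]_x f x <= \int[mu]_x g x)%E.
Proof.
move=> f0 g0 [N [mN N0 fgN]]; rewrite !ge0_integralTE//.
apply: ge_ereal_sup => _ [h /= hf <-].
pose h' := proj_nnsfun h (measurableC mN).
have h'E x : h' x = h x * \1_(~` N) x by [].
have -> : sintegral mu h = sintegral mu h'.
  rewrite -!integralT_nnsfun; apply: ae_eq_integral => //.
  - exact/measurable_EFinP.
  - exact/measurable_EFinP.
  exists N; split => // x /= /not_implyP[_ hx]; apply: contrapT => nNx; apply: hx.
  by rewrite -[RHS]/((h' x)%:E) h'E indicE mem_set// mulr1.
apply: ereal_sup_ubound; exists h' => // x.
change ((h' x)%:E <= g x)%E; rewrite h'E indicE.
have [Nx|nNx] := pselect (N x); first by rewrite memNset ?mulr0//; exact.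
rewrite mem_set// mulr1; apply: le_trans (hf x) _; apply: contrapT => fg.
by apply: nNx; apply: fgN.
Qed.

Lemma ae_eq_integral_nomeas (f g : X -> \bar R) : f = g %[ae mu] ->
  (\int[mu]_x f x = \int[mu]_x g x)%E.
Proof.
move=> fg; rewrite integralE [RHS]integralE.
have H (u v : X -> \bar R) : (forall x, (0 <= u x)%E) -> (forall x, (0 <= v x)%E) ->
    {ae mu, forall x, u x = v x} -> (\int[mu]_x u x = \int[mu]_x v x)%E.
  move=> u0 v0 uv; apply/eqP; rewrite eq_le; apply/andP; split;
    by apply: ge0_ae_le_integral_nomeas => //; move: uv; apply: filterS => x ->.
congr (_ - _)%E; apply: H => //; move: fg; apply: filterS => x /(_ I) E.
  by rewrite !funeposE E.
by rewrite !funenegE E.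
Qed.

End integral_ae.

Section hardy_hilbert.
Context {R : realType} {n : nat}.
Hypothesis n_gt0 : (0 < n)%N.
Local Notation C := R[i].
Local Notation T := 'rV[C]_n.
Local Notation sigma := (@sphere_measure R n).
Local Notation SH := (@L2_semi_hilbert R n).
Local Notation N2 := (hn (@L2dot R n)).
Local Notation cvg2 := (hn_cvg (@L2dot R n)).
Implicit Types (f g h p phi : T -> C) (F G : T -> C) (z : T).

Lemma complex_integral_ae F G : F = G %[ae sigma] -> complex_integral F = complex_integral G.
Proof.
move=> FG; apply: complex_ext; rewrite /= /Rintegral; congr fine;
  by apply: ae_eq_integral_nomeas; move: FG; apply: filterS => z E zT; rewrite E.
Qed.

Lemma L2dot_ae F F' G G' : F = F' %[ae sigma] -> G = G' %[ae sigma] ->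
  L2dot F G = L2dot F' G'.
Proof.
move=> FF GG; apply: complex_integral_ae; move: FF GG; apply: filterS2 => z E1 E2 zT.
by rewrite /conj_fun /= E1// E2.
Qed.

Lemma ae_refl F : F = F %[ae sigma].
Proof. exact: (filterS (fun z _ _ => erefl)) (ae_sphere n_gt0). Qed.

(** A chosen representative in L^2, on which the computations are made before they are carried to
    [boundary_value] almost everywhere. The default 0 is not reached on [H2]. *)
Definition bdry f : T -> C := xget 0 [set F | bval f F].

Lemma bdryP f : H2 f -> bval f (bdry f).
Proof. by move=> /(H2_bval n_gt0)[F bF]; rewrite /bdry; case: xgetP => // /(_ F). Qed.

Lemma bval_bdry f F : bval f F -> bdry f = F %[ae sigma].
Proof.
by move=> bF; exact: (bval_unique n_gt0) (bdryP (bval_H2 n_gt0 bF)) bF.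
Qed.

Lemma bdry_L2 f : H2 f -> L2 (bdry f).
Proof. by move=> /bdryP[]. Qed.

Lemma boundary_valueE f : H2 f -> boundary_value f = bdry f %[ae sigma].
Proof. by move=> Hf; exact: (bval_boundary n_gt0) (bdryP Hf). Qed.

Lemma H2dotE f g : H2 f -> H2 g -> H2dot f g = L2dot (bdry f) (bdry g).
Proof. by move=> Hf Hg; apply: L2dot_ae; exact: boundary_valueE. Qed.

Lemma H2dot_bval f g F G : bval f F -> bval g G -> H2dot f g = L2dot F G.
Proof.
move=> bF bG; rewrite H2dotE; [|exact: (bval_H2 n_gt0 bF)|exact: (bval_H2 n_gt0 bG)].
by apply: L2dot_ae; exact: bval_bdry.
Qed.

Lemma H2_L a f g : H2 f -> H2 g -> H2 (a *: f + g).
Proof.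
by move=> /bdryP b1 /bdryP b2; exact: (bval_H2 n_gt0 (bvalL n_gt0 a b1 b2)).
Qed.

Lemma H2_0 : H2 (0 : T -> C).
Proof. exact: (bval_H2 n_gt0 (bval0 n_gt0)). Qed.

Lemma H2_semi_hilbert : semi_hilbert (@H2 R n) H2dot.
Proof.
split.
- exact: H2_0.
- exact: H2_L.
- move=> a f g h Hf Hg Hh; have bf := bdryP Hf; have bg := bdryP Hg; have bh := bdryP Hh.
  rewrite (H2dot_bval (bvalL n_gt0 a bf bg) bh) (H2dot_bval bf bh) (H2dot_bval bg bh).
  by apply: (shdotL SH); exact: bdry_L2.
- move=> f g Hf Hg; rewrite !H2dotE//; apply: (shdotC SH); exact: bdry_L2.
- by move=> f Hf; rewrite H2dotE//; apply: (shdot_ge0 SH); exact: bdry_L2.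
Qed.

Local Notation NH := (hn (@H2dot R n)).

Lemma NH_bval f F : bval f F -> NH f = N2 F.
Proof. by move=> bF; rewrite /hn (H2dot_bval bF bF). Qed.

Lemma hardy_norm2E f : H2 f -> hardy_norm2 f = (NH f ^+ 2)%:E.
Proof. by move=> Hf; rewrite (bval_hardy n_gt0 (bdryP Hf)) (NH_bval (bdryP Hf)). Qed.

Lemma bval_sub f g F G : bval f F -> bval g G -> bval (f - g) (F - G).
Proof.
by move=> bf bg; have := bvalL n_gt0 (-1) bg bf; rewrite !scaleN1r ![- _ + _]addrC.
Qed.

Lemma H2S_closed (u : nat -> T -> C) F : (forall k, H2S (u k)) -> L2 F -> cvg2 u F -> H2S F.
Proof.
move=> Hu LF uF.
have /choice[p pP] k : exists p, is_poly p /\ N2 (p - u k) <= k.+1%:R^-1.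
  have [f bf] := H2S_bval n_gt0 (Hu k); have [_ _ [q [qq qF _]]] := bf.
  have [|N NP] := qF (k.+1%:R^-1); first by [].
  by exists (q N); split => //; exact: NP.
have Lu k : L2 (u k) by case: (Hu k).
have Lp k : L2 (p k) by case: (pP k) => pp _; exact: is_poly_L2.
split=> // e e0; pose d := Num.min 1 (e / 2).
have d0 : 0 < d by rewrite lt_min ltr01 divr_gt0.
have d1 : d <= 1 by rewrite ge_min lexx.
have de : d <= e / 2 by rewrite ge_min lexx orbT.
have d2 : 0 < d / 2 by rewrite divr_gt0.
have [N1 N1P] := uF _ d2; have [M MP] := natSinv_le d2.
pose k := maxn N1 M; have [[q qE] pk] := pP k.
exists q; rewrite -qE -[F \- p k]/(F - p k) L2norm2E; last exact: (shB SH).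
rewrite lte_fin (hnBC SH LF (Lp k)).
have h : N2 (p k - F) <= d.
  apply: le_trans (hn_tri SH (Lp k) LF (Lu k)) _.
  have := N1P k (leq_maxl _ _); have := MP k (leq_maxr _ _); move: pk.
  move: (N2 _) (N2 _) (k.+1%:R^-1) => a b c; clear; lra.
have := hn_ge0 (@L2dot R n) (p k - F); move: (N2 _) h => a; clear - d0 d1 de e0; nra.
Qed.

Lemma H2_complete : hn_complete (@H2dot R n) (@H2 R n).
Proof.
move=> u Hu uc; have Lb k := bdry_L2 (Hu k).
have E k l : NH (u k - u l) = N2 (bdry (u k) - bdry (u l)).
  by apply: NH_bval; apply: bval_sub; exact: bdryP.
have [|F LF uF] := @L2_hn_complete R n (fun k => bdry (u k)) Lb.
  move=> e e0; have [N NP] := uc e e0; exists N => k l Nk Nl.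
  by rewrite -E; exact: NP.
have HF : H2S F by apply: H2S_closed LF uF => k; exact: (bval_H2S n_gt0 (bdryP (Hu k))).
have [f bf] := H2S_bval n_gt0 HF; exists f; first exact: (bval_H2 n_gt0 bf).
move=> e e0; have [N NP] := uF e e0; exists N => k Nk.
by rewrite (NH_bval (bval_sub (bdryP (Hu k)) bf)); exact: NP.
Qed.

Lemma ae_le_bound phi F (M : R) : bval phi F -> (forall z, unit_ball z -> nc (phi z) <= M) ->
  {ae sigma, forall z, nc (F z) <= M}.
Proof.
move=> bF pM; move: (bval_radial n_gt0 bF) (@ae_sphere R n n_gt0); apply: filterS2 => z h z1.
apply/ler_addgt0Pr => e e0; have [d d1 dP] := h e e0.
pose r := Num.max ((d + 1) / 2) 2^-1.
have r1 : r < 1 by rewrite gt_max; apply/andP; split; lra.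
have rd : d < r by rewrite lt_max; apply/orP; left; lra.
have r0 : 0 <= r by rewrite le_max invr_ge0 ler0n orbT.
have bz : unit_ball (r%:C *: z) by rewrite /unit_ball/= enormZr// z1 mulr1.
have -> : F z = phi (r%:C *: z) - (phi (r%:C *: z) - F z) by ring.
by apply: le_trans (ncB _ _) (lerD (pM _ bz) (dP r rd r1)).
Qed.

Lemma bounded_H2 phi (M : R) : analytic phi -> (forall z, unit_ball z -> nc (phi z) <= M) ->
  H2 phi.
Proof.
move=> ap pM; split => //; have M0 : 0 <= M.
  by apply: le_trans (nc_ge0 (phi 0)) (pM _ _); rewrite /unit_ball/= enorm0.
apply: (@le_lt_trans _ _ (M ^+ 2)%:E); last exact: ltry.
apply: ge_ereal_sup => _ [r /andP[r0 r1] <-].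
rewrite -[X in (X <= _)%E]/(L2norm2 (dil r phi)).
have Ld := dil_L2 n_gt0 ap (ltW r0) r1; rewrite -N2_le//.
have [] // := @L2_sphere_bounded R n n_gt0 (dil r phi) M M0 (mfun_dil r (analytic_mfun ap)).
by move=> z z1; apply: pM; rewrite /unit_ball/= enormZr ?ltW// z1 mulr1.
Qed.

Lemma bval_mult phi f F G (M : R) : (forall z, unit_ball z -> nc (phi z) <= M) ->
  bval phi F -> bval f G -> bval (mult phi f) (F \* G).
Proof.
move=> pM bp bf; have M0 : 0 <= M.
  by apply: le_trans (nc_ge0 (phi 0)) (pM _ _); rewrite /unit_ball/= enorm0.
exact: (bvalM n_gt0 M0 (ae_le_bound bp pM) bp bf).
Qed.

Lemma bval_coordinate i : bval (coordinate i) (fun z : T => z ord0 i).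
Proof. exact: (bval_poly n_gt0 (is_poly_coord i)). Qed.

Lemma coordinate_le1 (i : 'I_n) z : unit_ball z -> nc (coordinate i z : C) <= 1.
Proof. by move=> bz; rewrite /coordinate on_ballE// (le_trans (nc_le_enorm z i))// ltW. Qed.

Lemma mult_N2_le F G (M : R) : 0 <= M -> mfun F -> {ae sigma, forall z, nc (F z) <= M} -> L2 G ->
  N2 (F \* G) <= M * N2 G.
Proof. by move=> M0 mF FM LG; have [_] := N2_mul_le M0 mF LG FM. Qed.

(** A dilation of [phi] keeps the bound [M], and a polynomial within 1 of it keeps [M + 1]: this is
    the uniform bound that general L^2 approximants lack. *)
Lemma bounded_poly_approx phi F (M e : R) : (forall z, unit_ball z -> nc (phi z) <= M) ->
  bval phi F -> 0 < e -> exists p, [/\ is_poly p,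
    {ae sigma, forall z, nc (p z) <= M + 1} & N2 (p - F) <= e].
Proof.
move=> pM bp e0; have [ap LF _] := bp.
have e2 : 0 < Num.min 1 (e / 2) by rewrite lt_min ltr01 divr_gt0.
have [r0 /andP[r00 r01] r0P] := bval_dil_cvg n_gt0 bp (ltac:(by rewrite divr_gt0) : 0 < e / 2).
have [q qq qP] := analytic_poly_approx (analytic_diff ap) r01 e2.
have mp := analytic_mfun ap; have mq := is_poly_mfun qq.
exists (dil r0 q); split.
- exact: is_poly_dil.
- have := @ae_sphere R n n_gt0; apply: filterS => z z1.
  have rz : enorm (r0%:C *: z) <= r0 by exact: dil_enorm.
  have -> : dil r0 q z = phi (r0%:C *: z) - (phi (r0%:C *: z) - q (r0%:C *: z)).
    by rewrite /dil; ring.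
  apply: le_trans (ncB _ _) _; apply: lerD.
    by apply: pM; exact: le_lt_trans r01.
  by apply: le_trans (qP _ rz) _; rewrite ge_min lexx.
have Lq : L2 (dil r0 q) by apply: (is_poly_L2 n_gt0); exact: is_poly_dil.
have Lp := dil_L2 n_gt0 ap r00 r01.
apply: le_trans (hn_tri SH Lq LF Lp) _; rewrite (hnBC SH Lq Lp).
have h1 : N2 (dil r0 phi - dil r0 q) <= e / 2.
  apply: (dil_dist_le n_gt0) => // [|z zr]; first by rewrite ltW// divr_gt0.
  by apply: le_trans (qP z zr) _; rewrite ge_min lexx orbT.
have h2 := r0P r0 (lexx _) r01.
by rewrite [leRHS](splitr e); exact: lerD.
Qed.

End hardy_hilbert.

(** * Quotient modules *)

Section quotient_modules.
Context {R : realType} {n : nat}.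
Hypothesis n_gt0 : (0 < n)%N.
Local Notation C := R[i].
Local Notation T := 'rV[C]_n.
Local Notation sigma := (@sphere_measure R n).
Local Notation SH := (@L2_semi_hilbert R n).
Local Notation N2 := (hn (@L2dot R n)).
Local Notation SH2 := (@H2_semi_hilbert R n n_gt0).
Local Notation NH := (hn (@H2dot R n)).
Implicit Types (f g h p phi u : T -> C) (F G : T -> C) (z : T).
Variable Q : set (T -> C).
Hypothesis hQ : quotient_module Q.

Lemma Q_H2 : Q `<=` @H2 R n.
Proof. by case: hQ => -[]. Qed.

Lemma Q_subspace : subspace Q.
Proof. by case: hQ => -[_ Q0 QL _] _ _; split. Qed.

Lemma Q_complete : hn_complete (@H2dot R n) Q.
Proof.
move=> u Qu uc; have Hu k := Q_H2 (Qu k).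
have [f Hf uf] := H2_complete n_gt0 Hu uc.
exists f => //; have [[_ _ _ Qcl] _ _] := hQ; apply: (Qcl u) => //.
have Hd k : H2 (u k - f) := shB SH2 (Hu k) Hf.
have -> : (fun k => hardy_norm2 (u k - f)) = (fun k => (NH (u k - f) ^+ 2)%:E).
  by apply/funext => k; exact: (hardy_norm2E n_gt0 (Hd k)).
apply: cvg_EFin; first by near=> k.
apply/cvgr0Pnorm_le => e e0.
have d0 : 0 < Num.min 1 e by rewrite lt_min ltr01.
have [N NP] := uf _ d0; exists N => // k /= Nk.
have := NP k Nk; rewrite le_min => /andP[h1 h2].
have h0 := hn_ge0 (@H2dot R n) (u k - f).
rewrite ger0_norm ?sqr_ge0//; apply: le_trans h2; rewrite expr2.
by rewrite ler_piMr.
Unshelve. all: end_near. Qed.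

Lemma orth_projP f : H2 f -> Q (orth_proj Q f) /\
  forall q, Q q -> H2dot (f - orth_proj Q f) q = 0.
Proof.
move=> Hf; have [g Qg gP] := projection SH2 Q_subspace Q_H2 Q_complete Hf.
by rewrite /orth_proj; case: xgetP => [g' -> //|/(_ g)]; case.
Qed.

Lemma orth_proj_dot f q : H2 f -> Q q -> H2dot (orth_proj Q f) q = H2dot f q.
Proof.
move=> Hf Qq; have [Qp /(_ q Qq)] := orth_projP Hf.
rewrite (shdotBl SH2 Hf (Q_H2 Qp) (Q_H2 Qq)).
by move=> h; rewrite -(subr0_eq h).
Qed.

(** Equality holds as functions and not merely up to norm 0, because [xget] chooses from the same
    set on both sides. *)
Lemma eq_orth_proj f g : H2 f -> H2 g -> (forall q, Q q -> H2dot f q = H2dot g q) ->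
  orth_proj Q f = orth_proj Q g.
Proof.
move=> Hf Hg fg; rewrite /orth_proj; congr (xget 0 _).
suff sub a b : H2 a -> H2 b -> (forall q, Q q -> H2dot a q = H2dot b q) ->
    [set g0 | Q g0 /\ forall q, Q q -> H2dot (a - g0) q = 0] `<=`
    [set g0 | Q g0 /\ forall q, Q q -> H2dot (b - g0) q = 0].
  apply/seteqP; split; first exact: (sub f g Hf Hg fg).
  exact: (sub g f Hg Hf (fun q Qq => esym (fg q Qq))).
move=> Ha Hb ab h [Qh hh]; split=> [|q Qq]; first exact: Qh.
have := hh q Qq; have Hh := Q_H2 Qh; have Hq := Q_H2 Qq.
by rewrite (shdotBl SH2 Ha Hh Hq) (shdotBl SH2 Hb Hh Hq) (ab q Qq).
Qed.

Lemma mult_H2 phi f (M : R) : analytic phi -> (forall z, unit_ball z -> nc (phi z) <= M) ->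
  H2 f -> H2 (mult phi f).
Proof.
move=> ap pM Hf; have bp := bdryP n_gt0 (bounded_H2 n_gt0 ap pM).
exact: (bval_H2 n_gt0 (bval_mult n_gt0 pM bp (bdryP n_gt0 Hf))).
Qed.

Lemma coordinate_analytic (i : 'I_n) : analytic (coordinate i : T -> C).
Proof. by case: (@bval_coordinate R n n_gt0 i). Qed.

Lemma multL phi (a : C) f g : mult phi (a *: f + g) = a *: mult phi f + mult phi g.
Proof.
apply/funext => z; rewrite -[LHS]/(phi z * (a * f z + g z)) -[RHS]/(a * (phi z * f z) + phi z * g z).
by ring.
Qed.

(** [H2adj] is a choice by [xget]; the Riesz theorem, with the coordinate bounded by 1 on the ball,
    provides a candidate, so the choice has its defining property. *)
Lemma H2adjP i f : H2 f -> H2 (H2adj (mult (coordinate i)) f) /\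
  forall h, H2 h -> H2dot (mult (coordinate i) h) f = H2dot h (H2adj (mult (coordinate i)) f).
Proof.
move=> Hf; have Hm h : H2 h -> H2 (mult (coordinate i) h).
  exact: (mult_H2 (coordinate_analytic i) (coordinate_le1 i)).
have [||g Hg gP] := @riesz R (T -> C) (@H2 R n) (@H2dot R n) SH2
  (fun h => H2dot (mult (coordinate i) h) f) (NH f) (H2_complete n_gt0).
- move=> a g h Hg Hh; rewrite multL; exact: (shdotL SH2 a (Hm _ Hg) (Hm _ Hh) Hf).
- move=> h Hh; apply: le_trans (cauchy_schwarz SH2 (Hm h Hh) Hf) _.
  rewrite [leLHS]mulrC; apply: (ler_wpM2l (hn_ge0 (@H2dot R n) f)).
  have bz := @bval_coordinate R n n_gt0 i; have bh := bdryP n_gt0 Hh.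
  rewrite (NH_bval n_gt0 (bval_mult n_gt0 (coordinate_le1 i) bz bh)) (NH_bval n_gt0 bh).
  rewrite -[leRHS]mul1r; have [_ Lz _] := bz; have [_ Lh _] := bh.
  apply: mult_N2_le => //; [by case: Lz|exact: (ae_le_bound n_gt0 bz (coordinate_le1 i))].
by rewrite /H2adj; case: xgetP => [g' -> //|/(_ g)]; case.
Qed.

Definition perp u := H2 u /\ forall q, Q q -> H2dot u q = 0.

Lemma perpL a u v : perp u -> perp v -> perp (a *: u + v).
Proof.
move=> [Hu u0] [Hv v0]; split; first exact: (shL SH2).
move=> q Qq; rewrite (shdotL SH2 a Hu Hv (Q_H2 Qq)).
by rewrite (u0 q Qq) (v0 q Qq) mulr0 addr0.
Qed.

Lemma perp0 : perp 0.
Proof.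
by split=> [|q Qq]; [exact: (sh0 SH2)|exact: (shdot0l SH2 (Q_H2 Qq))].
Qed.

Lemma perp_coordinate i u : perp u -> perp (mult (coordinate i) u).
Proof.
move=> [Hu u0]; split; first exact: (mult_H2 (coordinate_analytic i) (coordinate_le1 i)).
move=> q Qq; have [_ ->//] := H2adjP i (Q_H2 Qq).
by apply: u0; have [_ _] := hQ; apply.
Qed.

Definition perp_mult p := forall u, perp u -> perp (mult (on_ball p) u).

Lemma H2_off u z : H2 u -> ~ unit_ball z -> u z = 0.
Proof. by move=> [[_ u0] _]; exact: u0. Qed.

Lemma perp_mult_cst (a : C) : perp_mult (fun=> a).
Proof.
move=> u pu; have Hu := pu.1.
have -> : mult (on_ball (fun=> a)) u = a *: u + 0; last exact: (perpL a pu perp0).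
apply/funext => z; rewrite addr0 -[RHS]/(a * u z) /mult /=.
have [bz|nz] := pselect (unit_ball z); first by rewrite on_ballE.
by rewrite (H2_off Hu nz) !mulr0.
Qed.

Lemma perp_multD p q : perp_mult p -> perp_mult q -> perp_mult (fun z => p z + q z).
Proof.
move=> Pp Pq u pu; have Hu := pu.1.
have -> : mult (on_ball (fun z => p z + q z)) u = 1 *: mult (on_ball p) u + mult (on_ball q) u.
  apply/funext => z; rewrite scale1r -[RHS]/(on_ball p z * u z + on_ball q z * u z) /mult /=.
  have [bz|nz] := pselect (unit_ball z); first by rewrite !on_ballE// mulrDl.
  by rewrite (H2_off Hu nz) !mulr0 addr0.
by apply: perpL; [exact: Pp|exact: Pq].
Qed.

Lemma perp_multM p q : perp_mult p -> perp_mult q -> perp_mult (fun z => p z * q z).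
Proof.
move=> Pp Pq u pu; have Hu := pu.1.
have -> : mult (on_ball (fun z => p z * q z)) u = mult (on_ball p) (mult (on_ball q) u).
  apply/funext => z; rewrite /mult /=.
  have [bz|nz] := pselect (unit_ball z); first by rewrite !on_ballE// mulrA.
  by rewrite (H2_off Hu nz) !mulr0.
exact/Pp/Pq.
Qed.

Lemma perp_poly p u : is_poly p -> perp u -> perp (mult (on_ball p) u).
Proof.
move=> /is_polyP[D [c ->]]; move: u; rewrite -/(perp_mult (pfun c)) /pfun.
have ps (I : Type) (s : seq I) (F : I -> T -> C) : (forall i, perp_mult (F i)) ->
    perp_mult (fun z => \sum_(i <- s) F i z).
  move=> pF; elim: s => [|i s ih].
    by under eq_fun do rewrite big_nil; exact: perp_mult_cst.
  by under eq_fun do rewrite big_cons; apply: perp_multD; [exact: pF|exact: ih].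
have pp (I : Type) (s : seq I) (F : I -> T -> C) : (forall i, perp_mult (F i)) ->
    perp_mult (fun z => \prod_(i <- s) F i z).
  move=> pF; elim: s => [|i s ih].
    by under eq_fun do rewrite big_nil; exact: perp_mult_cst.
  by under eq_fun do rewrite big_cons; apply: perp_multM; [exact: pF|exact: ih].
apply: ps => a; apply: perp_multM; first exact: perp_mult_cst.
apply: pp => i; elim: (a i : nat) => [|k ih].
  by under eq_fun do rewrite expr0; exact: perp_mult_cst.
by under eq_fun do rewrite exprS; apply: perp_multM; [move=> v; exact: perp_coordinate|exact: ih].
Qed.

Lemma perp_poly_dot p u q : is_poly p -> perp u -> Q q -> L2dot (p \* bdry u) (bdry q) = 0.
Proof.
move=> pp pu Qq; have [_ /(_ q Qq) <-] := perp_poly pp pu.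
have Hq := Q_H2 Qq; have bu := bdryP n_gt0 pu.1.
have bp := bval_poly n_gt0 pp; have [M M0 pM] := is_poly_bounded pp.
have bm : bval (mult (on_ball p) u) (p \* bdry u).
  apply: (bval_mult n_gt0 _ bp bu) => z bz; rewrite on_ballE//.
  exact/pM/ltW.
by rewrite (H2dot_bval n_gt0 bm (bdryP n_gt0 Hq)).
Qed.

(** Polynomials [p] near the symbol are uniformly bounded but close to it only in L^2, so their
    product with an unbounded [u] is not directly close; [u] is approximated by a polynomial too. *)
Lemma perp_bounded phi u (M : R) : analytic phi -> (forall z, unit_ball z -> nc (phi z) <= M) ->
  perp u -> perp (mult phi u).
Proof.
move=> ap pM pu; have Hu := pu.1; split; first exact: (mult_H2 ap pM).
move=> q Qq; have Hq := Q_H2 Qq.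
have bp := bdryP n_gt0 (bounded_H2 n_gt0 ap pM); have bu := bdryP n_gt0 Hu.
have bq := bdryP n_gt0 Hq.
have bm := bval_mult n_gt0 pM bp bu.
rewrite (H2dot_bval n_gt0 bm bq).
set F := bdry phi in bp bm *; set U := bdry u in bu bm *; set G := bdry q in bq *.
have [_ LF _] := bp; have [_ LU [P [PP PU _]]] := bu; have [_ LG _] := bq.
have LP k := is_poly_L2 n_gt0 (PP k).
have M0 : 0 <= M by apply: le_trans (nc_ge0 (phi 0)) (pM _ _); rewrite /unit_ball/= enorm0.
have FM := ae_le_bound n_gt0 bp pM.
have mF : mfun F by case: LF.
apply: (@nc_le_small _ _ (N2 G)) => e e0.
have M2 : 0 < 2 * M + 1 by rewrite ltr_wpDl// mulr_ge0.
have [N NP] := PU (e / 2 / (2 * M + 1)) ltac:(by rewrite !divr_gt0).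
have [B B0 PB] := is_poly_bounded (PP N).
have B1 : 0 < B + 1 by rewrite ltr_wpDl.
have [p [pp pM1 pF]] := bounded_poly_approx n_gt0 pM bp (ltac:(by rewrite !divr_gt0) : 0 < e / 2 / (B + 1)).
have Lp := is_poly_L2 n_gt0 pp.
have LFp : L2 (F - p) by exact: (shB SH).
have LUP : L2 (U - P N) by exact: (shB SH).
have aeB : {ae sigma, forall z, nc (P N z) <= B}.
  by have := @ae_sphere R n n_gt0; apply: filterS => z z1; apply: PB; rewrite z1.
have aeFp : {ae sigma, forall z, nc ((F - p) z) <= 2 * M + 1}.
  move: FM pM1; apply: filterS2 => z h1 h2.
  have -> : 2 * M + 1 = M + (M + 1) by ring.
  by apply: le_trans (ncB _ _) _; exact: lerD.
have [LFU _] := N2_mul_le M0 mF LU FM.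
have [LpU _] := N2_mul_le (ltac:(by rewrite addr_ge0) : 0 <= M + 1) (is_poly_mfun pp) LU pM1.
have mFp : mfun (F - p) by case: LFp.
have [L1 h1] := N2_mul_le (ltW M2) mFp LUP aeFp.
have [L2' h2] := N2_mul_le B0 (is_poly_mfun (PP N)) LFp aeB.
(* In the first product the factor [F - p] is merely bounded and [U - P N] is small in L^2; in the
   second [P N] is bounded and [F - p] is small. Hence [N] is fixed before [p]. *)
have E : F \* U - p \* U = (F - p) \* (U - P N) + P N \* (F - p).
  apply/funext => z; rewrite -[LHS]/(F z * U z - p z * U z).
  rewrite -[RHS]/((F z - p z) * (U z - P N z) + P N z * (F z - p z)).
  by ring.
have -> : L2dot (F \* U) G = L2dot (F \* U - p \* U) G.
  by rewrite (shdotBl SH)// (perp_poly_dot pp pu Qq) subr0.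
have LE : L2 (F \* U - p \* U) by exact: (shB SH).
apply: le_trans (cauchy_schwarz SH LE LG) _; rewrite mulrC.
apply: ler_wpM2l; first exact: hn_ge0.
rewrite E; apply: le_trans (hnD SH L1 L2') _; rewrite [leRHS](splitr e); apply: lerD.
  apply: le_trans h1 _; rewrite mulrC -ler_pdivlMr// (hnBC SH LU (LP N)).
  exact: NP.
apply: le_trans h2 _; apply: (@le_trans _ _ ((B + 1) * N2 (F - p))).
  by rewrite ler_wpM2r ?hn_ge0// lerDl.
by rewrite mulrC -ler_pdivlMr// (hnBC SH LF Lp).
Qed.

(** Here the symbol itself is orthogonal to [Q]: its products with polynomials stay so, and
    polynomials approximate [f] while the symbol is bounded. *)
Lemma perp_symbol phi f (M : R) : analytic phi -> (forall z, unit_ball z -> nc (phi z) <= M) ->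
  perp phi -> H2 f -> perp (mult phi f).
Proof.
move=> ap pM pphi Hf; split; first exact: (mult_H2 ap pM).
move=> q Qq; have Hq := Q_H2 Qq.
have bp := bdryP n_gt0 pphi.1; have bf := bdryP n_gt0 Hf; have bq := bdryP n_gt0 Hq.
have bm := bval_mult n_gt0 pM bp bf.
rewrite (H2dot_bval n_gt0 bm bq).
have FM := ae_le_bound n_gt0 bp pM.
have M0 : 0 <= M by apply: le_trans (nc_ge0 (phi 0)) (pM _ _); rewrite /unit_ball/= enorm0.
have [_ LF _] := bp; have [_ LU [P [PP PU _]]] := bf; have [_ LG _] := bq.
have mF : mfun (bdry phi) by case: LF.
apply: (@nc_le_small _ _ (N2 (bdry q))) => e e0.
have M1 : 0 < M + 1 by rewrite ltr_wpDl.
have [N NP] := PU (e / (M + 1)) ltac:(by rewrite divr_gt0).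
have LP := is_poly_L2 n_gt0 (PP N).
have LUP : L2 (bdry f - P N) by exact: (shB SH).
have [L1 h1] := N2_mul_le M0 mF LUP FM.
have [L2' _] := N2_mul_le M0 mF LP FM.
have [L3 _] := N2_mul_le M0 mF LU FM.
have E : bdry phi \* bdry f = bdry phi \* (bdry f - P N) + bdry phi \* P N.
  apply/funext => z; rewrite -[LHS]/(bdry phi z * bdry f z).
  rewrite -[RHS]/(bdry phi z * (bdry f z - P N z) + bdry phi z * P N z).
  by ring.
rewrite E (shdotDl SH)//.
have -> : bdry phi \* P N = P N \* bdry phi by apply/funext => z /=; rewrite mulrC.
rewrite (perp_poly_dot (PP N) pphi Qq) addr0.
apply: le_trans (cauchy_schwarz SH L1 LG) _; rewrite mulrC.
apply: ler_wpM2l; first exact: hn_ge0.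
apply: le_trans h1 _; apply: (@le_trans _ _ ((M + 1) * N2 (bdry f - P N))).
  by rewrite ler_wpM2r ?hn_ge0// lerDl.
by rewrite mulrC -ler_pdivlMr// (hnBC SH LU LP); exact: NP.
Qed.

End quotient_modules.

(** * Duality and extremal lifts *)

Section duality.
Context {R : realType} {n : nat}.
Hypothesis n_gt0 : (0 < n)%N.
Local Notation C := R[i].
Local Notation T := 'rV[C]_n.
Local Notation SH := (@L2_semi_hilbert R n).
Local Notation N2 := (hn (@L2dot R n)).
Implicit Types (f g h p : T -> C) (F G : T -> C) (z : T).

Lemma conj_funK F : conj_fun (conj_fun F) = F.
Proof. by apply/funext => z; rewrite /conj_fun cJK. Qed.

Lemma conj_fun1 : conj_fun (fun=> 1) = (fun=> 1) :> (T -> C).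
Proof. by apply/funext => z; rewrite /conj_fun rmorph1. Qed.

Lemma L2dotJr F G : L2dot F (conj_fun G) = complex_integral (F \* G).
Proof. by rewrite /L2dot conj_funK. Qed.

Lemma L2dot1 F : L2dot F (fun=> 1) = complex_integral F.
Proof.
by rewrite -conj_fun1 L2dotJr; congr complex_integral; apply/funext => z /=; rewrite mulr1.
Qed.

Lemma L2dotJJ F G : L2 F -> L2 G -> L2dot (conj_fun F) (conj_fun G) = conjc (L2dot F G).
Proof.
move=> LF LG; rewrite -(shdotC SH LF LG) L2dotJr /L2dot; congr complex_integral.
by apply/funext => z /=; rewrite mulrC.
Qed.

Lemma N2J F : L2 F -> N2 (conj_fun F) = N2 F.
Proof. by move=> LF; rewrite /hn (L2dotJJ LF LF) ReJ. Qed.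

Lemma CI_mon (a : 'I_n -> nat) : complex_integral (mon a : T -> C) = mon a 0.
Proof.
have E : mon (fun=> 0%N) = (fun=> 1) :> (T -> C).
  by apply/funext => z; rewrite /mon big1// => i _; rewrite expr0.
have [->|a0] := pselect (a = fun=> 0%N); first by rewrite E CI_cst.
rewrite -L2dot1 -E (mon_orth n_gt0 a0).
have [i ai] : exists i, a i <> 0%N.
  by apply: contrapT => /forallNP H; apply: a0; apply/funext => i; exact: contrapT (H i).
by rewrite /mon (bigD1 i)//= mxE expr0n; case: (a i) ai => // k _; rewrite mul0r.
Qed.

Lemma CI_poly p : is_poly p -> complex_integral p = p 0.
Proof.
move=> /is_polyP[D [c ->]]; rewrite -L2dot1 pfunE.
rewrite (shdot_suml _ SH _ (@L2_cst R n 1)) => [|a]; last first.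
  by apply: (shZ SH); exact: mon_L2.
rewrite fct_sumE; apply: eq_bigr => a _.
by rewrite (shdotZl SH _ (mon_L2 n_gt0 _) (@L2_cst R n 1)) L2dot1 CI_mon.
Qed.

Lemma H2S_L2 F : H2S F -> L2 F.
Proof. by case. Qed.

Lemma H2S_dense_orth F H : L2 H -> (forall p, is_poly p -> L2dot p H = 0) -> H2S F ->
  L2dot F H = 0.
Proof.
move=> LH pH /(H2S_bval n_gt0)[f [_ LF [p [pp pF _]]]].
apply: (@nc_le_small _ _ (N2 H)) => e e0; have [N NP] := pF e e0.
have Lp := is_poly_L2 n_gt0 (pp N).
have -> : L2dot F H = L2dot (F - p N) H.
  by rewrite (shdotBl SH LF Lp LH) (pH _ (pp N)) subr0.
apply: le_trans (cauchy_schwarz SH (shB SH LF Lp) LH) _; rewrite mulrC.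
by apply: ler_wpM2l; [exact: hn_ge0|rewrite (hnBC SH LF Lp); exact: NP].
Qed.

(** The defect of multiplicativity of the integral, as an inner product with a vector that depends
    on [G] only; density of polynomials can then be used in one factor at a time. *)
Lemma L2dot_fluct F G : L2 F -> L2 G ->
  L2dot F (conj_fun G - conjc (complex_integral G) *: (fun=> 1)) =
  complex_integral (F \* G) - complex_integral F * complex_integral G.
Proof.
move=> LF LG; have L1' := @L2_cst R n 1.
rewrite (shdotBr SH LF (L2J LG) (shZ SH _ L1')) L2dotJr.
by rewrite (shdotZr SH _ LF L1') cJK L2dot1 mulrC.
Qed.

(* Holds for monomials since both sides vanish unless both are constant. *)
Lemma H2S_CI_M F G : H2S F -> H2S G ->
  complex_integral (F \* G) = complex_integral F * complex_integral G.
Proof.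
have Lf H : L2 H -> L2 (conj_fun H - conjc (complex_integral H) *: (fun=> 1) : T -> C).
  by move=> LH; apply: (shB SH (L2J LH)); apply: (shZ SH); exact: L2_cst.
have step H : L2 H -> (forall p, is_poly p ->
    complex_integral (p \* H) = complex_integral p * complex_integral H) ->
    forall K, H2S K -> complex_integral (K \* H) = complex_integral K * complex_integral H.
  move=> LH pH K HK; apply/eqP; rewrite -subr_eq0 -(L2dot_fluct (H2S_L2 HK) LH).
  apply/eqP; apply: (H2S_dense_orth (Lf _ LH) _ HK) => p pp.
  by rewrite (L2dot_fluct (is_poly_L2 n_gt0 pp) LH) (pH _ pp) subrr.
have MC (H K : T -> C) : H \* K = K \* H by apply/funext => z; exact: mulrC.
move=> HF HG; apply: (step G (H2S_L2 HG)) HF => p pp.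
rewrite MC mulrC; apply: (step p (is_poly_L2 n_gt0 pp)) HG => q qq.
by rewrite !CI_poly//; exact: is_polyM.
Qed.

Lemma H2S_L a F G : H2S F -> H2S G -> H2S (a *: F + G).
Proof.
move=> /(H2S_bval n_gt0)[f bf] /(H2S_bval n_gt0)[g bg].
exact: (bval_H2S n_gt0 (bvalL n_gt0 a bf bg)).
Qed.

Lemma H2S_poly p : is_poly p -> H2S p.
Proof. by move=> pp; exact: (bval_H2S n_gt0 (bval_poly n_gt0 pp)). Qed.

Lemma H2S_cst (a : C) : H2S (fun _ : T => a).
Proof. by apply: H2S_poly; exact: is_poly_cst. Qed.

Lemma H2S_subspace : subspace (@H2S R n).
Proof. by split; [exact: (H2S_cst 0)|exact: H2S_L]. Qed.

Lemma H2S_complete : hn_complete (@L2dot R n) (@H2S R n).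
Proof.
move=> u Hu uc; have [F LF uF] := L2_hn_complete (fun k => H2S_L2 (Hu k)) uc.
by exists F => //; exact: (H2S_closed n_gt0 Hu LF uF).
Qed.

Lemma H2S0_H2S F : H2S0 F -> H2S F.
Proof. by case. Qed.

Lemma H2S0_subspace : subspace (@H2S0 R n).
Proof.
have L1' := @L2_cst R n 1; split.
  by split; [exact: (H2S_cst 0)|exact: (shdot0l SH L1')].
move=> a F G [HF F0] [HG G0]; split; first exact: H2S_L.
by rewrite (shdotL SH a (H2S_L2 HF) (H2S_L2 HG) L1') F0 G0 mulr0 addr0.
Qed.

Lemma H2S0_complete : hn_complete (@L2dot R n) (@H2S0 R n).
Proof.
move=> u Hu uc; have [F HF uF] := H2S_complete (fun k => H2S0_H2S (Hu k)) uc.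
have L1' := @L2_cst R n 1; have LF := H2S_L2 HF.
exists F => //; split => //.
apply: (@nc_le_small _ _ (N2 (fun=> 1))) => e e0; have [N NP] := uF e e0.
have [HN N0] := Hu N; have LN := H2S_L2 HN.
have -> : L2dot F (fun=> 1) = L2dot (F - u N) (fun=> 1).
  by rewrite (shdotBl SH LF LN L1') N0 subr0.
apply: le_trans (cauchy_schwarz SH (shB SH LF LN) L1') _; rewrite mulrC.
by apply: ler_wpM2l; [exact: hn_ge0|rewrite (hnBC SH LF LN); exact: NP].
Qed.

Lemma H2S0_H2S_CI F G : H2S F -> H2S0 G -> complex_integral (F \* G) = 0.
Proof. by move=> HF [HG]; rewrite L2dot1 (H2S_CI_M HF HG) => ->; rewrite mulr0. Qed.

Lemma conj_mixed m : mixed m -> L2 m /\ forall F, H2S F ->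
  L2dot m F = 0 /\ complex_integral (m \* F) = 0.
Proof.
move=> [Lm mo]; split => // F HF; have H0 := H2S_cst 0; split.
  apply: mo; exists F, (conj_fun (fun=> 0)); split => //; first by exists (fun=> 0).
  by apply/funext => z /=; rewrite /conj_fun conjc0 addr0.
rewrite -L2dotJr; apply: mo; exists (fun=> 0), (conj_fun F); split => //; first by exists F.
by apply/funext => z /=; rewrite add0r.
Qed.

(* [E1] is the component of [E] in [H2S0]; what is left over is orthogonal to
   [H2S], to its conjugates and hence belongs to [mixed]. *)
Lemma H2S_of_annihilator g : L2 g ->
  (forall m, mixed m -> complex_integral (m \* g) = 0) ->
  (forall h, H2S0 h -> complex_integral (h \* g) = 0) -> H2S g.
Proof.
move=> Lg gm gh.
have [g1 Hg1 g1o] := projection SH H2S_subspace H2S_L2 H2S_complete Lg.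
have Lg1 := H2S_L2 Hg1; have Le := shB SH Lg Lg1.
pose E := conj_fun (g - g1); have LE : L2 E by exact: L2J.
have Eo k : H2S k -> L2dot E (conj_fun k) = 0.
  by move=> Hk; rewrite (L2dotJJ Le (H2S_L2 Hk)) (g1o k Hk) conjc0.
have [E1 HE1 E1o] := projection SH H2S0_subspace (fun F HF => H2S_L2 (H2S0_H2S HF))
  H2S0_complete LE.
have LE1 := H2S_L2 (H2S0_H2S HE1); have LE2 := shB SH LE LE1.
have L1' := @L2_cst R n 1.
have E2o k : H2S k -> L2dot (E - E1) (conj_fun k) = 0.
  move=> Hk; rewrite (shdotBl SH LE LE1 (L2J (H2S_L2 Hk))) (Eo k Hk) L2dotJr.
  have -> : E1 \* k = k \* E1 by apply/funext => z /=; rewrite mulrC.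
  by rewrite (H2S0_H2S_CI Hk HE1) subr0.
(* An element of [H2S] is a constant plus an element of [H2S0]; the latter is covered by [E1o], and
   constants by [E2o] since 1 is its own conjugate. *)
have E2o' k : H2S k -> L2dot (E - E1) k = 0.
  move=> Hk; have Lk := H2S_L2 Hk; pose a := complex_integral k.
  have H0 : H2S0 (k - a *: (fun=> 1)).
    split.
      by have := H2S_L (- a) (H2S_cst 1) Hk; rewrite addrC scaleNr.
    by rewrite (shdotBl SH Lk (shZ SH a L1') L1') (shdotZl SH a L1' L1') !L2dot1 CI_cst mulr1 subrr.
  have -> : k = a *: (fun=> 1) + (k - a *: (fun=> 1)) by rewrite addrC subrK.
  have LkA := H2S_L2 (H2S0_H2S H0).
  rewrite (shdotDr SH LE2 (shZ SH a L1') LkA) (E1o _ H0) (shdotZr SH a LE2 L1').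
  by rewrite -conj_fun1 (E2o _ (H2S_cst 1)) mulr0 addr0.
have mE2 : mixed (E - E1).
  split => // _ [G1 [_ [HG1 [G2 HG2 <-] ->]]].
  have LG1 := H2S_L2 HG1; have LG2 := L2J (H2S_L2 HG2).
  by rewrite -[_ \+ _]/(G1 + conj_fun G2) (shdotDr SH LE2 LG1 LG2) (E2o' _ HG1) (E2o _ HG2) addr0.
(* The conjugate of [g1] is orthogonal to [E], so this norm is the integral of [E] against [g], and
   [g] annihilates both the mixed part and the [H2S0] part of [E]. *)
have E0 : L2dot E E = 0.
  have -> : L2dot E E = L2dot E (conj_fun g) - L2dot E (conj_fun g1).
    rewrite -(shdotBr SH LE (L2J Lg) (L2J Lg1)); congr L2dot; apply/funext => z.
    by rewrite /E /conj_fun -[LHS]/(conjc (g z - g1 z)) conjcB.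
  rewrite (Eo _ Hg1) subr0.
  have -> : E = (E - E1) + E1 by rewrite subrK.
  by rewrite (shdotDl SH LE2 LE1 (L2J Lg)) !L2dotJr (gm _ mE2) (gh _ HE1) addr0.
have e0 : N2 (g1 - g) = 0.
  by rewrite (hnBC SH Lg1 Lg) -(N2J Le) -/E /hn E0 sqrtr0.
apply: (@H2S_closed R n n_gt0 (fun=> g1)) => // e ep.
by exists 0%N => k _; rewrite e0 ltW.
Qed.

End duality.

(** * Functionals bounded in the L^1 norm and their representing functions *)

Section bounded_functional.
Context {R : realType} {n : nat}.
Hypothesis n_gt0 : (0 < n)%N.
Local Notation C := R[i].
Local Notation T := 'rV[C]_n.
Local Notation sigma := (@sphere_measure R n).
Local Notation SH := (@L2_semi_hilbert R n).
Local Notation N2 := (hn (@L2dot R n)).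
Local Notation A1 := (fun F : T -> C => fine (L1norm F)).
Implicit Types (f g h p : T -> C) (F G : T -> C) (z : T).

Lemma fineL1 F : L2 F -> L1norm F = (A1 F)%:E.
Proof.
by move=> /L2_L1[_ F1]; rewrite fineK// ge0_fin_numE ?L1norm_ge0.
Qed.

Lemma A1_ge0 F : 0 <= A1 F.
Proof. by apply: fine_ge0; exact: L1norm_ge0. Qed.

Lemma A1D F G : L2 F -> L2 G -> A1 (F + G) <= A1 F + A1 G.
Proof.
move=> LF LG; rewrite -lee_fin EFinD -!fineL1//; last exact: (shD SH).
rewrite /L1norm -ge0_integralD//; first last.
- exact/measurable_EFinP/mfun_nc/L2_m.
- by move=> z _; rewrite lee_fin nc_ge0.
- exact/measurable_EFinP/mfun_nc/L2_m.
- by move=> z _; rewrite lee_fin nc_ge0.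
apply: ge0_le_integral => //.
- by move=> z _; rewrite lee_fin nc_ge0.
- by apply/measurable_EFinP; apply: mfun_nc; apply: mfunD; exact: L2_m.
- by apply: emeasurable_funD; exact/measurable_EFinP/mfun_nc/L2_m.
- by move=> z _; rewrite -EFinD lee_fin le_normcD.
Qed.

Lemma A1Z a F : L2 F -> A1 (a *: F) = nc a * A1 F.
Proof.
move=> LF; apply: EFin_inj; rewrite EFinM -!fineL1//; last exact: (shZ SH).
by rewrite -L1normZ//; exact: L2_m.
Qed.

Lemma A1_le_N2 F : L2 F -> A1 F <= N2 F.
Proof. by move=> LF; rewrite -lee_fin -fineL1//; exact: L1norm_le. Qed.

Lemma CI_M_le F G (M : R) : L2 F -> L2 G -> 0 <= M -> {ae sigma, forall z, nc (F z) <= M} ->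
  nc (complex_integral (F \* G)) <= M * A1 G.
Proof.
move=> LF LG M0 FM; rewrite -lee_fin EFinM -(fineL1 LG).
apply: le_trans (CI_le (L1M LF LG)) _; rewrite /L1norm -ge0_integralZl_EFin//; first last.
- exact/measurable_EFinP/mfun_nc/L2_m.
- by move=> z _; rewrite lee_fin nc_ge0.
apply: ge0_ae_le_integral_nomeas => [z|z|]; first by rewrite lee_fin nc_ge0.
  by rewrite -EFinM lee_fin mulr_ge0 ?nc_ge0.
move: FM; apply: filterS => z h; rewrite -EFinM lee_fin [leLHS]Normc.normcM.
by rewrite ler_wpM2r ?nc_ge0.
Qed.

(* Test function: the conjugate of [g] cut off to the set where [c < |g|]. *)
Lemma ae_le_of_functional g (c : R) : 0 <= c -> L2 g ->
  (forall F, L2 F -> nc (complex_integral (F \* g)) <= c * A1 F) ->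
  {ae sigma, forall z, nc (g z) <= c}.
Proof.
move=> c0 Lg gc; have mg := L2_m Lg; pose B := [set z | c < nc (g z)].
have mB : measurable B.
  have -> : B = (fun z => nc (g z)) @^-1` `]c, +oo[%classic.
    by apply/seteqP; split => z /=; rewrite in_itv/= andbT.
  by rewrite -[X in measurable X]setTI; exact: (mfun_nc mg).
pose s z : R := \1_B z.
have s0 z : 0 <= s z by rewrite /s indicE.
have s1 z : s z <= 1 by rewrite /s indicE; case: (_ \in _).
pose F : T -> C := (fun z => (s z)%:C) \* conj_fun g.
have nF z : nc (F z) = s z * nc (g z) by rewrite [LHS]Normc.normcM ncR_ge0// ncJ.
have LF : L2 F.
  apply: (L2_dom _ Lg) => [|z]; last by rewrite nF ler_piMl ?nc_ge0.
  apply: mfunM; last exact: mfunJ.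
  by apply/mfunP; split; [exact: measurable_indic|exact: measurable_cst].
have FgE z : (F \* g) z = (nc ((F \* g) z))%:C.
  rewrite -[(F \* g) z]/((s z)%:C * conjc (g z) * g z) -mulrA [conjc _ * _]mulrC mulcJ.
  by rewrite Normc.normcM !ncR_ge0 ?sqr_ge0// -rmorphM.
have LFg := L1M LF Lg; have LF1 := L2_L1 LF.
have I2 : (\int[sigma]_z nc ((F \* g) z))%R <= c * (\int[sigma]_z nc (F z))%R.
  have -> : (\int[sigma]_z nc (F z))%R = A1 F.
    by apply: EFin_inj; rewrite L1norm_fin// fineL1.
  rewrite -[leLHS]ger0_norm; last by apply: Rintegral_ge0 => z _; exact: nc_ge0.
  rewrite -ncR -CI_real; have <- : F \* g = fun z => (nc ((F \* g) z))%:C by exact/funext.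
  exact: gc.
pose h z := nc ((F \* g) z) - c * nc (F z).
have hE z : h z = s z * (nc (g z) * (nc (g z) - c)).
  by rewrite /h [nc ((F \* g) z)]Normc.normcM nF; ring.
have h0 z : 0 <= h z.
  rewrite hE /s indicE; have [zB|nB] := boolP (z \in B); last by rewrite mul0r.
  by rewrite mul1r mulr_ge0 ?nc_ge0// subr_ge0 ltW//; move: zB; rewrite inE.
have icF : sigma.-integrable setT (EFin \o (fun z => c * nc (F z))).
  by have := integrableZl measurableT c (L1_nc LF1).
have ih : sigma.-integrable setT (EFin \o h).
  by have := integrableB measurableT (L1_nc LFg) icF.
have Ih : (\int[sigma]_z (h z)%:E = 0)%E.
  apply/eqP; rewrite eq_le integral_ge0 ?andbT => [|z _]; last by rewrite lee_fin.
  rewrite -[leLHS]fineK; last exact: integrable_fin_num ih.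
  rewrite lee_fin -[leLHS]/(\int[sigma]_z h z)%R /h RintegralB//; last exact: L1_nc.
  by rewrite RintegralZl ?subr_le0//; exact: L1_nc.
have : ae_eq sigma setT (fun z => (h z)%:E) (cst 0%E).
  apply/ae_eq_integral_abs => //; first by case/integrableP: ih.
  by rewrite -[RHS]Ih; apply: eq_integral => z _; rewrite /= ger0_norm.
apply: filterS => z /(_ I)[] /eqP; rewrite hE leNgt => /eqP hz; apply/negP => cg.
have : 0 < s z * (nc (g z) * (nc (g z) - c)).
  rewrite /s indicE mem_set// mul1r mulr_gt0 ?subr_gt0//.
  exact: le_lt_trans cg.
by rewrite hz ltxx.
Qed.

(** The extension takes place inside L^2 with [c * A1] as dominating seminorm. Since [A1] is below
    the L^2 norm, the Riesz theorem represents the extension, and the bound in L^1 is used a second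
    time for the pointwise bound on the representing function. *)
Lemma bounded_representation (M : set (T -> C)) (l : (T -> C) -> C) (c : R) : 0 <= c ->
  subspace M -> M `<=` L2 ->
  (forall a F G, M F -> M G -> l (a *: F + G) = a * l F + l G) ->
  (forall F, M F -> nc (l F) <= c * A1 F) ->
  exists g, [/\ L2 g, {ae sigma, forall z, nc (g z) <= c} &
    forall F, M F -> l F = complex_integral (F \* g)].
Proof.
move=> c0 sM ML lL lc.
have sL : subspace (@L2 R n) by split; [exact: (sh0 SH)|exact: (shL SH)].
have pD F G : L2 F -> L2 G -> c * A1 (F + G) <= c * A1 F + c * A1 G.
  by move=> LF LG; rewrite -mulrDr ler_wpM2l ?A1D.
have pZ a F : L2 F -> c * A1 (a *: F) = nc a * (c * A1 F).
  by move=> LF; rewrite A1Z// mulrCA.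
have [L [LL Lc LE]] := hahn_banach sL pD pZ sM ML lL lc.
have Lb F : L2 F -> nc (L F) <= c * N2 F.
  by move=> LF; apply: le_trans (Lc F LF) _; rewrite ler_wpM2l ?A1_le_N2.
have [G LG GE] := riesz SH (@L2_hn_complete R n) LL Lb.
have Lg := L2J LG.
have gE F : L2 F -> L F = complex_integral (F \* conj_fun G) by exact: GE.
exists (conj_fun G); split => //.
  by apply: ae_le_of_functional => // F LF; rewrite -gE//; exact: Lc.
by move=> F MF; rewrite -LE// gE//; exact: ML.
Qed.

(* The powers of [f] obey the same evaluation bound, so the constant in that
   bound disappears in the limit. *)
Lemma bval_max_modulus f F (c : R) z : 0 <= c -> bval f F ->
  {ae sigma, forall w : T, nc (F w) <= c} -> unit_ball z -> nc (f z) <= c.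
Proof.
move=> c0 bF Fc bz.
have bX k : bval (on_ball (fun w : T => f w ^+ k)) (fun w => F w ^+ k).
  elim: k => [|k ih].
    by have := bval_poly n_gt0 (is_poly_cst 1); under eq_fun do rewrite expr0.
  have -> : on_ball (fun w => f w ^+ k.+1) = f \* on_ball (fun w => f w ^+ k).
    apply/funext => w; rewrite -[RHS]/(f w * on_ball (fun w => f w ^+ k) w).
    have [bw|nw] := pselect (unit_ball w); first by rewrite !on_ballE// exprS.
    by have [[_ ->//] _ _] := bF; rewrite mul0r /on_ball patchE memNset.
  have -> : (fun w => F w ^+ k.+1) = F \* (fun w => F w ^+ k).
    by apply/funext => w; rewrite exprS.
  exact: (bvalM n_gt0 c0 Fc).
have [e [K [e0 K0 pK]]] := point_evaluation n_gt0 bz.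
have fK k : nc (f z) ^+ k <= K * c ^+ k.
  have [_ LX [p [pp pF pf]]] := bX k.
  have [|_ XN] := L2_ae_bounded (exprn_ge0 k c0) (L2_m LX).
    by move: Fc; apply: filterS => w h; rewrite ncX lerXn2r ?nnegrE ?nc_ge0.
  have K1 : 0 < K + 1 by rewrite ltr_wpDl.
  apply/ler_addgt0Pr => d d0; pose t := d / (K + 1); have t0 : 0 < t by rewrite divr_gt0.
  have [N1 N1P] := pF t t0; have [N2' N2P] := pf z bz t t0.
  pose m := maxn N1 N2'; have Lp := is_poly_L2 n_gt0 (pp m).
  have h1 := N1P m (leq_maxl _ _); have h2 := N2P m (leq_maxr _ _).
  have h3 := pK _ (pp m) z (fun i => ltac:(by rewrite lerDl ltW)).
  have h4 : N2 (p m) <= c ^+ k + t.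
    have -> : p m = (fun w => F w ^+ k) + (p m - (fun w => F w ^+ k)) by rewrite addrC subrK.
    apply: le_trans (hnD SH LX (shB SH Lp LX)) _; exact: lerD.
  have h5 : nc (f z) ^+ k <= nc (p m z) + t.
    rewrite -ncX -(on_ballE (fun w => f w ^+ k) bz).
    have -> : on_ball (fun w => f w ^+ k) z = p m z - (p m z - on_ball (fun w => f w ^+ k) z).
      by rewrite subKr.
    by apply: le_trans (ncB _ _) _; rewrite lerD2l.
  apply: le_trans h5 _; apply: le_trans (lerD (le_trans h3 (ler_wpM2l K0 h4)) (lexx t)) _.
  have -> : K * (c ^+ k + t) + t = K * c ^+ k + (K + 1) * t by ring.
  by rewrite /t [(K + 1) * _]mulrC divfK ?gt_eqF// lexx.
rewrite leNgt; apply/negP => cf; have f0 := le_lt_trans c0 cf.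
(* If [nc (f z)] exceeded [c], some power would make [K * c ^+ k] at most half of [nc (f z) ^+ k],
   against [fK]. *)
have [k kP] := @exp_small R (c / nc (f z)) K 2^-1 ltac:(by rewrite divr_ge0// ltW)
  ltac:(by rewrite ltr_pdivrMr// mul1r) ltac:(by rewrite invr_gt0).
have fk0 : 0 < nc (f z) ^+ k by rewrite exprn_gt0.
move: kP; rewrite expr_div_n mulrA ler_pdivrMr// => /(le_trans (fK k)).
by move: fk0; move: (nc (f z) ^+ k) => x; clear; lra.
Qed.

End bounded_functional.

(** * The functional on [M_space] and its extremal lift *)

Section lifting.
Context {R : realType} {n : nat}.
Hypothesis n_gt0 : (0 < n)%N.
Local Notation C := R[i].
Local Notation T := 'rV[C]_n.
Local Notation SH := (@L2_semi_hilbert R n).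
Local Notation SH2 := (@H2_semi_hilbert R n n_gt0).
Local Notation A1 := (fun F : T -> C => fine (L1norm F)).
Implicit Types (f g h p phi u psi q : T -> C) (F G U B : T -> C) (z : T).

Lemma nc_le_supnorm phi z : Hinfty phi -> unit_ball z -> nc (phi z) <= supnorm phi.
Proof.
move=> [_ [M pM]] bz; apply: ub_le_sup; last by exists z.
by exists M => _ [w bw <-]; exact: pM.
Qed.

Lemma supnorm_le phi (c : R) : (forall z, unit_ball z -> nc (phi z) <= c) -> supnorm phi <= c.
Proof.
move=> pc; apply: ge_sup => [|_ [w bw <-]]; last exact: pc.
by exists (nc (phi 0)); exists 0 => //; rewrite /unit_ball/= enorm0.
Qed.

Variable Q : set (T -> C).
Hypothesis hQ : quotient_module Q.

Lemma lift_dot X phi (M : R) : analytic phi -> (forall z, unit_ball z -> nc (phi z) <= M) ->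
  is_lift Q X phi -> H2 (X (orth_proj Q one_ball)) /\
  forall q, Q q -> H2dot (X (orth_proj Q one_ball)) q = H2dot phi q.
Proof.
move=> ap pM Xphi.
have H1 : H2 (one_ball : T -> C) := bval_H2 n_gt0 (bval_poly n_gt0 (is_poly_cst 1)).
have [QP Po] := orth_projP n_gt0 hQ H1; have HP := Q_H2 hQ QP.
set P := orth_proj Q one_ball in QP Po HP *.
have Hm := mult_H2 n_gt0 ap pM HP.
rewrite (Xphi _ QP) /compression; split; first exact: (Q_H2 hQ (orth_projP n_gt0 hQ Hm).1).
move=> q Qq; rewrite (orth_proj_dot n_gt0 hQ Hm Qq).
have [Hd d0] : perp Q (mult phi (one_ball - P)).
  exact: (perp_bounded n_gt0 hQ ap pM (conj (shB SH2 H1 HP) Po)).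
have E : phi = mult phi P + mult phi (one_ball - P).
  apply/funext => z; rewrite -[RHS]/(phi z * P z + phi z * (one_ball z - P z)).
  have [bz|nz] := pselect (unit_ball z).
    by rewrite /one_ball on_ballE//; ring.
  by case: ap => _ /(_ z nz) ->; rewrite !mul0r addr0.
by rewrite [in RHS]E (shdotDl SH2 Hm Hd (Q_H2 hQ Qq)) (d0 q Qq) addr0.
Qed.

(** Paired with a boundary function, an element of [M_space] acts through its component in the
    conjugate of [Q] alone: the mixed part is orthogonal to the conjugates of [H2S], and the [H2S0]
    part is killed by multiplicativity of the integral. *)
Lemma M_space_repr F : M_space Q F -> L2 F /\ exists2 q, Q q &
  forall u U, bval u U -> complex_integral (F \* U) = H2dot u q.
Proof.
move=> [_ [_ [[B [LB [q Qq Bq]] <-] [m [h [mm hh ->]]] ->]]].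
have [Lm mo] := conj_mixed n_gt0 mm; have Lh := H2S_L2 (H2S0_H2S hh).
have LmB := L2J LB; have Lmh := shD SH Lm Lh.
split; first exact: (shD SH LmB Lmh).
exists q => // u U bU; have HU := bval_H2S n_gt0 bU; have LU := H2S_L2 HU; have LUJ := L2J LU.
rewrite -L2dotJr -[conj_fun B \+ _]/(conj_fun B + (m + h)).
rewrite (shdotDl SH LmB Lmh LUJ) (shdotDl SH Lm Lh LUJ) (L2dotJJ LB LU) -(shdotC SH LB LU).
rewrite !L2dotJr (mo U HU).2.
have -> : h \* U = U \* h by apply/funext => z; exact: mulrC.
rewrite (H2S0_H2S_CI n_gt0 HU hh) !addr0.
have Hq := Q_H2 hQ Qq; rewrite (H2dot_bval n_gt0 bU (bdryP n_gt0 Hq)).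
apply: L2dot_ae; first exact: ae_refl.
move: Bq (boundary_valueE n_gt0 Hq); apply: filterS2 => z h1 h2 zT.
by rewrite h1// h2.
Qed.

Lemma M_space_L2 : M_space Q `<=` L2.
Proof. by move=> F /M_space_repr[]. Qed.

Lemma boundary_set_bdry q : Q q -> boundary_set Q (bdry q).
Proof.
move=> Qq; have Hq := Q_H2 hQ Qq; split; first exact: bdry_L2.
exists q => //; move: (boundary_valueE n_gt0 Hq); apply: filterS => z h zT.
by rewrite h.
Qed.

Lemma boundary_set_subspace : subspace (boundary_set Q).
Proof.
have [Q0 QL] := Q_subspace hQ; split.
  split; first exact: (sh0 SH); exists 0 => //.
  by move: (bval_boundary n_gt0 (@bval0 R n n_gt0)); apply: filterS => z h zT; rewrite h.
move=> a F G [LF [f Qf Ff]] [LG [g Qg Gg]]; split; first exact: (shL SH a LF LG).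
exists (a *: f + g); first exact: QL.
have Hf := Q_H2 hQ Qf; have Hg := Q_H2 hQ Qg.
have b := bval_boundary n_gt0 (bvalL n_gt0 a (bdryP n_gt0 Hf) (bdryP n_gt0 Hg)).
have bf := boundary_valueE n_gt0 Hf; have bg := boundary_valueE n_gt0 Hg.
near=> z => zT; rewrite (near b z _ zT)//.
rewrite -[LHS]/(a * F z + G z) -[RHS]/(a * bdry f z + bdry g z).
rewrite (near Ff z _ zT)// (near Gg z _ zT)//.
by rewrite (near bf z _ zT)// (near bg z _ zT).
Unshelve. all: end_near. Qed.

Lemma mixed_subspace : subspace (@mixed R n).
Proof.
have L2G G : add_set (@H2S R n) (conj_set H2S) G -> L2 G.
  by move=> [G1 [_ [H1 [G2 H2' <-] ->]]]; exact: (shD SH (H2S_L2 H1) (L2J (H2S_L2 H2'))).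
split; first by split=> [|G /L2G LG]; [exact: (sh0 SH)|exact: (shdot0l SH LG)].
move=> a F G [LF Fo] [LG Go]; split=> [|H HH]; first exact: (shL SH a LF LG).
by rewrite (shdotL SH a LF LG (L2G H HH)) (Fo H HH) (Go H HH) mulr0 addr0.
Qed.

Lemma M_space_intro B m h : boundary_set Q B -> mixed m -> H2S0 h ->
  M_space Q (conj_fun B + (m + h)).
Proof.
move=> bB mm hh; exists (conj_fun B), (m + h); split => //; first by exists B.
by exists m, h.
Qed.

Lemma M_space_subspace : subspace (M_space Q).
Proof.
have [b0 bL] := boundary_set_subspace; have [m0 mL] := mixed_subspace.
have [h0 hL] := @H2S0_subspace R n n_gt0; split.
  have -> : 0 = conj_fun 0 + (0 + 0) :> (T -> C); last exact: M_space_intro.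
  by apply/funext => z; rewrite !addr0 -[RHS]/(conjc 0) conjc0.
move=> a F G [_ [_ [[B1 bB1 <-] [m1 [h1 [mm1 hh1 ->]]] ->]]].
move=> [_ [_ [[B2 bB2 <-] [m2 [h2 [mm2 hh2 ->]]] ->]]].
have := M_space_intro (bL (conjc a) _ _ bB1 bB2) (mL a _ _ mm1 mm2) (hL a _ _ hh1 hh2).
congr (M_space Q _); apply/funext => z.
rewrite -[LHS]/(conjc (conjc a * B1 z + B2 z) + (a * m1 z + m2 z + (a * h1 z + h2 z))).
rewrite -[RHS]/(a * (conjc (B1 z) + (m1 z + h1 z)) + (conjc (B2 z) + (m2 z + h2 z))).
by rewrite conjcD conjcM cJK; ring.
Qed.

Lemma X_functionalE psi F : H2 psi -> X_functional psi F = complex_integral (F \* bdry psi).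
Proof.
move=> Hp; apply: complex_integral_ae.
move: (boundary_valueE n_gt0 Hp); apply: filterS => z h zT.
by rewrite -[LHS]/(boundary_value psi z * F z) h// mulrC.
Qed.

Lemma X_functionalL psi a F G : H2 psi -> M_space Q F -> M_space Q G ->
  X_functional psi (a *: F + G) = a * X_functional psi F + X_functional psi G.
Proof.
move=> Hp /M_space_L2 LF /M_space_L2 LG; rewrite !X_functionalE// -!L2dotJr.
by rewrite (shdotL SH a LF LG (L2J (bdry_L2 n_gt0 Hp))).
Qed.

Lemma X_functional_le psi phi F (M : R) : analytic phi ->
  (forall z, unit_ball z -> nc (phi z) <= M) -> H2 psi ->
  (forall q, Q q -> H2dot psi q = H2dot phi q) -> M_space Q F ->
  nc (X_functional psi F) <= M * A1 F.
Proof.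
move=> ap pM Hpsi pp MF; have [LF [q Qq qP]] := M_space_repr MF.
have bp := bdryP n_gt0 (bounded_H2 n_gt0 ap pM).
rewrite (X_functionalE F Hpsi) (qP _ _ (bdryP n_gt0 Hpsi)) (pp q Qq) -(qP _ _ bp).
have -> : F \* bdry phi = bdry phi \* F by apply/funext => z; exact: mulrC.
have [_ Lp _] := bp; apply: (CI_M_le Lp LF _ (ae_le_bound n_gt0 bp pM)).
by apply: le_trans (nc_ge0 (phi 0)) (pM _ _); rewrite /unit_ball/= enorm0.
Qed.

Lemma X_norm_le psi (M : R) : 0 <= M ->
  (forall F, M_space Q F -> nc (X_functional psi F) <= M * A1 F) ->
  (X_norm Q psi <= M%:E)%E.
Proof.
move=> M0 XM; apply: ge_ereal_sup => _ [F [MF F1] <-]; rewrite lee_fin.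
apply: le_trans (XM F MF) _; rewrite ler_piMr//.
by rewrite -lee_fin -fineL1//; exact: M_space_L2.
Qed.

Lemma X_norm_fin psi (M : R) : 0 <= M -> H2 psi ->
  (forall F, M_space Q F -> nc (X_functional psi F) <= M * A1 F) ->
  exists c : R, [/\ 0 <= c, X_norm Q psi = c%:E &
    forall F, M_space Q F -> nc (X_functional psi F) <= c * A1 F].
Proof.
move=> M0 Hp XM; have XleM := X_norm_le M0 XM; have [S0 SL] := M_space_subspace.
have X0 : (0 <= X_norm Q psi)%E.
  apply: le_trans (_ : ((nc (X_functional psi 0))%:E <= _)%E); first by rewrite lee_fin nc_ge0.
  apply: ereal_sup_ubound; exists 0 => //; split => //.
  rewrite /L1norm; under eq_integral do rewrite nc0.
  by rewrite integral0.
have Xfin : X_norm Q psi \is a fin_num.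
  by rewrite ge0_fin_numE//; apply: le_lt_trans XleM _; rewrite ltry.
exists (fine (X_norm Q psi)); split; [exact: fine_ge0|by rewrite fineK|].
move=> F MF; have LF := M_space_L2 MF.
have := A1_ge0 F; rewrite le_eqVlt => /predU1P[a0|a0].
  (* If [F] has L^1 norm 0 it cannot be normalized; the a priori bound with [M] makes the functional
     vanish on it. *)
  by have := XM F MF; rewrite -a0 !mulr0.
have LZ := shZ SH (A1 F)^-1%:C LF.
have MZ : M_space Q ((A1 F)^-1%:C *: F) by rewrite -[_ *: _]addr0; exact: SL.
have nZ : nc (A1 F)^-1%:C = (A1 F)^-1 by rewrite ncR_ge0// invr_ge0 ltW.
rewrite -ler_pdivrMr// mulrC -lee_fin fineK//.
have -> : (A1 F)^-1 * nc (X_functional psi F) = nc (X_functional psi ((A1 F)^-1%:C *: F)).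
  rewrite !X_functionalE// -!L2dotJr (shdotZl SH _ LF (L2J (bdry_L2 n_gt0 Hp))).
  by rewrite Normc.normcM nZ.
apply: ereal_sup_ubound; exists ((A1 F)^-1%:C *: F) => //; split => //.
by rewrite (fineL1 LZ) A1Z// nZ mulVf ?gt_eqF.
Qed.

(** The given lift [phi] is a reference symbol: [theta - phi] is shown to be orthogonal to [Q],
    which transfers the compression from [phi] to [theta]. The bound [c] comes from the functional
    and is independent of [M]. *)
Lemma extremal_lift X phi psi (c M : R) : 0 <= c -> analytic phi ->
  (forall z, unit_ball z -> nc (phi z) <= M) -> is_lift Q X phi -> H2 psi ->
  (forall q, Q q -> H2dot psi q = H2dot phi q) ->
  (forall F, M_space Q F -> nc (X_functional psi F) <= c * A1 F) ->
  exists theta, [/\ analytic theta, forall z, unit_ball z -> nc (theta z) <= c &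
    is_lift Q X theta].
Proof.
move=> c0 ap pM Xphi Hpsi pp Xc.
have [g [Lg gc gE]] := bounded_representation c0 M_space_subspace M_space_L2
  (fun a F G => @X_functionalL psi a F G Hpsi) Xc.
have HPsi := bval_H2S n_gt0 (bdryP n_gt0 Hpsi).
have [b0 _] := boundary_set_subspace; have [m0 _] := mixed_subspace.
have [h0 _] := @H2S0_subspace R n n_gt0.
have cj0 : conj_fun 0 = 0 :> (T -> C) by apply/funext => z; exact: conjc0.
have Hg : H2S g.
  apply: (H2S_of_annihilator n_gt0 Lg) => [m mm|h hh].
    have := M_space_intro b0 mm h0; rewrite cj0 add0r addr0 => /gE <-.
    by rewrite (X_functionalE m Hpsi); have [_ /(_ _ HPsi)[]] := conj_mixed n_gt0 mm.
  have := M_space_intro b0 m0 hh; rewrite cj0 !add0r => /gE <-.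
  rewrite (X_functionalE h Hpsi) -(H2S0_H2S_CI n_gt0 HPsi hh).
  by congr complex_integral; apply/funext => z; exact: mulrC.
have [th bt] := H2S_bval n_gt0 Hg; have [ath _ _] := bt.
have thc z : unit_ball z -> nc (th z) <= c := bval_max_modulus n_gt0 c0 bt gc.
exists th; split; [exact: ath|exact: thc|move=> f Qf].
rewrite (Xphi f Qf); have Hf := Q_H2 hQ Qf.
have Ht := bounded_H2 n_gt0 ath thc; have Hp := bounded_H2 n_gt0 ap pM.
(* The representation is tested on the conjugate of the boundary function of [q], an element of
   [M_space] whose other two components are 0. *)
have tq q : Q q -> H2dot th q = H2dot phi q.
  move=> Qq; have Hq := Q_H2 hQ Qq; have bq := bdryP n_gt0 Hq; have Lq := bdry_L2 n_gt0 Hq.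
  have MF := M_space_intro (boundary_set_bdry Qq) m0 h0; rewrite !addr0 in MF.
  rewrite -(pp q Qq) (H2dot_bval n_gt0 bt bq) (H2dot_bval n_gt0 (bdryP n_gt0 Hpsi) bq).
  have CJ G : L2dot G (bdry q) = complex_integral (conj_fun (bdry q) \* G).
    by congr complex_integral; apply/funext => z; exact: mulrC.
  by rewrite !CJ -gE// (X_functionalE _ Hpsi).
have au : analytic (th - phi) by rewrite -scaleN1r addrC; exact: analyticL.
have uM z : unit_ball z -> nc ((th - phi) z) <= c + M.
  by move=> bz; apply: le_trans (ncB _ _) (lerD (thc z bz) (pM z bz)).
have pu : perp Q (th - phi).
  split; first exact: (shB SH2 Ht Hp).
  by move=> q Qq; rewrite (shdotBl SH2 Ht Hp (Q_H2 hQ Qq)) tq// subrr.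
have [_ uf] := perp_symbol n_gt0 hQ au uM pu Hf.
have Htf := mult_H2 n_gt0 ath thc Hf; have Hpf := mult_H2 n_gt0 ap pM Hf.
apply: (eq_orth_proj n_gt0 hQ Hpf Htf) => q Qq.
apply/esym/eqP; rewrite -subr_eq0 -(shdotBl SH2 Htf Hpf (Q_H2 hQ Qq)).
have -> : mult th f - mult phi f = mult (th - phi) f.
  by apply/funext => z; rewrite -[RHS]/((th z - phi z) * f z) mulrBl.
by rewrite uf.
Qed.

End lifting.

Theorem theorem4p5 (R : realType) (n : nat) (hn : (0 < n)%N)
    (Q : set ('rV[R[i]]_n -> R[i]))
    (X : ('rV[R[i]]_n -> R[i]) -> ('rV[R[i]]_n -> R[i])) :
  quotient_module Q ->
  contraction_on Q X ->
  (exists2 f, Q f & X f <> 0) ->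
  module_map Q X ->
  admits_lift Q X ->
  let psi := X (orth_proj Q one_ball) in
  X_norm Q psi =
    (inf [set supnorm phi | phi in [set phi | schur phi /\ is_lift Q X phi]])%:E
  /\ exists theta, [/\ schur theta, is_lift Q X theta &
       (supnorm theta)%:E = X_norm Q psi].
Proof.
move=> hQ _ _ _ [phi [Hphi phi1] Xphi] psi.
have dotE f : Hinfty f -> is_lift Q X f -> H2 psi /\ forall q, Q q -> H2dot psi q = H2dot f q.
  by move=> Hf; apply: (lift_dot hn hQ Hf.1) => z; exact: nc_le_supnorm.
have s0 (f : 'rV[R[i]]_n -> R[i]) : Hinfty f -> 0 <= supnorm f.
  move=> Hf; apply: le_trans (nc_ge0 (f 0)) (nc_le_supnorm Hf _).
  by rewrite /unit_ball/= enorm0.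
have [Hpsi _] := dotE phi Hphi Xphi.
have Xle f F : Hinfty f -> is_lift Q X f -> M_space Q F ->
    nc (X_functional psi F) <= supnorm f * fine (L1norm F).
  move=> Hf Xf; have [_ fE] := dotE f Hf Xf.
  by apply: (X_functional_le hn hQ Hf.1 _ Hpsi fE) => z; exact: nc_le_supnorm.
have [c [c0 cE cX]] := X_norm_fin hn hQ (s0 _ Hphi) Hpsi (fun F => Xle phi F Hphi Xphi).
have cle f : Hinfty f -> is_lift Q X f -> c <= supnorm f.
  move=> Hf Xf; rewrite -lee_fin -cE; apply: (X_norm_le hn hQ (s0 _ Hf)) => F.
  exact: Xle.
have [th [ath thc Xth]] := extremal_lift hn hQ c0 Hphi.1
  (fun z => nc_le_supnorm Hphi) Xphi Hpsi (dotE phi Hphi Xphi).2 cX.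
have Hth : Hinfty th by split=> //; exists c.
(* [th] is bounded by [c] by construction and, being itself a lift, has sup norm at least [c]. *)
have thE : supnorm th = c by apply/eqP; rewrite eq_le supnorm_le// cle.
have sth : schur th by split => //; rewrite thE; exact: le_trans (cle _ Hphi Xphi) phi1.
split; last by exists th; split => //; rewrite thE.
rewrite cE; congr EFin; apply/eqP; rewrite eq_le; apply/andP; split.
  apply: lb_le_inf; first by exists (supnorm th); exists th.
  by move=> _ [f [[Hf _] Xf] <-]; exact: cle.
rewrite -thE; apply: ge_inf; last by exists th.
by exists c => _ [f [[Hf _] Xf] <-]; exact: cle.
Qed.
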